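(* In the setting below, for every integer $n\ge1$ and every rational number $s$, the number $m(U_n,s)$ is finite.
   Context: Let $p$ be a prime, $n\ge1$, $\Psi$ a nontrivial complex-valued additive character of $\mathbf F_p$, and fix an embedding of the algebraic numbers into $\overline{\mathbf Q}_p$. For $\bar y\in\mathbf F_q^*$ ($q$ a power of $p$) let $K_m(\bar y,n)=\sum_{x_i\in\mathbf F_{q^m}^*}\Psi(\mathrm{Tr}_{\mathbf F_{q^m}/\mathbf F_p}(x_1+\cdots+x_n+\bar y/(x_1\cdots x_n)))$ and $L(\bar y,n,T)=\exp(\sum_{m\ge1}K_m(\bar y,n)T^m/m)$; it is known that $L(\bar y,n,T)^{(-1)^{n-1}}$ is a polynomial of degree $n+1$ with exactly one $p$-adic unit reciprocal root $\alpha_0(\bar y)$. For an integer $k$ let $L(U_n^{\otimes k},T)=\prod_{\bar y}(1-\alpha_0(\bar y)^kT^{\deg \bar y})^{-1}$, the product over closed points $\bar y$ of $\mathbf G_m/\mathbf F_p$ (with $\alpha_0(\bar y)$ computed over $\mathbf F_{p^{\deg\bar y}}$). This is a $p$-adic meromorphic function on $\mathbf C_p$, so it factors as $\prod_{i\ge0}(1-z_i(k)T)^{\pm1}$ with $z_i(k)\in\overline{\mathbf Q}_p$. For $s\in\mathbf Q$, the slope $s$ part is $L_s(U_n^{\otimes k},T)=\prod_{\mathrm{ord}_p z_i(k)=s}(1-z_i(k)T)^{\pm1}$, a rational function, and $d_s(U_n,k)$ is its degree (degree of numerator minus degree of denominator). Define $m(U_n,s)\in\mathbf Z_{\ge0}\cup\{+\infty\}$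 to be the smallest nonnegative integer $m$ such that whenever $k_1,k_2$ are integers with $k_1\equiv k_2\pmod{(p-1)p^m}$, one has $d_{s^*}(U_n,k_1)=d_{s^*}(U_n,k_2)$ for all rational $0\le s^*\le s$ (and $+\infty$ if no such $m$ exists). *)

(* Defs.v *)
From HB Require Import structures.
From mathcomp Require Import all_boot all_order all_algebra all_field.
From mathcomp Require Import boolp classical_sets fsbigop constructive_ereal.

Set Implicit Arguments.
Unset Strict Implicit.
Unset Printing Implicit Defensive.

Import Order.TTheory GRing.Theory Num.Theory.
Local Open Scope classical_set_scope.
Local Open Scope ring_scope.

(* An algebraic closure of Q_p with its valuation ord_p.  The fields ordp*,    *)
(* Qp_dense and Qp_complete say that Qp is the completion of rat for the       *)
(* p-adic valuation; with Qpbar_alg, they determine (Qpbar, ordp) up to        *)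
(* isomorphism of valued fields.  The value group of Qpbar is Q.               *)
Record padic_closure (p : nat) := PadicClosure {
  Qp : fieldType;
  Qpbar : closedFieldType;
  Qp_incl : {rmorphism Qp -> Qpbar};
  ordp : Qpbar -> \bar rat;
  ordp_eq_pinfty : forall x, (ordp x = +oo%E) <-> (x = 0);
  ordpM : forall x y, ordp (x * y) = (ordp x + ordp y)%E;
  ordpD : forall x y, (Order.min (ordp x) (ordp y) <= ordp (x + y)%R)%E;
  ordp_p : ordp p%:R = 1%:E%E;
  Qp_dense : forall (x : Qp) (N : nat),
    exists r : rat, (N%:R%:E <= ordp (Qp_incl (x - ratr r)%R))%E;
  Qp_complete : forall u : nat -> Qp,
    (forall N : nat, exists M, forall i j, (M <= i)%N -> (M <= j)%N ->
       (N%:R%:E <= ordp (Qp_incl (u i - u j)%R))%E) ->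
    exists l : Qp, forall N : nat, exists M, forall i, (M <= i)%N ->
       (N%:R%:E <= ordp (Qp_incl (u i - l)%R))%E;
  Qpbar_alg : integralRange Qp_incl
}.

Definition padic_cvg p (K : padic_closure p) (u : nat -> Qpbar K)
    (l : Qpbar K) : Prop :=
  forall N : nat, exists M, forall i, (M <= i)%N ->
    (N%:R%:E <= ordp (u i - l)%R)%E.

Definition nontrivial_additive_character p (Psi : 'F_p -> algC) : Prop :=
  [/\ Psi 0 = 1, {morph Psi : a b / a + b >-> a * b} & exists a, Psi a != 1].

(* A power series is the function giving its coefficients.                     *)
Section PowerSeries.
Variable R : fieldType.

Definition trunc_series (f : nat -> R) (N : nat) : {poly R} :=
  \poly_(i < N.+1) f i.

(* exp f = sum_j f^j / j!, for f without constant term: the coefficient of     *)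
(* T^N only depends on the terms j <= N and on f modulo T^(N+1).               *)
Definition exp_series (f : nat -> R) (N : nat) : R :=
  (\sum_(j < N.+1) (j`!%:R)^-1 *: trunc_series f N ^+ j)`_N.

Definition linear_factor (zeta : R) (e : bool) (i : nat) : R :=
  if e then (1 - zeta *: 'X)`_i else zeta ^+ i.

(* (1 - a T^d)^-1 = sum_j a^j T^(d j) *)
Definition euler_factor (a : R) (d i : nat) : R :=
  if (d %| i)%N then a ^+ (i %/ d) else 0.

End PowerSeries.

(* The trace from E to its prime field F_p, as the trace of the F_p-linear     *)
(* map "multiplication by x".                                                  *)
Definition prime_trace p (E : finFieldType) (charE : p \in [pchar E]) (x : E) :
    'F_p :=
  let b := vbasis {: pPrimeCharType charE} in
  \tr (passmx.mxof b b (amull (x : pPrimeCharType charE))).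

Section FiniteExtension.
Variables (F : finFieldType) (m : nat).
Hypothesis m_gt0 : (0 < m)%N.

Lemma frobenius_poly_neq0 : ('X^(#|F| ^ m) - 'X : {poly F}) != 0.
Proof.
have q_gt1 := card_finNzRing_gt1 F.
have : (1 < #|F| ^ m)%N by rewrite -(exp1n m) ltn_exp2r.
by move=> h; rewrite -size_poly_gt0 size_polyDl ?size_polyXn// size_polyN size_polyX.
Qed.

(* If F = F_q, this is F_(q^m) as an extension of F. *)
Definition finite_extension : splittingFieldType F :=
  projT1 (FinSplittingFieldFor frobenius_poly_neq0).

Lemma pchar_finite_extension p :
  p \in [pchar F] -> p \in [pchar (finvect_type finite_extension)].
Proof. exact: (rmorph_pchar (in_alg finite_extension)). Qed.

End FiniteExtension.

Section KloostermanL.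
Variables (p : nat) (Psi : 'F_p -> algC) (n : nat).
Variables (F : finFieldType) (charF : p \in [pchar F]) (y : F).

Definition kloosterman_sum (m : nat) (m_gt0 : (0 < m)%N) : algC :=
  let E := finvect_type (finite_extension F m_gt0) in
  \sum_(x : {ffun 'I_n -> E} | [forall i, x i != 0])
    Psi (prime_trace (pchar_finite_extension m_gt0 charF)
           (\sum_i x i + y%:A / \prod_i x i)).

Definition kloosterman_L : nat -> algC :=
  exp_series (fun m => if m is m'.+1
                       then kloosterman_sum (ltn0Sn m') / m%:R else 0).

(* P = L(y, n, T)^((-1)^(n-1)) *)
Definition is_kloosterman_poly (P : {poly algC}) : Prop :=
  if odd n then forall N, P`_N = kloosterman_L N
  else forall N, \sum_(i < N.+1) P`_i * kloosterman_L (N - i) = (N == 0)%:R.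

Variables (K : padic_closure p) (iota : {rmorphism algC -> Qpbar K}).

(* The p-adic unit reciprocal root alpha_0(y); it exists and is unique when    *)
(* y != 0, n > 0 and Psi is a nontrivial additive character.                   *)
Definition unit_root : Qpbar K :=
  xget 0 [set a | exists2 P : {poly algC}, is_kloosterman_poly P &
                  ordp a = 0%E /\ root (map_poly iota P) a^-1].

End KloostermanL.

(* Closed points of G_m over F_p: the maximal ideals of F_p[y, 1/y] are        *)
(* generated by the monic irreducible polynomials h(y) other than y.           *)
Definition closed_point (p : nat) :=
  {h : {poly 'F_p} | `[< irreducible_poly h >] && (h \is monic) && (h != 'X)}.

Section UnitRootL.
Variables (p : nat) (p_pr : prime p) (Psi : 'F_p -> algC) (n : nat).
Variables (K : padic_closure p) (iota : {rmorphism algC -> Qpbar K}).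

Lemma closed_point_mi (y : closed_point p) : monic_irreducible_poly (val y).
Proof. by case: y => h /= /andP[/andP[/asboolP ? ?] _]; split. Qed.

Definition closed_point_deg (y : closed_point p) : nat := (size (val y)).-1.

Definition residue_field (y : closed_point p) : finFieldType :=
  {poly %/ val y with closed_point_mi y}.

Definition residue_coord (y : closed_point p) : residue_field y :=
  in_qpoly (val y) 'X.

Lemma pchar_residue_field (y : closed_point p) : p \in [pchar (residue_field y)].
Proof.
have := pchar_Fp p_pr.
exact: (rmorph_pchar (in_alg {poly %/ val y with closed_point_mi y})).
Qed.

Definition alpha0 (y : closed_point p) : Qpbar K :=
  unit_root Psi n (pchar_residue_field y) (residue_coord y) iota.

(* L(U_n^{(x)k}, T): the points of degree > N do not contribute to the         *)
(* coefficient of T^N of the Euler product.                                    *)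
Definition unit_root_L (k : int) (N : nat) : Qpbar K :=
  (\big[*%R/1]_(y \in [set y : closed_point p | (closed_point_deg y <= N)%N])
     trunc_series (euler_factor (alpha0 y ^ k) (closed_point_deg y)) N)`_N.

End UnitRootL.

Section Slopes.
Variables (p : nat) (K : padic_closure p).

(* f = prod_i (1 - z_i T)^(+-1), coefficientwise, with sign + iff e_i.  The    *)
(* convergence of the coefficient of T already forces z_i --> 0, so that the   *)
(* product is a meromorphic function of T.  Finite products are included, by   *)
(* taking z_i = 0 for large i.                                                 *)
Definition is_factorization (f : nat -> Qpbar K)
    (ze : (nat -> Qpbar K) * (nat -> bool)) : Prop :=
  forall N, padic_cvg
    (fun M => (\prod_(i < M) trunc_series (linear_factor (ze.1 i) (ze.2 i)) N)`_N)
    (f N).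

Definition factorization (f : nat -> Qpbar K) :
    (nat -> Qpbar K) * (nat -> bool) :=
  xget (fun=> 0, fun=> true) [set ze | is_factorization f ze].

(* The factors of slope s with exponent +1 (e = true) or -1 (e = false). *)
Definition slope_poly (f : nat -> Qpbar K) (s : rat) (e : bool) :
    {poly Qpbar K} :=
  let ze := factorization f in
  \big[*%R/1]_(i \in [set i : nat | ordp (ze.1 i) = s%:E%E /\ ze.2 i = e])
    (1 - ze.1 i *: 'X).

Definition slope_degree (f : nat -> Qpbar K) (s : rat) : int :=
  (size (slope_poly f s true)).-1%:Z - (size (slope_poly f s false)).-1%:Z.

End Slopes.

Section MU.
Variables (p : nat) (p_pr : prime p) (Psi : 'F_p -> algC) (n : nat).
Variables (K : padic_closure p) (iota : {rmorphism algC -> Qpbar K}).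

(* d_s(U_n, k) *)
Definition dU (s : rat) (k : int) : int :=
  slope_degree (unit_root_L p_pr Psi n iota k) s.

Definition slope_stable (s : rat) (m : nat) : Prop :=
  forall k1 k2 : int, (k1 = k2 %[mod (p.-1 * p ^ m)%N])%Z ->
  forall s' : rat, 0 <= s' <= s -> dU s' k1 = dU s' k2.

(* m(U_n, s) *)
Definition mU (s : rat) : \bar nat :=
  if pselect (exists m, `[< slope_stable s m >]) is left ex_m
  then (ex_minn ex_m)%:E%E else +oo%E.

End MU.

(* Main.v *)
From HB Require Import structures.
Require Import Defs.
From mathcomp Require Import all_boot all_order all_algebra all_fingroup all_field.
From mathcomp Require Import constructive_ereal.
From mathcomp Require Import boolp classical_sets fsbigop.
From mathcomp Require Import cyclic ring lra zify.

Set Implicit Arguments.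
Unset Strict Implicit.
Unset Printing Implicit Defensive.
Import Order.TTheory GRing.Theory Num.Theory.
Local Open Scope ring_scope.

(** The sums K_m are traces of Frobenius on a Dwork cohomology of rank n+1.  A
    Mellin transform replaces the Dwork complex by two operators [Xi] and [alpha]
    on polynomials in one variable.  Modulo p^M the former is unitriangular up to
    nilpotents, so its cokernel is free of rank n+1, and (-1)^n K_m(y) is the trace
    of H(y^(p^(m-1))) ... H(y) for a matrix H of polynomials, whose coefficients
    satisfy overconvergence bounds that do not depend on M.

    All rows of H but the first are divisible by a uniformizer, so the unit root is
    1 modulo this uniformizer and its k-th power is a limit of power sums of
    Frobenius eigenvalues.  A power sum is an integral combination of traces on
    Sym^(k-i) H tensored with bounded representations, and the number of basis
    vectors of weight less than W in Sym^k H is bounded independently of k.  By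
    Dwork's trace formula and the compactness of the local field, L(U_n^k, T) = P/Q
    where the Newton polygons of P and Q lie above a superlinear curve that does
    not depend on k.  If k1 = k2 modulo (p-1)p^m, the two L-functions are congruent
    modulo p^m, and congruent series with a common superlinear lower bound have the
    same slopes up to s as soon as m is large. *)

(** * Valuations *)

(** Fredholm theory on p-adic Banach spaces is avoided. Modulo a power of p the Dwork parameter [ga]
    is nilpotent, so the Frobenius operators on polynomials have images of bounded degree and their
    traces are finite sums. The price is that H depends on the precision M, with no compatibility
    between different M: bounds must be free of M, and a compactness argument replaces a limit. The
    Mellin transform is chosen because a Kloosterman sum is a multiplicative convolution of n+1
    copies of one character: every variable contributes the same factor, and n survives only as an
    exponent. A given k is first replaced by a large j in its class modulo (p-1)p^M. This puts
    negative k on the same footing, makes the j-th powers of the non-unit eigenvalues vanish modulo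
    p^M, and keeps the degrees of the symmetric powers nonnegative. Two constants recur: u =
    1/(p-1), the valuation of the uniformizer, and 1/p = u - u/p, which is left of the growth rates
    once the Dwork operator has divided exponents by p. *)

Definition vge (p : nat) (K : padic_closure p) (r : rat) (x : Qpbar K) : bool :=
  (r%:E <= ordp x)%E.

Section Valuation.
Variables (p : nat) (p_pr : prime p) (K : padic_closure p).
Implicit Types (x y z : Qpbar K) (r s : rat).

Lemma ordp0 : ordp (0 : Qpbar K) = +oo%E.
Proof. exact/ordp_eq_pinfty. Qed.

Lemma ordp1 : ordp (1 : Qpbar K) = 0%:E%E.
Proof.
have h := ordpM (p%:R : Qpbar K) 1; rewrite mulr1 ordp_p in h.
by case: (ordp (1 : Qpbar K)) h => [r| |] //= [h]; congr (_%:E)%E; lra.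
Qed.

Lemma ordp_fin x : x != 0 -> {r : rat | ordp x = r%:E%E}.
Proof.
move=> x0; have h := ordpM x x^-1; rewrite divff // ordp1 in h.
by case: (ordp x) h => [r| |]; [exists r | case: (ordp _) | case: (ordp _)].
Qed.

Lemma vgeE x r s : ordp x = s%:E%E -> vge r x = (r <= s).
Proof. by move=> h; rewrite /vge h lee_fin. Qed.

Lemma vge0 r : vge r (0 : Qpbar K).
Proof. by rewrite /vge ordp0 leey. Qed.

Lemma vge1 : vge 0 (1 : Qpbar K).
Proof. by rewrite /vge ordp1. Qed.

Lemma vgeW r s x : s <= r -> vge r x -> vge s x.
Proof. by move=> h; rewrite /vge; apply: le_trans; rewrite lee_fin. Qed.

Lemma vgeM r s x y : vge r x -> vge s y -> vge (r + s) (x * y).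
Proof.
have [->|x0] := eqVneq x 0; first by rewrite mul0r => *; apply: vge0.
have [->|y0] := eqVneq y 0; first by rewrite mulr0 => *; apply: vge0.
have [a ax] := ordp_fin x0; have [b bY] := ordp_fin y0.
have xy : ordp (x * y) = (a + b)%:E%E by rewrite ordpM ax bY.
by rewrite (vgeE _ ax) (vgeE _ bY) (vgeE _ xy) => h1 h2; rewrite lerD.
Qed.

Lemma vgeMl r x y : vge 0 x -> vge r y -> vge r (x * y).
Proof. by move=> h1 h2; have := vgeM h1 h2; rewrite add0r. Qed.

Lemma vgeMr r x y : vge r x -> vge 0 y -> vge r (x * y).
Proof. by move=> h1 h2; have := vgeM h1 h2; rewrite addr0. Qed.

Lemma vgeD r x y : vge r x -> vge r y -> vge r (x + y).
Proof. by rewrite /vge => h1 h2; apply: le_trans (ordpD x y); rewrite le_min h1. Qed.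

Lemma ordpN1 : ordp (-1 : Qpbar K) = 0%:E%E.
Proof.
have n0 : (-1 : Qpbar K) != 0 by rewrite oppr_eq0 oner_eq0.
have [r e] := ordp_fin n0; have := ordpM (-1 : Qpbar K) (-1).
by rewrite mulrNN mulr1 ordp1 e => -[h]; congr (_%:E)%E; lra.
Qed.

Lemma ordpN x : ordp (- x) = ordp x.
Proof. by rewrite -mulN1r ordpM ordpN1 add0e. Qed.

Lemma vgeN r x : vge r (- x) = vge r x.
Proof. by rewrite /vge ordpN. Qed.

Lemma vgeB r x y : vge r x -> vge r y -> vge r (x - y).
Proof. by move=> h1 h2; rewrite vgeD ?vgeN. Qed.

Lemma vgeBC r x y : vge r (x - y) = vge r (y - x).
Proof. by rewrite -vgeN opprB. Qed.

Lemma vgeX r x n : vge r x -> vge (n%:R * r) (x ^+ n).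
Proof.
move=> h; elim: n => [|n IH]; first by rewrite mul0r expr0 vge1.
by rewrite exprS -addn1 natrD mulrDl mul1r addrC vgeM.
Qed.

Lemma vgeX0 x n : vge 0 x -> vge 0 (x ^+ n).
Proof. by move=> /(@vgeX _ _ n); rewrite mulr0. Qed.

Lemma vge_sum r (I : Type) (s : seq I) (P : pred I) (F : I -> Qpbar K) :
  (forall i, P i -> vge r (F i)) -> vge r (\sum_(i <- s | P i) F i).
Proof.
by move=> h; elim/big_ind: _ => // [|x y]; [apply: vge0 | apply: vgeD].
Qed.

Lemma vge_prod (I : Type) (s : seq I) (P : pred I) (w : I -> rat) (F : I -> Qpbar K) :
  (forall i, P i -> vge (w i) (F i)) ->
  vge (\sum_(i <- s | P i) w i) (\prod_(i <- s | P i) F i).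
Proof.
move=> h; elim/big_ind2: _ => // [|a x b y ha hb]; first exact: vge1.
exact: vgeM.
Qed.

Lemma vge_prod0 (I : Type) (s : seq I) (P : pred I) (F : I -> Qpbar K) :
  (forall i, P i -> vge 0 (F i)) -> vge 0 (\prod_(i <- s | P i) F i).
Proof.
by move=> h; elim/big_ind: _ => //; [exact: vge1 | move=> *; apply: vgeMl].
Qed.

Lemma vge_nat n : vge 0 (n%:R : Qpbar K).
Proof. by elim: n => [|n IH]; rewrite ?vge0 // -addn1 natrD vgeD ?vge1. Qed.

Lemma vge_int (m : int) : vge 0 (m%:~R : Qpbar K).
Proof. by case: m => n; rewrite ?NegzE ?mulrNz ?vgeN -?pmulrn vge_nat. Qed.

Lemma vge_pexp n : vge n%:R ((p ^ n)%:R : Qpbar K).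
Proof.
have hp : vge 1 (p%:R : Qpbar K) by rewrite /vge ordp_p.
by have := vgeX n hp; rewrite mulr1 natrX.
Qed.

Lemma vge_eq0 x : (forall N : nat, vge N%:R x) -> x = 0.
Proof.
move=> h; apply/eqP/negPn/negP => x0; have [r e] := ordp_fin x0.
have := h (Num.bound r); rewrite (vgeE _ e) => h2.
have := archi_boundP (normr_ge0 r); have := ler_norm r.
move: (h (Num.bound `|r|)); rewrite (vgeE _ e) => h3 h4 h5.
by have := lt_le_trans h5 (le_trans h3 h4); rewrite ltxx.
Qed.

(** The prime p is excluded by its valuation 1. For another prime q, a Bezout relation would make 1
    a multiple of p. *)
Lemma pchar0_Qpbar : [pchar (Qpbar K)] =i pred0.
Proof.
have p0 : (p%:R : Qpbar K) != 0.
  by apply/negP => /eqP h; have := ordp_p K; rewrite h ordp0.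
move=> q; rewrite !inE /=; apply/negP => /andP[q_pr /eqP q0].
have [eqpq|neq] := eqVneq q p.
  by move: q0; rewrite eqpq => q0; rewrite q0 eqxx in p0.
have cop : coprime q p by rewrite prime_coprime // dvdn_prime2 //.
have [u v] := egcdnP p (prime_gt0 q_pr); rewrite (eqnP cop) => e _.
have := congr1 (fun n => n%:R : Qpbar K) e; rewrite !natrD !natrM q0 mulr0 => e1.
have : vge 1 (v%:R * p%:R : Qpbar K).
  by apply: vgeMl (vge_nat _) _; rewrite /vge ordp_p.
have e2 : v%:R * p%:R = -1 :> Qpbar K by apply/eqP; rewrite -addr_eq0 -e1.
by rewrite e2 vgeN /vge ordp1 lee_fin.
Qed.

Lemma natr_Qpbar_eq0 n : ((n%:R : Qpbar K) == 0) = (n == 0%N).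
Proof. by move: n; apply/pcharf0P; exact: pchar0_Qpbar. Qed.

Lemma ordpX x n r : ordp x = r%:E%E -> ordp (x ^+ n) = (n%:R * r)%:E%E.
Proof.
move=> h; elim: n => [|n IH]; first by rewrite expr0 ordp1 mul0r.
by rewrite exprS ordpM h IH -addn1 natrD mulrDl mul1r addrC.
Qed.

Lemma ordpV x r : ordp x = r%:E%E -> ordp x^-1 = (- r)%:E%E.
Proof.
move=> h; have x0 : x != 0 by apply/eqP => x0; move: h; rewrite x0 ordp0.
have x1 : x^-1 != 0 by rewrite invr_eq0.
have [s e] := ordp_fin x1; have := ordpM x x^-1.
by rewrite divff // ordp1 h e => -[h1]; congr (_%:E)%E; lra.
Qed.

Lemma ordp_coprime n : coprime p n -> ordp (n%:R : Qpbar K) = 0%:E%E.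
Proof.
move=> cop; have n0 : (n%:R : Qpbar K) != 0.
  rewrite natr_Qpbar_eq0; apply: contraTneq cop => ->.
  by rewrite /coprime gcdn0; have := prime_gt1 p_pr; case: (p) => [|[]].
have [r e] := ordp_fin n0; have := vge_nat n; rewrite (vgeE _ e) => r0.
rewrite e; congr (_%:E)%E; apply/eqP; rewrite eq_le r0 andbT leNgt; apply/negP => rp.
have [u v] := egcdnP n (prime_gt0 p_pr); rewrite (eqnP cop) => e1 _.
have e2 : 1 = u%:R * p%:R - v%:R * n%:R :> Qpbar K.
  by rewrite -!natrM e1 natrD addrAC subrr add0r.
(* t = min(r, 1): were r positive, both terms of the Bezout relation, hence 1, would have valuation
   at least t > 0. *)
pose t : rat := if r <= 1 then r else 1.
have t0 : 0 < t by rewrite /t; case: ifP.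
have tr : t <= r by rewrite /t; case: ifP => // /negbT; rewrite -ltNge => /ltW.
have t1 : t <= 1 by rewrite /t; case: ifP.
have : vge t (1 : Qpbar K).
  rewrite e2 vgeB // vgeMl ?vge_nat //; last by rewrite (vgeE _ e).
  by rewrite /vge ordp_p lee_fin.
by rewrite /vge ordp1 lee_fin leNgt t0.
Qed.

Lemma ordp_nat n : (0 < n)%N -> ordp (n%:R : Qpbar K) = (logn p n)%:R%:E%E.
Proof.
move=> n0; have [m cop e] := pfactor_coprime p_pr n0.
by rewrite {1}e natrM ordpM ordp_coprime // natrX (ordpX _ (ordp_p K)) add0e mulr1.
Qed.

Lemma vgeV x r s : ordp x = s%:E%E -> r <= - s -> vge r x^-1.
Proof. by move=> /ordpV h; rewrite (vgeE _ h). Qed.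

Lemma vge_cancel x y r s : ordp x = s%:E%E -> vge r (x * y) -> vge (r - s) y.
Proof.
move=> h; have x0 : x != 0 by apply/eqP => x0; move: h; rewrite x0 ordp0.
move=> h1; rewrite -[y](mulKf x0) addrC; apply: vgeM h1.
by rewrite (vgeE _ (ordpV h)).
Qed.

Lemma vge_subX r x y n : vge 0 x -> vge 0 y -> vge r (x - y) -> vge r (x ^+ n - y ^+ n).
Proof.
move=> hx hy h; rewrite subrXX; apply: vgeMr => //; apply: vge_sum => i _.
by apply: vgeMl; apply: vgeX0.
Qed.

Lemma vge_subM r x y x' y' : vge 0 x -> vge 0 y' -> vge r (x - x') -> vge r (y - y') ->
  vge r (x * y - x' * y').
Proof.
move=> h1 h2 h3 h4; have -> : x * y - x' * y' = x * (y - y') + (x - x') * y' by ring.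
by apply: vgeD; [apply: vgeMl | apply: vgeMr].
Qed.

Lemma vge_trans r x y z : vge r (x - y) -> vge r (y - z) -> vge r (x - z).
Proof. by move=> h1 h2; have := vgeD h1 h2; rewrite addrA subrK. Qed.

Lemma vge_cong r x y s : s <= r -> vge r (x - y) -> vge s x = vge s y.
Proof.
move=> sr h; apply/idP/idP => h1.
  by have := vgeB h1 (vgeW sr h); rewrite opprB addrC subrK.
by have := vgeD h1 (vgeW sr h); rewrite addrC subrK.
Qed.

Lemma ordp_cong x y r s : ordp x = r%:E%E -> r < s -> vge s (x - y) -> ordp y = r%:E%E.
Proof.
move=> ex rs h; have [y0|y0] := eqVneq y 0.
  by move: h; rewrite y0 subr0 (vgeE _ ex) leNgt rs.
have [t et] := ordp_fin y0; have hr : vge r y.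
  by rewrite -(vge_cong (ltW rs) h) (vgeE _ ex).
rewrite et; congr (_%:E)%E; apply/eqP; rewrite eq_le andbC.
rewrite (vgeE _ et) in hr; rewrite hr leNgt; apply/negP => rt.
pose m := if t <= s then t else s.
have hm : r < m by rewrite /m; case: ifP.
have ms : m <= s by rewrite /m; case: ifP => // /negbT; rewrite -ltNge => /ltW.
have mt : m <= t by rewrite /m; case: ifP => // /negbT; rewrite -ltNge => /ltW.
by have := vge_cong ms h; rewrite (vgeE _ ex) (vgeE _ et) mt leNgt hm.
Qed.

End Valuation.

(** * Power series *)

Section Series.
Variable F : fieldType.
Implicit Types (f g h l : nat -> F) (N : nat).

Definition conv f g N : F := \sum_(i < N.+1) f i * g (N - i)%N.
Definition one_series N : F := (N == 0)%:R.

Lemma coef_trunc f N i : (trunc_series f N)`_i = if (i <= N)%N then f i else 0.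
Proof. by rewrite coef_poly ltnS. Qed.

Lemma conv_trunc f g N M : (N <= M)%N ->
  conv f g N = (trunc_series f M * trunc_series g M)`_N.
Proof.
move=> NM; rewrite coefM; apply: eq_bigr => i _; rewrite !coef_trunc.
have iN : (i <= N)%N by rewrite -ltnS.
by rewrite (leq_trans iN NM) (leq_trans (leq_subr _ _) NM).
Qed.

Lemma coefM_eq (P P' Q Q' : {poly F}) N : (forall i, (i <= N)%N -> P`_i = P'`_i) ->
  (forall i, (i <= N)%N -> Q`_i = Q'`_i) -> (P * Q)`_N = (P' * Q')`_N.
Proof.
move=> h1 h2; rewrite !coefM; apply: eq_bigr => i _.
by rewrite h1 ?h2 ?leq_subr // -ltnS.
Qed.

Lemma eq_conv f f' g g' N : (forall i, (i <= N)%N -> f i = f' i) ->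
  (forall i, (i <= N)%N -> g i = g' i) -> conv f g N = conv f' g' N.
Proof.
move=> h1 h2; apply: eq_bigr => i _.
by rewrite h1 ?h2 ?leq_subr // -ltnS.
Qed.

Lemma conv_poly (P Q : {poly F}) N : conv (fun i => P`_i) (fun i => Q`_i) N = (P * Q)`_N.
Proof. by rewrite coefM. Qed.

Lemma convC f g : conv f g =1 conv g f.
Proof. by move=> N; rewrite !(conv_trunc _ _ (leqnn N)) mulrC. Qed.

Lemma convA f g h : conv f (conv g h) =1 conv (conv f g) h.
Proof.
move=> N; pose t f := trunc_series f N.
transitivity ((t f * (t g * t h))`_N).
  rewrite (conv_trunc _ _ (leqnn N)); apply: coefM_eq => // i iN.
  by rewrite coef_trunc iN (conv_trunc _ _ iN).
rewrite mulrA (conv_trunc _ _ (leqnn N)); apply: coefM_eq => // i iN.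
by rewrite coef_trunc iN (conv_trunc _ _ iN).
Qed.

Lemma conv1 f : conv one_series f =1 f.
Proof.
move=> N; rewrite /conv big_ord_recl /= mul1r subn0 big1 ?addr0 // => i _.
by rewrite mul0r.
Qed.

Lemma conv_coef0 f g : conv f g 0%N = f 0%N * g 0%N.
Proof. by rewrite /conv big_ord1. Qed.

Lemma convD f g h N : conv f (fun i => g i + h i) N = conv f g N + conv f h N.
Proof. by rewrite /conv -big_split; apply: eq_bigr => i _; rewrite mulrDr. Qed.

Lemma convB f g h N : conv f (fun i => g i - h i) N = conv f g N - conv f h N.
Proof. by rewrite /conv -sumrB; apply: eq_bigr => i _; rewrite mulrBr. Qed.

Lemma convCA f g h : conv f (conv g h) =1 conv g (conv f h).
Proof.
move=> N; rewrite convA; under eq_conv do [rewrite convC|].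
by rewrite -convA.
Qed.

Lemma conv_inj f g h : f 0%N != 0 -> conv f g =1 conv f h -> g =1 h.
Proof.
move=> f0 e N; elim/ltn_ind: N => N IH.
have := e N; rewrite /conv !big_ord_recl !subn0 /=.
under [X in _ + X = _]eq_bigr => i _.
  rewrite IH; last by rewrite /bump /=; have := ltn_ord i; lia.
  over.
by move=> /addIr /mulfI -> //.
Qed.

(** Course-of-values recursion: the list of the first k coefficients of 1/g, for g with constant
    term 1. The Boolean supplies the constant term 1, which is computed when the list is still
    empty. *)
Fixpoint inv_rec g k : seq F :=
  if k is k'.+1 then
    let s := inv_rec g k' in
    rcons s (- \sum_(i < k') g i.+1 * nth 0 s (k' - i.+1)%N + (k' == 0%N)%:R)
  else [::].

Definition inv_series g N : F := nth 0 (inv_rec g N.+1) N.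

Lemma size_inv_rec g k : size (inv_rec g k) = k.
Proof. by elim: k => //= k IH; rewrite size_rcons IH. Qed.

Lemma nth_inv_rec g k N : (N < k)%N -> nth 0 (inv_rec g k) N = inv_series g N.
Proof.
rewrite /inv_series; elim: k => // k IH; rewrite ltnS leq_eqVlt => /orP[/eqP->//|h].
by rewrite [inv_rec g k.+1]/= nth_rcons size_inv_rec h IH.
Qed.

Lemma inv_seriesS g N : inv_series g N.+1 =
  - \sum_(i < N.+1) g i.+1 * inv_series g (N - i)%N.
Proof.
rewrite {1}/inv_series; move Ek: N.+1 => k /=.
rewrite nth_rcons size_inv_rec ltnn eqxx -Ek addr0; congr (- _).
by apply: eq_bigr => i _; rewrite nth_inv_rec // subSS ltnS leq_subr.
Qed.

Lemma inv_series0 g : inv_series g 0%N = 1.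
Proof. by rewrite /inv_series /= big_ord0 oppr0 add0r. Qed.

Lemma conv_inv g : g 0%N = 1 -> conv g (inv_series g) =1 one_series.
Proof.
move=> g0 [|N]; first by rewrite conv_coef0 g0 inv_series0 mul1r.
rewrite /conv big_ord_recl subn0 g0 mul1r inv_seriesS.
by under [X in _ + X]eq_bigr do rewrite lift0 subSS; rewrite addNr.
Qed.

(** [is_exp l g] says that [g = exp (sum_(m >= 1) l m T^m / m)]. *)
Definition is_exp l g :=
  g 0%N = 1 /\ forall N, N%:R * g N = \sum_(i < N) l i.+1 * g (N - i.+1)%N.

Definition pos_part l N : F := if N is 0 then 0 else l N.

Lemma conv_pos_part l g N : conv (pos_part l) g N = \sum_(i < N) l i.+1 * g (N - i.+1)%N.
Proof. by rewrite /conv big_ord_recl mul0r add0r. Qed.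

Lemma eq_is_exp l l' g : (forall m, (0 < m)%N -> l m = l' m) -> is_exp l g -> is_exp l' g.
Proof.
by move=> e [g0 h]; split=> // N; rewrite h; apply: eq_bigr => i _; rewrite e.
Qed.

(** Logarithmic derivatives add up; the splitting N = i + (N - i) is the Leibniz rule on
    coefficients. *)
Lemma is_exp_conv l l' g g' : is_exp l g -> is_exp l' g' ->
  is_exp (fun m => l m + l' m) (conv g g').
Proof.
move=> [g0 hg] [g0' hg']; split=> [|N]; first by rewrite conv_coef0 g0 g0' mulr1.
transitivity (conv (fun i => i%:R * g i) g' N + conv g (fun i => i%:R * g' i) N).
  rewrite /conv -big_split mulr_sumr; apply: eq_bigr => i _ /=.
  have iN : (i <= N)%N by rewrite -ltnS.
  have -> : N%:R = i%:R + (N - i)%:R :> F by rewrite -natrD subnKC.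
  by ring.
have e1 : (fun i => i%:R * g i) =1 conv (pos_part l) g.
  by move=> i; rewrite hg conv_pos_part.
have e2 : (fun i => i%:R * g' i) =1 conv (pos_part l') g'.
  by move=> i; rewrite hg' conv_pos_part.
rewrite (eq_conv (f' := conv (pos_part l) g) (g' := g')) //.
rewrite [X in _ + X](eq_conv (f' := g) (g' := conv (pos_part l') g')) //.
rewrite -convA -(conv_pos_part (fun m => l m + l' m)).
transitivity (conv (conv g g') (fun i => pos_part l i + pos_part l' i) N).
  rewrite convD; congr (_ + _); first by rewrite convC.
  by rewrite [RHS]convC convCA.
by rewrite convC; apply: eq_conv => // -[|i] //=; rewrite addr0.
Qed.

Lemma is_exp0 : is_exp (fun=> 0) one_series.
Proof.
split=> // N; rewrite big1 => [|i _]; last by rewrite mul0r.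
by case: N => [|N]; rewrite ?mul0r // mulr0.
Qed.

Hypothesis F0 : forall n, ((n%:R : F) == 0) = (n == 0%N).

Lemma is_exp_uniq l g g' : is_exp l g -> is_exp l g' -> g =1 g'.
Proof.
move=> [g0 h] [g0' h'] N; elim/ltn_ind: N => -[|N] IH; first by rewrite g0 g0'.
have n0 : N.+1%:R != 0 :> F by rewrite F0.
apply: (mulfI n0); rewrite h h'; apply: eq_bigr => i _.
by rewrite IH // subSS ltnS leq_subr.
Qed.

Fixpoint exp_rec l k : seq F :=
  if k is k'.+1 then
    let s := exp_rec l k' in
    rcons s (if k' is 0 then 1 else (\sum_(i < k') l i.+1 * nth 0 s (k' - i.+1)%N) / k'%:R)
  else [::].

Lemma is_exp_exists l : exists g, is_exp l g.
Proof.
exists (fun N => nth 0 (exp_rec l N.+1) N).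
have sz k : size (exp_rec l k) = k by elim: k => //= k IH; rewrite size_rcons IH.
have nthE k N : (N < k)%N -> nth 0 (exp_rec l k) N = nth 0 (exp_rec l N.+1) N.
  elim: k => // k IH; rewrite ltnS leq_eqVlt => /orP[/eqP->//|h].
  by rewrite [exp_rec l k.+1]/= nth_rcons sz h IH.
split=> // -[|N]; first by rewrite mul0r big_ord0.
move Ek: N.+1 => k; rewrite /= nth_rcons sz ltnn eqxx -Ek mulrC.
rewrite divfK ?F0 //; apply: eq_bigr => i _; congr (_ * _).
by rewrite nthE // subSS ltnS leq_subr.
Qed.

End Series.

Lemma coef_exp_ord (R : nzRingType) (t : {poly R}) j i :
  t`_0 = 0 -> (i < j)%N -> (t ^+ j)`_i = 0.
Proof.
move=> t0; elim: j i => // j IH i ij; rewrite exprS coefM big1 // => -[k /= ki] _.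
case: k ki => [|k] ki; first by rewrite t0 mul0r.
by rewrite IH ?mulr0 //; lia.
Qed.

Lemma coef_exp_eq (F : fieldType) (s t : {poly F}) N j :
  (forall i, (i <= N)%N -> s`_i = t`_i) -> (s ^+ j)`_N = (t ^+ j)`_N.
Proof.
move=> h; elim: j N h => // j IH N h; rewrite !exprS; apply: coefM_eq => // i iN.
by apply: IH => k ki; apply: h; exact: leq_trans iN.
Qed.

Lemma is_exp_exp_series (F : fieldType) (f : nat -> F) :
  (forall n, ((n%:R : F) == 0) = (n == 0%N)) -> f 0%N = 0 ->
  is_exp (fun m => m%:R * f m) (exp_series f).
Proof.
move=> F0 f0; have t0 M : (trunc_series f M)`_0 = 0 by rewrite coef_trunc f0.
pose G M : {poly F} := \sum_(j < M.+1) (j`!%:R)^-1 *: trunc_series f M ^+ j.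
have GE N M : (N <= M)%N -> exp_series f N = (G M)`_N.
  move=> NM; rewrite /exp_series !coef_sum.
  rewrite (big_ord_widen M.+1 (fun j => ((j`!%:R)^-1 *: trunc_series f N ^+ j)`_N)) //.
  rewrite [RHS](bigID (fun j : 'I_ _ => (j < N.+1)%N)) /= [X in _ = _ + X]big1 ?addr0.
    apply: eq_bigr => j _; rewrite !coefZ; congr (_ * _); apply: coef_exp_eq => i iN.
    by rewrite !coef_trunc iN (leq_trans iN NM).
  by move=> j; rewrite -ltnNge => jN; rewrite coefZ coef_exp_ord ?mulr0.
split=> [|[|N]]; rewrite ?mul0r ?big_ord0 //.
  by rewrite (GE 0%N 0%N) // /G big_ord1 fact0 invr1 scale1r expr0 coef1.
rewrite (GE _ _ (leqnn _)) mulr_natl -coef_deriv.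
(* Differentiating a truncated exponential loses its last term. As f has no constant term, the lost
   term starts in degree N+1 and does not reach the coefficient N. *)
have -> : (G N.+1)^`() = (G N.+1 - ((N.+1)`!%:R)^-1 *: trunc_series f N.+1 ^+ N.+1) *
    (trunc_series f N.+1)^`().
  rewrite /G [in RHS]big_ord_recr /= addrK linear_sum big_ord_recl /=.
  rewrite expr0 linearZ /= derivC scaler0 add0r mulr_suml.
  apply: eq_bigr => i _; rewrite -[bump 0 i]/i.+1 linearZ /= deriv_exp -scalerMnr -scaler_nat scalerA.
  rewrite -scalerAl [X in _ *: X = _]mulrC; congr (_ *: _).
  by rewrite factS natrM invfM mulrA divff ?mul1r ?F0.
rewrite mulrBl coefB -scalerAl coefZ.
have -> : (trunc_series f N.+1 ^+ N.+1 * (trunc_series f N.+1)^`())`_N = 0.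
  rewrite coefM big1 // => i _; rewrite coef_exp_ord ?mul0r //.
rewrite mulr0 subr0 mulrC coefM; apply: eq_bigr => i _.
rewrite coef_deriv coef_trunc ltn_ord mulr_natl subSS (GE (N - i)%N N.+1) //.
by rewrite (leq_trans (leq_subr _ _)).
Qed.

(** * Eigenvalues, traces of powers and Fredholm determinants *)

Section Triangular.
Variable F : closedFieldType.

(** Eigenvectors are row vectors, and [row_ebase v] completes v, up to a unit, to a basis. In this
    basis the first row of A is a multiple of the first basis vector, and a smaller block
    remains. *)
Lemma ex_trigmx n (A : 'M[F]_n) :
  exists P T : 'M[F]_n, [/\ P \in unitmx, P *m A = T *m P & is_trig_mx T].
Proof.
elim: n A => [|n IH] A.
  by exists 1%:M, A; split; rewrite ?unitmx1 ?mul1mx ?mulmx1 //; apply/is_trig_mxP => -[].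
have /closed_rootP[a ra] : size (char_poly A) != 1%N by rewrite size_char_poly.
rewrite -eigenvalue_root_char in ra; have /eigenvalueP[v vA v0] := ra.
pose U := row_ebase v; have Uu : U \in unitmx := row_ebase_unit v.
have rv : \rank v = 1%N by rewrite rank_rV v0.
have rowU : row 0 U *m A = a *: row 0 U.
  have e : v = col_ebase v *m row 0 U.
    rewrite -{1}(mulmx_ebase v) rv -mulmxA; congr (_ *m _).
    apply/rowP => j; rewrite !mxE (bigD1 0) //= !mxE /= mul1r big1 ?addr0 // => i i0.
    by rewrite !mxE; case: i i0 => -[|i] //= hi _; rewrite mul0r.
  have cu := col_ebase_unit v; rewrite e in vA; rewrite -!mulmxA scalemxAr in vA.
  by apply: (can_inj (mulKmx cu)).
have [B eB] : exists B : 'M[F]_(1 + n), B = U *m A *m invmx U by eexists.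
have rowB : row 0 B = a *: delta_mx 0 0.
  by rewrite eB !row_mul rowU -scalemxAl -row_mul mulmxV // row1.
have BE : B = block_mx a%:M 0 (dlsubmx B) (drsubmx B).
  rewrite -[LHS]submxK; congr block_mx; apply/matrixP => i j.
    have := congr1 (fun M : 'rV_(1 + n) => M 0 (lshift n j)) rowB.
    rewrite !ord1 !mxE /= mulr1 => e; rewrite mulr1n -e; congr (B _ _); exact: val_inj.
  have := congr1 (fun M : 'rV_(1 + n) => M 0 (rshift 1 j)) rowB.
  rewrite !ord1 !mxE /= mulr0 => <-; congr (B _ _); exact: val_inj.
have [P' [T' [P'u e' t']]] := IH (drsubmx B).
pose Q : 'M[F]_(1 + n) := block_mx 1%:M 0 0 P'.
exists (Q *m U), (block_mx a%:M 0 (P' *m dlsubmx B) T'); split.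
- by rewrite unitmx_mul Uu andbT unitmxE (@det_lblock _ 1) det1 mul1r -unitmxE.
- have -> : Q *m U *m A = Q *m B *m U by rewrite eB -!mulmxA mulVmx // mulmx1.
  rewrite mulmxA; congr (_ *m _); rewrite {1}BE /Q mulmx_block [RHS](@mulmx_block _ 1 n 1 n 1 n).
  by rewrite ?mul0mx ?mul1mx ?mulmx0 ?mulmx1 ?addr0 ?add0r e'.
by rewrite (@is_trig_block_mx _ 1 n 1 n) // eqxx t' andbT; apply/is_trig_mxP => i j; rewrite !ord1.
Qed.

End Triangular.

Section Fredholm.

Definition fred (F : fieldType) n (A : 'M[F]_n) : {poly F} :=
  \det (1%:M - 'X *: map_mx polyC A).

Lemma trig_mulmx (F : fieldType) n (A B : 'M[F]_n) : is_trig_mx A -> is_trig_mx B ->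
  is_trig_mx (A *m B) /\ forall i, (A *m B) i i = A i i * B i i.
Proof.
move=> /is_trig_mxP hA /is_trig_mxP hB; split.
  apply/is_trig_mxP => i j ij; rewrite mxE big1 // => k _.
  have [ik|ki] := ltnP i k; first by rewrite hA ?mul0r.
  by rewrite hB ?mulr0 //; exact: leq_ltn_trans ij.
move=> i; rewrite mxE (bigD1 i) //= big1 ?addr0 // => k ki.
have [ik|ki'] := ltnP i k; first by rewrite hA ?mul0r.
rewrite hB ?mulr0 // ltn_neqAle ki'; by rewrite andbT; apply: contra ki => /eqP/val_inj->.
Qed.

Lemma trig_expmx (F : fieldType) n (A : 'M[F]_n) m : is_trig_mx A ->
  is_trig_mx (A ^+ m) /\ forall i, (A ^+ m) i i = A i i ^+ m.
Proof.
move=> tA; elim: m => [|m [IH1 IH2]].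
  split=> [|i]; last by rewrite !expr0 mxE eqxx.
  by apply/is_trig_mxP => i j ij; rewrite expr0 mxE; case: eqP ij => // ->; rewrite ltnn.
rewrite exprS; have [h1 h2] := trig_mulmx tA IH1; split=> // i.
by rewrite exprS -IH2; exact: h2.
Qed.

Lemma conj_expmx (F : fieldType) n (P A T : 'M[F]_n) m :
  P *m A = T *m P -> P *m (A ^+ m) = T ^+ m *m P.
Proof.
move=> e; elim: m => [|m IH]; first by rewrite !expr0 mulmx1 mul1mx.
by rewrite exprS exprSr -[A * _]/(A *m _) -[_ * T]/(_ *m T) mulmxA e -!mulmxA IH !mulmxA -[T *m T ^+ m]/(T * T ^+ m) -[T ^+ m *m T]/(T ^+ m * T) -exprS -exprSr.
Qed.

Lemma mxtrace_conj (F : fieldType) n (P A T : 'M[F]_n) :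
  P \in unitmx -> P *m A = T *m P -> \tr A = \tr T.
Proof.
move=> Pu e; rewrite -[A](mulKmx Pu) e mulmxA mxtrace_mulC.
by rewrite mulmxA mulmxV // mul1mx.
Qed.

Lemma fred_eig (F : closedFieldType) n (A : 'M[F]_n) : exists s : seq F,
  fred A = \prod_(x <- s) (1 - x *: 'X) /\ forall m, \tr (A ^+ m) = \sum_(x <- s) x ^+ m.
Proof.
have [P [T [Pu e tT]]] := ex_trigmx A.
exists [seq T i i | i <- index_enum 'I_n]; split; last first.
  move=> m; rewrite (mxtrace_conj Pu (conj_expmx m e)) big_map; apply: eq_bigr => i _.
  by have [_ ->] := trig_expmx m tT.
pose Pc := map_mx polyC P.
have Pc0 : \det Pc != 0 by rewrite det_map_mx polyC_eq0 -unitfE -unitmxE.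
apply: (mulfI Pc0); rewrite /fred -det_mulmx mulmxBr mulmx1 -scalemxAr -map_mxM e.
rewrite map_mxM scalemxAl -[X in X - _]mul1mx -mulmxBl det_mulmx mulrC; congr (_ * _).
rewrite det_trig; last first.
  apply/is_trig_mxP => i j ij; rewrite !mxE (is_trig_mxP tT) // mulr0 subr0.
  by case: eqP ij => // ->; rewrite ltnn.
rewrite big_map; apply: eq_bigr => i _; rewrite !mxE eqxx mulr1n.
by rewrite -mul_polyC mulrC.
Qed.

Lemma is_exp_linear (F : fieldType) (x : F) :
  is_exp (fun m => - x ^+ m) (fun N => (1 - x *: 'X)`_N).
Proof.
split=> [|N]; first by rewrite coefB coefZ coefX coef1 mulr0 subr0.
have cE i : (1 - x *: 'X)`_i = if i is 0 then 1 else if i is 1 then - x else 0.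
  by rewrite coefB coefZ coefX coef1; case: i => [|[|i]] /=; rewrite ?mulr0 ?subr0 ?sub0r ?mulr1.
case: N => [|[|N]]; rewrite ?mul0r ?big_ord0 ?big_ord1 //.
  by rewrite !cE mul1r expr1 mulr1.
rewrite !big_ord_recr /= !subSS subnn subSn // subnn !cE mulr0 big1 ?add0r => [|i _].
  by rewrite mulr1 mulrNN -exprSr addrN.
rewrite cE; have : (1 < N.+2 - i.+1)%N by have := ltn_ord i; lia.
by case: (N.+2 - i.+1)%N => [|[|k]] // _; rewrite mulr0.
Qed.

Lemma is_exp_prod (F : fieldType) (s : seq F) :
  is_exp (fun m => - \sum_(x <- s) x ^+ m) (fun N => (\prod_(x <- s) (1 - x *: 'X))`_N).
Proof.
elim: s => [|x s IH].
  apply: (eq_is_exp (l := fun=> 0)) => [m _|]; first by rewrite big_nil oppr0.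
  split=> [|N]; rewrite big_nil coef1 //.
  by have [_ ->] := is_exp0 F; apply: eq_bigr => i _; rewrite !mul0r.
apply: (eq_is_exp (l := fun m => - x ^+ m - \sum_(x <- s) x ^+ m)) => [m _|].
  by rewrite big_cons opprD.
have := is_exp_conv (is_exp_linear x) IH.
rewrite (_ : conv _ _ = fun N => (\prod_(x <- x :: s) (1 - x *: 'X))`_N) //.
by apply/funext => N; rewrite conv_poly big_cons.
Qed.

Lemma is_exp_fred (F : closedFieldType) n (A : 'M[F]_n) :
  is_exp (fun m => - \tr (A ^+ m)) (fun N => (fred A)`_N).
Proof.
have [s [-> e]] := fred_eig A; apply: eq_is_exp (is_exp_prod s) => m _.
by rewrite e.
Qed.

(** Each W gives a line of slope u W; together they put the Newton polygon of g above a superlinear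
    curve. In the applications [c W] bounds the number of basis vectors of weight less than W: among
    N rows of a determinant at least N - c W have weight at least W. *)
Definition bnd (p : nat) (K : padic_closure p) (u : rat) (c : nat -> nat)
    (g : nat -> Qpbar K) :=
  forall W N : nat, vge (u * (W%:R * (N%:R - (c W)%:R))) (g N).

Variables (p : nat) (p_pr : prime p) (K : padic_closure p).

(* Only the permutations of the selected rows contribute, so the potential cancels. *)
Lemma bnd_fred n (A : 'M[Qpbar K]_n) (u : rat) (w : 'I_n -> nat) (pot : 'I_n -> rat)
    (c : nat -> nat) : 0 <= u ->
  (forall i j, vge (u * (w i)%:R + pot i - pot j) (A i j)) ->
  (forall W, (#|[set i | (w i < W)%N]| <= c W)%N) ->
  bnd u c (fun N => (fred A)`_N).
Proof.
move=> u0 hA hc W N; rewrite /fred /determinant coef_sum; apply: vge_sum => s _.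
rewrite -signr_odd; set b := odd _.
have -> : ((-1) ^+ b * \prod_i (1%:M - 'X *: map_mx polyC A) i (s i))`_N =
   (-1) ^+ b * (\prod_i (1%:M - 'X *: map_mx polyC A) i (s i))`_N.
  by case: b; rewrite ?expr1 ?expr0 ?mulN1r ?mul1r // coefN.
apply: vgeMl; first by case: b; rewrite ?expr1 ?expr0 ?vgeN vge1.
have -> : \prod_i (1%:M - 'X *: map_mx polyC A) i (s i) =
   \prod_i ((- A i (s i)) *: 'X + ((i == s i)%:R)%:P).
  by apply: eq_bigr => i _; rewrite !mxE addrC -mulNr mulrC mul_polyC scalerN scaleNr polyC_natr.
(* J is the set of rows from which the term in 'X is taken; off J the identity matrix forces the
   permutation to be trivial. *)
rewrite bigA_distr coef_sum; apply: vge_sum => J _.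
have [fixJ|] := boolP [forall i, (i \notin J) ==> (s i == i)]; last first.
  rewrite negb_forall => /existsP[i]; rewrite negb_imply => /andP[iJ si].
  by rewrite (bigD1 i) //= (negPf iJ) eq_sym (negPf si) mul0r coef0 vge0.
have -> : \prod_i (if i \in J then (- A i (s i)) *: 'X else ((i == s i)%:R)%:P) =
   (\prod_(i in J) (- A i (s i))) *: 'X^#|J|.
  rewrite (bigID (mem J)) /= [X in _ * X]big1 ?mulr1 => [|i iJ]; last first.
    by rewrite (negPf iJ); move/forallP: fixJ => /(_ i); rewrite iJ => /eqP ->; rewrite eqxx.
  rewrite (eq_bigr (fun i => (- A i (s i)) *: 'X)) => [|i ->//].
  by rewrite scaler_prod prodr_const.
rewrite coefZ coefXn; have [NJ|] := eqVneq N #|J|; last by rewrite mulr0 vge0.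
rewrite mulr1; pose wt i : rat := u * (w i)%:R + pot i - pot (s i).
have h := @vge_prod p K _ (index_enum 'I_n) (mem J) wt (fun i => - A i (s i)).
apply: vgeW (h _) => [|i _]; last by rewrite vgeN hA.
rewrite /wt sumrB big_split /=.
have -> : \sum_(i in J) pot (s i) = \sum_(i in J) pot i.
  rewrite [RHS](reindex_inj (@perm_inj _ s)); apply: eq_bigl => i /=.
  apply/idP/idP => iJ; apply: contraT => h1.
    move/forallP: fixJ => /(_ (s i)); rewrite h1 => /eqP /perm_inj e.
    by rewrite e iJ in h1.
  by move/forallP: fixJ => /(_ i); rewrite h1 => /eqP e; rewrite e (negPf h1) in iJ.
rewrite addrK -mulr_sumr ler_wpM2l // -natr_sum.
have le1 : (W * (#|J| - c W) <= \sum_(i in J) w i)%N.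
  apply: (@leq_trans (\sum_(i in J :\: [set i | (w i < W)%N]) W)).
    rewrite sum_nat_const mulnC leq_mul2r; apply/orP; right.
    rewrite cardsD; apply: leq_sub2l; apply: leq_trans (hc W).
    by apply: subset_leq_card; apply: subsetIr.
  rewrite [leqRHS](big_setID [set i | (w i < W)%N]) /=.
  apply: leq_trans (leq_addl _ _); apply: leq_sum => i; rewrite !inE -leqNgt.
  by case/andP.
have le2 : W%:R * (N%:R - (c W)%:R) <= (W * (#|J| - c W))%:R :> rat.
  rewrite natrM ler_wpM2l ?ler0n // NJ lerBlDr -natrD ler_nat; lia.
by apply: le_trans le2 _; rewrite ler_nat.
Qed.

Lemma bnd_conv u c c' (g g' : nat -> Qpbar K) : 0 <= u -> bnd u c g -> bnd u c' g' ->
  bnd u (fun W => c W + c' W)%N (conv g g').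
Proof.
move=> u0 h h' W N; apply: vge_sum => i _.
have iN : (i <= N)%N by rewrite -ltnS.
apply: vgeW (vgeM (h W i) (h' W (N - i)%N)).
rewrite -mulrDr -mulrDr ler_wpM2l // ler_wpM2l ?ler0n //.
by rewrite natrB // natrD; lra.
Qed.

Lemma bnd_one u c : 0 <= u -> bnd u c (one_series (Qpbar K)).
Proof.
move=> u0 W [|N]; rewrite /one_series ?vge0 //; apply: vgeW (vge1 K).
by rewrite sub0r mulrN mulrN oppr_le0 !mulr_ge0 ?ler0n.
Qed.

Lemma bndW u c c' (g : nat -> Qpbar K) : 0 <= u -> (forall W, (c W <= c' W)%N) ->
  bnd u c g -> bnd u c' g.
Proof.
move=> u0 le h W N; apply: vgeW (h W N); rewrite ler_wpM2l // ler_wpM2l ?ler0n //.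
by rewrite lerB // ler_nat.
Qed.

Lemma bnd_vge0 u c (g : nat -> Qpbar K) N : bnd u c g -> vge 0 (g N).
Proof. by move=> /(_ 0%N N); rewrite mul0r mulr0. Qed.

End Fredholm.

(** * Newton polygons *)

Section NewtonPolygon.
Variables (p : nat) (p_pr : prime p) (K : padic_closure p).
Implicit Types (x y z : Qpbar K) (r s : rat) (G H : nat -> Qpbar K).

Definition vgt (r : rat) (x : Qpbar K) : bool := (r%:E < ordp x)%E.

Lemma vgtE r s x : ordp x = s%:E%E -> vgt r x = (r < s).
Proof. by move=> h; rewrite /vgt h lte_fin. Qed.

Lemma vgt0 r : vgt r 0.
Proof. by rewrite /vgt ordp0 ltry. Qed.

Lemma vgtW r x : vgt r x -> vge r x.
Proof. exact: ltW. Qed.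

Lemma vge_gt r s x : r < s -> vge s x -> vgt r x.
Proof. by move=> rs; rewrite /vgt /vge; apply: lt_le_trans; rewrite lte_fin. Qed.

Lemma vgtD r x y : vgt r x -> vgt r y -> vgt r (x + y).
Proof. by rewrite /vgt => h1 h2; apply: lt_le_trans (ordpD x y); rewrite lt_min h1. Qed.

Lemma vgtN r x : vgt r (- x) = vgt r x.
Proof. by rewrite /vgt ordpN. Qed.

Lemma vgt_sum r (I : Type) (t : seq I) (P : pred I) (F : I -> Qpbar K) :
  (forall i, P i -> vgt r (F i)) -> vgt r (\sum_(i <- t | P i) F i).
Proof.
by move=> h; elim/big_ind: _ => // [|x y]; [apply: vgt0 | apply: vgtD].
Qed.

Lemma vgt_geM r s x y : vgt r x -> vge s y -> vgt (r + s) (x * y).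
Proof.
have [->|x0] := eqVneq x 0; first by rewrite mul0r => *; apply: vgt0.
have [->|y0] := eqVneq y 0; first by rewrite mulr0 => *; apply: vgt0.
have [a ax] := ordp_fin x0; have [b bY] := ordp_fin y0.
have xy : ordp (x * y) = (a + b)%:E%E by rewrite ordpM ax bY.
by rewrite (vgtE _ ax) (vgeE _ bY) (vgtE _ xy) => h1 h2; rewrite ltr_leD.
Qed.

Lemma ordpD_gt r x y : ordp x = r%:E%E -> vgt r y -> ordp (x + y) = r%:E%E.
Proof.
move=> ex; have [->|y0] := eqVneq y 0; first by rewrite addr0.
have [t et] := ordp_fin y0; rewrite (vgtE _ et) => rt.
apply: (ordp_cong ex rt); rewrite opprD addrA subrr add0r vgeN.
by rewrite (vgeE _ et).
Qed.

Lemma vge_gtM r s x y : vge r x -> vgt s y -> vgt (r + s) (x * y).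
Proof. by move=> h1 h2; rewrite addrC mulrC; apply: vgt_geM. Qed.

(** The line of slope s and intercept c supports the Newton polygon of G, and a and b are the first
    and last abscissas of contact; a = b when s is not a slope. *)
Definition np G s (a b : nat) := exists c : rat,
  [/\ ordp (G a) = (c + s * a%:R)%:E%E, ordp (G b) = (c + s * b%:R)%:E%E,
      forall N, vge (c + s * N%:R) (G N) &
      forall N, (N < a)%N || (b < N)%N -> vgt (c + s * N%:R) (G N)].

Lemma np_uniq G s a b a' b' : np G s a b -> np G s a' b' -> a = a' /\ b = b'.
Proof.
suff le A B A' B' : np G s A B -> np G s A' B' -> (A <= A')%N /\ (B' <= B)%N.
  move=> h1 h2; have [? ?] := le _ _ _ _ h1 h2; have [? ?] := le _ _ _ _ h2 h1.
  by split; apply/eqP; rewrite eqn_leq; apply/andP.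
move=> [c [h1 h2 h3 h4]] [c' [h1' h2' h3' h4']].
have cc : c = c'.
  apply/eqP; rewrite eq_le; apply/andP; split.
    by have := h3 A'; rewrite (vgeE _ h1'); lra.
  by have := h3' A; rewrite (vgeE _ h1); lra.
subst c'; split; rewrite leqNgt; apply/negP => lt.
  by have := h4 A'; rewrite lt (vgtE _ h1') ltxx => /(_ isT).
by have := h4 B'; rewrite lt orbT (vgtE _ h2') ltxx => /(_ isT).
Qed.

Lemma eq_np G H s a b : G =1 H -> np G s a b -> np H s a b.
Proof. by move=> /funext ->. Qed.

(** The supporting lines add up, and at each of the two end abscissas a single term of the
    convolution attains the minimum, so nothing cancels there. *)
Lemma np_conv G H s a b a' b' : np G s a b -> np H s a' b' ->
  np (conv G H) s (a + a')%N (b + b')%N.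
Proof.
move=> [c [h1 h2 h3 h4]] [c' [h1' h2' h3' h4']]; exists (c + c').
have split_r N (i : 'I_N.+1) : c + c' + s * N%:R = (c + s * i%:R) + (c' + s * (N - i)%N%:R).
  have iN : (i <= N)%N by rewrite -ltnS.
  by rewrite natrB //; ring.
have exact_at A A' : ordp (G A) = (c + s * A%:R)%:E%E ->
    ordp (H A') = (c' + s * A'%:R)%:E%E ->
    (forall i, (i <= A + A')%N -> i != A -> vgt (c + s * i%:R) (G i) ||
       vgt (c' + s * (A + A' - i)%N%:R) (H (A + A' - i)%N)) ->
    ordp (conv G H (A + A')%N) = (c + c' + s * (A + A')%:R)%:E%E.
  move=> e1 e2 h; have lt : (A < (A + A').+1)%N by lia.
  rewrite /conv (bigD1 (Ordinal lt)) //=; apply: ordpD_gt.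
    by rewrite addKn ordpM e1 e2 natrD; congr (_%:E)%E; ring.
  apply: vgt_sum => i iA; rewrite (split_r _ i).
  have iN : (i <= A + A')%N by rewrite -ltnS.
  have /orP[g|g] := h i iN iA; first by apply: vgt_geM.
  by apply: vge_gtM.
split.
- apply: exact_at => // i iN iA; have [lt|] := ltnP i a; first by rewrite h4 ?lt.
  rewrite leq_eqVlt eq_sym (negPf iA) /= => lt; rewrite h4' ?orbT //.
  by apply/orP; left; lia.
- apply: exact_at => // i iN iA; have [lt|] := ltnP b i; first by rewrite h4 ?lt ?orbT.
  rewrite leq_eqVlt (negPf iA) /= => lt; rewrite h4' ?orbT //.
  by apply/orP; right; lia.
- by move=> N; apply: vge_sum => i _; rewrite (split_r _ i); apply: vgeM.
move=> N hN; apply: vgt_sum => i _; rewrite (split_r _ i).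
have iN : (i <= N)%N by rewrite -ltnS.
have [g|g] : (i < a)%N || (b < i)%N \/ (N - i < a')%N || (b' < N - i)%N.
  case/orP: hN => hN; [have [lt|ge] := ltnP i a | have [lt|ge] := ltnP b i].
  - by left.
  - by right; apply/orP; left; lia.
  - by left; rewrite orbT.
  by right; apply/orP; right; lia.
- by apply: vgt_geM => //; apply: h4.
by apply: vge_gtM => //; apply: h4'.
Qed.

Lemma np_tail G s r : s < r -> G 0%N = 1 -> (forall N, vge (r * N%:R) (G N)) -> np G s 0 0.
Proof.
move=> sr G0 h; exists 0; rewrite G0 mulr0 addr0 ordp1; split=> // N.
  by rewrite add0r; apply: vgeW (h N); rewrite ler_wpM2r ?ler0n // ltW.
by rewrite /= => N0; rewrite add0r; apply: vge_gt (h N); rewrite ltr_pM2r ?ltr0n.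
Qed.

Lemma np_one s : np (one_series (Qpbar K)) s 0 0.
Proof.
by apply: (@np_tail _ _ (s + 1)) => [|//|[|N]]; rewrite /one_series ?mulr0 ?vge0 ?vge1 //; lra.
Qed.

Lemma np_linear z s : np (fun N => (1 - z *: 'X)`_N) s
  (ordp z < s%:E)%E (ordp z <= s%:E)%E.
Proof.
have cE i : (1 - z *: 'X)`_i = if i is 0 then 1 else if i is 1 then - z else 0.
  by rewrite coefB coefZ coefX coef1; case: i => [|[|i]] /=; rewrite ?mulr0 ?subr0 ?sub0r ?mulr1.
have [->|z0] := eqVneq z 0.
  rewrite ordp0 ltNge leey leye_eq /=.
  by apply: eq_np (np_one s) => N; rewrite scale0r subr0 coef1.
have [r er] := ordp_fin z0; rewrite er lte_fin lee_fin.
have e1 : ordp (- z) = r%:E%E by rewrite ordpN.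
case: ltgtP => rs /=; [exists (r - s) | exists 0 | exists 0].
all: rewrite !cE ?ordp1 ?e1 ?mulr0 ?mulr1 ?addr0 ?add0r ?subrK; split=> //; rewrite ?rs //.
all: move=> [|[|N]]; rewrite cE ?vge0 ?vgt0 // ?mulr0 ?mulr1 ?addr0 ?add0r ?subrK.
all: rewrite ?(vgeE _ e1) ?(vgtE _ e1) ?(vgeE _ (ordp1 K)) ?(vgtE _ (ordp1 K)) // ?rs; lra.
Qed.

Lemma np_prod (t : seq (Qpbar K)) s : np (fun N => (\prod_(z <- t) (1 - z *: 'X))`_N) s
  (\sum_(z <- t) (ordp z < s%:E)%E)%N (\sum_(z <- t) (ordp z <= s%:E)%E)%N.
Proof.
elim: t => [|z t IH]; rewrite ?big_nil ?big_cons.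
  by apply: eq_np (np_one s) => N; rewrite coef1.
by apply: eq_np (np_conv (np_linear z s) IH) => N; rewrite conv_poly.
Qed.

(** Contact points of the truncation at N0, found by adding one coefficient at a time: a new point
    is above the current line, on it, or below it, and in the last case it becomes the only contact
    point. *)
Lemma np_upto G s N0 : G 0%N = 1 -> exists a b c, [/\ (a <= N0)%N, (b <= N0)%N, c <= 0,
  ordp (G a) = (c + s * a%:R)%:E%E & [/\ ordp (G b) = (c + s * b%:R)%:E%E,
   forall N, (N <= N0)%N -> vge (c + s * N%:R) (G N) &
   forall N, (N <= N0)%N -> (N < a)%N || (b < N)%N -> vgt (c + s * N%:R) (G N)]].
Proof.
move=> G0; elim: N0 => [|N0 [a [b [c [aN bN c0 ha [hb h1 h2]]]]]].
  exists 0%N, 0%N, 0; rewrite G0 mulr0 addr0 ordp1; split=> //; split=> //.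
    by case=> // _; rewrite G0 mulr0 addr0 vge1.
  by case.
pose d := c + s * N0.+1%:R.
have [lt|] := boolP (vgt d (G N0.+1)).
  exists a, b, c; split=> //; [exact: leqW | exact: leqW|]; split=> // N.
    by rewrite leq_eqVlt => /orP[/eqP->|]; [exact: vgtW | exact: h1].
  by rewrite leq_eqVlt => /orP[/eqP->|]; [move=> _; exact: lt | exact: h2].
rewrite /vgt -leNgt => le.
have x0 : G N0.+1 != 0 by apply/eqP => e; rewrite e ordp0 in le.
have [r er] := ordp_fin x0; rewrite er lee_fin in le.
move: le; rewrite le_eqVlt => /orP[/eqP re|lt].
  exists a, N0.+1, c; split=> //; first exact: leqW.
  split=> [|N|N]; first by rewrite er re.
    by rewrite leq_eqVlt => /orP[/eqP->|]; [rewrite (vgeE _ er) re | exact: h1].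
  rewrite leq_eqVlt => /orP[/eqP->|NN]; first by rewrite ltnn orbF => /leq_trans /(_ aN); lia.
  by case/orP => lt; apply: h2 => //; [rewrite lt | lia].
exists N0.+1, N0.+1, (r - s * N0.+1%:R); rewrite er subrK; split=> //.
  by apply: le_trans c0; rewrite lerBlDr; apply: ltW.
split=> // N; rewrite leq_eqVlt => /orP[/eqP->|NN].
- by rewrite subrK (vgeE _ er).
- by apply: vgeW (h1 _ NN); rewrite /d in lt; lra.
- by rewrite ltnn.
by move=> _; apply: vge_gt (h1 _ NN); rewrite /d in lt; lra.
Qed.

(** Only finitely many coefficients matter for slopes up to s, uniformly in G. If u W > s + u, the
    line attached to W exceeds s N as soon as N > W c(W). *)
Lemma bnd_slope u c s : 0 < u -> exists N0 : nat, forall G, bnd u c G ->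
  forall N, (N0 < N)%N -> vgt (s * N%:R) (G N).
Proof.
move=> u0; pose W := Num.bound (`|s| / u + 1).
have hW : s + u < u * W%:R.
  have : `|s| / u + 1 < W%:R.
    by have := archi_boundP (normr_ge0 (`|s| / u + 1)); rewrite ger0_norm ?addr_ge0 ?mulr_ge0 // ?invr_ge0 ltW.
  rewrite -ltrBrDr ltr_pdivrMr // => h; have := ler_norm s; nra.
exists (W * c W)%N => G h N hN; apply: vge_gt (h W N).
have h1 : (W * c W)%:R < N%:R :> rat by rewrite ltr_nat.
rewrite natrM in h1; have n0 : 0 <= N%:R :> rat by rewrite ler0n.
have : (s + u) * N%:R <= u * W%:R * N%:R by rewrite ler_wpM2r // ltW.
nra.
Qed.

Lemma np_exists u c s G : 0 < u -> bnd u c G -> G 0%N = 1 -> exists a b, np G s a b.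
Proof.
move=> u0 hG G0; have [N0 h] := bnd_slope c s u0.
have [a [b [d [aN bN d0 ha [hb h1 h2]]]]] := np_upto s N0 G0.
have big N : (N0 < N)%N -> vgt (d + s * N%:R) (G N).
  move=> /(h _ hG) h3; apply: le_lt_trans h3; rewrite lee_fin; lra.
exists a, b, d; split=> // N => [|hN].
  by have [/h1//|/big/vgtW] := leqP N N0.
by have [/h2|/big] := leqP N N0; [exact|].
Qed.

(** Beyond N0 both series are above every supporting line of slope at most s. Up to N0 these lines
    stay below M0, their intercept being at most 0 because the constant term is 1; so a congruence
    modulo p^M0 neither moves a contact point nor creates one. *)
Lemma np_cong u c s : 0 < u -> exists M0 : nat, forall G H,
  bnd u c G -> bnd u c H -> G 0%N = 1 -> H 0%N = 1 ->
  (forall N, vge M0%:R (G N - H N)) ->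
  forall s' a b, 0 <= s' <= s -> np G s' a b -> np H s' a b.
Proof.
move=> u0; have [N0 hN0] := bnd_slope c s u0.
pose M0 := (Num.bound `|s * N0%:R|).+1; exists M0.
have hM : s * N0%:R + 1 < M0%:R.
  rewrite /M0 -addn1 natrD ltrD2r; apply: le_lt_trans (ler_norm _) _.
  by have := archi_boundP (normr_ge0 `|s * N0%:R|); rewrite normr_id.
move=> G H hG hH G0 H0 cong s' a b /andP[s0 ss] [d [h1 h2 h3 h4]].
have d0 : d <= 0 by have := h3 0%N; rewrite G0 (vgeE _ (ordp1 K)) mulr0 addr0.
have low N : (N <= N0)%N -> d + s' * N%:R < M0%:R.
  move=> NN; have le1 : N%:R <= N0%:R :> rat by rewrite ler_nat.
  have n0 : 0 <= N%:R :> rat by rewrite ler0n.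
  have : s' * N%:R <= s * N0%:R by apply: ler_pM.
  lra.
have high N : d + s' * N%:R <= s * N%:R.
  have : s' * N%:R <= s * N%:R by rewrite ler_wpM2r ?ler0n.
  lra.
have att N : ordp (G N) = (d + s' * N%:R)%:E%E -> (N <= N0)%N.
  move=> e; rewrite leqNgt; apply/negP => /(hN0 _ hG); rewrite (vgtE _ e).
  by rewrite ltNge high.
have aN := att _ h1; have bN := att _ h2.
exists d; split.
- exact: (ordp_cong h1 (low _ aN)).
- exact: (ordp_cong h2 (low _ bN)).
- move=> N; have [NN|NN] := leqP N N0.
    by rewrite -(vge_cong (ltW (low _ NN)) (cong N)).
  by apply: vgeW (vgtW (hN0 _ hH _ NN)).
move=> N hN; have [NN|NN] := leqP N N0; last first.
  by apply: le_lt_trans (hN0 _ hH _ NN); rewrite lee_fin.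
have -> : H N = G N + - (G N - H N) by rewrite opprB addrC subrK.
apply: vgtD; first exact: h4.
by rewrite vgtN; apply: vge_gt (cong N); apply: low.
Qed.

End NewtonPolygon.

(** * Factorizations and slopes *)

Section Factorization.
Variables (p : nat) (p_pr : prime p) (K : padic_closure p).
Implicit Types (x y z c : Qpbar K) (r s : rat) (f g : nat -> Qpbar K).
Implicit Types ze : (nat -> Qpbar K) * (nat -> bool).

Lemma padic_cvg_cst x : padic_cvg (fun=> x) x.
Proof. by move=> N; exists 0%N => i _; rewrite subrr; exact: vge0. Qed.

Lemma padic_cvgD (u v : nat -> Qpbar K) x y : padic_cvg u x -> padic_cvg v y ->
  padic_cvg (fun i => u i + v i) (x + y).
Proof.
move=> hu hv N; have [M1 h1] := hu N; have [M2 h2] := hv N.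
exists (maxn M1 M2) => i; rewrite geq_max => /andP[i1 i2].
by rewrite opprD addrACA; apply: vgeD; [exact: h1 | exact: h2].
Qed.

Lemma padic_cvg_sum n (u : 'I_n -> nat -> Qpbar K) (x : 'I_n -> Qpbar K) :
  (forall i, padic_cvg (u i) (x i)) ->
  padic_cvg (fun M => \sum_(i < n) u i M) (\sum_(i < n) x i).
Proof.
elim: n u x => [|n IH] u x h.
  by move=> N; exists 0%N => i _; rewrite !big_ord0 subrr; exact: vge0.
move=> N; have [M hM] := padic_cvgD (IH _ _ (fun i => h (widen_ord (leqnSn n) i))) (h ord_max) N.
by exists M => i /hM; rewrite !big_ord_recr.
Qed.

Lemma vge_some c : exists r : nat, vge (- r%:R) c.
Proof.
have [->|c0] := eqVneq c 0; first by exists 0%N; apply: vge0.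
have [r er] := ordp_fin c0; exists (Num.bound `|r|); rewrite (vgeE _ er).
have := archi_boundP (normr_ge0 `|r|); have := ler_norm (- r); rewrite normrN normr_id; lra.
Qed.

Lemma padic_cvgZ c (u : nat -> Qpbar K) x : padic_cvg u x -> padic_cvg (fun i => c * u i) (c * x).
Proof.
move=> hu N; have [r hr] := vge_some c; have [M hM] := hu (N + r)%N.
exists M => i /hM h; rewrite -mulrBr; have := vgeM hr h.
by rewrite natrD addrC addrK.
Qed.

Lemma padic_cvg_conv g (u : nat -> nat -> Qpbar K) f N :
  (forall i, padic_cvg (u ^~ i) (f i)) ->
  padic_cvg (fun M => conv g (u M) N) (conv g f N).
Proof. by move=> h; apply: padic_cvg_sum => i; apply: padic_cvgZ. Qed.

Lemma padic_cvg_vge (u : nat -> Qpbar K) x r : padic_cvg u x ->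
  (forall M, exists2 i, (M <= i)%N & vge r (u i)) -> vge r x.
Proof.
move=> hu h; have [M hM] := hu (Num.bound `|r|); have [i Mi ui] := h M.
rewrite -[x](subrK (u i)) addrC; apply: vgeD ui _; rewrite vgeBC.
apply: vgeW (hM _ Mi); have := archi_boundP (normr_ge0 `|r|).
by have := ler_norm r; rewrite normr_id; lra.
Qed.

Lemma padic_cvg_uniq (u : nat -> Qpbar K) x y : padic_cvg u x -> padic_cvg u y -> x = y.
Proof.
move=> hx hy; apply/eqP; rewrite -subr_eq0; apply/eqP; apply: vge_eq0 => N.
have [M1 h1] := hx N; have [M2 h2] := hy N.
have := vgeB (h2 _ (leq_maxr M1 M2)) (h1 _ (leq_maxl M1 M2)).
by rewrite opprB addrC addrA subrK.
Qed.

Lemma coef_prod_eq (I : Type) (t : seq I) (P Q : I -> {poly Qpbar K}) N :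
  (forall i k, (k <= N)%N -> (P i)`_k = (Q i)`_k) ->
  (\prod_(i <- t) P i)`_N = (\prod_(i <- t) Q i)`_N.
Proof.
elim: t N => [|i t IH] N h; rewrite ?big_nil // !big_cons; apply: coefM_eq => [k|k kN].
  exact: h.
by apply: IH => j l lk; apply: h; exact: leq_trans kN.
Qed.

Definition lfs ze i : nat -> Qpbar K := linear_factor (ze.1 i) (ze.2 i).
Definition partial ze M N := (\prod_(i < M) trunc_series (lfs ze i) N)`_N.

Lemma partial0 ze : partial ze 0 =1 one_series _.
Proof. by move=> N; rewrite /partial big_ord0 coef1. Qed.

Lemma partialS ze M : partial ze M.+1 =1 conv (partial ze M) (lfs ze M).
Proof.
move=> N; rewrite /partial big_ord_recr coefM; apply: eq_bigr => i _ /=.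
have iN : (i <= N)%N by rewrite -ltnS.
rewrite coef_trunc leq_subr; congr (_ * _); apply: coef_prod_eq => j k ki.
by rewrite !coef_trunc ki (leq_trans ki iN).
Qed.

Lemma partial_add ze I0 M : partial ze (I0 + M) =1
  conv (partial ze I0) (partial (fun i => ze.1 (I0 + i)%N, fun i => ze.2 (I0 + i)%N) M).
Proof.
elim: M => [|M IH] N.
  by rewrite addn0 convC (eq_conv (f' := one_series _) (g' := partial ze I0)) ?conv1 // => i _; rewrite partial0.
rewrite addnS partialS (eq_conv (f' := _) (g' := lfs ze (I0 + M)) (fun i _ => IH i)) //.
by rewrite -convA; apply: eq_conv => // i _; rewrite partialS.
Qed.

Lemma lfs0 ze i : lfs ze i 0%N = 1.
Proof.
by rewrite /lfs /linear_factor; case: ifP => _ //; rewrite coefB coefZ coefX coef1 mulr0 subr0.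
Qed.

Lemma partial_coef0 ze M : partial ze M 0%N = 1.
Proof.
elim: M => [|M IH]; first by rewrite partial0.
by rewrite partialS conv_coef0 IH lfs0 mulr1.
Qed.

Lemma lfs_true ze i : ze.2 i -> lfs ze i =1 fun N => (1 - ze.1 i *: 'X)`_N.
Proof. by rewrite /lfs /linear_factor => ->. Qed.

Lemma lfs_false ze i : ~~ ze.2 i ->
  conv (lfs ze i) (fun N => (1 - ze.1 i *: 'X)`_N) =1 one_series _.
Proof.
rewrite /lfs /linear_factor => /negbTE -> N; rewrite convC.
have cE k : (1 - ze.1 i *: 'X)`_k = if k is 0 then 1 else if k is 1 then - ze.1 i else 0.
  by rewrite coefB coefZ coefX coef1; case: k => [|[|k]] /=; rewrite ?mulr0 ?subr0 ?sub0r ?mulr1.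
case: N => [|N]; first by rewrite conv_coef0 cE mul1r.
rewrite /conv !big_ord_recl /= !cE mul1r mulNr subn0 subSS subn0 -exprS big1 ?addr0 ?addrN //.
by move=> j _; rewrite cE mul0r.
Qed.

Lemma lfs_vge ze i r N : vge r (ze.1 i) -> vge (r * N%:R) (lfs ze i N).
Proof.
move=> h; case: (boolP (ze.2 i)) => e.
  rewrite lfs_true // coefB coefZ coefX coef1; case: N => [|[|N]] /=.
  - by rewrite mulr0 !mulr0 subr0 vge1.
  - by rewrite mulr1 sub0r mulr1 vgeN.
  by rewrite mulr0 subr0 vge0.
by rewrite /lfs /linear_factor (negPf e) mulrC; apply: vgeX.
Qed.

Lemma conv_vge r g h N : (forall k, vge (r * k%:R) (g k)) -> (forall k, vge (r * k%:R) (h k)) ->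
  vge (r * N%:R) (conv g h N).
Proof.
move=> hg hh; apply: vge_sum => i _; have iN : (i <= N)%N by rewrite -ltnS.
by apply: vgeW (vgeM (hg i) (hh (N - i)%N)); rewrite -mulrDr -natrD subnKC.
Qed.

Lemma partial_vge ze M r N : (forall i, vge r (ze.1 i)) -> vge (r * N%:R) (partial ze M N).
Proof.
move=> h; elim: M N => [|M IH] N.
  by rewrite partial0; case: N => [|N]; rewrite /one_series ?mulr0 ?vge1 ?vge0.
by rewrite partialS; apply: conv_vge => // k; apply: lfs_vge.
Qed.

Definition zeros ze M e : seq (Qpbar K) := [seq ze.1 i | i <- iota 0 M & ze.2 i == e].

Lemma zerosS ze M e : zeros ze M.+1 e = zeros ze M e ++ (if ze.2 M == e then [:: ze.1 M] else [::]).
Proof. by rewrite /zeros -addn1 iotaD filter_cat map_cat add0n /=; case: ifP. Qed.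

Lemma partial_zeros ze M :
  conv (partial ze M) (fun N => (\prod_(z <- zeros ze M false) (1 - z *: 'X))`_N)
  =1 fun N => (\prod_(z <- zeros ze M true) (1 - z *: 'X))`_N.
Proof.
elim: M => [|M IH] N.
  by rewrite !big_nil (eq_conv (f' := one_series _) (g' := one_series _)) ?conv1 ?coef1 // => i _; rewrite ?partial0 ?coef1.
rewrite (eq_conv (f' := conv (partial ze M) (lfs ze M)) (fun i _ => partialS ze M i) (fun=> fun=> erefl)).
rewrite !zerosS !big_cat /=; case: (boolP (ze.2 M)) => e.
  rewrite /= !big_cons !big_nil !mulr1 -conv_poly.
  rewrite -[in RHS](eq_conv (fun i _ => IH i) (fun=> fun=> erefl)).
  by rewrite -!convA; apply: eq_conv => // i _; rewrite convC; apply: eq_conv => // k _; rewrite lfs_true.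
rewrite /= !big_cons !big_nil !mulr1 -IH.
rewrite (eq_conv (fun=> fun=> erefl) (fun i _ => esym (conv_poly _ _ i))).
rewrite -!convA; apply: eq_conv => // i _; rewrite convCA convC.
rewrite (eq_conv (f' := one_series _) (fun k _ => lfs_false e k) (fun=> fun=> erefl)).
by rewrite conv1.
Qed.

Lemma is_factorization_cvg0 f ze : is_factorization f ze ->
  forall N : nat, exists M, forall i, (M <= i)%N -> vge N%:R (ze.1 i).
Proof.
move=> /(_ 1%N) h N; have [M hM] := h N; exists M => i Mi.
have := vgeB (hM i.+1 (leqW Mi)) (hM i Mi).
rewrite opprB addrA subrK -[X in X - _]/(partial ze i.+1 1) -[X in _ - X]/(partial ze i 1).
rewrite partialS /conv big_ord_recr big_ord1 /= subn0 subnn lfs0 mulr1 partial_coef0 mul1r addrK.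
rewrite /lfs /linear_factor; case: ifP => _; last by rewrite expr1.
by rewrite coefB coefZ coefX coef1 mulr1 sub0r vgeN.
Qed.

Lemma factorizationP f : (exists ze, is_factorization f ze) ->
  is_factorization f (factorization f).
Proof. by move=> h; apply: (@xgetPex _ _ [set ze | is_factorization f ze]). Qed.

Lemma size_prod_linear (t : seq (Qpbar K)) : 0 \notin t ->
  size (\prod_(z <- t) (1 - z *: 'X)) = (size t).+1.
Proof.
elim: t => [|z t IH]; rewrite ?big_nil ?size_poly1 // inE negb_or eq_sym => /andP[z0 /IH h].
rewrite big_cons; have s2 : size (1 - z *: 'X) = 2%N.
  rewrite addrC size_polyDl ?size_polyN ?size_scale // ?size_polyX //.
  by rewrite size_poly1.
by rewrite size_mul -?size_poly_gt0 ?h ?s2.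
Qed.

Lemma size_slope_poly f s e I0 :
  (forall i, (I0 <= i)%N -> vge (s + 1) ((factorization f).1 i)) ->
  (size (slope_poly f s e)).-1 =
  (\sum_(z <- zeros (factorization f) I0 e) (ordp z == s%:E%E))%N.
Proof.
move=> tail; set ze := factorization f.
pose r := [seq i <- iota 0 I0 | (ordp (ze.1 i) == s%:E%E) && (ze.2 i == e)].
have inr i : (i \in r) = [&& ordp (ze.1 i) == s%:E%E, ze.2 i == e & (i < I0)%N].
  by rewrite mem_filter mem_iota /= add0n andbA.
have -> : slope_poly f s e = \prod_(z <- [seq ze.1 i | i <- r]) (1 - z *: 'X).
  rewrite /slope_poly (fsbigE r) ?filter_uniq ?iota_uniq //.
  - rewrite big_map [LHS]big_seq_cond [RHS]big_seq; apply: eq_bigl => i.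
    case: (boolP (i \in r)) => //= ir; have := ir; rewrite inr.
    by case/and3P => /eqP h1 /eqP h2 _; apply: mem_set; split.
  - by move=> i /=; rewrite inr => /and3P[/eqP h1 /eqP h2 _].
  move=> i [h1 h2]; rewrite inr h1 h2 !eqxx /= -leqNgt => /tail; rewrite -/ze.
  by rewrite (vgeE _ h1) => h3; exfalso; move: h3; lra.
rewrite size_prod_linear /=; last first.
  apply/mapP => -[i]; rewrite inr => /and3P[/eqP h1 _ _] h; move: h1.
  by rewrite -h ordp0.
rewrite size_map size_filter /zeros big_map big_filter -sum1_count big_mkcond [RHS]big_mkcond /=.
by apply: eq_bigr => i _; rewrite andbC; case: (ze.2 i == e); case: (ordp _ == _).
Qed.

Lemma count_slope s (t : seq (Qpbar K)) :
  (\sum_(z <- t) (ordp z == s%:E%E))%:Z =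
  (\sum_(z <- t) (ordp z <= s%:E)%E)%:Z - (\sum_(z <- t) (ordp z < s%:E)%E)%:Z :> int.
Proof.
elim: t => [|z t IH]; rewrite ?big_nil // !big_cons !PoszD IH le_eqVlt.
have : ((ordp z == s%:E%E) + (ordp z < s%:E)%E =
    ((ordp z == s%:E%E) || (ordp z < s%:E)%E))%N.
  by case: eqVneq => [->|] //=; rewrite ltxx.
move: (\sum_(z0 <- t) (ordp z0 <= s%:E)%E)%N (\sum_(z0 <- t) (ordp z0 < s%:E)%E)%N => m n.
by case: (ordp z == _); case: (_ < _)%E => //=; lia.
Qed.

(** [factorization] picks an arbitrary factorization. Let A and B collect the numerators and
    denominators among its first I0 factors, so that f = A t / B where the tail t has no slope up to
    s. Comparing the Newton polygons in A t Q = B P counts the zeros and poles of slope s through P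
    and Q alone. *)
Lemma slope_degreeE f P Q s a b a' b' : (exists ze, is_factorization f ze) ->
  conv f Q =1 P -> np P s a b -> np Q s a' b' ->
  slope_degree f s = (b%:Z - a%:Z) - (b'%:Z - a'%:Z).
Proof.
move=> /factorizationP fact fQ nP nQ; set ze := factorization f in fact.
pose r := (Num.bound `|s + 1|).
have rs : s + 1 <= r%:R.
  by have := archi_boundP (normr_ge0 `|s + 1|); have := ler_norm (s + 1); rewrite normr_id /r; lra.
have [I0 hI0] := is_factorization_cvg0 fact r.
pose tz e := zeros ze I0 e.
pose A N := (\prod_(z <- tz true) (1 - z *: 'X))`_N.
pose B N := (\prod_(z <- tz false) (1 - z *: 'X))`_N.
have A0 : A 0%N = 1 by case: (is_exp_prod (tz true)).
have B0 : B 0%N = 1 by case: (is_exp_prod (tz false)).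
pose ze' := (fun i => ze.1 (I0 + i)%N, fun i => ze.2 (I0 + i)%N).
pose t := conv (inv_series A) (conv f B).
have At : conv A t =1 conv f B.
  move=> N; rewrite convA (eq_conv (f' := one_series _) (fun i _ => conv_inv A0 i) (fun=> fun=> erefl)).
  by rewrite conv1.
have tl M : partial ze' M =1 conv (inv_series A) (conv B (partial ze (I0 + M))).
  move=> N; have e : conv A (partial ze' M) =1 conv B (partial ze (I0 + M)).
    move=> k; rewrite [RHS](eq_conv (fun=> fun=> erefl) (fun i _ => partial_add ze I0 M i)).
    rewrite [RHS]convA; apply: eq_conv => // i _.
    by rewrite convC partial_zeros.
  rewrite -(eq_conv (fun=> fun=> erefl) (fun i _ => e i)) convA.
  rewrite (eq_conv (f' := one_series _) (g' := partial ze' M)) ?conv1 // => i _.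
  by rewrite convC conv_inv.
(* The series t is a limit of partial products of the tail, and these satisfy the bound
   uniformly. *)
have t_ge N : vge (r%:R * N%:R) (t N).
  have cvg i : padic_cvg (fun M => conv B (partial ze M) i) (conv f B i).
    by rewrite convC; apply: padic_cvg_conv => k; exact: fact.
  apply: padic_cvg_vge (@padic_cvg_conv (inv_series A) (fun M => conv B (partial ze M)) _ N cvg) _.
  move=> M; exists (I0 + M)%N; first exact: leq_addl.
  by rewrite -tl; apply: partial_vge => i; apply: hI0; exact: leq_addr.
have t0 : t 0%N = 1.
  rewrite /t !conv_coef0 inv_series0 B0 mul1r mulr1.
  have := fact 0%N => /padic_cvg_uniq; apply=> N; exists 0%N => i _.
  by rewrite -[X in _ - X](partial_coef0 ze i) subrr; exact: vge0.
have nt : np t s 0 0 by apply: (@np_tail _ _ _ _ r%:R) => //; lra.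
have nl := np_conv p_pr (np_conv p_pr (np_prod p_pr (tz true) s) nt) nQ.
have nr := np_conv p_pr (np_prod p_pr (tz false) s) nP.
have lr : conv (conv A t) Q =1 conv B P.
  move=> N; rewrite (eq_conv (fun i _ => At i) (fun=> fun=> erefl)).
  rewrite (eq_conv (f' := conv B f) (fun i _ => convC f B i) (fun=> fun=> erefl)) -convA.
  exact: eq_conv.
have [h1 h2] := np_uniq (eq_np lr nl) nr.
have tail i : (I0 <= i)%N -> vge (s + 1) ((factorization f).1 i).
  by move=> /hI0; apply: vgeW.
rewrite /slope_degree !(size_slope_poly _ tail) -/ze -/(tz true) -/(tz false) !count_slope.
by move: h1 h2; rewrite !addn0; lia.
Qed.

End Factorization.

(** * The local field generated by a primitive p-th root of unity *)

Lemma big_ord_prev (V : nmodType) q (F : nat -> V) : (0 < q)%N ->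
  \sum_(i < q) F i = \sum_(i < q.-1) F i + F q.-1.
Proof. by case: q => // q _; rewrite big_ord_recr. Qed.

Section LocalField.
Variables (p : nat) (p_pr : prime p) (K : padic_closure p).
Implicit Types (x y z : Qpbar K) (r s : rat).

Lemma ordp_int (m : int) : m != 0 -> exists k : nat, ordp (m%:~R : Qpbar K) = k%:R%:E%E.
Proof.
case: m => n n0; [exists (logn p n)|exists (logn p n.+1)].
  by rewrite -pmulrn ordp_nat // lt0n.
by rewrite NegzE mulrNz ordpN -pmulrn ordp_nat.
Qed.

Lemma ratr_frac (q : rat) : (ratr q : Qpbar K) = (numq q)%:~R / (denq q)%:~R.
Proof. by []. Qed.

Lemma ratr_0 (F : unitRingType) : ratr 0 = 0 :> F.
Proof. by rewrite /ratr mul0r. Qed.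

Lemma intr_eq0_Qpbar (m : int) : ((m%:~R : Qpbar K) == 0) = (m == 0).
Proof.
have e n : ((n%:R : Qpbar K) == 0) = (n == 0%N) by exact: natr_Qpbar_eq0.
by case: m => n; rewrite ?NegzE ?mulrNz ?oppr_eq0 -pmulrn e.
Qed.

Lemma Qp_incl_ratr (q : rat) : Qp_incl K (ratr q) = ratr q.
Proof.
have ci (m : int) : Qp_incl K m%:~R = m%:~R by rewrite rmorph_int.
by rewrite /ratr fmorph_div !ci.
Qed.

Lemma ordp_ratr (q : rat) : q != 0 -> exists z : int, ordp (ratr q : Qpbar K) = z%:~R%:E%E.
Proof.
move=> q0; have n0 : numq q != 0 by rewrite numq_eq0.
have [a ha] := ordp_int n0; have [b hb] := ordp_int (denq_neq0 q).
exists (a%:Z - b%:Z); rewrite ratr_frac ordpM ha (ordpV hb).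
by rewrite intrB.
Qed.

(** A nonzero element of [Qp] has the valuation of any sufficiently close rational number. *)
Lemma ordp_Qp (a : Qp K) : a != 0 -> exists z : int, ordp (Qp_incl K a) = z%:~R%:E%E.
Proof.
move=> a0; have ia0 : Qp_incl K a != 0 by rewrite fmorph_eq0.
have [r er] := ordp_fin ia0; have [q hq] := Qp_dense a (Num.bound `|r|).
have lt : r < (Num.bound `|r|)%:R.
  by have := archi_boundP (normr_ge0 `|r|); have := ler_norm r; rewrite normr_id; lra.
rewrite rmorphB Qp_incl_ratr in hq.
have eq := ordp_cong er lt hq.
have q0 : q != 0.
  by apply: contra_eqN eq => /eqP ->; rewrite ratr_0 ordp0.
by have [z hz] := ordp_ratr q0; exists z; rewrite er -hz eq.
Qed.

Lemma ratr_approx (q : rat) (N : nat) : vge 0 (ratr q : Qpbar K) ->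
  exists2 z : nat, (z < p ^ N)%N & vge N%:R (ratr q - z%:R : Qpbar K).
Proof.
move=> hq; have [q0|q0] := eqVneq q 0.
  exists 0%N; first by rewrite expn_gt0 prime_gt0.
  by rewrite q0 ratr_0 subr0 vge0.
have cop : coprime p `|denq q|.
  rewrite prime_coprime //; apply/negP => pd.
  have cn : coprime p `|numq q|.
    rewrite prime_coprime //; apply/negP => pn; have := coprime_num_den q.
    by rewrite /coprime => /eqP e; have := dvdn_gcd p `|numq q| `|denq q|; rewrite pn pd e dvdn1 => /eqP h; move: p_pr; rewrite h.
  have en : ordp ((numq q)%:~R : Qpbar K) = 0%:E%E.
    by have := ordp_coprime p_pr K cn; case: (numq q) => m; rewrite ?NegzE ?mulrNz ?ordpN -?pmulrn.
  have ed : ordp ((denq q)%:~R : Qpbar K) = (logn p `|denq q|)%:R%:E%E.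
    by have := denq_gt0 q; case: (denq q) => // m m0; rewrite -pmulrn ordp_nat.
  have lg : (0 < logn p `|denq q|)%N.
    by rewrite -pfactor_dvdn ?expn1 // absz_gt0 denq_neq0.
  have h : ordp (ratr q : Qpbar K) = (- (logn p `|denq q|)%:R)%:E%E.
    by rewrite ratr_frac ordpM en (ordpV ed) add0e.
  by move: hq; rewrite (vgeE _ h) oppr_ge0 leNgt ltr0n lg.
have copN : coprimez (p ^ N)%N (denq q) by rewrite coprimezE absz_nat coprimeXl.
have /coprimezP[[a b] /= ab] := copN.
(* b is an inverse of the denominator modulo p^N. *)
pose z := (((numq q) * b) %% (p ^ N)%N)%Z.
have pN0 : ((p ^ N)%N : int) != 0 by rewrite eqz_nat -lt0n expn_gt0 prime_gt0.
have z0 : 0 <= z by rewrite modz_ge0.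
have zE : z = `|z|%N :> int by rewrite gez0_abs.
exists `|z|%N; first by rewrite -ltz_nat -zE ltz_mod.
have d0 : ((denq q)%:~R : Qpbar K) != 0 by rewrite intr_eq0_Qpbar denq_neq0.
have ed : ordp ((denq q)%:~R : Qpbar K) = 0%:E%E.
  by have := ordp_coprime p_pr K cop; have := denq_gt0 q; case: (denq q) => // m _; rewrite -pmulrn.
have -> : ratr q - `|z|%N%:R = (numq q - z * denq q)%:~R / (denq q)%:~R :> Qpbar K.
  by rewrite intrB intrM mulrBl mulfK // ratr_frac {2}zE -pmulrn.
have [c hc] : exists c : int, numq q - z * denq q = c * (p ^ N)%N.
  have e := divz_eq (numq q * b) (p ^ N)%N; rewrite -/z in e.
  set D := divz _ _ in e; set P := Posz (p ^ N) in e ab *.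
  have ez : z = numq q * b - D * P.
    by apply/eqP; rewrite eq_sym subr_eq addrC -e.
  exists (numq q * a + D * denq q).
  have -> : numq q - z * denq q = numq q * (a * P + b * denq q) - z * denq q by rewrite ab mulr1.
  by rewrite ez; ring.
rewrite hc intrM; apply: vgeMr; last by apply: (vgeV ed); rewrite oppr0.
by apply: vgeMl; [exact: vge_int | rewrite -pmulrn vge_pexp].
Qed.

Variable pi : Qpbar K.
Hypothesis pi_root : \sum_(i < p) (1 + pi) ^+ i = 0.

(** The valuation of a uniformizer of the field generated by the p-th roots of unity. *)
Definition unit_val : rat := (p.-1)%:R^-1.
Local Notation u := unit_val.

Lemma p1_gt0 : (0 < p.-1)%N.
Proof. by have := prime_gt1 p_pr; case: (p) => [|[]]. Qed.

Lemma unit_val_gt0 : 0 < u.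
Proof. by rewrite invr_gt0 ltr0n p1_gt0. Qed.

Lemma unit_valK : (p.-1)%:R * u = 1.
Proof. by rewrite divff // pnatr_eq0 -lt0n p1_gt0. Qed.

Lemma unit_val_le1 : u <= 1.
Proof. by rewrite invf_le1 ?ltr0n ?p1_gt0 // ler1n p1_gt0. Qed.

Lemma zeta_p : (1 + pi) ^+ p = 1.
Proof.
apply/eqP; rewrite -subr_eq0 -[X in _ - X](expr1n _ p) subrXX.
under eq_bigr do rewrite expr1n mulr1; rewrite -{2}pi_root.
rewrite (reindex_inj rev_ord_inj) /= [X in _ == X](_ : _ = 0) ?pi_root //.
rewrite (eq_bigr (fun i : 'I_p => (1 + pi) ^+ i)) ?pi_root ?mulr0 // => i _.
by congr (_ ^+ _); have := ltn_ord i; lia.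
Qed.

Lemma pi_neq0 : pi != 0.
Proof.
apply/eqP => e; move: pi_root; rewrite e addr0.
under eq_bigr do rewrite expr1n; rewrite sumr_const card_ord.
by move/eqP; rewrite natr_Qpbar_eq0 // => /eqP h; move: p_pr; rewrite h.
Qed.

Lemma pi_eq : pi ^+ p.-1 = - \sum_(i < p.-1) 'C(p, i.+1)%:R * pi ^+ i.
Proof.
have := zeta_p; rewrite exprDn big_ord_recl /= bin0 expr1n mul1r expr0 mulr1n.
under eq_bigr do rewrite expr1n mul1r /bump /= add1n -mulr_natl exprS mulrCA.
move/eqP; rewrite -subr_eq0 addrAC subrr add0r -mulr_sumr.
rewrite mulf_eq0 (negPf pi_neq0) /=; have p1 := p1_gt0.
rewrite (big_ord_prev (fun i => 'C(p, i.+1)%:R * pi ^+ i)) ?prime_gt0 //.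
by rewrite prednK ?prime_gt0 // binn mul1r addrC addr_eq0 => /eqP ->.
Qed.

(** [pi_eq] is an Eisenstein equation. Its middle binomials are divisible by p, so first the
    valuation is positive, and then the constant term p alone determines the valuation of
    pi^(p-1). *)
Lemma ordp_pi : ordp pi = u%:E%E.
Proof.
have [v ev] := ordp_fin pi_neq0; rewrite ev; congr (_%:E)%E.
have e := pi_eq; have p1 := p1_gt0.
have p1E : p.-1 = p.-2.+1 by rewrite prednK.
have P1 : 1 <= (p.-1)%:R :> rat by rewrite ler1n.
have eq1 := ordpX (p.-1) ev.
have v0 : 0 < v.
  rewrite ltNge; apply/negP => v0.
  suff : vgt ((p.-1)%:R * v) (pi ^+ p.-1) by rewrite (vgtE _ eq1) ltxx.
  rewrite e vgtN; apply: vgt_sum => i _.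
  apply: (@vge_gt _ _ _ (1 + i%:R * v)).
    have : (p.-1)%:R * v <= i%:R * v by rewrite ler_wnM2r // ler_nat ltnW.
    lra.
  apply: vgeM; last by rewrite (vgeE _ (ordpX i ev)).
  have lt : (0 < i.+1 < p)%N by have := ltn_ord i; lia.
  have /dvdnP[k ->] := prime_dvd_bin p_pr lt.
  by rewrite natrM; apply: vgeMl; rewrite ?vge_nat // /vge ordp_p.
have : ordp (pi ^+ p.-1) = 1%:E%E.
  rewrite e ordpN p1E big_ord_recl /= expr0 mulr1 bin1; apply: ordpD_gt; first exact: ordp_p.
  apply: vgt_sum => i _; apply: (@vge_gt _ _ _ (1 + (bump 0 i)%:R * v)).
    by rewrite ltrDl mulr_gt0 // ltr0n.
  apply: vgeM; last by rewrite (vgeE _ (ordpX _ ev)).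
  have lt : (0 < (bump 0 i).+1 < p)%N by rewrite /bump /=; have := ltn_ord i; lia.
  have /dvdnP[k ->] := prime_dvd_bin p_pr lt.
  by rewrite natrM; apply: vgeMl; rewrite ?vge_nat // /vge ordp_p.
have P0 : (p.-1)%:R != 0 :> rat by rewrite pnatr_eq0 -lt0n.
by rewrite eq1 => -[h]; rewrite -[v](mulKf P0) h mulr1.
Qed.

(** ** Completeness and compactness *)

(** The local field obtained by adjoining [pi] to [Qp]. Values of polynomials suffice, since [pi] is
    algebraic; inverses come with [inEV]. *)
Definition inE_ x := exists q : {poly Qp K}, x = (map_poly (Qp_incl K) q).[pi].

Lemma inE_sum (l : 'I_p.-1 -> Qp K) : inE_ (\sum_(j < p.-1) Qp_incl K (l j) * pi ^+ j).
Proof.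
exists (\sum_j l j *: 'X^j); rewrite rmorph_sum horner_sum; apply: eq_bigr => j _.
by rewrite /= map_polyZ map_polyXn hornerZ hornerXn.
Qed.

Definition pi_poly : {poly Qp K} := 'X^(p.-1) + \poly_(i < p.-1) 'C(p, i.+1)%:R.

Lemma pi_poly_monic : pi_poly \is monic.
Proof.
rewrite monicE lead_coefDl ?lead_coefXn // size_polyXn.
by rewrite ltnS; apply: size_poly.
Qed.

Lemma pi_poly_size : size pi_poly = p.
Proof.
rewrite size_polyDl size_polyXn ?ltnS ?size_poly // prednK // prime_gt0 //.
Qed.

Lemma pi_poly_root : (map_poly (Qp_incl K) pi_poly).[pi] = 0.
Proof.
rewrite rmorphD /= map_polyXn hornerD hornerXn pi_eq.
rewrite poly_def rmorph_sum horner_sum addrC; apply/eqP; rewrite subr_eq0; apply/eqP.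
apply: eq_bigr => i _; rewrite /= map_polyZ map_polyXn hornerZ hornerXn /=.
by rewrite rmorph_nat.
Qed.

Lemma inE_coord x : inE_ x -> exists l : 'I_p.-1 -> Qp K,
  x = \sum_(j < p.-1) Qp_incl K (l j) * pi ^+ j.
Proof.
case=> q ->; have e := Pdiv.IdomainMonic.divp_eq pi_poly_monic q.
set q1 := modp q pi_poly in e; exists (fun j => q1`_j).
rewrite {1}e rmorphD rmorphM hornerD hornerM pi_poly_root mulr0 add0r.
have sz : (size q1 <= p.-1)%N.
  have : (size q1 < size pi_poly)%N by rewrite ltn_modp monic_neq0 ?pi_poly_monic.
  by rewrite pi_poly_size; lia.
rewrite (horner_coef_wide _ (n := p.-1)); last by rewrite size_map_poly.
by apply: eq_bigr => j _; rewrite coef_map.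
Qed.

Lemma distinct_ord_sum (I : finType) (t : I -> Qpbar K) r :
  (forall i j a, ordp (t i) = a%:E%E -> ordp (t j) = a%:E%E -> i = j) ->
  vge r (\sum_i t i) -> forall i, vge r (t i).
Proof.
move=> inj h i; apply: contraT => hi.
have ti : t i != 0 by apply: contraNneq hi => ->; exact: vge0.
pose f j : rat := fine (ordp (t j)).
have fE j : t j != 0 -> ordp (t j) = (f j)%:E%E.
  by move=> tj; have [a ha] := ordp_fin tj; rewrite /f ha.
have [j tj min] : exists2 j, t j != 0 & forall k, t k != 0 -> f j <= f k.
  by case: (@Order.TotalTheory.arg_minP _ _ _ i (fun j => t j != 0) f ti) => j tj min; exists j.
have fj : f j < r.
  apply: le_lt_trans (min i ti) _; rewrite ltNge; apply/negP => ri.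
  by move: hi; rewrite (vgeE _ (fE _ ti)) ri.
have : ordp (\sum_i t i) = (f j)%:E%E.
  rewrite (bigD1 j) //=; apply: ordpD_gt; first exact: fE.
  apply: vgt_sum => k kj; have [->|tk] := eqVneq (t k) 0; first exact: vgt0.
  rewrite (vgtE _ (fE _ tk)) lt_neqAle min // andbT.
  apply: contra kj => /eqP e; apply/eqP/(inj _ _ (f k)); first exact: fE.
  by rewrite -e fE.
by move=> e; move: h; rewrite (vgeE _ e) leNgt fj.
Qed.

(** Valuations on [Qp] are integers, while those of pi^j for j < p-1 are distinct modulo 1; so the
    terms of the sum cannot cancel. *)
Lemma coord_ge (l : 'I_p.-1 -> Qp K) r :
  vge r (\sum_(j < p.-1) Qp_incl K (l j) * pi ^+ j) ->
  forall j : 'I_p.-1, vge (r - j%:R * u) (Qp_incl K (l j)).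
Proof.
move=> h j; have opj := ordpX j ordp_pi.
apply: vge_cancel opj _; rewrite mulrC.
apply: (distinct_ord_sum _ h) => {h j} i j a ha hb.
have nz k : ordp (Qp_incl K (l k) * pi ^+ k) = a%:E%E -> l k != 0.
  by move=> e; apply: contra_eqN e => /eqP ->; rewrite rmorph0 mul0r ordp0.
have [zi hi] := ordp_Qp (nz _ ha); have [zj hj] := ordp_Qp (nz _ hb).
move: ha hb; rewrite !ordpM hi hj (ordpX i ordp_pi) (ordpX j ordp_pi) => -[e1] [e2].
have e : (zi - zj)%:~R * (p.-1)%:R = (j%:Z - i%:Z)%:~R :> rat.
  have k1 := unit_valK; have : (zi%:~R - zj%:~R : rat) = (j%:R - i%:R) * u by lra.
  by rewrite !intrB -!pmulrn => ->; rewrite -mulrA [u * _]mulrC k1 mulr1.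
have {}e : (zi - zj) * (p.-1)%:Z = j%:Z - i%:Z.
  by apply: (intr_inj (R := rat)); rewrite -e intrM -pmulrn.
apply: val_inj => /=; have := ltn_ord i; have := ltn_ord j; move: e.
  set d := zi - zj; move: (p.-1) (nat_of_ord i) (nat_of_ord j) => P a1 b1 e h1 h2.
  have [d1|[d1|d1]] : (1 <= d) \/ (d <= -1) \/ (d = 0) by lia.
  - have : P%:Z <= d * P%:Z by rewrite ler_peMl.
    lia.
  - have : P%:Z <= (- d) * P%:Z by rewrite ler_peMl //; lia.
    lia.
  by move: e; rewrite d1 mul0r; lia.
Qed.

Lemma inE_complete (v : nat -> Qpbar K) : (forall i, inE_ (v i)) ->
  (forall N : nat, exists M, forall i j, (M <= i)%N -> (M <= j)%N -> vge N%:R (v i - v j)) ->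
  exists2 l, inE_ l & padic_cvg v l.
Proof.
move=> hv cau; have [c hc] := choice (fun i => inE_coord (hv i)).
have cc j : exists l : Qp K, forall N : nat, exists M, forall i, (M <= i)%N ->
    vge N%:R (Qp_incl K (c i j - l)).
  apply: Qp_complete => N; have [M hM] := cau N.+1; exists M => i k Mi Mk.
  have := hM i k Mi Mk; rewrite !hc -sumrB.
  under eq_bigr do rewrite -mulrBl -rmorphB.
  move=> /(@coord_ge (fun j => c i j - c k j)) /(_ j); apply: vgeW.
  rewrite -addn1 natrD -addrA lerDl subr_ge0.
  have k1 := unit_valK; have lt : (j <= p.-1)%N by apply: ltnW.
  by rewrite -{2}k1 ler_wpM2r ?ler_nat // ltW // unit_val_gt0.
have [l hl] := choice cc.
exists (\sum_(j < p.-1) Qp_incl K (l j) * pi ^+ j); first exact: inE_sum.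
rewrite (_ : v = fun i => \sum_(j < p.-1) Qp_incl K (c i j) * pi ^+ j); last exact/funext.
apply: padic_cvg_sum => j N; have [M hM] := hl j N; exists M => i Mi.
rewrite -mulrBl -rmorphB; apply: vgeMr; first exact: hM.
by apply: vgeX0; rewrite (vgeE _ ordp_pi) ltW // unit_val_gt0.
Qed.

Lemma inE_finite (N : nat) : exists s : seq (Qpbar K),
  forall x, inE_ x -> vge 0 x -> exists2 y, y \in s & vge N%:R (x - y).
Proof.
pose S (z : {ffun 'I_p.-1 -> 'I_(p ^ N)}) : Qpbar K := \sum_j (z j)%:R * pi ^+ j.
exists (map S (enum {: {ffun 'I_p.-1 -> 'I_(p ^ N)}})) => x /inE_coord[l ->] hx.
have ap j : exists z : 'I_(p ^ N), vge N%:R (Qp_incl K (l j) - z%:R).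
  have lj : vge 0 (Qp_incl K (l j)).
    have [->|l0] := eqVneq (l j) 0; first by rewrite rmorph0 vge0.
    have [z hz] := ordp_Qp l0; have := coord_ge hx j; rewrite !(vgeE _ hz) => h.
    (* [coord_ge] only gives a valuation greater than -1, but this valuation is an integer. *)
    have h1 : (-1)%:~R < (z%:~R : rat).
      have : j%:R * u < (p.-1)%:R * u by rewrite ltr_pM2r ?unit_val_gt0 // ltr_nat.
      by rewrite unit_valK; move: h; lra.
    by rewrite ltr_int in h1; rewrite ler0z; lia.
  have [q hq] := Qp_dense (l j) N; rewrite rmorphB Qp_incl_ratr in hq.
  have q0 : vge 0 (ratr q : Qpbar K).
    by rewrite -(vge_cong _ hq) // ler0n.
  have [z zN hz] := ratr_approx N q0; exists (Ordinal zN).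
  exact: vge_trans hq hz.
have [z hz] := choice ap; exists (S (finfun z)); first by apply: map_f; rewrite mem_enum.
rewrite /S -sumrB; apply: vge_sum => j _; rewrite ffunE -mulrBl; apply: vgeMr => //.
by apply: vgeX0; rewrite (vgeE _ ordp_pi) ltW // unit_val_gt0.
Qed.

(** A diagonal argument. No subsequence appears in the conclusion: it is enough that every finite
    stretch of g is approximated by arbitrarily late rows of x. *)
Lemma inE_compact (x : nat -> nat -> Qpbar K) :
  (forall M N, inE_ (x M N) /\ vge 0 (x M N)) ->
  exists g : nat -> Qpbar K, [/\ forall N, inE_ (g N) &
    forall k N M0 : nat, exists2 M, (M0 <= M)%N & forall i, (i <= N)%N -> vge k%:R (x M i - g i)].
Proof.
move=> hx; pose inf (A : nat -> Prop) := forall M0, exists2 M, (M0 <= M)%N & A M.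
pose near_ k n (B : nat -> Prop) := forall M M', B M -> B M' ->
  forall i, (i < n)%N -> vge k%:R (x M i - x M' i).
(* Pigeonhole on one coefficient after another: an infinite set of rows has an infinite subset on
   which the first n coefficients agree modulo p^k. *)
have refine A k n : inf A -> exists B : nat -> Prop,
    [/\ inf B, forall M, B M -> A M & near_ k n B].
  elim: n => [|n IH] iA; first by exists A; split.
  have [B [iB BA nB]] := IH iA; have [s hs] := inE_finite k.
  have [y iy] : exists y, inf (fun M => B M /\ vge k%:R (x M n - y)).
    apply: contrapT => no.
    have {}no y : exists M0, forall M, (M0 <= M)%N -> B M -> ~~ vge k%:R (x M n - y).
      apply: contrapT => no1; apply: no; exists y => M0; apply: contrapT => no2; apply: no1.
      by exists M0 => M MM BM; apply/negP => h; apply: no2; exists M.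
    have [F hF] := choice no; have [M MM BM] := iB (\max_(y <- s) F y)%N.
    have [h1 h2] := hx M n; have [y ys hy] := hs _ h1 h2.
    have /negP := hF y M (leq_trans (leq_bigmax_seq _ ys isT) MM) BM; exact.
  exists (fun M => B M /\ vge k%:R (x M n - y)); split=> // [M [/BA]//|].
  move=> M M' [BM hM] [BM' hM'] i; rewrite ltnS leq_eqVlt => /orP[/eqP->|lt]; last exact: nB.
  by apply: vge_trans hM _; rewrite vgeBC.
pose st (A : nat -> Prop) k := if pselect (inf A) is left iA then sval (cid (refine A k k iA)) else A.
have stP A k : inf A -> [/\ inf (st A k), forall M, st A k M -> A M & near_ k k (st A k)].
  by move=> iA; rewrite /st; case: pselect => // iA'; case: cid.
pose fix A k := if k is k'.+1 then st (A k') k' else fun=> True.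
have iA k : inf (A k).
  by elim: k => [M0|k IH] /=; [exists M0 | have [] := stP _ k IH].
have dec k j : (k <= j)%N -> forall M, A j M -> A k M.
  move=> /subnK <-; elim: (j - k)%N => // d IH M; rewrite addSn /= => h.
  by have [_ sub _] := stP _ (d + k)%N (iA (d + k)%N); exact: IH (sub _ h).
have pick k : exists M, (k <= M)%N /\ A k M by have [M] := iA k k; exists M.
have [m hm] := choice pick.
have close k i : (i < k)%N -> forall M, A k.+1 M -> vge k%:R (x (m k.+1) i - x M i).
  by move=> ik M hM; have [_ _ nr] := stP _ k (iA k); apply: nr => //; have [] := hm k.+1.
have cvg i : exists2 l, inE_ l & padic_cvg (fun k => x (m k.+1) i) l.
  apply: inE_complete => [k|N]; first by have [] := hx (m k.+1) i.
  exists (maxn N i.+1) => a b; rewrite !geq_max => /andP[Na ia] /andP[Nb ib].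
  have hmN : vge (maxn N i.+1)%:R (x (m (maxn N i.+1).+1) i - x (m a.+1) i).
    apply: close; first exact: leq_maxr.
    by apply: dec (proj2 (hm a.+1)); rewrite ltnS geq_max Na.
  have hmN' : vge (maxn N i.+1)%:R (x (m (maxn N i.+1).+1) i - x (m b.+1) i).
    apply: close; first exact: leq_maxr.
    by apply: dec (proj2 (hm b.+1)); rewrite ltnS geq_max Nb.
  rewrite vgeBC in hmN; apply: vgeW (vge_trans hmN hmN').
  by rewrite ler_nat leq_maxl.
have [g hg] := choice (fun i => let: ex_intro2 l h1 h2 := cvg i in ex_intro (fun l => inE_ l /\ padic_cvg (fun k => x (m k.+1) i) l) l (conj h1 h2)).
exists g; split=> [N|k N M0]; first by have [] := hg N.
have [F hF] := choice (fun i => (hg i).2 k).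
pose j := maxn M0 (\max_(i < N.+1) F i)%N; exists (m j.+1).
  by have [h _] := hm j.+1; apply: leq_trans h; rewrite leqW // leq_maxl.
move=> i iN; apply: hF; apply: leq_trans (leq_maxr _ _).
by apply: (@leq_bigmax _ (fun i : 'I_N.+1 => F i) (Ordinal (iN : (i < N.+1)%N))).
Qed.

(** ** Weierstrass factorization over the local field *)

Lemma inED x y : inE_ x -> inE_ y -> inE_ (x + y).
Proof. by move=> [a ->] [b ->]; exists (a + b); rewrite rmorphD hornerD. Qed.

Lemma inEN x : inE_ x -> inE_ (- x).
Proof. by move=> [a ->]; exists (- a); rewrite rmorphN hornerN. Qed.

Lemma inEM x y : inE_ x -> inE_ y -> inE_ (x * y).
Proof. by move=> [a ->] [b ->]; exists (a * b); rewrite rmorphM hornerM. Qed.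

Lemma inE0 : inE_ 0.
Proof. by exists 0; rewrite rmorph0 horner0. Qed.

Lemma inE1 : inE_ 1.
Proof. by exists 1; rewrite rmorph1 hornerE. Qed.

Lemma inEX x n : inE_ x -> inE_ (x ^+ n).
Proof. by move=> h; elim: n => [|n IH]; rewrite ?expr0 ?exprS; [exact: inE1 | exact: inEM]. Qed.

Lemma inE_pi : inE_ pi.
Proof. by exists 'X; rewrite map_polyX hornerX. Qed.

Lemma inE_bigsum (I : Type) (s : seq I) (P : pred I) (F : I -> Qpbar K) :
  (forall i, P i -> inE_ (F i)) -> inE_ (\sum_(i <- s | P i) F i).
Proof. by move=> h; elim/big_ind: _ => // [|? ?]; [exact: inE0 | exact: inED]. Qed.

(** An equation q1(x) x + q_0 = 0 gives 1/x as a polynomial in x if q_0 is nonzero; otherwise x is a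
    root of q1, which has smaller degree. *)
Lemma inEV x : inE_ x -> inE_ x^-1.
Proof.
have [->|x0] := eqVneq x 0; first by rewrite invr0.
have [q mq rq] := Qpbar_alg x; elim: {q}(size q) {-2}q (leqnn (size q)) mq rq => [|k IH] q sq.
  by move: sq; rewrite leqn0 size_poly_eq0 => /eqP ->; rewrite monicE lead_coef0 eq_sym oner_eq0.
move=> mq rq xE; pose q1 := drop_poly 1 q.
have qE : q = q1 * 'X + (q`_0)%:P.
  by apply/polyP => -[|i]; rewrite coefD coefMX coefC /= ?add0r ?addr0 // coef_drop_poly addn1.
have hE : (map_poly (Qp_incl K) q1).[x] * x + Qp_incl K q`_0 = 0.
  move: rq; rewrite {1}qE rmorphD rmorphM /= map_polyX map_polyC /root.
  by rewrite hornerD hornerMX hornerC => /eqP.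
have q1E : inE_ (map_poly (Qp_incl K) q1).[x].
  rewrite horner_coef; apply: inE_bigsum => i _; apply: inEM; last exact: inEX.
  by exists (q1`_i)%:P; rewrite map_polyC hornerC coef_map.
have [c0|c0] := eqVneq q`_0 0; last first.
  have -> : x^-1 = (map_poly (Qp_incl K) q1).[x] * - (Qp_incl K q`_0)^-1.
    have i0 : Qp_incl K q`_0 != 0 by rewrite fmorph_eq0.
    apply: (mulIf x0); rewrite mulVf // mulrAC (_ : _ * x = - Qp_incl K q`_0) ?mulrNN ?divff //.
    by apply/eqP; rewrite -addr_eq0 hE.
  apply: inEM => //; apply: inEN; exists ((q`_0)^-1)%:P.
  by rewrite map_polyC hornerC /= fmorphV.
apply: (IH q1) => //.
- have q0 : q != 0 by rewrite monic_neq0.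
  by rewrite /q1 size_drop_poly; lia.
- by move: mq; rewrite {1}qE c0 addr0 monicMr ?monicX.
by move: hE; rewrite c0 rmorph0 addr0 => /eqP; rewrite mulf_eq0 (negPf x0) orbF.
Qed.

End LocalField.

Lemma eq_ler (x y : rat) : x = y -> x <= y.
Proof. by move=> ->. Qed.

Lemma poly_split1 (F : closedFieldType) (G : {poly F}) : G`_0 = 1 ->
  exists2 t : seq F, G = \prod_(z <- t) (1 - z *: 'X) & 0 \notin t.
Proof.
move=> G0; have [r hr] := closed_field_poly_normal G.
have nz x : x \in r -> x != 0.
  move=> xr; apply: contra_eqN G0 => /eqP x0; rewrite -horner_coef0 hr hornerZ.
  rewrite horner_prod (big_rem _ xr) /= x0 hornerXsubC subrr mul0r mulr0.
  by rewrite eq_sym oner_eq0.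
exists [seq x^-1 | x <- r]; last first.
  by apply/mapP => -[x xr /esym/eqP]; rewrite invr_eq0 (negPf (nz x xr)).
have e : lead_coef G * \prod_(x <- r) (- x) = 1.
  have := G0; rewrite -horner_coef0 {1}hr hornerZ horner_prod => h.
  rewrite -[RHS]h; congr (_ * _).
  by apply: eq_bigr => x _; rewrite hornerXsubC sub0r.
rewrite big_map {1}hr big_seq [RHS]big_seq.
rewrite (eq_bigr (fun x => (- x) *: (1 - x^-1 *: 'X))) => [|x /nz x0]; last first.
  by rewrite scalerBr scalerA mulNr divff // scaleN1r opprK addrC -alg_polyC scaleNr.
by rewrite scaler_prod scalerA -!big_seq e scale1r.
Qed.

Section Weierstrass.
Variables (p : nat) (p_pr : prime p) (K : padic_closure p).
Variable pi : Qpbar K.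
Hypothesis pi_root : \sum_(i < p) (1 + pi) ^+ i = 0.
Local Notation inE_ := (inE_ pi).
Implicit Types (P Q R G H : nat -> Qpbar K) (s r u : rat) (c : nat -> nat).

(** For series whose constant term may vanish, such as a difference of two series: a linear growth
    faster than s leaves finitely many candidates for contact. *)
Lemma np_exists_gen H s r (e : rat) : s < r -> (exists N, H N != 0) ->
  (forall N, vge (r * N%:R - e) (H N)) -> exists a b, np H s a b.
Proof.
move=> sr [N1 HN1] hH; have [v hv] := ordp_fin HN1.
pose B := Num.bound (`|e + `|v - s * N1%:R| | / (r - s)).
have rs0 : 0 < r - s by rewrite subr_gt0.
have hB N : (B <= N)%N -> vgt (v - s * N1%:R + s * N%:R) (H N).
  move=> BN; apply: vge_gt (hH N).
  have h1 : `|e + `|v - s * N1%:R| | / (r - s) < N%:R.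
    apply: lt_le_trans (_ : B%:R <= _); last by rewrite ler_nat.
    by have := archi_boundP (normr_ge0 (`|e + `|v - s * N1%:R| | / (r - s))); rewrite ger0_norm // divr_ge0 // ltW.
  rewrite ltr_pdivrMr // in h1; have := ler_norm (e + `|v - s * N1%:R|).
  have := ler_norm (v - s * N1%:R); lra.
pose n := (maxn B N1).+1; pose f (i : 'I_n) := fine (ordp (H i)) - s * (i : nat)%:R.
have lt1 : (N1 < n)%N by rewrite ltnS leq_maxr.
pose i1 := Ordinal lt1; have Pi1 : H i1 != 0 by [].
have fE i : H i != 0 -> forall lt : (i < n)%N, ordp (H i) = (f (Ordinal lt) + s * i%:R)%:E%E.
  by move=> h lt; rewrite /f /= subrK; have [w ew] := ordp_fin h; rewrite ew.
case: (@Order.TotalTheory.arg_minP _ _ _ i1 (fun i => H i != 0) f Pi1) => i0 Hi0 min.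
pose att (i : nat) := (i < n)%N && (ordp (H i) == (f i0 + s * i%:R)%:E%E).
have att0 : att i0 by rewrite /att ltn_ord (fE _ Hi0 (ltn_ord i0)) /f /= eqxx.
have [a attA minA] := ex_minnP (ex_intro att _ att0).
have ub i : att i -> (i <= n)%N by case/andP => /ltnW.
have [b attB maxB] := ex_maxnP (ex_intro att _ att0) ub.
have le1 : f i0 <= v - s * N1%:R.
  by have := min i1 Pi1; rewrite {2}/f /= hv.
have strict N : ~~ att N -> vgt (f i0 + s * N%:R) (H N).
  have [Nn|nN] := ltnP N n; last first.
    move=> _; apply: le_lt_trans (hB N _); first by rewrite lee_fin lerD2r.
    by apply: leq_trans nN; rewrite leqW // leq_maxl.
  rewrite /att Nn /=; have [->|h0] := eqVneq (H N) 0; first by move=> _; exact: vgt0.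
  have e1 := fE N h0 Nn; rewrite e1 => ne; rewrite (vgtE _ e1) lt_neqAle lerD2r min // andbT.
  by apply: contraNneq ne => ->.
exists a, b, (f i0); split.
- by case/andP: attA => _ /eqP.
- by case/andP: attB => _ /eqP.
- move=> N; case: (boolP (att N)) => [/andP[_ /eqP e1]|/strict/vgtW //].
  by rewrite (vgeE _ e1).
move=> N hN; apply: strict; apply/negP => aN; case/orP: hN.
  by rewrite ltnNge minA.
by rewrite ltnNge maxB.
Qed.

Lemma np_mono H s r a b a' b' : s < r -> np H s a b -> np H r a' b' -> (b <= a')%N.
Proof.
move=> sr [c [_ h2 h3 _]] [c' [h1' _ h3' _]]; rewrite leqNgt; apply/negP => lt.
have := h3' b; rewrite (vgeE _ h2) => e1.
have := h3 a'; rewrite (vgeE _ h1') => e2.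
have lt1 : a'%:R < b%:R :> rat by rewrite ltr_nat.
nra.
Qed.

(** Otherwise every s t, in a sequence increasing to j + 1, is a slope. Each segment has positive
    length, so the segment of s t ends beyond t; but slopes below j + 1 concern only finitely many
    coefficients. *)
Lemma nonslope u c P (j : nat) : 0 < u -> bnd u c P -> P 0%N = 1 ->
  exists (s : rat) (a : nat), [/\ j%:R < s, s < j%:R + 1 & np P s a a].
Proof.
move=> u0 hP P0; have [N0 hN0] := bnd_slope K c (j%:R + 1) u0.
pose s (t : nat) : rat := j%:R + 1 - t.+2%:R^-1.
have st t : j%:R < s t /\ s t < j%:R + 1.
  have h1 : 0 < t.+2%:R^-1 :> rat by rewrite invr_gt0.
  have h2 : t.+2%:R^-1 < 1 :> rat by rewrite invf_lt1 // ltr1n.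
  by rewrite /s; move: (_^-1) h1 h2 => w h1 h2; split; lra.
apply: contrapT => no.
have step t a b : np P (s t) a b -> (t < b)%N.
  elim: t a b => [|t IH] a b h; have ab : a != b.
  - by apply: contra_notN no => /eqP ab; exists (s 0%N), a; have [? ?] := st 0%N; split=> //; rewrite {2}ab.
  - have [c1 [_ h2 _ h4]] := h; case: b ab h h2 h4 => [|//] ab h h2 h4.
    by have := h4 0%N; rewrite lt0n ab (vgtE _ h2) ltxx => /(_ isT).
  - by apply: contra_notN no => /eqP ab; exists (s t.+1), a; have [? ?] := st t.+1; split=> //; rewrite {2}ab.
  have [a1 [b1 h1]] := np_exists p_pr (s t) u0 hP P0.
  have lt1 := IH _ _ h1.
  have lt : s t < s t.+1.
    by rewrite /s ltrD2l ltrN2 ltf_pV2 ?posrE ?ltr0n // ltr_nat.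
  have le1 := np_mono lt h1 h.
  have le2 : (a <= b)%N.
    have [c1 [g1 g2 _ g4]] := h; rewrite leqNgt; apply/negP => ba.
    by have := g4 b; rewrite ba (vgtE _ g2) ltxx => /(_ isT).
  by have := ltn_neqAle a b; rewrite ab le2 => lt3; lia.
have [a [b h]] := np_exists p_pr (s N0) u0 hP P0; have := hN0 _ hP _ (step _ _ _ h).
have [c1 [_ h2 h3 _]] := h.
have c0 : c1 <= 0 by have := h3 0%N; rewrite P0 (vgeE _ (ordp1 K)) mulr0 addr0.
rewrite (vgtE _ h2); have [_ lt] := st N0; have b0 : 0 <= b%:R :> rat by [].
rewrite ltNge => /negP; apply.
have : s N0 * b%:R <= (j%:R + 1) * b%:R by rewrite ler_wpM2r // ltW.
lra.
Qed.

(** The strict inequalities off the contact point are uniform: finitely many are treated one by one,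
    and beyond N0 the slope s + 1 leaves a margin of at least 1. *)
Lemma gap u c P s a : 0 < u -> bnd u c P -> P 0%N = 1 -> np P s a a ->
  exists d e : rat, [/\ 0 < e, ordp (P a) = (d + s * a%:R)%:E%E &
    forall N, N != a -> vge (d + s * N%:R + e) (P N)].
Proof.
move=> u0 hP P0 [d [h1 _ h3 h4]]; exists d.
have [N0 hN0] := bnd_slope K c (s + 1) u0.
have d0 : d <= 0 by have := h3 0%N; rewrite P0 (vgeE _ (ordp1 K)) mulr0 addr0.
have small n : exists2 e, 0 < e & forall N, (N < n)%N -> N != a -> vge (d + s * N%:R + e) (P N).
  elim: n => [|n [e e0 IH]]; first by exists 1.
  have [ena|na] := eqVneq n a.
    exists e => // N; rewrite ltnS leq_eqVlt => /orP[/eqP->|lt]; first by rewrite ena eqxx.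
    exact: IH.
  have hn : vgt (d + s * n%:R) (P n) by apply: h4; rewrite -neq_ltn.
  have [f f0 hf] : exists2 f, 0 < f & vge (d + s * n%:R + f) (P n).
    have [->|Pn] := eqVneq (P n) 0; first by exists 1 => //; exact: vge0.
    have [v ev] := ordp_fin Pn; move: hn; rewrite (vgtE _ ev) => hn.
    by exists (v - (d + s * n%:R)); rewrite ?subr_gt0 // (vgeE _ ev); lra.
  exists (if e <= f then e else f); first by case: ifP.
  move=> N; rewrite ltnS leq_eqVlt => /orP[/eqP-> _|lt Na].
    by apply: vgeW hf; rewrite lerD2l; case: ifP => // /negbT; rewrite -ltNge => /ltW.
  by apply: vgeW (IH _ lt Na); rewrite lerD2l; case: ifP => // /negbT; rewrite -ltNge => /ltW.
have [e e0 he] := small N0.+1.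
exists (if e <= 1 then e else 1); split=> // [|N Na]; first by case: ifP.
have [NN|NN] := ltnP N N0.+1.
  by apply: vgeW (he _ NN Na); rewrite lerD2l; case: ifP => // /negbT; rewrite -ltNge => /ltW.
apply: vgeW (vgtW (hN0 _ hP _ NN)).
have N1 : 1 <= N%:R :> rat by rewrite ler1n; lia.
have le1 : (if e <= 1 then e else 1) <= 1 by case: ifP.
lra.
Qed.

(* The coefficients of the cofactor are the fixed point of a contraction. *)
Lemma weierstrass u c P (j : nat) : 0 < u -> bnd u c P -> P 0%N = 1 ->
  (forall N, inE_ (P N)) -> exists (s : rat) (t : seq (Qpbar K)) R,
  [/\ j%:R < s < j%:R + 1, forall z, z \in t -> (ordp z < s%:E)%E, R 0%N = 1,
      forall N, vge (s * N%:R) (R N) &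
      conv (fun N => (\prod_(z <- t) (1 - z *: 'X))`_N) R =1 P].
Proof.
move=> u0 hP P0 PE; have [s [a [js sj1 npP]]] := nonslope j u0 hP P0.
have [d [e [e0 ordPa hgap]]] := gap u0 hP P0 npP.
have s0 : 0 <= s by apply: le_trans (ltW js).
have Pa0 : P a != 0 by apply/eqP => h; move: ordPa; rewrite h ordp0.
(* A fixed point Q of [Phi] makes the coefficients of P Q vanish beyond the index a. Solving for Q i
   divides by the dominant coefficient P a, so that [Phi] contracts by the gap e. *)
pose Phi Q i : Qpbar K := if i == 0%N then 1 else
  - (P a)^-1 * \sum_(k < (a + i).+1 | (k : nat) != i) P (a + i - k)%N * Q k.
have PhiB Q Q' (x : rat) : Q 0%N = Q' 0%N -> (forall k, vge (s * k%:R + x) (Q k - Q' k)) ->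
    forall i, vge (s * i%:R + x + e) (Phi Q i - Phi Q' i).
  move=> Q00 h i; rewrite /Phi; case: eqP => [_|/eqP i0]; first by rewrite subrr vge0.
  rewrite -mulrBr -sumrB mulNr vgeN.
  have -> : s * i%:R + x + e = - (d + s * a%:R) + (d + s * (a + i)%:R + x + e).
    by rewrite natrD; ring.
  apply: vgeM; first by rewrite (vgeE _ (ordpV ordPa)).
  apply: vge_sum => k ki; rewrite -mulrBr.
  have kai : (k <= a + i)%N by rewrite -ltnS.
  have nk : (a + i - k)%N != a by apply: contra ki => /eqP hk; apply/eqP; lia.
  apply: vgeW (vgeM (hgap _ nk) (h k)); by rewrite natrB // eq_ler //; ring.
have Phi_ge Q : Q 0%N = 1 -> (forall k, vge (s * k%:R) (Q k)) ->
    forall i, (0 < i)%N -> vge (s * i%:R + e) (Phi Q i).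
  move=> Q0 h i i0; have := PhiB Q (fun=> 0) 0.
  rewrite /Phi gtn_eqF // => H.
  rewrite mulNr vgeN.
  have -> : s * i%:R + e = - (d + s * a%:R) + (d + s * (a + i)%:R + e).
    by rewrite natrD; ring.
  apply: vgeM; first by rewrite (vgeE _ (ordpV ordPa)).
  apply: vge_sum => k ki; have kai : (k <= a + i)%N by rewrite -ltnS.
  have nk : (a + i - k)%N != a by apply: contra ki => /eqP hk; apply/eqP; lia.
  apply: vgeW (vgeM (hgap _ nk) (h k)); by rewrite natrB // eq_ler //; ring.
pose Qt t := iter t Phi (fun i => (i == 0%N)%:R).
have Qt0 t : Qt t 0%N = 1 by case: t.
have Qt_ge t i : vge (s * i%:R) (Qt t i).
  elim: t i => [|t IH] i.
    by rewrite /Qt /=; case: i => [|i]; rewrite ?mulr0 ?vge1 ?vge0.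
  case: i => [|i]; first by rewrite Qt0 mulr0 vge1.
  by apply: vgeW (Phi_ge _ (Qt0 t) IH _ _); rewrite ?lerDl ?ltW.
have QtB t i : vge (s * i%:R + t%:R * e) (Qt t.+1 i - Qt t i).
  elim: t i => [|t IH] i.
    by rewrite mul0r addr0; apply: vgeB; exact: Qt_ge.
  have -> : s * i%:R + t.+1%:R * e = s * i%:R + t%:R * e + e by rewrite -addn1 natrD; ring.
  by apply: PhiB => //; rewrite !Qt0.
have QtE t i : inE_ (Qt t i).
  elim: t i => [|t IH] i; first by rewrite /Qt /=; case: i => [|i]; [exact: inE1 | exact: inE0].
  rewrite /Qt iterS /Phi; case: eqP => _; first exact: inE1.
  apply: inEM; first by apply/inEN/inEV.
  by apply: inE_bigsum => k _; apply: inEM; [exact: PE | exact: IH].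
have QtC t t' i : (t <= t')%N -> vge (s * i%:R + t%:R * e) (Qt t' i - Qt t i).
  move=> /subnK <-; elim: (t' - t)%N => [|k IH]; first by rewrite subrr vge0.
  rewrite addSn; apply: vge_trans IH; apply: vgeW (QtB (k + t)%N i).
  by rewrite lerD2l ler_wpM2r ?ler_nat ?leq_addl // ltW.
have lim i : exists l, inE_ l /\ padic_cvg (Qt ^~ i) l.
  have cau (N : nat) : exists M, forall k k', (M <= k)%N -> (M <= k')%N -> vge N%:R (Qt k i - Qt k' i).
    pose M := Num.bound (N%:R / e); exists M => k k' Mk Mk'.
    have hM : N%:R <= M%:R * e.
      have q0 : 0 <= N%:R / e by rewrite divr_ge0 // ltW.
      by have := archi_boundP q0; rewrite ltr_pdivrMr // => /ltW.
    have le1 : N%:R <= s * i%:R + M%:R * e by apply: le_trans hM _; rewrite lerDr mulr_ge0.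
    apply: vgeW le1 _; apply: vge_trans (QtC _ _ i Mk) _; rewrite vgeBC; exact: QtC.
  by have [l h1 h2] := inE_complete p_pr pi_root (fun t => QtE t i) cau; exists l.
have [Q hQ] := choice lim.
have Q0 : Q 0%N = 1.
  apply: padic_cvg_uniq (hQ 0%N).2 _ => // N; exists 0%N => t _.
  by rewrite Qt0 subrr; exact: vge0.
have Q_ge i : vge (s * i%:R) (Q i).
  by apply: padic_cvg_vge (hQ i).2 _ => M; exists M => //; exact: Qt_ge.
have fixQ i : Phi Q i = Q i.
  apply: (@padic_cvg_uniq _ K (fun t => Qt t.+1 i)); last first.
    by move=> N; have [M hM] := (hQ i).2 N; exists M => t Mt; apply: hM; exact: leqW.
  rewrite /Qt; under boolp.eq_fun do rewrite iterS.
  rewrite /Phi; case: eqP => _; first exact: padic_cvg_cst.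
  apply: padic_cvgZ; rewrite [X in padic_cvg _ X]big_mkcond.
  under boolp.eq_fun do rewrite big_mkcond.
  apply: padic_cvg_sum => k; case: ifP => _; last exact: padic_cvg_cst.
  by apply: padic_cvgZ; exact: (hQ k).2.
have PQ0 i : (0 < i)%N -> conv P Q (a + i)%N = 0.
  move=> i0; rewrite convC /conv; have lt : (i < (a + i).+1)%N by rewrite ltnS leq_addl.
  rewrite (bigD1 (Ordinal lt)) //= addnK -[Q i]fixQ /Phi gtn_eqF // mulrAC mulNr mulVf //.
  rewrite mulN1r addrC; apply/eqP; rewrite subr_eq0; apply/eqP.
  by apply: eq_big => [k|k _]; [rewrite -val_eqE | rewrite mulrC].
pose G : {poly Qpbar K} := \poly_(N < a.+1) conv P Q N.
have GE N : G`_N = conv P Q N.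
  rewrite coef_poly ltnS; case: leqP => // aN.
  by rewrite -(subnKC (ltnW aN)) PQ0 // subn_gt0.
have G0 : G`_0 = 1 by rewrite GE conv_coef0 P0 Q0 mulr1.
have npQ : np Q s 0 0.
  exists 0; rewrite Q0 mulr0 addr0 ordp1; split=> // N; rewrite add0r //= => N0.
  rewrite -fixQ; apply: vge_gt (Phi_ge _ Q0 Q_ge _ N0); lra.
have npG : np (fun N => G`_N) s a a.
  by have := np_conv p_pr npP npQ; rewrite !addn0; apply: eq_np => N; rewrite GE.
have [t Gt t0] := poly_split1 G0.
have szt : (size t <= a)%N.
  have := size_poly a.+1 (conv P Q); rewrite -/G {1}Gt size_prod_linear //.
exists s, t, (inv_series Q); split=> //.
- by rewrite js.
- have := np_prod p_pr t s; rewrite -Gt => npt; have [h1 _] := np_uniq npG npt.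
  move=> z zt; apply: contraT => hz.
  have : (\sum_(z <- t) (ordp z < s%:E)%E < size t)%N.
    rewrite (perm_big _ (perm_to_rem zt)) big_cons (negPf hz) /= add0n.
    rewrite (perm_size (perm_to_rem zt)) /= ltnS.
    by rewrite -[leqRHS]sum1_size; apply: leq_sum => y _; case: (_ < _)%E.
  by rewrite -h1; lia.
- by rewrite inv_series0.
- move=> N; elim/ltn_ind: N => -[|N] IH; first by rewrite inv_series0 mulr0 vge1.
  rewrite inv_seriesS vgeN; apply: vge_sum => i _.
  have iN : (i <= N)%N by rewrite -ltnS.
  apply: vgeW (vgeM (Q_ge i.+1) (IH (N - i)%N _)); last by rewrite ltnS leq_subr.
  by rewrite -mulrDr -natrD addSn subnKC.
move=> N; rewrite -Gt (eq_conv (fun i _ => GE i) (fun=> fun=> erefl)) -convA.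
by rewrite (eq_conv (fun=> fun=> erefl) (fun i _ => conv_inv Q0 i)) convC conv1.
Qed.

Lemma poly_bnd (q : {poly Qpbar K}) s : exists e : rat, forall N, vge (s * N%:R - e) q`_N.
Proof.
have [r hr] := choice (fun N => vge_some q`_N).
exists (\sum_(i < size q) ((r i)%:R + `|s * (i : nat)%:R|)) => N.
have [sN|Ns] := leqP (size q) N; first by rewrite nth_default // vge0.
apply: vgeW (hr N); rewrite (bigD1 (Ordinal Ns)) //=.
have : 0 <= \sum_(i < size q | i != Ordinal Ns) ((r i)%:R + `|s * (i : nat)%:R|) :> rat.
  by apply: sumr_ge0 => i _; rewrite addr_ge0.
have := ler_norm (s * N%:R); lra.
Qed.

Lemma slope_between (t : seq (Qpbar K)) s : (forall z, z \in t -> (ordp z < s%:E)%E) ->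
  exists2 s' : rat, s' < s & forall z, z \in t -> (ordp z < s'%:E)%E.
Proof.
elim: t => [|x t IH] h; first by exists (s - 1) => //; lra.
have [|s' ss' hs'] := IH; first by move=> z zt; apply: h; rewrite inE zt orbT.
have hx := h x (mem_head _ _); have x0 : x != 0 by apply: contraTneq hx => ->; rewrite ordp0.
have [v ev] := ordp_fin x0; rewrite ev lte_fin in hx.
exists (Num.max s' ((v + s) / 2)) => [|z]; first by rewrite gt_max ss' /=; lra.
rewrite inE => /orP[/eqP ->|zt]; first by rewrite ev lte_fin lt_max; apply/orP; right; lra.
by apply: lt_le_trans (hs' z zt) _; rewrite lee_fin le_max lexx.
Qed.

Lemma inv_series_vge R s N : R 0%N = 1 -> (forall k, vge (s * k%:R) (R k)) ->
  vge (s * N%:R) (inv_series R N).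
Proof.
move=> R0 hR; elim/ltn_ind: N => -[|N] IH; first by rewrite inv_series0 mulr0 vge1.
rewrite inv_seriesS vgeN; apply: vge_sum => i _.
have iN : (i <= N)%N by rewrite -ltnS.
apply: vgeW (vgeM (hR i.+1) (IH (N - i)%N _)); last by rewrite ltnS leq_subr.
by rewrite -mulrDr -natrD addSn subnKC.
Qed.

(** The Weierstrass polynomial G at s divides the one at s'. The remainder of the division is also G
    times a series H of linear growth s; were H nonzero, the product would have a contact point at
    an index at least deg G, which the degree of a remainder forbids. *)
Lemma next_zeros s s' (t t' : seq (Qpbar K)) R R' : s < s' ->
  (forall z, z \in t -> (ordp z < s%:E)%E) -> 
  conv (fun N => (\prod_(z <- t) (1 - z *: 'X))`_N) R =1
  conv (fun N => (\prod_(z <- t') (1 - z *: 'X))`_N) R' ->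
  R 0%N = 1 -> R' 0%N = 1 -> (forall N, vge (s * N%:R) (R N)) ->
  (forall N, vge (s' * N%:R) (R' N)) ->
  exists2 e, \prod_(z <- t') (1 - z *: 'X) = \prod_(z <- t ++ e) (1 - z *: 'X) &
    forall z, z \in e -> vge s z.
Proof.
move=> ss' ht eR R0 R'0 hR hR'.
set G := \prod_(z <- t) _ in eR *; set G' := \prod_(z <- t') _ in eR *.
have t0 : 0 \notin t by apply/negP => /ht; rewrite ordp0.
have c0 (v : seq (Qpbar K)) : (\prod_(z <- v) (1 - z *: 'X))`_0 = 1.
  rewrite -horner_coef0 horner_prod big1 // => z _.
  by rewrite hornerD hornerN hornerZ hornerX mulr0 subr0 hornerC.
have szG : size G = (size t).+1 by rewrite size_prod_linear.
have G0 : G != 0 by rewrite -size_poly_gt0 szG.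
pose q := G' %/ G; pose r := G' %% G.
have eG : G' = G * q + r by rewrite mulrC; exact: divp_eq.
pose H N := conv R (inv_series R') N - q`_N.
have rH : (fun N => r`_N) =1 conv (fun N => G`_N) H.
  move=> N; rewrite convB convA (eq_conv (fun i _ => eR i) (fun=> fun=> erefl)) -convA.
  rewrite (eq_conv (fun=> fun=> erefl) (fun i _ => conv_inv R'0 i)) convC conv1 conv_poly.
  by rewrite eG coefD addrAC subrr add0r.
have r0 : r = 0.
  apply: contrapT => /eqP r0; have [s1 s1s hs1] := slope_between ht.
  have [e he] := poly_bnd q s.
  have hH N : vge (s * N%:R - Num.max 0 e) (H N).
    apply: vgeB; last by apply: vgeW (he N); rewrite lerD2l lerN2 le_max lexx orbT.
    apply: vgeW (conv_vge N hR _) => [|k]; first by rewrite gerBl le_max lexx.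
    by apply: vgeW (inv_series_vge k R'0 hR'); rewrite ler_wpM2r // ltW.
  have [|a1 [b1 nH]] := np_exists_gen s1s _ hH.
    apply: contrapT => no; case/negP: r0; apply/eqP/polyP => N; rewrite coef0 rH.
    rewrite /conv big1 // => i _; case: (eqVneq (H (N - i)%N) 0) => [->|h]; first exact: mulr0.
    by case: no; exists (N - i)%N.
  have := np_conv p_pr (np_prod p_pr t s1) nH => /(eq_np (fsym rH)) [c [h1 _ _ _]].
  have : r`_(\sum_(z <- t) (ordp z < s1%:E)%E + a1)%N = 0.
    have : (size r < size G)%N by rewrite ltn_modp.
    have -> : (\sum_(z <- t) (ordp z < s1%:E)%E = size t)%N.
      by rewrite -[RHS]sum1_size big_seq [RHS]big_seq; apply: eq_bigr => z /hs1 ->.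
    by rewrite szG ltnS => h; rewrite nth_default // (leq_trans h) // leq_addr.
  by move=> h; move: h1; rewrite h ordp0.
have eq' : G' = G * q by rewrite eG r0 addr0.
have q0 : q`_0 = 1.
  by have := c0 t'; rewrite -/G' eq' coef0M c0 mul1r.
have [e qe e0] := poly_split1 q0.
exists e; first by rewrite eq' qe big_cat.
have eRq : R =1 conv (fun N => q`_N) R'.
  apply: (@conv_inj _ (fun N => G`_N)); first by rewrite c0 oner_eq0.
  move=> N; rewrite eR convA; apply: eq_conv => // i _.
  by rewrite conv_poly eq'.
move=> z ze; have z0 : z != 0 by apply: contraNneq e0 => <-.
have [v ev] := ordp_fin z0; rewrite (vgeE _ ev) leNgt; apply/negP => vs.
have npR := np_tail vs R0 hR; have npR' := np_tail (lt_trans vs ss') R'0 hR'.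
have npq := np_prod p_pr e v; rewrite -qe in npq.
have [_ ] := np_uniq (eq_np eRq npR) (np_conv p_pr npq npR').
by rewrite (perm_big _ (perm_to_rem ze)) big_cons /= ev lexx.
Qed.

Lemma coef0_linear (v : seq (Qpbar K)) : (\prod_(z <- v) (1 - z *: 'X))`_0 = 1.
Proof.
rewrite -horner_coef0 horner_prod big1 // => z _.
by rewrite hornerD hornerN hornerZ hornerX mulr0 subr0 hornerC.
Qed.

Lemma prod_linear_vge (v : seq (Qpbar K)) s N : (forall z, z \in v -> vge s z) ->
  vge (s * N%:R) (\prod_(z <- v) (1 - z *: 'X))`_N.
Proof.
elim: v N => [|x v IH] N h.
  by rewrite big_nil coef1; case: N => [|N]; rewrite ?mulr0 ?vge1 ?vge0.
rewrite big_cons -conv_poly; apply: conv_vge => // k; last first.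
  by apply: IH => z zv; apply: h; rewrite inE zv orbT.
rewrite coefB coefZ coefX coef1; case: k => [|[|k]] /=.
- by rewrite !mulr0 subr0 vge1.
- by rewrite !mulr1 sub0r vgeN h // mem_head.
by rewrite mulr0 subr0 vge0.
Qed.

Lemma zero_seq u c P : 0 < u -> bnd u c P -> P 0%N = 1 -> (forall N, inE_ (P N)) ->
  exists z : nat -> Qpbar K, [/\ forall N : nat, exists M, forall i, (M <= i)%N -> vge N%:R (z i),
    forall i, vge 0 (z i) & forall N, padic_cvg (fun M => (\prod_(i < M) (1 - z i *: 'X))`_N) (P N)].
Proof.
move=> u0 hP P0 PE.
have [s hs] := choice (fun j => weierstrass j u0 hP P0 PE).
have [t ht] := choice hs; have [R hR] := choice ht => {hs ht}.
(* Index 0 stands for the trivial factorization without zeros, of slope 0, valid because P is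
   integral. *)
pose s' j := if j is i.+1 then s i else 0; pose t' j := if j is i.+1 then t i else [::].
pose R' j := if j is i.+1 then R i else P.
have good j : [/\ j%:R - 1 <= s' j, 0 <= s' j, s' j < s' j.+1 & [/\ forall z, z \in t' j -> (ordp z < (s' j)%:E)%E,
   R' j 0%N = 1, forall N, vge (s' j * N%:R) (R' j N) &
   conv (fun N => (\prod_(z <- t' j) (1 - z *: 'X))`_N) (R' j) =1 P]].
  case: j => [|j] /=.
    have [/andP[h1 h2] _ _ _ _] := hR 0%N; split=> //; split=> // N.
      by rewrite mul0r; exact: bnd_vge0 hP.
    rewrite -[RHS]conv1; apply: eq_conv => // i _; by rewrite big_nil coef1.
  have [/andP[h1 h2] h3 h4 h5 h6] := hR j; have [/andP[g1 g2] _ _ _ _] := hR j.+1.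
  have j0 : 0 <= j%:R :> rat by [].
  have e : j.+1%:R = j%:R + 1 :> rat by rewrite -addn1 natrD.
  by rewrite e in g1 *; split=> //; lra.
have [e he] : exists e : nat -> seq (Qpbar K), forall j,
    \prod_(z <- t' j.+1) (1 - z *: 'X) = \prod_(z <- t' j ++ e j) (1 - z *: 'X) /\
    (forall z, z \in e j -> vge (s' j) z).
  have [j|e he] := @choice _ _ (fun j e => \prod_(z <- t' j.+1) (1 - z *: 'X) = \prod_(z <- t' j ++ e) (1 - z *: 'X) /\
    (forall z, z \in e -> vge (s' j) z)); last by exists e.
  have [_ _ lt [h1 h2 h3 h4]] := good j.
  have [_ _ _ [h1' h2' h3' h4']] := good j.+1.
  have hh N : conv (fun N => (\prod_(z <- t' j) (1 - z *: 'X))`_N) (R' j) N =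
    conv (fun N => (\prod_(z <- t' j.+1) (1 - z *: 'X))`_N) (R' j.+1) N by rewrite h4 h4'.
  by have [e e1 e2] := next_zeros lt h1 hh h2 h2' h3 h3'; exists e.
(* The padding 0 contributes the factor 1 and makes every block nonempty, so that the i-th entry
   already lies in the first i + 1 blocks. *)
pose Z j := flatten [seq rcons (e i) 0 | i <- iota 0 j].
have ZS j : Z j.+1 = Z j ++ rcons (e j) 0.
  by rewrite /Z -addn1 iotaD map_cat flatten_cat /= cats0.
have prodZ j : \prod_(z <- Z j) (1 - z *: 'X) = \prod_(z <- t' j) (1 - z *: 'X).
  elim: j => [|j IH]; first by rewrite !big_nil.
  rewrite ZS big_cat /= IH (he j).1 big_cat /=; congr (_ * _).
  by rewrite big_rcons /= scale0r subr0 mulr1.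
have szZ j : (j <= size (Z j))%N.
  elim: j => // j IH; rewrite ZS size_cat size_rcons addnS ltnS.
  by apply: leq_trans IH _; rewrite leq_addr.
have preZ j k : (j <= k)%N -> exists2 w, Z k = Z j ++ w & forall z, z \in w -> vge (s' j) z.
  move=> /subnKC <-; elim: (k - j)%N => [|d [w hw hz]]; first by exists [::]; rewrite ?addn0 ?cats0.
  rewrite addnS ZS hw -catA; exists (w ++ rcons (e (j + d)%N) 0) => // z.
  rewrite mem_cat mem_rcons inE => /orP[/hz //|/orP[/eqP->|h]]; first exact: vge0.
  apply: vgeW ((he _).2 _ h); elim: (d) => [|d' IH]; first by rewrite addn0.
  by apply: le_trans IH _; rewrite addnS; have [_ _ /ltW] := good (j + d')%N.
pose z i := nth 0 (Z i.+1) i.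
have zE k i : (i < k)%N -> z i = nth 0 (Z k) i.
  by move=> /preZ [w -> _]; rewrite nth_cat szZ.
have z0 i : vge 0 (z i).
  have [w] := preZ 0%N i.+1 isT; rewrite /z /= => -> h.
  have [lt|ge] := ltnP i (size w); last by rewrite nth_default // vge0.
  by apply: h; exact: mem_nth.
have zj j i : (size (Z j) <= i)%N -> vge (s' j) (z i).
  move=> ge; have [|w] := preZ j i.+1; first by apply: leq_trans (szZ j) (leqW ge).
  rewrite /z => -> h; rewrite nth_cat ltnNge ge /=.
  have [lt|ge'] := ltnP (i - size (Z j)) (size w); last by rewrite nth_default // vge0.
  by apply: h; exact: mem_nth.
exists z; split=> // [N|N k].
  exists (size (Z N.+1)) => i /zj; apply: vgeW.
  by have [h _ _ _] := good N.+1; apply: le_trans h; rewrite -addn1 natrD; lra.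
exists (size (Z k.+1)) => M hM.
have [_ sk0 _ [_ h2 h3 h4]] := good k.+1; have [h1 _ _ _] := good k.+1.
have ks : k%:R <= s' k.+1 by apply: le_trans h1; rewrite -addn1 natrD; lra.
set A : {poly Qpbar K} := \prod_(z <- Z k.+1) (1 - z *: 'X).
have A0 i : vge 0 A`_i.
  rewrite -[0](mul0r i%:R); apply: prod_linear_vge => x xZ.
  by have [w ew hw] := preZ 0%N k.+1 isT; apply: hw; rewrite -[w]cat0s -/(Z 0) -ew.
have key (g h : nat -> Qpbar K) : (forall i, vge 0 (g i)) -> h 0%N = 1 ->
    (forall i, vge (s' k.+1 * i%:R) (h i)) -> vge k%:R (conv g h N - g N).
  move=> g0 h0 hs; rewrite convC /conv big_ord_recl h0 mul1r subn0 addrAC subrr add0r.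
  apply: vge_sum => i _; apply: vgeMr (g0 _); apply: vgeW (hs _).
  apply: le_trans ks _; rewrite -[leLHS]mulr1 ler_wpM2l // lift0 ler1n //.
have eM : \prod_(i < M) (1 - z i *: 'X) = A * \prod_(size (Z k.+1) <= i < M) (1 - z i *: 'X).
  rewrite -(big_mkord xpredT (fun i => 1 - z i *: 'X)) (big_cat_nat (leq0n _) hM) /=; congr (_ * _).
  rewrite /A [RHS](big_nth 0) !big_mkord; apply: eq_bigr => i _; congr (1 - _ *: _).
  have [lt|ge] := leqP i k; first by rewrite -zE.
  have [w ew _] := preZ k.+1 i.+1 (leqW ge).
  by rewrite /z ew nth_cat ltn_ord.
apply: vge_trans (_ : vge k%:R (A`_N - P N)).
  rewrite eM -conv_poly; apply: key => //; first by rewrite -(big_map z xpredT (fun x => 1 - x *: 'X)) coef0_linear.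
  move=> i; rewrite -(big_map z xpredT (fun x => 1 - x *: 'X)); apply: prod_linear_vge => x /mapP[l].
  by rewrite mem_index_iota => /andP[lt _] ->; exact: zj.
rewrite vgeBC -h4 -prodZ; exact: key.
Qed.

Lemma vge_conv_inv Q (D : nat -> Qpbar K) r N : Q 0%N = 1 -> (forall i, vge 0 (Q i)) ->
  (forall i, (i <= N)%N -> vge r (conv D Q i)) -> forall i, (i <= N)%N -> vge r (D i).
Proof.
move=> Q0 hQ h i; elim/ltn_ind: i => i IH iN.
have := h i iN; rewrite /conv big_ord_recr /= subnn Q0 mulr1 => hi.
have hs : vge r (\sum_(k < i) D k * Q (i - k)%N).
  by apply: vge_sum => k _; apply: vgeMr (hQ _); apply: IH (ltn_ord k) _; apply: leq_trans (ltnW (ltn_ord k)) iN.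
by have := vgeB hi hs; rewrite addrAC subrr add0r.
Qed.

Lemma factorization_exists u c c' f P Q : 0 < u -> bnd u c P -> bnd u c' Q -> P 0%N = 1 -> Q 0%N = 1 ->
  (forall N, inE_ (P N)) -> (forall N, inE_ (Q N)) -> conv f Q =1 P ->
  exists ze, is_factorization f ze.
Proof.
move=> u0 hP hQ P0 Q0 PE QE fQ.
have [x [_ x0 hx]] := zero_seq u0 hP P0 PE; have [y [_ y0 hy]] := zero_seq u0 hQ Q0 QE.
(* The zeros of P, with exponent +1, go to even indices and those of Q, with exponent -1, to odd
   ones. Convergence is checked after multiplication by Q. *)
pose ze := (fun i => if odd i then y i./2 else x i./2, fun i => ~~ odd i).
exists ze => N k.
have mapS (g : nat -> Qpbar K) m : map g (iota 0 m) ++ [:: g m] = map g (iota 0 m.+1).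
  by rewrite -[m.+1]addn1 iotaD map_cat.
have zt M : zeros ze M true = [seq x i | i <- iota 0 (uphalf M)].
  elim: M => // M IH; rewrite zerosS IH /= uphalf_half; case: (odd M) => /=.
    by rewrite cats0.
  exact: mapS.
have zf M : zeros ze M false = [seq y i | i <- iota 0 M./2].
  elim: M => // M IH; rewrite zerosS IH /= uphalf_half; case: (odd M) => /=.
    exact: mapS.
  by rewrite cats0.
have bigE (g : nat -> Qpbar K) M : \prod_(z <- [seq g i | i <- iota 0 M]) (1 - z *: 'X) = \prod_(i < M) (1 - g i *: 'X) :> {poly _}.
  by rewrite big_map -[in iota _ _](subn0 M) -/(index_iota 0 M) big_mkord.
have [a ha] := choice (fun i => hx i k); have [b hb] := choice (fun i => hy i k).
pose M0 := (\max_(i < N.+1) a i + \max_(i < N.+1) b i).*2.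
exists M0 => M hM; rewrite -/(partial ze M N).
pose D i := partial ze M i - f i.
apply: (@vge_conv_inv Q D _ N) => // [i|i iN]; first exact: bnd_vge0 hQ.
pose B i := (\prod_(j < M./2) (1 - y j *: 'X))`_i.
pose A i := (\prod_(j < uphalf M) (1 - x j *: 'X))`_i.
have eD : conv D Q i = conv (partial ze M) (fun i => Q i - B i) i + (A i - P i).
  have := partial_zeros ze M i; rewrite zt zf !bigE => e1.
  rewrite convB e1 -fQ convC convB (convC Q) (convC Q f) /A; ring.
have M1 : (\max_(i < N.+1) a i + \max_(i < N.+1) b i <= M./2)%N.
  by move: hM; rewrite /M0 -{1}(odd_double_half M) => hM; have := half_leq hM; rewrite doubleK half_bit_double.
have M2 : (M./2 <= uphalf M)%N by rewrite uphalf_half leq_addl.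
rewrite eD; apply: vgeD; last first.
  apply: ha; apply: leq_trans M2; apply: leq_trans M1; apply: leq_trans (leq_addr _ _).
  by rewrite -ltnS in iN; exact: (leq_bigmax (Ordinal iN)).
apply: vge_sum => j _; apply: vgeMl.
  rewrite -(mul0r j%:R); apply: partial_vge => // l; rewrite /ze /=; case: ifP => _; [exact: y0|exact: x0].
rewrite vgeBC; apply: hb; apply: leq_trans M1; apply: leq_trans (leq_addl _ _).
have lt : (i - j < N.+1)%N by rewrite ltnS (leq_trans (leq_subr _ _)).
exact: (leq_bigmax (Ordinal lt)).
Qed.

End Weierstrass.

(** * The Euler product *)

Section ClosedPoints.
Variables (p : nat) (p_pr : prime p).

Definition points N : seq (closed_point p) :=
  undup (pmap insub [seq \poly_(i < N.+1) (f : {ffun 'I_N.+1 -> 'F_p}) (inord i) | f <- enum {: {ffun 'I_N.+1 -> 'F_p}}]).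

Lemma closed_point_size (y : closed_point p) : size (val y) = (closed_point_deg y).+1.
Proof.
by have [[h _] _] := closed_point_mi y; rewrite /closed_point_deg prednK // ltnW.
Qed.

Lemma closed_point_deg_gt0 (y : closed_point p) : (0 < closed_point_deg y)%N.
Proof.
by have [[h _] _] := closed_point_mi y; rewrite closed_point_size ltnS in h.
Qed.

Lemma mem_points N (y : closed_point p) : (y \in points N) = (closed_point_deg y <= N)%N.
Proof.
rewrite mem_undup mem_pmap_sub; apply/mapP/idP => [[f _ e]|yN].
  rewrite -ltnS -closed_point_size e; exact: size_poly.
exists [ffun i : 'I_N.+1 => (val y)`_i]; first by rewrite mem_enum.
apply/polyP => i; rewrite coef_poly; case: ltnP => iN; first by rewrite ffunE inordK.
by rewrite nth_default // closed_point_size (leq_trans _ iN).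
Qed.

Lemma uniq_points N : uniq (points N).
Proof. exact: undup_uniq. Qed.

Lemma points_filter N N0 : (N <= N0)%N ->
  perm_eq (points N) [seq y <- points N0 | (closed_point_deg y <= N)%N].
Proof.
move=> NN0; apply: uniq_perm; [exact: uniq_points|exact/filter_uniq/uniq_points|].
move=> y; rewrite mem_filter !mem_points; case: leqP => //= h; by rewrite (leq_trans h NN0).
Qed.

Lemma fsbig_points (R : Type) (idx : R) (op : Monoid.com_law idx) N (F : closed_point p -> R) :
  \big[op/idx]_(y \in [set y : closed_point p | (closed_point_deg y <= N)%N]%classic) F y =
  \big[op/idx]_(y <- points N) F y.
Proof.
have -> : [set y : closed_point p | (closed_point_deg y <= N)%N]%classic = [set` points N]%classic.
  by apply/seteqP; split => y /=; rewrite mem_points.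
by symmetry; apply: fsbig_seq; exact: undup_uniq.
Qed.

End ClosedPoints.

Section EulerProduct.
Variables (F : fieldType) (F0 : forall n, ((n%:R : F) == 0) = (n == 0%N)).

Lemma coef_prod_poly_eq (I : Type) (t : seq I) (P Q : I -> {poly F}) N :
  (forall i k, (k <= N)%N -> (P i)`_k = (Q i)`_k) ->
  forall k, (k <= N)%N -> (\prod_(i <- t) P i)`_k = (\prod_(i <- t) Q i)`_k.
Proof.
move=> h; elim: t => [|i t IH] k kN; rewrite ?big_nil // !big_cons.
apply: coefM_eq => j jk; [apply: h|apply: IH]; exact: leq_trans kN.
Qed.

Lemma is_exp_euler (a : F) d : (0 < d)%N ->
  is_exp (fun m => if (d %| m)%N then d%:R * a ^+ (m %/ d) else 0) (euler_factor a d).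
Proof.
move=> d0; split=> [|N]; first by rewrite /euler_factor dvdn0 div0n.
rewrite /euler_factor; case: ifP => [/dvdnP[k ->]|nd].
  rewrite mulnK //.
  rewrite (eq_bigr (fun i : 'I__ => (if (d %| i.+1)%N then d else 0)%:R * a ^+ k)) => [|i _].
    rewrite -big_distrl -natr_sum /=; congr (_%:R * _).
    rewrite (eq_bigr (fun i : 'I__ => ((d %| i.+1) * d)%N)) => [|i _]; last by case: (d %| _)%N; rewrite ?mul1n.
    by rewrite -big_distrl /=; have := divn_count_dvd d (k * d); rewrite mulnK // big_add1 /= big_mkord => <-.
  case: ifP => [/dvdnP[j ej]|_]; last by rewrite !mul0r.
  rewrite ej mulnK // -mulnBl mulnK // dvdn_mull // -mulrA -exprD subnKC //.
  by rewrite -(leq_pmul2r d0) -ej.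
rewrite mulr0 big1 // => i _; case: ifP => di; last by rewrite mul0r.
case: ifP => [dn|]; last by rewrite mulr0.
by have := dvdn_add di dn; rewrite subnKC ?nd.
Qed.
End EulerProduct.

Section UnitRootSeries.
Variables (p : nat) (p_pr : prime p) (Psi : 'F_p -> algC) (n : nat).
Variables (K : padic_closure p) (iota : {rmorphism algC -> Qpbar K}).
Local Notation alpha y := (alpha0 p_pr Psi n iota y).
Local Notation deg := (@closed_point_deg p).

Lemma unit_root_L_points k N N0 : (N <= N0)%N -> unit_root_L p_pr Psi n iota k N =
  (\prod_(y <- points p N0) trunc_series (euler_factor (alpha y ^ k) (deg y)) N0)`_N.
Proof.
move=> NN0; rewrite /unit_root_L fsbig_points /= (perm_big _ (points_filter p NN0)) big_filter big_mkcond /=.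
apply: coef_prod_poly_eq (leqnn N) => y i iN; rewrite coef_trunc (leq_trans iN NN0).
case: leqP => h; first by rewrite coef_trunc iN.
rewrite coef1 /euler_factor; case: i iN => [|i] iN; first by rewrite dvdn0 div0n.
by rewrite gtnNdvd // (leq_ltn_trans iN).
Qed.

Lemma is_exp_unit_root_L k : is_exp
  (fun m => \sum_(y <- points p m) if (deg y %| m)%N then (deg y)%:R * (alpha y ^ k) ^+ (m %/ deg y) else 0)
  (unit_root_L p_pr Psi n iota k).
Proof.
have key N0 t : exists2 g, is_exp (fun m => \sum_(y <- t) if (deg y %| m)%N then (deg y)%:R * (alpha y ^ k) ^+ (m %/ deg y) else 0) g
    & forall i, (i <= N0)%N -> g i = (\prod_(y <- t) trunc_series (euler_factor (alpha y ^ k) (deg y)) N0)`_i.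
  elim: t => [|y t [g h1 h2]].
    exists (one_series _) => [|i _]; last by rewrite big_nil coef1.
    by apply: eq_is_exp (@is_exp0 _) => m _; rewrite big_nil.
  exists (conv (euler_factor (alpha y ^ k) (deg y)) g) => [|i iN].
    apply: (eq_is_exp _ (is_exp_conv (is_exp_euler _ (closed_point_deg_gt0 y)) h1)) => m _.
    by rewrite big_cons.
  rewrite big_cons coefM; apply: eq_bigr => j _.
  have ji : (j <= i)%N by rewrite -ltnS.
  by rewrite coef_trunc (leq_trans ji iN) h2 // (leq_trans (leq_subr _ _) iN).
split=> [|N].
  by have [g [g0 _] h2] := key 0%N (points p 0); rewrite (unit_root_L_points k (leqnn 0)) -h2.
have [g [g0 hg] h2] := key N (points p N).
rewrite (unit_root_L_points k (leqnn N)) -h2 // hg; apply: eq_bigr => i _.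
rewrite (@unit_root_L_points k _ N) ?leq_subr // -h2 ?leq_subr //; congr (_ * _).
rewrite (perm_big _ (points_filter p (ltn_ord i))) big_filter [RHS]big_mkcond /=.
apply: eq_bigr => y _; case: leqP => // h; rewrite gtnNdvd //.
Qed.

Lemma exprz_cong (x : Qpbar K) (r : rat) (z : int) : 0 < r -> vge r (x - 1) -> vge r (x ^ z - 1).
Proof.
move=> r0 h; have ex : ordp x = 0%:E%E by apply: ordp_cong (ordp1 K) r0 _; rewrite vgeBC.
have x0 : vge 0 x by rewrite (vgeE _ ex).
have hn m : vge r (x ^+ m - 1).
  by rewrite -[X in _ - X](expr1n _ m); apply: vge_subX => //; exact: vge1.
case: z => m; first exact: hn.
have nz : x ^+ m.+1 != 0.
  by rewrite expf_neq0 //; apply/eqP => h0; rewrite h0 ordp0 in ex.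
have -> : x ^ (Negz m) - 1 = (x ^+ m.+1)^-1 * - (x ^+ m.+1 - 1).
  by rewrite NegzE -exprnN mulrN mulrBr mulVf // mulr1 opprB.
apply: vgeMl; last by rewrite vgeN.
by rewrite (vgeE _ (ordpV (ordpX m.+1 ex))) mulr0 oppr0.
Qed.

(** In the binomial expansion at 1 the middle terms gain a factor p; the last one has valuation at
    least p r, which is at least r + 1 when (p-1) r >= 1. *)
Lemma vge_exp_p (x : Qpbar K) (r : rat) : (1 <= r *+ p.-1) -> vge r (x - 1) -> vge (r + 1) (x ^+ p - 1).
Proof.
move=> rp h; have r0 : 0 <= r by rewrite -(pmulrn_lge0 _ (p1_gt0 p_pr)) (le_trans _ rp).
have -> : x ^+ p - 1 = \sum_(i < p) 'C(p, i.+1)%:R * (x - 1) ^+ i.+1.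
  have -> : x ^+ p = (1 + (x - 1)) ^+ p by congr (_ ^+ _); ring.
  rewrite exprDn big_ord_recl expr1n bin0 expr0 mulr1 mulr1n addrAC subrr add0r.
  by apply: eq_bigr => i _; rewrite expr1n mul1r mulr_natl.
have hx i : vge r ((x - 1) ^+ i.+1).
  by apply: vgeW (vgeX i.+1 h); rewrite mulr_natl mulrS lerDl mulrn_wge0.
apply: vge_sum => i _; have [lt|ge] := ltnP i.+1 p.
  rewrite addrC; apply: vgeM => //; have /dvdnP[q ->] := prime_dvd_bin p_pr (lt : 0 < i.+1 < p)%N.
  by rewrite natrM; apply: vgeMl; [exact: vge_nat | rewrite (vgeE _ (ordp_p K))].
apply: vgeMl; first exact: vge_nat.
have -> : i.+1 = p.-1.+1 by apply/eqP; rewrite prednK ?prime_gt0 // eqn_leq ge ltn_ord.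
by apply: vgeW (vgeX _ h); rewrite mulr_natl mulrS lerD2l.
Qed.

Lemma vge_exp_pX (x : Qpbar K) (r : rat) m : (1 <= r *+ p.-1) -> vge r (x - 1) ->
  vge (r + m%:R) (x ^+ (p ^ m) - 1).
Proof.
move=> rp h; elim: m => [|m IH]; first by rewrite addr0 expr1.
rewrite expnSr exprM -addn1 natrD addrA; apply: vge_exp_p => //.
by apply: le_trans rp _; rewrite mulrnDl lerDl mulrn_wge0.
Qed.

Lemma vge_prod_coef (I : Type) (t : seq I) (P : I -> {poly Qpbar K}) :
  (forall i k, vge 0 (P i)`_k) -> forall k, vge 0 (\prod_(i <- t) P i)`_k.
Proof.
move=> h; elim: t => [|i t IH] k; rewrite ?big_nil ?big_cons.
  by rewrite coef1; case: (k == 0%N); rewrite ?vge1 ?vge0.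
by rewrite coefM; apply: vge_sum => j _; apply: vgeMl.
Qed.

Lemma vge_prod_sub (I : Type) (t : seq I) (P Q : I -> {poly Qpbar K}) r :
  (forall i k, vge 0 (P i)`_k) -> (forall i k, vge 0 (Q i)`_k) ->
  (forall i k, vge r ((P i)`_k - (Q i)`_k)) ->
  forall k, vge r ((\prod_(i <- t) P i)`_k - (\prod_(i <- t) Q i)`_k).
Proof.
move=> hP hQ h; elim: t => [|i t IH] k; first by rewrite !big_nil subrr vge0.
rewrite !big_cons !coefM -sumrB; apply: vge_sum => j _; apply: vge_subM => //.
exact: vge_prod_coef.
Qed.

Hypothesis u_alpha : forall y, vge (unit_val p) (alpha y - 1).

(** A unit that is 1 modulo a uniformizer lies on the boundary (p-1) r = 1 of [vge_exp_p], so every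
    factor p of k1 - k2 gains one unit of valuation. *)
Lemma unit_root_L_cong (k1 k2 : int) m : (k1 = k2 %[mod (p.-1 * p ^ m)%N])%Z ->
  forall N, vge m%:R (unit_root_L p_pr Psi n iota k1 N - unit_root_L p_pr Psi n iota k2 N).
Proof.
move=> /eqP; rewrite eqz_mod_dvd => /dvdzP[t et] N; rewrite !(unit_root_L_points _ (leqnn N)).
have u0 := unit_val_gt0 p_pr.
have ua0 y : ordp (alpha y) = 0%:E%E by apply: ordp_cong (ordp1 K) u0 _; rewrite vgeBC.
have a1 (z : int) y : vge (unit_val p) (alpha y ^ z - 1) by exact: exprz_cong.
have a2 (z : int) y : vge 0 (alpha y ^ z).
  have e : ordp (alpha y ^ z) = 0%:E%E by apply: ordp_cong (ordp1 K) u0 _; rewrite vgeBC.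
  by rewrite (vgeE _ e).
have a3 y : alpha y != 0 by apply/eqP => h; have := ua0 y; rewrite h ordp0.
have ef (z : int) y i : vge 0 (trunc_series (euler_factor (alpha y ^ z) (deg y)) N)`_i.
  rewrite coef_trunc; case: ifP => _; last exact: vge0.
  by rewrite /euler_factor; case: ifP => _; [exact: vgeX0 | exact: vge0].
apply: vge_prod_sub => // y i; rewrite !coef_trunc; case: ifP => _; last by rewrite subrr vge0.
rewrite /euler_factor; case: ifP => _; last by rewrite subrr vge0.
apply: vge_subX => //.
have -> : k1 = k2 + (p ^ m)%N%:Z * (p.-1%:Z * t).
  by rewrite -[k1](subrK k2) et PoszM; ring.
rewrite expfzDr // -{2}[alpha y ^ k2]mulr1 -mulrBr; apply: vgeMl => //.
rewrite -exprz_exp; apply: vgeW (_ : m%:R <= unit_val p + m%:R) _; first by rewrite lerDr ltW.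
apply: exprz_cong; first by rewrite ltr_wpDr.
by apply: vge_exp_pX => //; rewrite -mulr_natl unit_valK.
Qed.

End UnitRootSeries.

(** * Finiteness from uniform quotients *)

Section Stability.
Variables (p : nat) (p_pr : prime p) (Psi : 'F_p -> algC) (n : nat).
Variables (K : padic_closure p) (iota : {rmorphism algC -> Qpbar K}).
Local Notation f k := (unit_root_L p_pr Psi n iota k).
Variable pi : Qpbar K.
Hypothesis pi_root : \sum_(i < p) (1 + pi) ^+ i = 0.

Lemma mU_finite (u : rat) (c : nat -> nat) (s : rat) : 0 < u ->
  (forall y, vge (unit_val p) (alpha0 p_pr Psi n iota y - 1)) ->
  (forall k, exists P Q, [/\ P 0%N = 1, Q 0%N = 1, bnd u c P, bnd u c Q &
    [/\ forall N, inE_ pi (P N), forall N, inE_ pi (Q N) & conv (f k) Q =1 P]]) ->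
  exists m : nat, mU p_pr Psi n iota s = m%:E%E.
Proof.
move=> u0 ha MC; suff ex : exists m, `[< slope_stable p_pr Psi n iota s m >].
  rewrite /mU; case: pselect => // ex'; by exists (ex_minn ex').
(* The two L-functions are compared through the cross products P1 Q2 and P2 Q1, hence the doubled
   count. *)
have [m hm] := np_cong K (fun W => c W + c W)%N s u0.
exists m; apply/asboolP => k1 k2 k12 s' hs'.
have [P1 [Q1 [P10 Q10 bP1 bQ1 [EP1 EQ1 e1]]]] := MC k1.
have [P2 [Q2 [P20 Q20 bP2 bQ2 [EP2 EQ2 e2]]]] := MC k2.
have [a1 [b1 n1]] := np_exists p_pr s' u0 bP1 P10.
have [a2 [b2 n2]] := np_exists p_pr s' u0 bP2 P20.
have [d1 [g1 l1]] := np_exists p_pr s' u0 bQ1 Q10.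
have [d2 [g2 l2]] := np_exists p_pr s' u0 bQ2 Q20.
have x1 := factorization_exists p_pr pi_root u0 bP1 bQ1 P10 Q10 EP1 EQ1 e1.
have x2 := factorization_exists p_pr pi_root u0 bP2 bQ2 P20 Q20 EP2 EQ2 e2.
rewrite /dU (slope_degreeE p_pr x1 e1 n1 l1) (slope_degreeE p_pr x2 e2 n2 l2).
have u0' := ltW u0.
have cg N : vge m%:R (conv P1 Q2 N - conv P2 Q1 N).
  have -> : conv P1 Q2 N - conv P2 Q1 N = conv (conv Q1 Q2) (fun N => f k1 N - f k2 N) N.
    rewrite convB (convC (conv Q1 Q2)) [X in _ = _ - X]convC; congr (_ - _).
      by rewrite convA; apply: eq_conv => // i _; rewrite e1.
    rewrite (eq_conv (fun=> fun=> erefl) (fun i _ => convC Q1 Q2 i)) convA.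
    by apply: eq_conv => // i _; rewrite e2.
  apply: vge_sum => i _; apply: vgeMl; last exact: unit_root_L_cong.
  by apply: vge_sum => j _; apply: vgeMl; [exact: bnd_vge0 bQ1|exact: bnd_vge0 bQ2].
have := hm _ _ (bnd_conv u0' bP1 bQ2) (bnd_conv u0' bP2 bQ1) _ _ cg s' _ _ hs' (np_conv p_pr n1 l2).
rewrite !conv_coef0 P10 Q20 P20 Q10 mulr1 => /(_ erefl erefl) h.
by have [] := np_uniq h (np_conv p_pr n2 l1); lia.
Qed.

End Stability.

(** * Passage to the limit in approximate quotients *)

Section Approximation.
Variables (p : nat) (p_pr : prime p) (K : padic_closure p).
Variable pi : Qpbar K.
Hypothesis pi_root : \sum_(i < p) (1 + pi) ^+ i = 0.
Local Notation inE_ := (inE_ pi).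

(** The quotients for different M need not converge. Interleaving P and Q in one sequence yields a
    common accumulation point, to which the bounds pass since they are closed conditions. The loss e
    N depends on N only and is absorbed by a large M. *)
Lemma approx_quotient (f : nat -> Qpbar K) (u : rat) (c e : nat -> nat) : 0 <= u ->
  (forall N, vge 0 (f N)) ->
  (forall M : nat, exists P Q, [/\ P 0%N = 1, Q 0%N = 1, bnd u c P, bnd u c Q &
    [/\ forall N, inE_ (P N), forall N, inE_ (Q N) &
        forall N : nat, vge (M%:R - (e N)%:R) (conv f Q N - P N)]]) ->
  exists P Q, [/\ P 0%N = 1, Q 0%N = 1, bnd u c P, bnd u c Q &
    [/\ forall N, inE_ (P N), forall N, inE_ (Q N) & conv f Q =1 P]].
Proof.
move=> u0 f0 H; have [P HP] := choice H; have [Q HQ] := choice HP => {H HP}.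
pose x M i := if odd i then Q M i./2 else P M i./2.
have hx M i : inE_ (x M i) /\ vge 0 (x M i).
  have [_ _ bP bQ [EP EQ _]] := HQ M; rewrite /x; case: ifP => _; split=> //; [exact: bnd_vge0 bQ|exact: bnd_vge0 bP].
have [g [gE gA]] := inE_compact p_pr pi_root hx.
have app (k N M0 : nat) : exists2 M, (M0 <= M)%N &
    forall i, (i <= N)%N -> vge k%:R (P M i - g i.*2) /\ vge k%:R (Q M i - g i.*2.+1).
  have [M M0M hM] := gA k N.*2.+1 M0; exists M => // i iN; split.
    by have := hM i.*2; rewrite /x odd_double doubleK; apply; rewrite leqW // leq_double.
  by have := hM i.*2.+1; rewrite /x /= odd_double uphalf_double; apply; rewrite ltnS leq_double.
have lim0 (a : nat -> Qpbar K) (b : Qpbar K) (r : rat) : (forall k : nat, exists2 M, vge r (a M) & vge k%:R (a M - b)) -> vge r b.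
  move=> h; have [M h1 h2] := h (Num.bound `|r|).
  rewrite -[b](subKr (a M)); apply: vgeB => //; apply: vgeW h2.
  by apply: le_trans (ler_norm r) (ltW (archi_boundP _)).
have lim1 (a : nat -> Qpbar K) (b : Qpbar K) : (forall M, a M = 1) -> (forall k : nat, exists M, vge k%:R (a M - b)) -> b = 1.
  move=> h1 h; apply/eqP; rewrite -subr_eq0; apply/eqP; apply: vge_eq0 => N.
  by have [M] := h N; rewrite h1 vgeBC.
exists (fun i => g i.*2), (fun i => g i.*2.+1); split.
- by apply: (lim1 (P ^~ 0%N)) => [M|k]; [have [] := HQ M | have [M _ /(_ 0%N isT)[]] := app k 0%N 0%N; exists M].
- by apply: (lim1 (Q ^~ 0%N)) => [M|k]; [have [] := HQ M | have [M _ /(_ 0%N isT)[]] := app k 0%N 0%N; exists M].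
- move=> W N; apply: (lim0 (P ^~ N)) => k; have [M _ /(_ N (leqnn N))[h _]] := app k N 0%N.
  by exists M => //; have [_ _ b _ _] := HQ M; exact: b.
- move=> W N; apply: (lim0 (Q ^~ N)) => k; have [M _ /(_ N (leqnn N))[_ h]] := app k N 0%N.
  by exists M => //; have [_ _ _ b _] := HQ M; exact: b.
split=> // N; apply/eqP; rewrite -subr_eq0; apply/eqP; apply: vge_eq0 => k.
have [M hM hN] := app k N (k + e N)%N.
have [_ _ _ _ [_ _ /(_ N) h3]] := HQ M.
have -> : conv f (fun i => g i.*2.+1) N - g N.*2 =
  (conv f (Q M) N - P M N) - conv f (fun i => Q M i - g i.*2.+1) N + (P M N - g N.*2).
  by rewrite convB; ring.
apply: vgeD; last by have [] := hN N (leqnn N).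
apply: vgeB.
  apply: vgeW h3; have : (k + e N)%:R <= M%:R :> rat by rewrite ler_nat.
  by rewrite natrD; lra.
apply: vge_sum => i _; apply: vgeMl => //.
by have [] := hN (N - i)%N (leq_subr _ _).
Qed.

(** The recursion divides by N at each step, so the precision lost at N adds up to the valuation of
    N!. *)
Lemma is_exp_cong (l l' g g' : nat -> Qpbar K) (M : rat) : is_exp l g -> is_exp l' g' ->
  (forall N, vge 0 (g N)) -> (forall m, vge 0 (l' m)) ->
  (forall m, (0 < m)%N -> vge M (l m - l' m)) -> forall N : nat, vge (M - (logn p N`!)%:R) (g N - g' N).
Proof.
move=> [g0 hg] [g'0 hg'] g_ge l_ge hl; elim/ltn_ind => -[|N] IH.
  rewrite g0 g'0 subrr; exact: vge0.
have N0 : ordp (N.+1%:R : Qpbar K) = (logn p N.+1)%:R%:E%E by rewrite ordp_nat.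
have -> : M - (logn p (N.+1)`!)%:R = M - (logn p N`!)%:R - (logn p N.+1)%:R.
  by rewrite factS lognM ?fact_gt0 // natrD; ring.
apply: vge_cancel N0 _; rewrite mulrBr hg hg' -sumrB; apply: vge_sum => i _.
have -> : l i.+1 * g (N.+1 - i.+1)%N - l' i.+1 * g' (N.+1 - i.+1)%N =
  (l i.+1 - l' i.+1) * g (N - i)%N + l' i.+1 * (g (N - i)%N - g' (N - i)%N) by rewrite subSS; ring.
apply: vgeD; first by apply: vgeMr (g_ge _); apply: vgeW (hl i.+1 isT); rewrite gerBl.
apply: vgeMl => //; apply: vgeW (IH _ _); last by rewrite ltnS leq_subr.
rewrite lerD2l lerN2 ler_nat dvdn_leq_log ?fact_gt0 //.
by rewrite -(bin_fact (leq_subr i N)) dvdn_mull // dvdn_mulr.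
Qed.
End Approximation.

(** * Traces of operators on polynomials *)

Section Operators.
Variable R : comNzRingType.
Implicit Types (f g D O : {poly R} -> {poly R}) (h q : {poly R}).

Definition lin f := forall a h q, f (a *: h + q) = a *: f h + f q.

Lemma linD f h q : lin f -> f (h + q) = f h + f q.
Proof. by move=> lf; have := lf 1 h q; rewrite !scale1r. Qed.

Lemma lin0 f : lin f -> f 0 = 0.
Proof. by move=> lf; have := linD 0 0 lf; rewrite addr0 => /eqP; rewrite -subr_eq subrr eq_sym => /eqP. Qed.

Lemma linZ f a h : lin f -> f (a *: h) = a *: f h.
Proof. by move=> lf; have := lf a h 0; rewrite !addr0 lin0 // addr0. Qed.

Lemma linN f h : lin f -> f (- h) = - f h.
Proof. by move=> lf; rewrite -scaleN1r linZ // scaleN1r. Qed.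

Lemma linB f h q : lin f -> f (h - q) = f h - f q.
Proof. by move=> lf; rewrite linD // linN. Qed.

Lemma lin_sum f (I : Type) (t : seq I) (P : pred I) (F : I -> {poly R}) : lin f ->
  f (\sum_(i <- t | P i) F i) = \sum_(i <- t | P i) f (F i).
Proof.
move=> lf; elim/big_rec2: _ => [|i x y _ <-]; first exact: lin0.
by rewrite linD.
Qed.

Lemma lin_poly f h W : lin f -> (size h <= W)%N -> f h = \sum_(i < W) h`_i *: f 'X^i.
Proof.
move=> lf hW; rewrite {1}[h](_ : _ = \sum_(i < W) h`_i *: 'X^i).
  by rewrite lin_sum //; apply: eq_bigr => i _; rewrite linZ.
rewrite -poly_def; apply/polyP => i; rewrite coef_poly; case: ltnP => // Wi.
by rewrite nth_default // (leq_trans hW).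
Qed.

Lemma lin_eq f g : lin f -> lin g -> (forall i, f 'X^i = g 'X^i) -> f =1 g.
Proof.
move=> lf lg e h; rewrite (lin_poly lf (leqnn _)) (lin_poly lg (leqnn _)).
by apply: eq_bigr => i _; rewrite e.
Qed.

Lemma lin_comp f g : lin f -> lin g -> lin (f \o g).
Proof. by move=> lf lg a h q /=; rewrite lg lf. Qed.

Lemma lin_can f g : lin f -> cancel f g -> cancel g f -> lin g.
Proof. by move=> lf fg gf a h q; apply: (can_inj fg); rewrite lf !gf. Qed.

Definition bdd L f := forall h, (size (f h) <= L)%N.
(** The trace of an operator on a free module of infinite rank: if all its values have size at most
    L, only the first L diagonal entries can be nonzero. *)
Definition ptr L f : R := \sum_(v < L) (f 'X^v)`_v.

Lemma ptr_widen L L' f : (L <= L')%N -> bdd L f -> ptr L' f = ptr L f.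
Proof.
move=> LL b; rewrite /ptr -!(big_mkord xpredT (fun v => (f 'X^v)`_v)) (big_cat_nat (leq0n _) LL) /=.
rewrite [X in _ + X]big1_seq ?addr0 // => i /andP[_]; rewrite mem_index_iota => /andP[Li _].
by rewrite nth_default // (leq_trans (b _)).
Qed.

Lemma eq_ptr L f g : f =1 g -> ptr L f = ptr L g.
Proof. by move=> e; apply: eq_bigr => i _; rewrite e. Qed.

Lemma ptr_sum L (I : Type) (t : seq I) (F : I -> {poly R} -> {poly R}) :
  ptr L (fun h => \sum_(i <- t) F i h) = \sum_(i <- t) ptr L (F i).
Proof. by rewrite exchange_big; apply: eq_bigr => i _; rewrite coef_sum. Qed.

Lemma ptrZ L a f : ptr L (fun h => a *: f h) = a * ptr L f.
Proof. by rewrite mulr_sumr; apply: eq_bigr => i _; rewrite coefZ. Qed.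

Lemma lin_bdd f L : lin f -> exists W, forall h, (size h <= L)%N -> (size (f h) <= W)%N.
Proof.
move=> lf; exists (\max_(i < L) size (f 'X^i)) => h hL; rewrite (lin_poly lf hL).
apply: leq_trans (size_sum _ _ _) _; apply/bigmax_leqP => i _.
by apply: leq_trans (size_scale_leq _ _) _; exact: leq_bigmax.
Qed.

Lemma ptr_comm f g L L' : lin f -> lin g -> bdd L f -> bdd L' (g \o f) ->
  ptr L (f \o g) = ptr L' (g \o f).
Proof.
move=> lf lg bf bg; pose W := (L' + \max_(v < L) size (g 'X^v))%N.
rewrite -(ptr_widen (leq_addr _ _ : L' <= W)%N bg) /ptr.
under eq_bigr => v _.
  rewrite /= (@lin_poly f _ W) //; last by apply: leq_trans (leq_addl _ _); exact: (leq_bigmax v).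
  rewrite coef_sum; over.
rewrite exchange_big; apply: eq_bigr => w _ /=; rewrite (lin_poly lg (bf _)) coef_sum.
by apply: eq_bigr => v _; rewrite !coefZ mulrC.
Qed.

Section Unitriangular.
Variable U : {poly R} -> {poly R}.
Hypothesis linU : lin U.
Hypothesis triU : forall v : nat, (size (U 'X^v - 'X^v : {poly R})%R <= v)%N.

Lemma unitri_size h k : (size h <= k.+1)%N -> (size (U h - h`_k *: 'X^k)%R <= k)%N.
Proof.
move=> hk; rewrite (lin_poly linU hk) big_ord_recr /= -addrA -scalerBr.
apply: leq_trans (size_polyD _ _) _; rewrite geq_max; apply/andP; split; last first.
  by apply: leq_trans (size_scale_leq _ _) _.
apply: leq_trans (size_sum _ _ _) _; apply/bigmax_leqP => i _.
apply: leq_trans (size_scale_leq _ _) _; rewrite -[U _](subrK 'X^i).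
apply: leq_trans (size_polyD _ _) _; rewrite geq_max size_polyXn ltn_ord andbT.
by apply: leq_trans (triU _) _; exact: ltnW.
Qed.

Lemma unitri_inj h : U h = 0 -> h = 0.
Proof.
move=> Uh; apply/eqP; rewrite -size_poly_eq0; case e : (size h) => [//|k].
have := @unitri_size h k; rewrite e Uh sub0r size_polyN => /(_ (leqnn _)) hk.
have : (h`_k *: 'X^k : {poly R})`_k = 0 by rewrite nth_default.
by rewrite coefZ coefXn eqxx mulr1; have := lead_coef_eq0 h; rewrite lead_coefE e -size_poly_eq0 e /= => + /eqP => ->.
Qed.

Lemma unitri_surj q : exists h, U h = q.
Proof.
elim: {q}(size q) {-2}q (leqnn (size q)) => [|k IH] q hq.
  by exists 0; rewrite lin0 //; move: hq; rewrite leqn0 size_poly_eq0 => /eqP.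
have [|h hh] := IH (q - U (q`_k *: 'X^k)).
  have h1 : (size (q - q`_k *: 'X^k)%R <= k)%N.
    apply/leq_sizeP => j kj; rewrite coefB coefZ coefXn; case: eqP => [->|nj].
      by rewrite mulr1 subrr.
    by rewrite mulr0 subr0 nth_default // (leq_trans hq) // ltn_neqAle kj eq_sym andbT; apply/eqP.
  have h2 : (size (U (q`_k *: 'X^k) - q`_k *: 'X^k)%R <= k)%N.
    by rewrite linZ // -scalerBr; apply: leq_trans (size_scale_leq _ _) _.
  have -> : q - U (q`_k *: 'X^k) = (q - q`_k *: 'X^k) - (U (q`_k *: 'X^k) - q`_k *: 'X^k) by ring.
  by apply: leq_trans (size_polyD _ _) _; rewrite size_polyN geq_max h1 h2.
by exists (h + q`_k *: 'X^k); rewrite linD // hh subrK.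
Qed.

Lemma unitri_inv : exists U', [/\ lin U', cancel U U' & cancel U' U].
Proof.
have [U' hU] := choice unitri_surj; have c h : U' (U h) = h.
  by apply/eqP; rewrite -subr_eq0; apply/eqP/unitri_inj; rewrite linB // hU subrr.
by exists U'; split=> //; exact: lin_can linU c hU.
Qed.

(** Neumann series: f = U (1 - W) with W = - ga U^-1 V and W^m = 0. As V may raise degrees, it is
    the nilpotence of ga that makes the sum finite. *)
Lemma unitri_nil_inv (ga : R) m (V : {poly R} -> {poly R}) f : ga ^+ m = 0 -> lin V ->
  (forall h, f h = U h + ga *: V h) -> exists f', [/\ lin f', cancel f f' & cancel f' f].
Proof.
move=> gm linV fE; have [U' [linU' UK U'K]] := unitri_inv.
pose W0 h := - U' (V h); pose W h := ga *: W0 h.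
have linW0 : lin W0 by move=> a h q; rewrite /W0 linV linU' opprD scalerN.
have WX k h : iter k W h = ga ^+ k *: iter k W0 h.
  by elim: k => [|k IH] /=; rewrite ?scale1r // IH /W (linZ _ _ linW0) scalerA exprS.
have Wm h : iter m W h = 0 by rewrite WX gm scale0r.
have linW k : lin (iter k W).
  elim: k => [//|k IH] a h q /=; by rewrite IH /W linW0 scalerDr !scalerA mulrC.
have fW h : f h = U (h - W h).
  by rewrite fE (linB _ _ linU) /W /W0 (linZ _ _ linU) (linN _ linU) U'K scalerN opprK.
have tele h : \sum_(k < m) (iter k W h - iter k.+1 W h) = h.
  rewrite -(big_mkord xpredT (fun k => iter k W h - iter k.+1 W h)).
  rewrite (eq_bigr (fun k => - (iter k.+1 W h - iter k W h))) => [|k _]; last by rewrite opprB.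
  by rewrite sumrN telescope_sumr // Wm sub0r opprK.
exists (fun q => \sum_(k < m) iter k W (U' q)); split.
- move=> a h q; rewrite scaler_sumr -big_split; apply: eq_bigr => k _.
  by rewrite linU' linW.
- move=> h; rewrite fW UK -[RHS]tele; apply: eq_bigr => k _.
  by rewrite (linB _ _ (linW k)) -iterSr.
move=> q; rewrite fW -[RHS]U'K; congr U; rewrite -[RHS]tele sumrB; congr (_ - _).
by rewrite -[W _]/(iter 1 W _) (lin_sum _ _ _ (linW 1)); apply: eq_bigr.
Qed.

End Unitriangular.

(** In the basis 1, ..., X^(d-1), D 1, D X, ... given by f, the operator O0 is block triangular with
    diagonal blocks H and O1. The conjugation by f, which need not respect degrees, preserves the
    trace by [ptr_comm]. *)
Lemma trace_step d f f' D O0 O1 L (H : 'M[R]_d) : lin f -> lin f' -> cancel f f' -> cancel f' f ->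
  lin D -> lin O0 -> lin O1 -> (forall i, (i < d)%N -> f 'X^i = 'X^i) ->
  (forall k, f 'X^(d + k) = D 'X^k) -> (forall h, O0 (D h) = D (O1 h)) -> bdd L O0 -> bdd L O1 ->
  (forall i : 'I_d, exists q, O0 'X^i = \sum_j H j i *: 'X^j + D q) ->
  ptr L O0 = \tr H + ptr L O1.
Proof.
move=> lf lf' fK f'K lD l0 l1 fi fd OD b0 b1 hH.
have fX h : f ('X^d * h) = D h.
  have e : f \o (fun h => 'X^d * h) =1 D.
    apply: lin_eq => // [|i]; last by rewrite /= -exprD fd.
    by move=> a u v /=; rewrite mulrDr -scalerAr lf.
  exact: e.
have [W hW] := lin_bdd L lf'.
have lO : lin (O0 \o f) by exact: lin_comp.
have bO : bdd L (O0 \o f) by move=> h; exact: b0.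
have bW : bdd (d + (W + L))%N (f' \o (O0 \o f)).
  by move=> h; apply: leq_trans (hW _ (bO h)) _; rewrite addnCA leq_addr.
transitivity (ptr L ((O0 \o f) \o f')); first by apply: eq_ptr => h /=; rewrite f'K.
rewrite (ptr_comm lO lf' bO bW) /ptr big_split_ord /=; congr (_ + _).
  apply: eq_bigr => i _; rewrite fi // ; have [q ->] := hH i.
  rewrite -fX -[X in f' (X + _)](_ : f (\sum_j H j i *: 'X^j) = _); last first.
    by rewrite lin_sum //; apply: eq_bigr => j _; rewrite linZ // fi.
  rewrite -linD // fK coefD coefXnM ltn_ord addr0 coef_sum (bigD1 i) //= big1 => [|j ji].
    by rewrite coefZ coefXn eqxx mulr1 addr0.
  by rewrite coefZ coefXn eq_sym (negPf ji : (j == i :> nat) = false) mulr0.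
rewrite -/(ptr L O1) -(ptr_widen (leq_addl W L) b1); apply: eq_bigr => k _.
by rewrite fd OD -fX fK coefXnM ltnNge leq_addr /= addKn.
Qed.

End Operators.

(** * The Mellin transform of the Dwork complex *)

Section FrobeniusData.
Variables (p m J : nat).

(* ga^a e a is the coefficient of x^a in the splitting function, and           *)
(* sum_j eta j X^(p^j) is the logarithmic derivative of its infinite product   *)
(* prod_k theta(x^(p^k)), where X = ga x.                                      *)
Record frob_data (S : comNzRingType) (ga : S) (e eta : nat -> S) : Prop := FrobData {
  fd_p : exists p', p%:R = ga * p';
  fd_nil : ga ^+ m = 0;
  fd_e0 : e 0%N = 1;
  fd_e : forall a, a%:R * e a = \sum_(j < a.+1 | (p ^ j <= a)%N) e (a - p ^ j)%N;
  fd_eta0 : eta 0%N = 1;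
  fd_etaJ : eta J = 0;
  fd_eta_ga : forall j, exists x, eta j.+1 = ga * x;
  fd_eta : forall j u, (p ^ j <= u)%N ->
    p%:R * eta j * ga ^+ (p.-1 * (u - p ^ j)) = (eta j.+1 - 1) * ga ^+ (p.-1 * u)
}.

Lemma frob_data_map (S S' : comNzRingType) (f : {rmorphism S -> S'}) ga e eta :
  frob_data ga e eta -> frob_data (f ga) (f \o e) (f \o eta).
Proof.
case=> [[p' hp] hn h0 he e0 eJ eg er]; split=> /=.
- by exists (f p'); rewrite -rmorphM -hp rmorph_nat.
- by rewrite -rmorphXn hn rmorph0.
- by rewrite h0 rmorph1.
- by move=> a; rewrite -(rmorph_nat f) -rmorphM he rmorph_sum.
- by rewrite e0 rmorph1.
- by rewrite eJ rmorph0.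
- by move=> j; have [x hx] := eg j; exists (f x); rewrite hx rmorphM.
by move=> j u pu; rewrite -(rmorph_nat f) -!rmorphXn -!rmorphM er // rmorphM rmorphB rmorph1.
Qed.

Section Ops.
Variables (S : comNzRingType) (ga : S) (e eta : nat -> S).

(** If F is the product whose logarithmic derivative is given by eta, this is the conjugate of X
    d/dX by multiplication by X^(-s) F: the differential whose cokernel carries the Mellin transform
    at s. *)
Definition Dop (s : S) (h : {poly S}) : {poly S} :=
  'X * h^`() - s *: h + (\sum_(j < J) eta j *: 'X^(p ^ j)) * h.

(** Dwork's operator: multiply by the splitting function, keep the exponents p u + d and replace
    them by u. It is written in the variable X = ga x and divided by ga^d (see [gauge_Aop]); this
    rescaling creates the powers of ga that bound the degree. *)
Definition Aop (d : nat) (h : {poly S}) : {poly S} :=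
  \poly_(u < m) (ga ^+ (p.-1 * u) * \sum_(v < (p * u + d).+1) h`_v * e (p * u + d - v)%N).

Definition shifted_e (a v : nat) : S := if (v <= a)%N then e (a - v)%N else 0.

Lemma linDop s : lin (Dop s).
Proof.
move=> a h q; rewrite /Dop derivD derivZ !mulrDr !scalerDr -!scalerAr scalerN !scalerA [s * a]mulrC.
rewrite opprD; ring.
Qed.

Lemma linAop d : lin (Aop d).
Proof.
move=> a h q; apply/polyP => u; rewrite coefD coefZ !coef_poly; case: ltnP => _; last by rewrite mulr0 addr0.
rewrite mulrCA -mulrDr; congr (_ * _); rewrite mulr_sumr -big_split; apply: eq_bigr => v _.
by rewrite coefD coefZ mulrDl mulrA.
Qed.

Lemma DopX s v : Dop s 'X^v = (v%:R - s) *: 'X^v + \sum_(j < J) eta j *: 'X^(v + p ^ j).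
Proof.
rewrite /Dop derivXn mulr_suml; congr (_ + _); last first.
  by apply: eq_bigr => j _; rewrite -scalerAl -exprD addnC.
rewrite scalerBl scaler_nat; congr (_ - _); case: v => [|v]; first by rewrite !mulr0n mulr0.
by rewrite mulrnAr -exprS.
Qed.

Hypothesis fd : frob_data ga e eta.
Hypothesis p_gt1 : (1 < p)%N.

Lemma coef_AopX d v u : (Aop d 'X^v)`_u = ga ^+ (p.-1 * u) * shifted_e (p * u + d) v.
Proof.
have nil k : (m <= k)%N -> ga ^+ k = 0.
  by move=> /subnKC <-; rewrite exprD (fd_nil fd) mul0r.
rewrite coef_poly; case: ltnP => um; last first.
  by rewrite nil ?mul0r // (leq_trans um) // leq_pmull // -subn1 subn_gt0.
congr (_ * _); rewrite /shifted_e; case: leqP => h.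
  have h' : (v < (p * u + d).+1)%N by [].
  rewrite (bigD1 (Ordinal h')) //= coefXn eqxx mul1r big1 ?addr0 // => i iv.
  by rewrite coefXn (negPf (iv : (i : nat) != v)) mul0r.
rewrite big1 // => i _; rewrite coefXn; case: eqP => [E|]; last by rewrite mul0r.
by have := ltn_ord i; rewrite E ltnS leqNgt h.
Qed.

Lemma bdd_Aop d : bdd m (Aop d).
Proof. by move=> h; exact: size_poly. Qed.

Lemma coef_Dop s h u : (Dop s h)`_u = (u%:R - s) * h`_u +
  \sum_(j < J) eta j * (if (p ^ j <= u)%N then h`_(u - p ^ j) else 0).
Proof.
rewrite /Dop !coefD coefN coefZ coefXM coef_deriv mulrBl mulr_natl mulr_suml coef_sum; congr (_ - _ + _).
  by case: u => [|u]; rewrite ?mulr0n.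
apply: eq_bigr => j _; rewrite -scalerAl coefZ coefXnM ltnNge; by case: leqP.
Qed.

Hypothesis mJ : (m <= p ^ J)%N.

(** The recursion [fd_e] may involve any j, the right-hand side only j <= J. When a larger j could
    occur, u is at least p^J >= m and the power of ga vanishes. *)
Lemma shifted_e_rec d u v : (d < p)%N ->
  ga ^+ (p.-1 * u) * (((p * u + d)%:R - v%:R) * shifted_e (p * u + d) v) =
  ga ^+ (p.-1 * u) * \sum_(j < J.+1) shifted_e (p * u + d) (v + p ^ j).
Proof.
move=> dp; rewrite /shifted_e; case: leqP => [h|h]; last first.
  rewrite mulr0 mulr0 big1 ?mulr0 // => j _; case: leqP => // h'.
  by have := leq_trans (leq_addr _ _) h'; rewrite leqNgt h.
set a := (p * u + d - v)%N; have [aJ|Ja] := ltnP a (p ^ J.+1); last first.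
  suff -> : ga ^+ (p.-1 * u) = 0 by rewrite !mul0r.
  have mu : (m <= p.-1 * u)%N.
    have pu : (p ^ J <= u)%N.
      rewrite -ltnS -(@ltn_pmul2l p) ?(ltnW p_gt1) // -expnS mulnS.
      by apply: leq_ltn_trans Ja _; rewrite /a addnC; apply: leq_ltn_trans (leq_subr _ _) _; rewrite ltn_add2r.
    apply: leq_trans mJ (leq_trans pu _); rewrite leq_pmull // -subn1 subn_gt0 //.
  by rewrite -(subnKC mu) exprD (fd_nil fd) mul0r.
congr (_ * _); rewrite -natrB // -/a (fd_e fd).
have cv i : (v + p ^ i <= p * u + d)%N = (p ^ i <= a)%N by rewrite /a; lia.
rewrite [RHS](eq_bigr (fun j : 'I__ => if (p ^ j <= a)%N then e (a - p ^ j)%N else 0)) => [|j _]; last first.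
  by rewrite cv /a; case: ifP => // _; congr e; lia.
rewrite -[RHS]big_mkcond /= -(big_mkord (fun j => p ^ j <= a)%N (fun j => e (a - p ^ j)%N)).
rewrite -[RHS](big_mkord (fun j => p ^ j <= a)%N (fun j => e (a - p ^ j)%N)).
rewrite (big_nat_widen _ _ _ _ _ (leq_addr J.+1 a.+1)) [RHS](big_nat_widen _ _ _ _ _ (leq_addl a.+1 J.+1)).
apply: eq_bigl => j; case: (leqP (p ^ j) a) => //= pj.
have -> : (j < a.+1)%N by rewrite ltnS (leq_trans (ltnW (ltn_expl _ p_gt1)) pj).
by rewrite -(ltn_exp2l _ _ p_gt1) (leq_ltn_trans pj).
Qed.

(** Frobenius commutes with the connection up to the factor p: [fd_eta] is the logarithmic
    derivative of F(x) = theta(x) F(x^p), where theta is the splitting function and F its infinite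
    product. *)
Lemma Aop_Dop d s h : (d < p)%N -> Aop d (Dop (p%:R * s + d%:R) h) = p%:R *: Dop s (Aop d h).
Proof.
move=> dp; have l1 : lin (fun h => Aop d (Dop (p%:R * s + d%:R) h)).
  by apply: (lin_comp (linAop d)); exact: linDop.
have l2 : lin (fun h => p%:R *: Dop s (Aop d h)).
  by move=> a x y; rewrite linAop linDop scalerDr !scalerA mulrC.
apply: (lin_eq l1 l2) => v {h l1 l2}; apply/polyP => u.
rewrite DopX linAop (lin_sum _ _ _ (linAop d)) coefD coefZ coef_sum coefZ coef_Dop mulrDr mulr_sumr.
rewrite (eq_bigr (fun j : 'I_J => ga ^+ (p.-1 * u) * (eta j * shifted_e (p * u + d) (v + p ^ j)))); last first.
  by move=> j _; rewrite (linZ _ _ (linAop d)) coefZ coef_AopX mulrCA.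
rewrite [X in _ = _ + X](eq_bigr (fun j : 'I_J => ga ^+ (p.-1 * u) * ((eta j.+1 - 1) * shifted_e (p * u + d) (v + p ^ j.+1)))); last first.
  move=> j _; case: ifP => pj.
    rewrite coef_AopX !mulrA (fd_eta fd pj) [_ * ga ^+ _]mulrC -!mulrA; congr (_ * (_ * _)).
    have pju : (p ^ j.+1 <= p * u)%N by rewrite expnS leq_mul2l pj orbT.
    have eq1 : (p * (u - p ^ j) = p * u - p ^ j.+1)%N by rewrite mulnBr expnS.
    rewrite /shifted_e eq1; move: (p ^ j.+1)%N pju => w pju.
    have -> : (v <= p * u - w + d)%N = (v + w <= p * u + d)%N by lia.
    by case: ifP => // _; congr e; lia.
  rewrite !mulr0 /shifted_e; case: leqP => h; last by rewrite !mulr0.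
  have /negP[] := negbT pj; rewrite -ltnS -(@ltn_pmul2l p) ?(ltnW p_gt1) // -expnS mulnS.
  by apply: leq_ltn_trans (leq_trans (leq_addl _ _) h) _; rewrite addnC ltn_add2r.
rewrite coef_AopX -!mulr_sumr; have := shifted_e_rec u v dp.
set G := ga ^+ _; set E := shifted_e _ => key.
have SAB : \sum_(i < J) eta i * E (v + p ^ i)%N - \sum_(i < J) (eta i.+1 - 1) * E (v + p ^ i.+1)%N =
    \sum_(i < J.+1) E (v + p ^ i)%N.
  have : \sum_(i < J.+1) eta i * E (v + p ^ i)%N = \sum_(i < J) eta i * E (v + p ^ i)%N.
    by rewrite big_ord_recr /= (fd_etaJ fd) mul0r addr0.
  rewrite big_ord_recl /= (fd_eta0 fd) mul1r => <-; rewrite [RHS]big_ord_recl -addrA; congr (_ + _).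
  by rewrite -sumrB; apply: eq_bigr => i _; rewrite mulrBl mul1r opprB addrC subrK.
move: SAB key; set SA := \sum_(i < J) _; set SB := \sum_(i < J) _ => <-; rewrite natrD natrM => key.
apply/eqP; rewrite -subr_eq0; apply/eqP.
transitivity (G * (SA - SB) - G * ((p%:R * u%:R + d%:R - v%:R) * E v)); first by ring.
by rewrite key subrr.
Qed.

End Ops.
End FrobeniusData.

(** * Operators with free cokernel *)

Section Cokernel.
Variables (S : comNzRingType) (ga : S) (m d : nat) (D U V : {poly S} -> {poly S}).
Hypotheses (ga_m : ga ^+ m = 0) (linU : lin U) (linV : lin V).
Hypothesis DE : forall h, D h = U h + ga *: V h.
Hypothesis triU : forall k : nat, (size (U 'X^k - 'X^(d + k) : {poly S})%R <= d + k)%N.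

Implicit Types (h q r : {poly S}).

(** The change of basis that sends X^(d+k) to D X^k and fixes lower powers. It is unitriangular up
    to ga, so the cokernel of D is free on 1, ..., X^(d-1). *)
Definition adapted h := take_poly d h + D (drop_poly d h).

Lemma lin_take : lin (@take_poly S d).
Proof. by move=> a h q; rewrite take_polyD take_polyZ. Qed.

Lemma lin_drop : lin (@drop_poly S d).
Proof. by move=> a h q; rewrite drop_polyD drop_polyZ. Qed.

Lemma linD_of : lin D.
Proof. by move=> a h q; rewrite !DE linU linV !scalerDr !scalerA [ga * a]mulrC; ring. Qed.

Lemma lin_adapted : lin adapted.
Proof. by move=> a h q; rewrite /adapted lin_take lin_drop linD_of !scalerDr; ring. Qed.

Lemma adapted_split r q : (size r <= d)%N -> adapted (r + 'X^d * q) = r + D q.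
Proof.
move=> rd; rewrite /adapted -[X in take_poly _ (_ + X)]mulrC -[X in drop_poly _ (_ + X)]mulrC.
by rewrite take_polyDMXn // drop_polyDMXn.
Qed.

Lemma adapted_lt i : (i < d)%N -> adapted 'X^i = 'X^i.
Proof.
move=> id; have := @adapted_split 'X^i 0; rewrite mulr0 addr0 size_polyXn => /(_ id) ->.
by rewrite (lin0 linD_of) addr0.
Qed.

Lemma adapted_ge k : adapted 'X^(d + k) = D 'X^k.
Proof.
have := @adapted_split 0 'X^k; rewrite add0r -exprD => ->; first by rewrite add0r.
by rewrite size_poly0.
Qed.

Lemma adapted_inv : exists f', [/\ lin f', cancel adapted f' & cancel f' adapted].
Proof.
pose U1 h := take_poly d h + U (drop_poly d h); pose V1 h := V (drop_poly d h).
have l1 : lin U1 by move=> a h q; rewrite /U1 lin_take lin_drop linU !scalerDr; ring.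
have l2 : lin V1 by move=> a h q; rewrite /V1 lin_drop linV.
have t1 (v : nat) : (size (U1 'X^v - 'X^v : {poly S})%R <= v)%N.
  rewrite /U1; have [vd|dv] := ltnP v d.
    rewrite take_poly_id ?size_polyXn // drop_poly_eq0 ?size_polyXn // (lin0 linU) addr0 subrr.
    by rewrite size_poly0.
  rewrite -(subnKC dv) -[X in take_poly _ X]add0r -[X in drop_poly _ X]add0r exprD mulrC.
  rewrite take_polyDMXn ?size_poly0 // drop_polyDMXn ?size_poly0 // add0r mulrC -exprD; exact: triU.
apply: (unitri_nil_inv l1 t1 ga_m l2) => h.
by rewrite /adapted /U1 /V1 DE addrA.
Qed.

Lemma cokernel_div h : exists r q, (size r <= d)%N /\ h = r + D q.
Proof.
have [f' [_ _ fK]] := adapted_inv; exists (take_poly d (f' h)), (drop_poly d (f' h)).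
by split; [exact: size_take_poly | rewrite -[LHS]fK].
Qed.

Lemma cokernel_uniq r q r' q' : (size r <= d)%N -> (size r' <= d)%N -> r + D q = r' + D q' -> r = r'.
Proof.
move=> rd rd'; rewrite -!adapted_split // => e; have [f' [_ fK _]] := adapted_inv.
have := can_inj fK e => /(congr1 (take_poly d)).
by rewrite ![_ * q]mulrC ![_ * q']mulrC !take_polyDMXn.
Qed.

Lemma cokernel_trace O0 O1 L (H : 'M[S]_d) : lin O0 -> lin O1 ->
  (forall h, O0 (D h) = D (O1 h)) -> bdd L O0 -> bdd L O1 ->
  (forall i : 'I_d, exists q, O0 'X^i = \sum_j H j i *: 'X^j + D q) ->
  ptr L O0 = \tr H + ptr L O1.
Proof.
move=> l0 l1 e b0 b1 h; have [f' [lf' fK f'K]] := adapted_inv.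
exact: (trace_step lin_adapted lf' fK f'K linD_of l0 l1 adapted_lt adapted_ge e b0 b1 h).
Qed.

End Cokernel.

Section Mellin.
Variables (p m J : nat) (p_gt1 : (1 < p)%N) (mJ : (m <= p ^ J)%N).
Section Rho.
Variables (S : comNzRingType) (ga : S) (e eta : nat -> S).
Hypothesis fd : frob_data p m J ga e eta.

Implicit Types (s : S) (h q : {poly S}).

(** Modulo ga only eta_0 = 1 survives, so X^k is sent to a polynomial with leading term X^(k+1): the
    cokernel has rank one. *)
Lemma cokernel_Dop s : exists U V, [/\ lin U, lin V, forall h, Dop p J eta s h = U h + ga *: V h &
  forall k : nat, (size (U 'X^k - 'X^(1 + k) : {poly S})%R <= 1 + k)%N].
Proof.
have [x hx] := choice (fd_eta_ga fd).
have J0 : (0 < J)%N.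
  by rewrite lt0n; apply/eqP => J0; have := fd_etaJ fd; rewrite J0 (fd_eta0 fd) => /eqP; rewrite oner_eq0.
exists (fun h => 'X * h^`() - s *: h + 'X * h), (fun h => (\sum_(j < J.-1) x j *: 'X^(p ^ j.+1)) * h); split.
- move=> a h q; rewrite derivD derivZ !mulrDr !scalerDr -!scalerAr scalerN !scalerA [s * a]mulrC opprD; ring.
- by move=> a h q; rewrite mulrDr -scalerAr.
- move=> h; rewrite /Dop -[RHS]addrA; congr (_ + _).
  rewrite scalerAl -mulrDl; congr (_ * _).
  rewrite -(big_mkord xpredT (fun j => eta j *: 'X^(p ^ j))) big_ltn // big_add1 big_mkord.
  rewrite (fd_eta0 fd) expn0 scale1r expr1; congr (_ + _).
  by rewrite scaler_sumr; apply: eq_bigr => j _; rewrite hx scalerA.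
move=> k; rewrite derivXn add1n exprS addrK mulrnAr -scaler_nat.
have -> : k%:R *: ('X * 'X^(k.-1)) - s *: 'X^k = (k%:R - s) *: 'X^k :> {poly S}.
  by rewrite scalerBl; case: (k) => [|k']; rewrite ?scale0r // -exprS.
by apply: leq_trans (size_scale_leq _ _) _; rewrite size_polyXn.
Qed.

(** The coordinate on the rank one cokernel, normalized by [rho1]: formally the integral of X^(-s) F
    h dX/X divided by its value at h = 1. The default 0 is not reached, by [rhoP]. *)
Definition rho s (h : {poly S}) : S := xget 0 [set c | exists q, h = c%:P + Dop p J eta s q]%classic.

Lemma rhoP s h : exists q, h = (rho s h)%:P + Dop p J eta s q.
Proof.
have [U [V [lU lV DE tri]]] := cokernel_Dop s.
have [r [q [r1 hE]]] := cokernel_div (fd_nil fd) lU lV DE tri h.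
rewrite /rho; case: xgetP => [y -> //|/(_ r`_0)[]]; exists q; rewrite {1}hE.
by rewrite {1}(size1_polyC r1).
Qed.

Lemma rho_uniq s h c q : h = c%:P + Dop p J eta s q -> rho s h = c.
Proof.
have [U [V [lU lV DE tri]]] := cokernel_Dop s; have [q' e1] := rhoP s h; move=> e2.
have := cokernel_uniq (fd_nil fd) lU lV DE tri _ _ (etrans (esym e1) e2).
by rewrite !size_polyC_leq1 => /(_ isT isT) /polyC_inj.
Qed.

Lemma rhoL s a h h' : rho s (a *: h + h') = a * rho s h + rho s h'.
Proof.
have [q e1] := rhoP s h; have [q' e2] := rhoP s h'.
apply: (@rho_uniq _ _ _ (a *: q + q')); rewrite linDop {1}e1 {1}e2 scalerDr polyCD polyCM -mul_polyC.
by rewrite -!mul_polyC; ring.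
Qed.

Lemma rho1 s : rho s 1 = 1.
Proof. by apply: (@rho_uniq _ _ _ 0); rewrite (lin0 (linDop p J eta s)) addr0. Qed.

Lemma rhoD s q : rho s (Dop p J eta s q) = 0.
Proof. by apply: (@rho_uniq _ _ _ q); rewrite add0r. Qed.

Lemma rho_rep (phi : {poly S} -> S) s : (forall a h h', phi (a *: h + h') = a * phi h + phi h') ->
  (forall q, phi (Dop p J eta s q) = 0) -> forall h, phi h = phi 1 * rho s h.
Proof.
move=> lphi h0 h; have [q e1] := rhoP s h.
rewrite {1}e1 -alg_polyC lphi h0 addr0 mulrC //.
Qed.

End Rho.

Lemma Dop_map (S S' : comNzRingType) (f : {rmorphism S -> S'}) (eta : nat -> S) s h :
  map_poly f (Dop p J eta s h) = Dop p J (f \o eta) (f s) (map_poly f h).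
Proof.
rewrite /Dop rmorphD rmorphB !rmorphM /= map_polyX deriv_map map_polyZ rmorph_sum; congr (_ + _ * _).
by apply: eq_bigr => j _; rewrite /= map_polyZ map_polyXn.
Qed.

Lemma rho_map (S S' : comNzRingType) (f : {rmorphism S -> S'}) ga (e eta : nat -> S) s h :
  frob_data p m J ga e eta -> f (rho eta s h) = rho (f \o eta) (f s) (map_poly f h).
Proof.
move=> fd; have [q e1] := rhoP fd s h; symmetry.
apply: (rho_uniq (frob_data_map f fd) (q := map_poly f q)).
by rewrite -Dop_map {1}e1 rmorphD /= map_polyC.
Qed.

Lemma Aop_map (S S' : comNzRingType) (f : {rmorphism S -> S'}) ga (e : nat -> S) d h :
  map_poly f (Aop p m ga e d h) = Aop p m (f ga) (f \o e) d (map_poly f h).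
Proof.
apply/polyP => u; rewrite coef_map !coef_poly /=; case: ifP => _; last exact: rmorph0.
rewrite rmorphM rmorphXn rmorph_sum /=; congr (_ * _); apply: eq_bigr => v _.
by rewrite rmorphM coef_map.
Qed.

End Mellin.

Section MellinAop.
Variables (p m J : nat) (p_gt1 : (1 < p)%N) (mJ : (m <= p ^ J)%N).
Variables (S : comNzRingType) (ga : S) (e eta : nat -> S).
Hypothesis fd : frob_data p m J ga e eta.
Implicit Types (s c : S) (f h q : {poly S}) (d : nat).
Local Notation Aop_ := (Aop p m ga e).
Local Notation Dop_ := (Dop p J eta).
Local Notation rho_ := (rho p J eta).

Lemma rho_Aop s d h : (d < p)%N -> rho_ s (Aop_ d h) = rho_ s (Aop_ d 1) * rho_ (p%:R * s + d%:R) h.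
Proof.
move=> dp; apply: (rho_rep fd (phi := fun h => rho_ s (Aop_ d h))) => [a x y|q].
  by rewrite linAop (rhoL fd).
by rewrite (Aop_Dop fd) // -[X in rho_ s X]addr0 (rhoL fd) (rhoD fd) mulr0 add0r -(lin0 (linDop p J eta s)) (rhoD fd).
Qed.

(** The functional equation in s, as for the Gamma function. *)
Lemma rho_XM s h : rho_ s ('X * h) = rho_ s 'X * rho_ (s - 1) h.
Proof.
rewrite -[X in rho_ s X * _]mulr1; apply: (rho_rep fd (phi := fun h => rho_ s ('X * h))) => [a x y|q].
  by rewrite mulrDr -scalerAr (rhoL fd).
suff -> : 'X * Dop_ (s - 1) q = Dop_ s ('X * q) by exact: rhoD fd _ _.
rewrite /Dop derivM derivX mul1r scalerBl scale1r -!mul_polyC; ring.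
Qed.

Lemma Aop_XS d h : Aop_ d.+1 ('X * h) = Aop_ d h.
Proof.
have l : lin (fun h => Aop_ d.+1 ('X * h)) by move=> a x y; rewrite mulrDr -scalerAr linAop.
apply: (lin_eq l (linAop p m ga e d)) => v; rewrite -exprS; apply/polyP => u.
by rewrite !(coef_AopX fd) // /shifted_e addnS ltnS subSS.
Qed.

Lemma Aop_X0 h : Aop_ 0 ('X * h) = ga ^+ p.-1 *: ('X * Aop_ p.-1 h).
Proof.
have l1 : lin (fun h => Aop_ 0 ('X * h)) by move=> a x y; rewrite mulrDr -scalerAr linAop.
have l2 : lin (fun h => ga ^+ p.-1 *: ('X * Aop_ p.-1 h)).
  by move=> a x y; rewrite linAop mulrDr -scalerAr scalerDr !scalerA mulrC.
apply: (lin_eq l1 l2) => v; rewrite -exprS; apply/polyP => u.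
rewrite (coef_AopX fd) // coefZ coefXM; case: u => [|u] /=; first by rewrite /shifted_e !muln0 !mulr0.
rewrite (coef_AopX fd) // mulrA -exprD mulnS; congr (_ * _); rewrite /shifted_e.
have -> : (p * u.+1 + 0 = (p * u + p.-1).+1)%N by rewrite mulnS; have := ltnW p_gt1; lia.
by rewrite ltnS subSS.
Qed.

End MellinAop.

Section MellinTransform.
Variables (p m J : nat) (p_gt1 : (1 < p)%N) (mJ : (m <= p ^ J)%N).
Variables (S : comNzRingType) (ga : S) (e eta : nat -> S).
Hypothesis fd : frob_data p m J ga e eta.
Implicit Types (s c : S) (f h q : {poly S}) (H : {poly {poly S}}) (d : nat).
Local Notation Aop_ := (Aop p m ga e).
Local Notation Dop_ := (Dop p J eta).
Local Notation rho_ := (rho p J eta).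
Local Notation gaT := (ga%:P).
Local Notation eT := (polyC \o e).
Local Notation etaT := (polyC \o eta).
Local Notation rhoT := (rho p J etaT).

Lemma fdT : frob_data p m J gaT eT etaT.
Proof. exact: frob_data_map fd. Qed.

(** Here s is the indeterminate 'X of the coefficient ring S['X]. Identities between functionals
    become identities between polynomials in s, which [mel_comp] and [rho_mel] specialize. *)
Definition mel H : {poly S} := rhoT 'X H.
Definition amel d : {poly S} := mel (Aop p m gaT eT d 1).
Definition rmel : {poly S} := mel 'X.

Lemma mel_comp q H : (mel H) \Po q = rhoT q (map_poly (comp_poly q) H).
Proof.
rewrite -[_ \Po _]/(comp_poly q (mel H)) (rho_map _ _ _ fdT) /= comp_polyX; congr (rho _ _ _ _ _).
by apply/funext => j /=; rewrite comp_polyC.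
Qed.

Lemma rho_mel s h : rho_ s h = (mel (map_poly polyC h)).[s].
Proof.
rewrite -[_.[s]]/(horner_eval s _) (rho_map _ _ _ fdT) /= -map_poly_comp /=.
have E : horner_eval s \o polyC =1 id by move=> c; rewrite /= /horner_eval hornerC.
congr (rho _ _ _ _ _); first by apply/funext => j /=; rewrite /horner_eval hornerC.
  by rewrite /horner_eval hornerX.
by rewrite (eq_map_poly E) map_poly_id.
Qed.

Lemma amel_comp d q : (amel d) \Po q = rhoT q (Aop p m gaT eT d 1).
Proof.
rewrite mel_comp (@Aop_map p m _ _ (comp_poly q) _ _ d); congr (rhoT q (Aop _ _ _ _ _ _)).
- by rewrite /= comp_polyC.
- by apply/funext => j /=; rewrite comp_polyC.
by rewrite rmorph1.
Qed.

Lemma rmel_comp q : rmel \Po q = rhoT q 'X.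
Proof. by rewrite mel_comp map_polyX. Qed.

Lemma amelE d s : (amel d).[s] = rho_ s (Aop_ d 1).
Proof. by rewrite rho_mel (@Aop_map p m _ _ polyC _ _ d) rmorph1. Qed.

Lemma amelS d : (d.+1 < p)%N -> (rmel \Po (p%:R * 'X + d.+1%:R)) * amel d.+1 = amel d.
Proof.
move=> dp; rewrite rmel_comp mulrC; have := rho_Aop p_gt1 mJ fdT 'X ('X * 1) dp.
by rewrite (Aop_XS p_gt1 fdT) mulr1 => h; exact: (esym h).
Qed.

Lemma amel0 : (rmel \Po (p%:R * 'X)) * amel 0 = ga ^+ p.-1 *: (rmel * (amel p.-1 \Po ('X - 1))).
Proof.
rewrite rmel_comp mulrC; have := rho_Aop p_gt1 mJ fdT 'X ('X * 1) (ltnW p_gt1).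
rewrite addr0 (Aop_X0 p_gt1 mJ fdT) mulr1 => <-; rewrite amel_comp -(rho_XM fdT).
rewrite -[_ *: ('X * _)]addr0 (rhoL fdT) -mul_polyC polyC_exp.
rewrite -[RHS]addr0; congr (_ + _).
by rewrite -(lin0 (linDop p J etaT 'X)) (rhoD fdT).
Qed.

Variable n : nat.

(** [alpha] is Frobenius and [Xi] the connection after the Mellin transform. A convolution of n+1
    equal factors becomes an (n+1)-st power; the residues d modulo p of the exponent give the p
    terms of [alpha], and [beta] is the last of them without its scalar. *)
Definition alpha c f : {poly S} := \sum_(d < p) c ^+ d *: (amel d ^+ n.+1 * (f \Po (p%:R * 'X + d%:R))).
Definition Xi c f : {poly S} := rmel ^+ n.+1 * (f \Po ('X - 1)) - c *: f.
Definition beta f : {poly S} := amel p.-1 ^+ n.+1 * (f \Po (p%:R * 'X + p.-1%:R)).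

Lemma lin_alpha c : lin (alpha c).
Proof.
move=> a f h; rewrite /alpha scaler_sumr -big_split; apply: eq_bigr => d _.
by rewrite comp_polyD comp_polyZ mulrDr -scalerAr scalerDr !scalerA mulrC.
Qed.

Lemma lin_Xi c : lin (Xi c).
Proof.
by move=> a f h; rewrite /Xi comp_polyD comp_polyZ mulrDr -scalerAr !scalerDr scalerN !scalerA [c * a]mulrC opprD; ring.
Qed.

Lemma lin_beta : lin beta.
Proof. by move=> a f h; rewrite /beta comp_polyD comp_polyZ mulrDr -scalerAr. Qed.

Lemma comp_polynat q (k : nat) : (k%:R : {poly S}) \Po q = k%:R.
Proof. exact: rmorph_nat (comp_poly q) k. Qed.

(** The sum over d telescopes: by [amelS] the first part of the term d+1 is the second part of the
    term d. The remaining parts, for d = 0 and d = p-1, match through [amel0], whose factor ga^(p-1)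
    dictates the relation between c and c'. *)
Lemma alpha_Xi c c' f : c ^+ p = ga ^+ (p.-1 * n.+1) * c' ->
  alpha c (Xi c f) = Xi c' (ga ^+ (p.-1 * n.+1) *: beta f).
Proof.
move=> cc; pose F d := amel d ^+ n.+1 * (f \Po (p%:R * 'X + d%:R)).
have e1 d : c ^+ d *: (amel d ^+ n.+1 * (Xi c f \Po (p%:R * 'X + d%:R))) =
    c ^+ d *: (((rmel \Po (p%:R * 'X + d%:R)) * amel d) ^+ n.+1 * (f \Po (p%:R * 'X + d%:R - 1)))
    - c ^+ d.+1 *: F d.
  rewrite /Xi comp_polyB comp_polyZ comp_polyM rmorphXn /= -comp_polyA comp_polyB comp_polyX.
  rewrite -polyC1 comp_polyC polyC1 exprMn [c ^+ d.+1]exprSr -scalerA -scalerBr; congr (_ *: _).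
  by rewrite -!mul_polyC /F; ring.
rewrite /alpha; under eq_bigr => d _ do rewrite e1.
rewrite sumrB.
have p0 : (0 < p)%N by exact: ltnW.
rewrite -(big_mkord xpredT (fun d => c ^+ d *: (((rmel \Po (p%:R * 'X + d%:R)) * amel d) ^+ n.+1 * (f \Po (p%:R * 'X + d%:R - 1))))).
rewrite -(big_mkord xpredT (fun d => c ^+ d.+1 *: F d)).
have splitr (G : nat -> {poly S}) : \sum_(0 <= d < p) G d = \sum_(0 <= d < p.-1) G d + G p.-1.
  by rewrite -{1}(prednK p0) big_nat_recr.
rewrite big_ltn // big_add1 splitr.
rewrite /= [X in _ + X - _](_ : _ = \sum_(0 <= d < p.-1) c ^+ d.+1 *: F d); last first.
  rewrite big_nat [RHS]big_nat; apply: eq_bigr => d /andP[_ dp].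
  have dp' : (d.+1 < p)%N by rewrite -(prednK p0) ltnS.
  rewrite amelS // /F; congr (_ *: (_ * (_ \Po _))).
  by rewrite -[d.+1]addn1 natrD addrA addrK.
rewrite opprD addrA addrK prednK // cc expr0 scale1r addr0 amel0.
rewrite /Xi comp_polyZ /beta comp_polyM rmorphXn /= -comp_polyA comp_polyD comp_polyM comp_polyX !comp_polynat.
have -> : p%:R * ('X - 1) + p.-1%:R = p%:R * 'X - 1 :> {poly S}.
  by rewrite -[p in p%:R * ('X - 1)](prednK p0) -addn1 natrD -[p in RHS](prednK p0) -[X in _ = X%:R * _ - _]addn1 natrD; ring.
rewrite exprZn -exprM scalerAr -scalerAl -!mul_polyC !polyCM; congr (_ - _).
  by rewrite exprMn; ring.
by rewrite /F; ring.
Qed.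

End MellinTransform.

(** * Digit strings, for the iterates of Frobenius *)

Section Digits.
Variable p : nat.

Fixpoint digs k : seq (seq nat) :=
  if k is k'.+1 then [seq d :: es | d <- iota 0 p, es <- digs k'] else [:: [::]].

(** The head is the most significant digit. *)
Fixpoint dval (es : seq nat) : nat := if es is d :: es' then (d * p ^ size es' + dval es')%N else 0%N.

Lemma mem_digs k es : (es \in digs k) = (size es == k) && all (fun d => d < p)%N es.
Proof.
elim: k es => [|k IH] [|d es] //=; first by apply/allpairsP => -[[a b] /= [_ _]].
rewrite eqSS andbCA -IH; apply/allpairsP/andP => [[[a b] /= [ha hb [-> ->]]]|[hd he]].
  by move: ha; rewrite mem_iota.
by exists (d, es); rewrite mem_iota.
Qed.

Lemma uniq_digs k : uniq (digs k).
Proof.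
elim: k => [//|k IH]; apply: allpairs_uniq => //; first exact: iota_uniq.
by move=> [a b] [c d] _ _ /= [-> ->].
Qed.

Lemma big_digsS (V : nmodType) k (F : seq nat -> V) :
  \sum_(es <- digs k.+1) F es = \sum_(d < p) \sum_(es <- digs k) F ((d : nat) :: es).
Proof. by rewrite /= big_allpairs_dep /= -(big_mkord xpredT (fun d => \sum_(es <- digs k) F (d :: es))) /index_iota subn0. Qed.

Lemma map_dval_digs k : [seq dval es | es <- digs k] = iota 0 (p ^ k).
Proof.
elim: k => [//|k IH] /=.
have H t a : [seq dval es | es <- [seq (d : nat) :: es | d <- iota a t, es <- digs k]] = iota (a * p ^ k) (t * p ^ k).
  elim: t a => [//|t IHt] a; rewrite /= map_cat IHt mulSn iotaD -mulSnr; congr (_ ++ _).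
  rewrite -map_comp -[in RHS](addn0 (a * p ^ k)%N) iotaDl -IH -map_comp; apply/eq_in_map => es.
  by rewrite mem_digs => /andP[/eqP <- _].
by rewrite H mul0n expnS.
Qed.

End Digits.

Section FrobeniusTrace.
Variables (p m J : nat) (p_gt1 : (1 < p)%N) (mJ : (m <= p ^ J)%N) (n : nat).
Variables (S : comNzRingType) (ga : S) (e eta : nat -> S).
Hypothesis fd : frob_data p m J ga e eta.
Implicit Types (s c y a b : S) (f h q B : {poly S}) (d : nat) (es : seq nat).
Local Notation Aop_ := (Aop p m ga e).
Local Notation Dop_ := (Dop p J eta).
Local Notation rho_ := (rho p J eta).
Local Notation amel := (amel p m J ga e eta).
Local Notation rmel := (rmel p J eta).
Local Notation alpha := (alpha p m J ga e eta n).
Local Notation beta := (beta p m J ga e eta n).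
Local Notation Xi := (Xi p J eta n).

Definition cg (f h : {poly S}) := exists w, f = h + ga *: w.

Lemma cg_refl f : cg f f. Proof. by exists 0; rewrite scaler0 addr0. Qed.

Lemma cgD f f' h h' : cg f h -> cg f' h' -> cg (f + f') (h + h').
Proof. by move=> [w ->] [w' ->]; exists (w + w'); rewrite scalerDr; ring. Qed.

Lemma cgM f f' h h' : cg f h -> cg f' h' -> cg (f * f') (h * h').
Proof.
move=> [w ->] [w' ->]; exists (w * h' + h * w' + ga *: (w * w')).
by rewrite -!mul_polyC; ring.
Qed.

Lemma cgZ c f h : cg f h -> cg (c *: f) (c *: h).
Proof. by rewrite -!mul_polyC; apply: cgM; exact: cg_refl. Qed.

Lemma cgX f h k : cg f h -> cg (f ^+ k) (h ^+ k).
Proof.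
move=> fh; elim: k => [|k IH]; first exact: cg_refl.
by rewrite !exprS; exact: cgM.
Qed.

Lemma cg_sum (I : Type) (t : seq I) (F G : I -> {poly S}) : (forall i, cg (F i) (G i)) ->
  cg (\sum_(i <- t) F i) (\sum_(i <- t) G i).
Proof.
move=> h; elim: t => [|i t IH]; rewrite ?big_nil ?big_cons; first exact: cg_refl.
exact: cgD.
Qed.

Lemma cg_p f : cg (p%:R * f) 0.
Proof. by have [p' pE] := fd_p fd; exists (p' *: f); rewrite -polyC_natr pE mul_polyC scalerA add0r. Qed.

Lemma melL (T := {poly S}) (a : T) (h h' : {poly T}) :
  mel p J eta (a *: h + h') = a * mel p J eta h + mel p J eta h'.
Proof. exact: rhoL (fdT fd) _ _ _ _. Qed.

Lemma mel_polyC (a : {poly S}) : mel p J eta a%:P = a.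
Proof.
by apply: (rho_uniq (fdT fd) (q := 0)); rewrite (lin0 (linDop p J (polyC \o eta) 'X)) addr0.
Qed.

(** Modulo ga, the image of 1 under the differential is X - s, which has class 0. *)
Lemma rmel_cg : cg rmel 'X.
Proof.
have [U [V [lU lV DE _]]] := cokernel_Dop (fdT fd) ('X : {poly S}).
have [x hx] := choice (fd_eta_ga fd).
have J0 : (0 < J)%N.
  by rewrite lt0n; apply/eqP => J0; have := fd_etaJ fd; rewrite J0 (fd_eta0 fd) => /eqP; rewrite oner_eq0.
pose W : {poly {poly S}} := \sum_(j < J.-1) (x j)%:P *: 'X^(p ^ j.+1).
have e1 : Dop p J (polyC \o eta) 'X 1 = (- 'X)%:P + ('X + ga%:P *: W).
  rewrite /Dop derivC mulr0 mulr1 sub0r alg_polyC -polyCN; congr (_ + _).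
  rewrite -(big_mkord xpredT (fun j => (polyC \o eta) j *: 'X^(p ^ j))) big_ltn // big_add1 big_mkord /=.
  rewrite (fd_eta0 fd) expn0 scale1r expr1; congr (_ + _).
  by rewrite scaler_sumr; apply: eq_bigr => j _; rewrite hx scalerA polyCM.
have := rhoD (fdT fd) 'X 1; rewrite e1 -/(mel p J eta _) => e2.
have E : mel p J eta (ga%:P *: W + 'X) = 'X.
  have := melL 1 (- 'X)%:P ('X + ga%:P *: W); rewrite scale1r e2 mul1r mel_polyC addrC addrC [in X in _ + X]addrC.
  by move=> /esym/eqP; rewrite addrC subr_eq0 => /eqP.
by exists (- mel p J eta W); rewrite scalerN -mul_polyC -{1}E melL addrAC subrr add0r.
Qed.

(** All coefficients of the image of 1 but the constant one carry a positive power of ga. *)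
Lemma amel_cg d : cg (amel d) (e d)%:P.
Proof.
pose W : {poly {poly S}} := \poly_(u < m.-1) (ga%:P ^+ (p.-1 * u.+1).-1 * (e (p * u.+1 + d))%:P) * 'X.
exists (mel p J eta W).
suff e1 : Aop p m ga%:P (polyC \o e) d 1 = ga%:P *: W + ((e d)%:P)%:P.
  by rewrite /amel e1 melL mel_polyC addrC mul_polyC.
apply/polyP => u; rewrite -(expr0 'X) (coef_AopX (fdT fd)) // /shifted_e /= coefD coefZ coefMX coefC.
case: u => [|u]; first by rewrite !muln0 expr0 mul1r mulr0 add0r subn0.
have pu : (0 < p.-1 * u.+1)%N by rewrite muln_gt0 -subn1 subn_gt0 p_gt1.
rewrite /= addr0 subn0 coef_poly; case: ltnP => um.
  by rewrite mulrA -exprS prednK.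
rewrite mulr0 -polyC_exp.
have mu : (m <= p.-1 * u.+1)%N.
  apply: (@leq_trans u.+1); last by rewrite leq_pmull // -subn1 subn_gt0.
  by case: (m) um.
by rewrite -(subnKC mu) exprD (fd_nil fd) mul0r polyC0 mul0r.
Qed.

(** Modulo ga, X^k is sent to X^(n+1) (X-1)^k - c X^k, of degree n+1+k; this is where the rank n+1
    comes from. *)
Lemma cokernel_Xi c : exists U V, [/\ lin U, lin V, forall h, Xi c h = U h + ga *: V h &
  forall k : nat, (size (U 'X^k - 'X^(n.+1 + k) : {poly S})%R <= n.+1 + k)%N].
Proof.
have [w hw] := cgX n.+1 rmel_cg.
exists (fun h => 'X^(n.+1) * (h \Po ('X - 1)) - c *: h), (fun h => w * (h \Po ('X - 1))); split.
- by move=> a f h; rewrite comp_polyD comp_polyZ mulrDr -scalerAr !scalerDr scalerN !scalerA [c * a]mulrC opprD; ring.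
- by move=> a f h; rewrite comp_polyD comp_polyZ mulrDr -scalerAr.
- by move=> h; rewrite /Xi hw mulrDl scalerAl; ring.
move=> k; have -> : 'X^(n.+1) * ('X^k \Po ('X - 1)) - c *: 'X^k - 'X^(n.+1 + k) =
    'X^(n.+1) * (('X - 1) ^+ k - 'X^k) - c *: 'X^k :> {poly S}.
  by rewrite comp_Xn_poly exprD; ring.
apply: leq_trans (size_polyD _ _) _; rewrite size_polyN geq_max; apply/andP; split; last first.
  apply: leq_trans (size_scale_leq _ _) _; rewrite size_polyXn addSn ltnS leq_addl //.
apply: leq_trans (size_polyMleq _ _) _; rewrite size_polyXn /= addSn ltnS leq_add2l.
rewrite subrXX [X in X * _](_ : _ = (-1)%:P); last by rewrite polyCN polyC1; ring.
rewrite mul_polyC; apply: leq_trans (size_scale_leq _ _) _.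
apply: leq_trans (size_sum _ _ _) _; apply/bigmax_leqP => i _.
apply: leq_trans (size_polyMleq _ _) _; rewrite -polyC1 size_exp_XsubC size_polyXn.
by have := ltn_ord i; lia.
Qed.

(** Modulo ga the values of [alpha] are constants, because p is a multiple of ga and [amel d] is
    constant. So all rows but the first are divisible by ga, which is the source of the unit
    root. *)
Lemma frob_matrix c c' : exists r : 'M[S]_n.+1, forall i : 'I_n.+1, exists q,
  alpha c 'X^i = \sum_j ((j == ord0)%:R * (\sum_(d < p) c ^+ d * (e d ^+ n.+1 * d%:R ^+ i)) + ga * r j i) *: 'X^j + Xi c' q.
Proof.
have [U [V [lU lV DE tri]]] := cokernel_Xi c'.
have H (i : 'I_n.+1) : exists r : {poly S}, exists2 q, alpha c 'X^i =
    (\sum_(d < p) c ^+ d * (e d ^+ n.+1 * d%:R ^+ i))%:P + ga *: r + Xi c' q & (size r <= n.+1)%N.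
  have [w hw] : cg (alpha c 'X^i) (\sum_(d < p) c ^+ d * (e d ^+ n.+1 * d%:R ^+ i))%:P.
    rewrite rmorph_sum; apply: cg_sum => d; rewrite /= polyCM mul_polyC; apply: cgZ.
    rewrite polyCM; apply: cgM; first by rewrite polyC_exp; apply: cgX; exact: amel_cg.
    rewrite comp_Xn_poly polyC_exp; apply: cgX; rewrite -[_%:P]add0r polyC_natr.
    by apply: cgD; [exact: cg_p | exact: cg_refl].
  have [r [q [rn wE]]] := cokernel_div (fd_nil fd) lU lV DE tri w.
  exists r, (ga *: q) => //; rewrite hw wE scalerDr (linZ _ _ (lin_Xi _ _ _ _ _)) addrA //.
have [r hr] := choice H.
exists (\matrix_(j, i) (r i)`_j) => i; have [q e1 e2] := hr i; exists q; rewrite e1; congr (_ + _).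
set kap := \sum_(d < p) _; under eq_bigr => j _ do rewrite scalerDl.
rewrite big_split /=; congr (_ + _).
  rewrite (bigD1 ord0) //= big1 ?addr0 => [|j /negPf ->]; last by rewrite mul0r scale0r.
  by rewrite mul1r expr0 alg_polyC.
rewrite (_ : r i = \sum_(j < n.+1) (r i)`_j *: 'X^j); last first.
  by rewrite -poly_def; apply/polyP => j; rewrite coef_poly; case: ltnP => // jn; rewrite nth_default // (leq_trans e2).
by rewrite scaler_sumr; apply: eq_bigr => j _; rewrite mxE scalerA.
Qed.

Lemma size_comp_nil f a b : (exists a', a = ga * a') -> (size (f \Po (a *: 'X + b%:P)) <= m)%N.
Proof.
move=> [a' aE]; have -> : f \Po (a *: 'X + b%:P) = (f \Po ('X + b%:P)) \Po (a *: 'X).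
  by rewrite -comp_polyA comp_polyD comp_polyX comp_polyC.
move: (f \Po _) => {}f; apply/leq_sizeP => k mk; rewrite comp_polyE coef_sum big1 // => i _.
rewrite coefZ exprZn coefZ coefXn; case: eqP => [<-|_]; last by rewrite !mulr0.
by rewrite aE exprMn -(subnKC mk) exprD (fd_nil fd) !mul0r mulr0.
Qed.

(** A fixed point formula. Multiplication by X - s intertwines the operator with a times itself, and
    on its cokernel the operator acts by B(s); so the trace t satisfies t = B(s) + a t. *)
Lemma trace_subst a b s B L : (exists a', a = ga * a') -> s = a * s + b ->
  bdd L (fun h => B * (h \Po (a *: 'X + b%:P))) ->
  (1 - a) * ptr L (fun h => B * (h \Po (a *: 'X + b%:P))) = B.[s].
Proof.
move=> _ sE bL; set O := fun h => _.
have lO : lin O by move=> x f h; rewrite /O comp_polyD comp_polyZ mulrDr -scalerAr.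
have lU : lin (fun h => ('X - s%:P) * h) by move=> x f h; rewrite mulrDr -scalerAr.
have lV : lin (fun=> 0 : {poly S}) by move=> x f h; rewrite scaler0 addr0.
have lO1 : lin (fun h => a *: O h) by move=> x f h; rewrite lO scalerDr !scalerA mulrC.
have tri (k : nat) : (size (('X - s%:P) * 'X^k - 'X^(1 + k) : {poly S})%R <= 1 + k)%N.
  rewrite mulrBl -exprS addrAC subrr add0r size_polyN mul_polyC.
  by apply: leq_trans (size_scale_leq _ _) _; rewrite size_polyXn.
have DE h : ('X - s%:P) * h = ('X - s%:P) * h + 0 *: 0 by rewrite scale0r addr0.
have := cokernel_trace (m := 1) (expr1 0) lU lV DE tri (O0 := O) (O1 := fun h => a *: O h) (L := L) (H := (B.[s])%:M) lO lO1.
rewrite mxtrace_scalar mulr1n ptrZ => E; rewrite mulrBl mul1r {1}E //; first by rewrite addrK.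
- move=> h; rewrite /O comp_polyM comp_polyB comp_polyX comp_polyC; set w := h \Po _.
  have -> : b = s - a * s by rewrite {1}sE addrC addKr.
  by rewrite polyCB polyCM -!mul_polyC; ring.
- by move=> h; apply: leq_trans (size_scale_leq _ _) (bL h).
move=> i; rewrite ord1 big_ord1 mxE eqxx mulr1n expr0.
have /factor_theorem[q hq] : root (B - (B.[s])%:P) s by rewrite /root hornerD hornerN hornerC subrr.
exists q; rewrite /O -polyC1 comp_polyC polyC1 mulr1 alg_polyC mulrC -hq; ring.
Qed.

Fixpoint bmel es : {poly S} :=
  if es is d :: es' then amel d * (bmel es' \Po (p%:R *: 'X + d%:R%:P)) else 1.

Fixpoint Aops es h : {poly S} := if es is d :: es' then Aop_ d (Aops es' h) else h.

Lemma lin_Aops es : lin (Aops es).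
Proof. by elim: es => [//|d es IH] a f h /=; rewrite IH linAop. Qed.

Lemma Aops_Dop es s h : all (fun d => d < p)%N es ->
  Aops es (Dop_ ((p ^ size es)%:R * s + (dval p es)%:R) h) = (p ^ size es)%:R *: Dop_ s (Aops es h).
Proof.
elim: es s h => [|d es IH] s h /=; first by rewrite mul1r addr0 scale1r.
move=> /andP[dp ep]; rewrite (_ : _ + _ = (p ^ size es)%:R * (p%:R * s + d%:R) + (dval p es)%:R); last first.
  by rewrite expnS natrD !natrM; ring.
by rewrite IH // (linZ _ _ (linAop _ _ _ _ _)) (Aop_Dop fd) // scalerA -natrM expnSr.
Qed.

Lemma rho_Aops es s h : all (fun d => d < p)%N es ->
  rho_ s (Aops es h) = (bmel es).[s] * rho_ ((p ^ size es)%:R * s + (dval p es)%:R) h.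
Proof.
elim: es s h => [|d es IH] s h /=; first by rewrite hornerC mul1r mul1r addr0.
move=> /andP[dp ep]; rewrite (rho_Aop p_gt1 mJ fd) // IH // hornerM horner_comp (amelE fd) mulrA.
rewrite hornerD hornerZ hornerX hornerC; congr (_ * rho_ _ _).
by rewrite expnS natrD !natrM; ring.
Qed.

(** The argument of [trace_subst] with multiplication by X - s replaced by [Dop s], which commutes
    with the operator up to a power of p exactly when s is the fixed point. *)
Lemma trace_Aops d es s : all (fun d => d < p)%N (d :: es) ->
  s = (p ^ size (d :: es))%:R * s + (dval p (d :: es))%:R ->
  (1 - (p ^ size (d :: es))%:R) * ptr m (Aops (d :: es)) = (bmel (d :: es)).[s].
Proof.
move=> ep sE; set Q := _%:R in sE *.
have [U [V [lU lV DE tri]]] := cokernel_Dop fd s.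
have l0 := lin_Aops (d :: es).
have l1 : lin (fun h => Q *: Aops (d :: es) h) by move=> x f h; rewrite l0 scalerDr !scalerA mulrC.
have b0 : bdd m (Aops (d :: es)) by move=> h; exact: bdd_Aop.
have := cokernel_trace (fd_nil fd) lU lV DE tri (O0 := Aops (d :: es)) (O1 := fun h => Q *: Aops (d :: es) h)
  (L := m) (H := ((bmel (d :: es)).[s])%:M) l0 l1.
rewrite mxtrace_scalar mulr1n ptrZ => E; rewrite mulrBl mul1r {1}E //; first by rewrite addrK.
- by move=> h; rewrite {1}sE Aops_Dop // (linZ _ _ (linDop _ _ _ _)).
- by move=> h; apply: leq_trans (size_scale_leq _ _) (b0 h).
move=> i; rewrite ord1 big_ord1 mxE eqxx mulr1n expr0 alg_polyC.
have [q hq] := rhoP fd s (Aops (d :: es) 1); exists q.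
by rewrite {1}hq rho_Aops // (rho1 fd) mulr1.
Qed.

Variable y : S.
(** [cfib i], defined next, is the parameter over the i-th Frobenius conjugate of y; rescaling n+1
    variables by ga costs ga^(n+1). The scalar [g] is what [alpha_Xi] loses at each step (see
    [cfib_p]). *)
Local Notation g := (ga ^+ (p.-1 * n.+1)).
Definition cfib i : S := ga ^+ n.+1 * y ^+ (p ^ i).

Fixpoint dwt es : S := if es is d :: es' then cfib (size es') ^+ d * dwt es' else 1.

Definition subst_op es h : {poly S} :=
  bmel es ^+ n.+1 * (h \Po ((p ^ size es)%:R *: 'X + (dval p es)%:R%:P)).

Fixpoint alphas k h : {poly S} := if k is k'.+1 then alpha (cfib k') (alphas k' h) else h.

Definition betas k h : {poly S} := iter k (fun h => g *: beta h) h.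

Lemma cfib_p i : cfib i ^+ p = g * cfib i.+1.
Proof.
rewrite /cfib exprMn -!exprM mulrA -exprD expnSr; congr (ga ^+ _ * _).
by rewrite -[in LHS](prednK (ltnW p_gt1)) mulnS mulnC addnC.
Qed.

Lemma subst_opS d es h :
  amel d ^+ n.+1 * (subst_op es h \Po (p%:R * 'X + d%:R)) = subst_op (d :: es) h.
Proof.
rewrite /subst_op /= comp_polyM rmorphXn /= -comp_polyA mulrA -exprMn; congr (_ * (h \Po _)).
  by congr ((_ * (_ \Po _)) ^+ _); rewrite -mul_polyC !polyC_natr.
rewrite comp_polyD comp_polyZ comp_polyX comp_polyC expnS !natrD !natrM -!mul_polyC !polyC_natr.
by rewrite !polyCD !polyCM !polyC_natr; ring.
Qed.

Lemma alphasE k h : alphas k h = \sum_(es <- digs p k) dwt es *: subst_op es h.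
Proof.
elim: k h => [|k IH] h /=.
  by rewrite big_seq1 scale1r /subst_op /= expr1n mul1r scale1r addr0 comp_polyXr.
rewrite IH big_digsS /alpha; apply: eq_bigr => d _.
rewrite -[_ \Po _]/(comp_poly _ _) rmorph_sum mulr_sumr scaler_sumr big_seq [RHS]big_seq; apply: eq_bigr => es.
rewrite mem_digs => /andP[/eqP sz _].
by rewrite /= comp_polyZ -scalerAr scalerA subst_opS sz.
Qed.

Lemma betasE k h : betas k h = g ^+ k *: subst_op (nseq k p.-1) h.
Proof.
elim: k => [|k IH]; first by rewrite /betas /= scale1r /subst_op /= expr1n mul1r scale1r addr0 comp_polyXr.
rewrite /betas iterS -/(betas k h) IH (linZ _ _ (lin_beta _ _ _ _ _ _ _)) scalerA -exprS; congr (_ *: _).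
exact: subst_opS.
Qed.

Lemma dwt_max k : dwt (nseq k p.-1) = g ^+ k * y ^+ (p ^ k).-1.
Proof.
elim: k => [|k IH]; first by rewrite /= mulr1.
rewrite /= IH size_nseq /cfib exprMn -!exprM mulrACA -!exprD; congr (ga ^+ _ * y ^+ _).
  by rewrite [(p.-1 * n.+1)%N]mulnC mulnS.
have w0 : (0 < p ^ k)%N by rewrite expn_gt0 ltnW.
have -> : (p ^ k.+1 = p ^ k * p.-1 + p ^ k)%N.
  by rewrite addnC -mulnS prednK ?expnSr // ltnW.
by case: (p ^ k)%N w0 => // w _; rewrite addnS.
Qed.

Lemma lin_alphas k : lin (alphas k).
Proof. by elim: k => [//|k IH] a f h /=; rewrite IH lin_alpha. Qed.

Lemma alphas_Xi k h : alphas k (Xi (cfib 0) h) = Xi (cfib k) (betas k h).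
Proof.
elim: k => [//|k IH] /=; rewrite IH; exact: (alpha_Xi p_gt1 mJ fd _ (cfib_p k)).
Qed.

Variable Hf : nat -> 'M[S]_n.+1.
Hypothesis HfP : forall k (i : 'I_n.+1), exists q,
  alpha (cfib k) 'X^i = \sum_j Hf k j i *: 'X^j + Xi (cfib k.+1) q.

Fixpoint Hprod k : 'M[S]_n.+1 := if k is k'.+1 then Hf k' *m Hprod k' else 1%:M.

Lemma alphas_matrix k (i : 'I_n.+1) : exists q,
  alphas k 'X^i = \sum_j Hprod k j i *: 'X^j + Xi (cfib k) q.
Proof.
elim: k i => [|k IH] i /=.
  exists 0; rewrite (lin0 (lin_Xi _ _ _ _ _)) addr0 (bigD1 i) //= big1 => [|j ji].
    by rewrite mxE eqxx scale1r addr0.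
  by rewrite mxE (negPf ji) scale0r.
have [q ->] := IH i; have [Q hQ] := choice (HfP k).
exists (\sum_j Hprod k j i *: Q j + g *: beta q).
have E : alpha (cfib k) (\sum_j Hprod k j i *: 'X^j) =
    \sum_j (Hf k *m Hprod k) j i *: 'X^j + Xi (cfib k.+1) (\sum_j Hprod k j i *: Q j).
  rewrite (lin_sum _ _ _ (lin_alpha _ _ _ _ _ _ _ _)) (lin_sum _ _ _ (lin_Xi _ _ _ _ _)).
  under eq_bigr => j _ do rewrite (linZ _ _ (lin_alpha _ _ _ _ _ _ _ _)) hQ scalerDr -(linZ _ _ (lin_Xi _ _ _ _ _)).
  rewrite big_split /=; congr (_ + _).
  under eq_bigr => j _ do rewrite scaler_sumr.
  rewrite exchange_big; apply: eq_bigr => l _; rewrite mxE scaler_suml.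
  by apply: eq_bigr => j _; rewrite scalerA mulrC.
rewrite (linD _ _ (lin_alpha _ _ _ _ _ _ _ _)) (alpha_Xi p_gt1 mJ fd _ (cfib_p k)) E.
by rewrite [in RHS](linD _ _ (lin_Xi _ _ _ _ _)) [RHS]addrA.
Qed.

(* The kernel and the cokernel of [Xi] contribute the two traces; the last digit *)
(* sequence cancels the contribution of the kernel.                              *)
Lemma frob_trace k : (0 < k)%N -> y ^+ (p ^ k).-1 = 1 ->
  \tr (Hprod k) = (1 - (p ^ k)%:R) ^+ n *
    \sum_(es <- digs p k | es != nseq k p.-1) dwt es * ptr m (Aops es) ^+ n.+1.
Proof.
move=> k0 y1; have ck : cfib k = cfib 0.
  have e1 : y ^+ (p ^ k) = y.
    by rewrite -(@prednK (p ^ k)) ?expn_gt0 ?(ltnW p_gt1) // exprS y1 mulr1.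
  by rewrite /cfib e1 expn0 expr1.
have [p' pE] := fd_p fd.
have QE : exists a', (p ^ k)%:R = ga * a'.
  by exists (p' * (p ^ k.-1)%:R); rewrite mulrA -pE -natrM -expnS prednK.
pose L := (m + \sum_(es <- digs p k) size (bmel es ^+ n.+1))%N.
have bL es : es \in digs p k -> bdd L (subst_op es).
  move=> hes h; rewrite /subst_op; apply: leq_trans (size_polyMleq _ _) _.
  move: (hes); rewrite mem_digs => /andP[/eqP -> _].
  have h1 := size_comp_nil h (dval p es)%:R QE.
  have h2 : (size (bmel es ^+ n.+1) <= \sum_(es <- digs p k) size (bmel es ^+ n.+1))%N.
    by rewrite (big_rem _ hes) /= leq_addr.
  by apply: leq_trans (leq_pred _) _; rewrite addnC leq_add.
have max_in : nseq k p.-1 \in digs p k.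
  rewrite mem_digs size_nseq eqxx all_nseq; apply/orP; right.
  by rewrite -(ltn_predK p_gt1) /=.
have lb : lin (betas k).
  by elim: (k) => [//|k' IH] a f h; rewrite /betas !iterS -!/(betas k' _) IH lin_beta scalerDr !scalerA mulrC.
have bA : bdd L (alphas k).
  move=> h; rewrite alphasE big_seq; apply: leq_trans (size_sum _ _ _) _; apply/bigmax_leqP_seq => es hes _.
  by apply: leq_trans (size_scale_leq _ _) _; apply: bL.
have bB : bdd L (betas k).
  by move=> h; rewrite betasE; apply: leq_trans (size_scale_leq _ _) _; apply: bL.
have [U [V [lU lV DE tri]]] := cokernel_Xi (cfib 0).
have aX h : alphas k (Xi (cfib 0) h) = Xi (cfib 0) (betas k h) by rewrite alphas_Xi ck.
have aM (i : 'I_n.+1) : exists q, alphas k 'X^i = \sum_j Hprod k j i *: 'X^j + Xi (cfib 0) q.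
  by rewrite -ck; exact: alphas_matrix.
have := cokernel_trace (fd_nil fd) lU lV DE tri (lin_alphas k) lb aX bA bB aM.
have -> : ptr L (betas k) = ptr L (fun h => dwt (nseq k p.-1) *: subst_op (nseq k p.-1) h).
  by apply: eq_ptr => h; rewrite betasE dwt_max y1 mulr1.
rewrite (eq_ptr L (alphasE k)) ptr_sum (bigD1_seq _ max_in (uniq_digs p k)) /= addrC => /addIr <-.
rewrite mulr_sumr big_seq_cond [RHS]big_seq_cond; apply: eq_bigr => es /andP[hes _].
rewrite ptrZ mulrCA; congr (_ * _).
move: (hes); rewrite mem_digs => /andP[/eqP sz ep].
have [iv hiv] : exists iv : S, (1 - (p ^ k)%:R) * iv = 1.
  have [a' aE] := QE; exists (\sum_(i < m) (p ^ k)%:R ^+ i).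
  have xm : ((p ^ k)%:R : S) ^+ m = 0 by rewrite aE exprMn (fd_nil fd) mul0r.
  have := subrXX 1 ((p ^ k)%:R : S) m; rewrite expr1n xm subr0 => E; rewrite [RHS]E; congr (_ * _).
  by apply: eq_bigr => i _; rewrite expr1n mul1r.
(* The fixed point is common to [subst_op es] and [Aops es]. Their traces, multiplied by 1 - p^k,
   are bmel(s)^(n+1) and bmel(s), which leaves the factor (1 - p^k)^n. *)
pose s := iv * (dval p es)%:R.
have sE : s = (p ^ k)%:R * s + (dval p es)%:R.
  have : (1 - (p ^ k)%:R) * s = (dval p es)%:R by rewrite /s mulrA hiv mul1r.
  by move=> <-; ring.
have h1 := @trace_subst _ _ _ (bmel es ^+ n.+1) L QE sE.
have h2 : (1 - (p ^ k)%:R) * ptr m (Aops es) = (bmel es).[s].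
  move: (s) sE => s1 sE1; case: es {h1 s} hes sz ep sE1 => [|d es] hes sz ep sE1; first by move: sz k0 => <-.
  by rewrite -sz; apply: trace_Aops; rewrite ?sz.
have e1 : (1 - (p ^ k)%:R) * ptr L (subst_op es) = (bmel es ^+ n.+1).[s].
  by move: (bL es hes) h1; rewrite /subst_op sz => b /(_ b).
have cancel (a b : S) : (1 - (p ^ k)%:R) * a = (1 - (p ^ k)%:R) * b -> a = b.
  by move=> ab; rewrite -[a]mul1r -[b]mul1r -hiv -!mulrA ![_ * (iv * _)]mulrCA ab.
by apply: cancel; rewrite e1 horner_exp -h2 exprMn exprS -mulrA.
Qed.

End FrobeniusTrace.

(** * The Artin-Hasse exponential *)

Lemma logn_fact_lt p n : prime p -> (0 < n)%N -> (p.-1 * logn p n`! < n)%N.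
Proof.
move=> p_pr n0; rewrite logn_fact //.
have p0 := prime_gt0 p_pr.
(* The maximum with 1 keeps the final inequality strict. *)
suff H m : (p.-1 * (\sum_(1 <= k < m.+1) n %/ p ^ k) + maxn 1 (n %/ p ^ m) <= n)%N.
  by apply: leq_trans (H n); rewrite -addn1 leq_add2l leq_maxl.
elim: m => [|m IH]; first by rewrite big_geq // muln0 add0n divn1 geq_max n0 leqnn.
rewrite big_nat_recr //= mulnDr; apply: leq_trans IH; rewrite -addnA leq_add2l.
have le1 : (p * (n %/ p ^ m.+1) <= n %/ p ^ m)%N.
  by rewrite mulnC expnSr divnMA leq_divM.
have pE : p = p.-1.+1 by rewrite prednK.
by move: le1; rewrite {1}pE mulSn; move: (n %/ p ^ m.+1)%N (n %/ p ^ m)%N => w v; case: w => [|w]; lia.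
Qed.

Section ArtinHasse.
Variables (p : nat) (p_pr : prime p) (K : padic_closure p).
Implicit Types (x y z : Qpbar K) (r s : rat).
Local Notation u := (unit_val p).

(** Zp as the closure of the natural numbers. Unlike mere integrality in [Qpbar], it implies x^p = x
    modulo p. *)
Definition in_Zp x := forall N : nat, exists z : nat, vge N%:R (x - z%:R).

Lemma in_Zp_nat (k : nat) : in_Zp k%:R.
Proof. by move=> N; exists k; rewrite subrr vge0. Qed.

Lemma in_Zp_vge x : in_Zp x -> vge 0 x.
Proof. by move=> /(_ 0%N)[z h]; rewrite -[x](subrK z%:R); apply: vgeD => //; exact: vge_nat. Qed.

Lemma in_ZpD x y : in_Zp x -> in_Zp y -> in_Zp (x + y).
Proof.
move=> hx hy N; have [a ha] := hx N; have [b hb] := hy N; exists (a + b)%N.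
by rewrite natrD opprD addrACA; exact: vgeD.
Qed.

Lemma in_Zp_sum (I : Type) (t : seq I) (P : pred I) (F : I -> Qpbar K) :
  (forall i, P i -> in_Zp (F i)) -> in_Zp (\sum_(i <- t | P i) F i).
Proof. by move=> h; elim/big_ind: _ => //; [exact: (in_Zp_nat 0) | exact: in_ZpD]. Qed.

Lemma vge_nat_dvd (N z : nat) : vge N%:R (z%:R : Qpbar K) -> (p ^ N %| z)%N.
Proof.
case: z => [|z] h; first exact: dvdn0.
by rewrite pfactor_dvdn //; move: h; rewrite (vgeE _ (ordp_nat p_pr K _)) // ler_nat.
Qed.

Lemma in_Zp_div (a : nat) x : (0 < a)%N -> vge 0 x -> in_Zp (a%:R * x) -> in_Zp x.
Proof.
move=> a0 x0; have [a' copa aE] := pfactor_coprime p_pr a0.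
rewrite {}aE in a0 *; move: (logn p a) a0 => k a0.
elim: k a0 => [|k IH] a0 h; last first.
  apply: IH => [|N]; first by move: a0; rewrite expnSr mulnA muln_gt0 => /andP[].
  have [z hz] := h N.+1.
  have : vge 1 (z%:R : Qpbar K).
    rewrite -[z%:R](subKr ((a' * p ^ k.+1)%:R * x)); apply: vgeB.
      rewrite expnSr mulnA natrM -mulrA mulrCA -[1]addr0; apply: vgeM; first by rewrite (vgeE _ (ordp_p K)).
      by apply: vgeMl => //; exact: vge_nat.
    by apply: vgeW hz; rewrite ler1n.
  move=> /(@vge_nat_dvd 1); rewrite expn1 => /dvdnP[z' ez]; exists z'.
  have pE : ordp (p%:R : Qpbar K) = 1%:E%E by exact: ordp_p.
  have -> : N%:R = N.+1%:R - 1 :> rat by rewrite -addn1 natrD addrK.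
  apply: vge_cancel pE _; move: hz; rewrite ez expnSr mulnA !natrM; apply: etrans; congr vge; ring.
move: a0 h; rewrite expn0 muln1 => a0 h N; have [z hz] := h N.
have cop : coprime a' (p ^ N) by rewrite coprime_sym coprimeXl.
have [b c e1 _] := egcdnP (p ^ N) a0.
rewrite (eqP (cop : gcdn a' (p ^ N) == 1)%N) in e1.
exists (b * z)%N.
have -> : x - (b * z)%:R = b%:R * (a'%:R * x - z%:R) - (c * p ^ N)%:R * x.
  have : (b * a')%:R = (c * p ^ N + 1)%:R :> Qpbar K by rewrite e1.
  by rewrite natrM natrD => e2; rewrite mulrBr mulrA e2 natrM; ring.
apply: vgeB; first by apply: vgeMl => //; exact: vge_nat.
by rewrite natrM; apply: vgeMr => //; apply: vgeMl; [exact: vge_nat | exact: vge_pexp].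
Qed.

Lemma in_Zp_fermat x : in_Zp x -> vge 1 (x ^+ p - x).
Proof.
move=> hx; have x0 := in_Zp_vge hx; have [z hz] := hx 1%N.
have h1 : vge 1 (x ^+ p - z%:R ^+ p) by apply: vge_subX => //; exact: vge_nat.
have h2 : vge 1 (z%:R ^+ p - z%:R : Qpbar K).
  have zp : (z <= z ^ p)%N.
    by case: (z) => // z'; rewrite -{1}[z'.+1]expn1 leq_pexp2l // prime_gt0.
  have /eqP := fermat_little z p_pr; rewrite eqn_mod_dvd // => /dvdnP[q eq'].
  rewrite -natrX -natrB // eq' natrM; apply: vgeMl; first exact: vge_nat.
  by rewrite (vgeE _ (ordp_p K)).
by apply: vge_trans h1 _; apply: vge_trans h2 _; rewrite vgeBC.
Qed.

Definition p_power (m : nat) : bool := (m == p ^ logn p m)%N.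

Lemma p_powerX j : p_power (p ^ j).
Proof. by rewrite /p_power pfactorK. Qed.

Lemma sum_p_power (V : nmodType) a (g : nat -> V) :
  \sum_(i < a | p_power i.+1) g i.+1 = \sum_(j < a.+1 | (p ^ j <= a)%N) g (p ^ j)%N.
Proof.
have p1 := prime_gt1 p_pr.
rewrite -(big_mkord (fun i => p_power i.+1) (fun i => g i.+1)) -(big_mkord (fun j => p ^ j <= a)%N (fun j => g (p ^ j)%N)).
rewrite -(big_add1 _ _ 0 a.+1 p_power g) -big_filter -[RHS]big_filter -[RHS](big_map (fun j => p ^ j)%N xpredT g).
apply: perm_big; apply: uniq_perm; first by apply: filter_uniq; exact: iota_uniq.
  by rewrite map_inj_uniq ?filter_uniq ?iota_uniq // => i j; exact: expnI.
move=> x; rewrite mem_filter mem_index_iota; apply/idP/mapP => [/andP[/eqP px /andP[x0 xa]]|[j]].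
  exists (logn p x) => //; rewrite mem_filter mem_index_iota -px -ltnS xa /=.
  by apply: leq_trans xa; rewrite ltnS ltnW // ltn_logl.
by rewrite mem_filter mem_index_iota => /andP[pa _] ->; rewrite p_powerX expn_gt0 ltnS pa (ltnW p1).
Qed.

Definition stretch (g : nat -> Qpbar K) N : Qpbar K := if (p %| N)%N then g (N %/ p)%N else 0.
Definition exp_mono (c : Qpbar K) N : Qpbar K := c ^+ N / N`!%:R.
Definition convpow (g : nat -> Qpbar K) k : nat -> Qpbar K := iter k (conv g) (one_series _).

Lemma is_exp_mono c : is_exp (fun m => if m == 1%N then c else 0) (exp_mono c).
Proof.
split=> [|[|N]]; first by rewrite /exp_mono expr0 fact0 divr1.
  by rewrite mul0r big_ord0.
rewrite big_ord_recl big1 => [|i _]; last by rewrite mul0r.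
rewrite eqxx addr0 subn1 /exp_mono factS natrM invfM exprS /=.
have n0 : N.+1%:R != 0 :> Qpbar K by rewrite natr_Qpbar_eq0.
transitivity (N.+1%:R / N.+1%:R * (c * (c ^+ N / N`!%:R))); first by ring.
by rewrite divff // mul1r.
Qed.

Lemma is_exp_convpow l g k : is_exp l g -> is_exp (fun m => k%:R * l m) (convpow g k).
Proof.
move=> lg; elim: k => [|k IH].
  by apply: (eq_is_exp _ (@is_exp0 _)) => m _; rewrite mul0r.
apply: (eq_is_exp _ (is_exp_conv lg IH)) => m _.
by rewrite -addn1 natrD mulrDl mul1r addrC.
Qed.

Lemma is_exp_stretch l g : is_exp l g ->
  is_exp (fun m => if (p %| m)%N then p%:R * l (m %/ p)%N else 0) (stretch g).
Proof.
move=> [g0 hg]; have p0 := prime_gt0 p_pr; split; first by rewrite /stretch dvdn0 div0n.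
have blk (G : nat -> Qpbar K) a : (forall i, ~~ (p %| i.+1)%N -> G i = 0) ->
    \sum_(i < p * a) G i = \sum_(k < a) G (p * k + p.-1)%N.
  move=> G0; elim: a => [|a IH]; first by rewrite muln0 !big_ord0.
  rewrite big_ord_recr /= -IH mulnSr.
  rewrite -!(big_mkord xpredT G) (big_cat_nat (leq0n _) (leq_addr p _)) /=; congr (_ + _).
  have -> : (p * a + p = (p * a + p.-1).+1)%N by lia.
  rewrite big_nat_recr ?leq_addr //= big_nat big1 ?add0r // => i /andP[h1 h2].
  rewrite G0 // -(subnKC h1) -addnS dvdn_addr ?dvdn_mulr //; apply/negP => /dvdn_leq.
  by rewrite ltnS => /(_ isT); lia.
move=> N; rewrite {1}/stretch; case: ifP => [/dvdnP[a ->]|nd]; last first.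
  rewrite mulr0 big1 // => i _; case: ifP => di; last by rewrite mul0r.
  rewrite /stretch; case: ifP => dn; last by rewrite mulr0.
  by have := dvdn_add di dn; rewrite subnKC ?nd.
transitivity (p%:R * (a%:R * g a)); first by rewrite mulnK // natrM; ring.
rewrite hg mulr_sumr [(a * p)%N]mulnC.
rewrite (blk (fun i => (if (p %| i.+1)%N then p%:R * l (i.+1 %/ p)%N else 0) * stretch g (p * a - i.+1)%N)).
  apply: eq_bigr => k _; have e1 : (p * k + p.-1).+1 = (p * k.+1)%N by rewrite mulnS; lia.
  rewrite e1 dvdn_mulr // mulKn // /stretch -mulnBr dvdn_mulr // mulKn // mulrA //.
by move=> i /negPf ->; rewrite mul0r.
Qed.

Lemma convpow_coef g k N M : (N <= M)%N -> convpow g k N = (trunc_series g M ^+ k)`_N.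
Proof.
elim: k N => [|k IH] N NM; first by rewrite expr0 coef1.
rewrite exprS coefM /convpow iterS -/(convpow g k) /conv; apply: eq_bigr => i _.
have iN : (i <= N)%N by rewrite -ltnS.
by rewrite coef_trunc (leq_trans iN NM) IH // (leq_trans (leq_subr _ _)).
Qed.

Definition integral (P : {poly Qpbar K}) := forall i, vge 0 P`_i.

Lemma integralM P Q : integral P -> integral Q -> integral (P * Q).
Proof. by move=> hP hQ i; rewrite coefM; apply: vge_sum => j _; apply: vgeMl. Qed.

Lemma integralX P k : integral P -> integral (P ^+ k).
Proof.
move=> hP; elim: k => [|k IH]; last by rewrite exprS; exact: integralM.
by move=> i; rewrite expr0 coef1; case: (i == 0%N); [exact: vge1 | exact: vge0].
Qed.

Lemma vge_p : vge 1 (p%:R : Qpbar K).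
Proof. by rewrite (vgeE _ (ordp_p K)). Qed.

Lemma frobenius_add P Q N : integral P -> integral Q ->
  vge 1 (((P + Q) ^+ p)`_N - ((P ^+ p)`_N + (Q ^+ p)`_N)).
Proof.
move=> hP hQ; have p0 := prime_gt0 p_pr.
have -> : (P + Q) ^+ p = P ^+ p + (\sum_(i < p.-1) P ^+ (p - i.+1) * Q ^+ i.+1 *+ 'C(p, i.+1) + Q ^+ p).
  rewrite exprDn big_ord_recl subn0 expr0 mulr1 bin0 mulr1n; congr (_ + _).
  under eq_bigr => i _ do rewrite lift0.
  rewrite (big_ord_prev (fun i => P ^+ (p - i.+1) * Q ^+ i.+1 *+ 'C(p, i.+1)) p0) prednK //.
  by rewrite subnn expr0 mul1r binn mulr1n.
rewrite !coefD [X in vge 1 X](_ : _ = (\sum_(i < p.-1) P ^+ (p - i.+1) * Q ^+ i.+1 *+ 'C(p, i.+1))`_N); last by ring.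
rewrite coef_sum; apply: vge_sum => i _; rewrite coefMn -mulr_natl.
have ip : (0 < i.+1 < p)%N by have := ltn_ord i; have := prime_gt0 p_pr; lia.
have /dvdnP[q ->] := prime_dvd_bin p_pr ip; rewrite natrM -mulrA.
apply: vgeMl; first exact: vge_nat.
by apply: vgeMr; [exact: vge_p | exact/integralM/integralX/hQ/integralX].
Qed.

Lemma frobenius_poly (b : nat -> Qpbar K) n N : (forall i, (i < n)%N -> in_Zp (b i)) ->
  vge 1 (((\poly_(i < n) b i) ^+ p)`_N - stretch (fun i => (\poly_(i < n) b i)`_i) N).
Proof.
have p0 := prime_gt0 p_pr.
elim: n N => [|n IH] N hb.
  rewrite poly_def big_ord0 expr0n gtn_eqF // coef0 /stretch coef0 if_same subrr; exact: vge0.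
have hi k : (k <= n.+1)%N -> integral (\poly_(i < k) b i).
  move=> kn i; rewrite coef_poly; case: ifP => ik; last exact: vge0.
  by apply: in_Zp_vge; apply: hb; exact: leq_trans kn.
have eP : \poly_(i < n.+1) b i = \poly_(i < n) b i + b n *: 'X^n.
  by rewrite !poly_def big_ord_recr.
have hm : integral (b n *: 'X^n).
  move=> i; rewrite coefZ coefXn; apply: vgeMl; first exact: in_Zp_vge (hb _ _).
  by case: (_ == _); [exact: vge1 | exact: vge0].
have h1 := frobenius_add N (hi n (leqnSn n)) hm.
have h2 := IH N (fun i lt => hb i (ltnW lt)).
rewrite eP; apply: vge_trans h1 _.
have -> : stretch (fun i => (\poly_(i < n) b i + b n *: 'X^n)`_i) N =
   stretch (fun i => (\poly_(i < n) b i)`_i) N + (if (N == n * p)%N then b n else 0).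
  rewrite /stretch; case: ifP => [/dvdnP[q ->]|nd]; last first.
    rewrite add0r; case: eqP => // e1; by rewrite e1 dvdn_mull in nd.
  rewrite mulnK // coefD coefZ coefXn eqn_pmul2r //; congr (_ + _).
  by case: (_ == _); rewrite ?mulr1 ?mulr0.
rewrite opprD addrACA; apply: vgeD => //.
rewrite exprZn -exprM coefZ coefXn mulnC; case: (_ == _); last by rewrite mulr0 subrr; exact: vge0.
by rewrite mulr1; apply: in_Zp_fermat; exact: hb.
Qed.

Lemma ordp_fact (k : nat) : ordp (k`!%:R : Qpbar K) = (logn p k`!)%:R%:E%E.
Proof. by rewrite ordp_nat // fact_gt0. Qed.

Lemma vge_exp_mono c (r : rat) k : (0 < k)%N -> vge r c -> vge (r + k.-1%:R * (r - u)) (exp_mono c k).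
Proof.
move=> k0 hc; rewrite /exp_mono.
have -> : r + k.-1%:R * (r - u) = k%:R * r + - (k.-1%:R * u).
  by rewrite -{2}(prednK k0) -addn1 natrD; ring.
apply: vgeM; first exact: vgeX.
rewrite (vgeE _ (ordpV (ordp_fact k))) lerN2.
have := logn_fact_lt p_pr k0; rewrite -{2}(prednK k0) ltnS => le1.
have u0 := unit_val_gt0 p_pr.
have : (p.-1 * logn p k`!)%:R * u <= k.-1%:R * u by rewrite ler_wpM2r ?ler_nat ?(ltW u0).
by rewrite natrM mulrAC unit_valK // mul1r.
Qed.

Variable e : nat -> Qpbar K.
Hypothesis e_exp : is_exp (fun m => (p_power m)%:R) e.

Lemma ah_rec a : a%:R * e a = \sum_(j < a.+1 | (p ^ j <= a)%N) e (a - p ^ j)%N.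
Proof.
rewrite e_exp.2 -(sum_p_power a (fun m => e (a - m)%N)) [RHS]big_mkcond; apply: eq_bigr => i _.
by case: (p_power _); rewrite ?mul1r ?mul0r.
Qed.

(** Dwork's argument: compare E(T)^p = E(T^p) exp(p T) modulo p in degree a+1, the earlier
    coefficients being in Zp. Then p e(a+1) is divisible by p, so e(a+1) is integral; it is in Zp
    because (a+1) e(a+1) is a sum of earlier coefficients. *)
Lemma ah_in_Zp a : in_Zp (e a).
Proof.
have p0 := prime_gt0 p_pr; have p1 := prime_gt1 p_pr.
have F0 := @natr_Qpbar_eq0 p p_pr K.
have key : convpow e p =1 conv (stretch e) (exp_mono p%:R).
  apply: (is_exp_uniq F0 (is_exp_convpow p e_exp)).
  apply: (eq_is_exp _ (is_exp_conv (is_exp_stretch e_exp) (is_exp_mono p%:R))) => m m0.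
  case: ifP => [/dvdnP[q eq']|nd].
    have q0 : (0 < q)%N by move: m0; rewrite eq'; case: (q).
    have m1 : (m == 1%N) = false by rewrite eq'; apply/eqP; nia.
    have lp1 := pfactorK 1 p_pr; rewrite expn1 in lp1.
    rewrite m1 addr0 eq' mulnK // /p_power lognM // lp1 addn1 expnSr.
    by rewrite eqn_pmul2r.
  rewrite add0r; case: eqP => [->|m1]; first by rewrite /p_power logn1 mulr1.
  rewrite /p_power; case: eqP => [E|]; last by rewrite mulr0.
  case: (logn p m) E => [|k] E; first by rewrite E in m1.
  by rewrite E expnS dvdn_mulr in nd.
elim/ltn_ind: a => -[|a] IH; first by rewrite e_exp.1; exact: (in_Zp_nat 1).
have rec_in : in_Zp (a.+1%:R * e a.+1).
  rewrite ah_rec; apply: in_Zp_sum => j pj; apply: IH.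
  by rewrite ltn_subrL expn_gt0 p0.
apply: (in_Zp_div (ltn0Sn a) _ rec_in).
have pE : ordp (p%:R : Qpbar K) = 1%:E%E by exact: ordp_p.
rewrite -(subrr 1); apply: vge_cancel pE _.
pose A := \poly_(i < a.+1) e i.
have eA : (trunc_series e a.+1 ^+ p)`_a.+1 = (A ^+ p)`_a.+1 + p%:R * e a.+1.
  have -> : trunc_series e a.+1 = A + e a.+1 *: 'X^(a.+1).
    by rewrite /trunc_series /A !poly_def big_ord_recr.
  suff gen q : (1 < q)%N -> ((A + e a.+1 *: 'X^(a.+1)) ^+ q)`_a.+1 = (A ^+ q)`_a.+1 + q%:R * e a.+1.
    exact: gen.
  case: q => [|[|q]] // _; rewrite exprDn big_ord_recl big_ord_recl !coefD coef_sum [X in _ + (_ + X)]big1 => [|i _].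
    rewrite /= addr0 bin0 subn0 expr0 mulr1 mulr1n bin1 expr1 coefMn mulr_natl; congr (_ + _ *+ _).
    by rewrite -scalerAr coefZ coefMXn ltnn subnn /= -horner_coef0 horner_exp horner_coef0 coef_poly /= e_exp.1 expr1n mulr1.
  rewrite exprZn -exprM coefMn -scalerAr coefZ coefMXn !lift0.
  have -> : (a.+1 < a.+1 * i.+2)%N by rewrite ltn_Pmulr.
  by rewrite mulr0 mul0rn.
have -> : p%:R * e a.+1 = conv (stretch e) (exp_mono p%:R) a.+1 - (A ^+ p)`_a.+1.
  by rewrite -key (convpow_coef e p (leqnn _)) eA; ring.
rewrite convC /conv big_ord_recl subn0 /= {1}/exp_mono expr0 fact0 divr1 mul1r addrAC; apply: vgeD.
  rewrite vgeBC; have := @frobenius_poly e a.+1 a.+1 (fun i => @IH i).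
  have -> : stretch (fun i => (\poly_(i < a.+1) e i)`_i) a.+1 = stretch e a.+1.
    rewrite /stretch; case: ifP => // /dvdnP[q eq']; rewrite eq' mulnK // coef_poly.
    by rewrite (_ : (q < q * p)%N) //; case: (q) eq' => // q' _; rewrite ltn_Pmulr.
  by [].
apply: vge_sum => i _; rewrite -[bump 0 i]/i.+1; apply: vgeMr.
  apply: vgeW (vge_exp_mono (ltn0Sn i) vge_p); rewrite lerDl mulr_ge0 // subr_ge0.
  exact: unit_val_le1.
rewrite /stretch; case: ifP => [dv|_]; last exact: vge0.
apply: in_Zp_vge; apply: IH; apply: leq_ltn_trans (leq_div _ _) _.
by rewrite subSS ltnS leq_subr.
Qed.

End ArtinHasse.

(** * Dwork's splitting function *)

Section Splitting.
Variables (p : nat) (p_pr : prime p) (K : padic_closure p).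
Variable pi : Qpbar K.
Hypothesis pi_root : \sum_(i < p) (1 + pi) ^+ i = 0.
Implicit Types (x y z : Qpbar K) (r s : rat).
Local Notation u := (unit_val p).
Local Notation inE_ := (inE_ pi).

Let p0 : (0 < p)%N := prime_gt0 p_pr.
Let p1 : (1 < p)%N := prime_gt1 p_pr.
Let u0 : 0 < u := unit_val_gt0 p_pr.

Lemma p_natr_neq0 : p%:R != 0 :> Qpbar K.
Proof. by rewrite natr_Qpbar_eq0 // -lt0n. Qed.

Lemma pred_natr : p%:R = (p.-1)%:R + 1 :> rat.
Proof. by rewrite -[p in LHS](prednK p0) -addn1 natrD. Qed.

Lemma pu : p%:R * u = 1 + u.
Proof. by rewrite pred_natr mulrDl unit_valK // mul1r. Qed.

(** The gain is 2 and not 1: besides the factor p, the p-1 factors y of the linear term are worth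
    (p-1) u = 1. The term (x-y)^p gains as much because r >= 2 u. *)
Lemma vge_pth_sub x y r : vge u x -> vge u y -> 2 * u <= r -> vge r (x - y) ->
  vge (r + 2) (x ^+ p - y ^+ p).
Proof.
move=> ux uy ru h; have r0 : 0 <= r by apply: le_trans ru; rewrite mulr_ge0 // ltW.
have -> : x ^+ p - y ^+ p = \sum_(i < p) 'C(p, i.+1)%:R * (y ^+ (p - i.+1) * (x - y) ^+ i.+1).
  have -> : x ^+ p = (y + (x - y)) ^+ p by congr (_ ^+ _); ring.
  rewrite exprDn big_ord_recl subn0 expr0 mulr1 bin0 mulr1n addrAC subrr add0r.
  by apply: eq_bigr => i _; rewrite lift0 mulr_natl.
apply: vge_sum => i _; have iu : vge ((p - i.+1)%:R * u + i.+1%:R * r) (y ^+ (p - i.+1) * (x - y) ^+ i.+1).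
  by apply: vgeM; exact: vgeX.
have i1 : i.+1%:R = i%:R + 1 :> rat by rewrite -addn1 natrD.
have i0 : 0 <= i%:R :> rat by [].
have hu := unit_valK p_pr; have hp := pred_natr.
have [lt|ge] := ltnP i.+1 p.
  have /dvdnP[q ->] := prime_dvd_bin p_pr (lt : 0 < i.+1 < p)%N.
  rewrite natrM; apply: vgeW (_ : _ <= 1 + ((p - i.+1)%:R * u + i.+1%:R * r)) _; last first.
    by apply: vgeM => //; apply: vgeMl; [exact: vge_nat | exact: vge_p].
  rewrite natrB // i1; nra.
apply: vgeMl; first exact: vge_nat.
have e1 : i.+1 = p by apply/eqP; rewrite eqn_leq ge ltn_ord.
have h3 : (p.-1)%:R * (2 * u) <= (p.-1)%:R * r by rewrite ler_wpM2l.
apply: vgeW iu; rewrite e1 subnn mul0r add0r hp; nra.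
Qed.

(** The truncated logarithm of the Artin-Hasse exponential. *)
Definition Lam I x := \sum_(i < I) x ^+ (p ^ i) / (p ^ i)%:R.

Lemma ordp_pX i : ordp ((p ^ i)%:R : Qpbar K) = i%:R%:E%E.
Proof. by rewrite natrX (ordpX _ (ordp_p K)) mulr1. Qed.

Lemma vge_pX_sub x y r i : vge u x -> vge u y -> 2 * u <= r -> vge r (x - y) ->
  vge (r + 2 * i%:R) (x ^+ (p ^ i) - y ^+ (p ^ i)).
Proof.
move=> ux uy ru h; elim: i => [|i IH]; first by rewrite mulr0 addr0.
have hX z : vge u z -> vge u (z ^+ (p ^ i)).
  move=> hz; apply: vgeW (vgeX _ hz); rewrite ler_peMl ?(ltW u0) // ler1n expn_gt0 p0 //.
have -> : r + 2 * i.+1%:R = r + 2 * i%:R + 2 by rewrite -[i.+1]addn1 natrD; ring.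
rewrite expnSr !exprM; apply: vge_pth_sub (hX _ ux) (hX _ uy) _ IH.
by apply: le_trans ru _; rewrite lerDl mulr_ge0.
Qed.

Lemma Lam_sub I x y r : (0 < I)%N -> vge u x -> vge u y -> 2 * u <= r -> vge r (x - y) ->
  vge (r + 1) (Lam I x - Lam I y - (x - y)).
Proof.
case: I => // I _ ux uy ru h; rewrite /Lam !big_ord_recl !expn0 !divr1 !expr1.
rewrite [X in vge _ X](_ : _ = \sum_(i < I) (x ^+ (p ^ i.+1) - y ^+ (p ^ i.+1)) / (p ^ i.+1)%:R); last first.
  by under [RHS]eq_bigr do rewrite mulrBl; rewrite sumrB; ring.
apply: vge_sum => i _; have := vgeM (vge_pX_sub i.+1 ux uy ru h) (_ : vge (- i.+1%:R) ((p ^ i.+1)%:R^-1)).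
rewrite (vgeE _ (ordpV (ordp_pX i.+1))) lexx => /(_ isT); apply: vgeW.
have : 1 <= i.+1%:R :> rat by rewrite ler1n.
lra.
Qed.

Lemma pow_incr (i j : nat) : (i <= j)%N -> (p ^ i)%:R * u - i%:R <= (p ^ j)%:R * u - j%:R.
Proof.
move=> /subnK <-; elim: (j - i)%N => [//|k IH]; apply: le_trans IH _.
rewrite addSn expnS natrM -addn1 natrD; have := pu.
have w1 : 1 <= (p ^ (k + i))%:R :> rat by rewrite ler1n expn_gt0 p0.
move: (_ ^ _)%:R w1 => w w1 h; have -> : p%:R * w * u = w * (p%:R * u) by ring.
rewrite h; nra.
Qed.

Lemma vge_Lam_term x i : vge u x -> vge ((p ^ i)%:R * u - i%:R) (x ^+ (p ^ i) / (p ^ i)%:R).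
Proof.
move=> ux; apply: vgeM; first exact: vgeX.
by rewrite (vgeE _ (ordpV (ordp_pX i))).
Qed.

Lemma vge_pi : vge u pi.
Proof. by rewrite (vgeE _ (ordp_pi p_pr pi_root)). Qed.

(** The first two terms are pi (1 + pi^(p-1)/p), where pi^(p-1)/p is -1 up to a multiple of pi; the
    later terms are small by [pow_incr]. *)
Lemma Lam_pi I : (1 < I)%N -> vge (2 * u) (Lam I pi).
Proof.
case: I => [|[|I]] // _; rewrite /Lam !big_ord_recl expn0 divr1 expr1 addrA; apply: vgeD.
  rewrite /bump /= expn1; have -> : pi + pi ^+ p / p%:R = pi * (1 + pi ^+ p.-1 / p%:R).
    have -> : pi ^+ p = pi * pi ^+ p.-1 by rewrite -exprS prednK.
    by ring.
  have -> : 2 * u = u + u by ring.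
  apply: vgeM vge_pi _; rewrite (pi_eq p_pr pi_root).
  rewrite -(big_mkord xpredT (fun i => 'C(p, i.+1)%:R * pi ^+ i)) big_ltn ?p1_gt0 // bin1 expr0 mulr1.
  rewrite mulNr mulrDl divff ?p_natr_neq0 // opprD addrA subrr add0r vgeN mulr_suml big_nat.
  apply: vge_sum => i /andP[i1 ip]; have ip' : (0 < i.+1 < p)%N by lia.
  have /dvdnP[q ->] := prime_dvd_bin p_pr ip'.
  rewrite natrM mulrAC mulfK ?p_natr_neq0 //; apply: vgeMl; first exact: vge_nat.
  by apply: vgeW (vgeX i vge_pi); rewrite ler_peMl ?(ltW u0) // ler1n.
apply: vge_sum => i _; apply: vgeW (vge_Lam_term _ vge_pi); rewrite !lift0.
apply: le_trans (pow_incr (_ : 2 <= i.+2)%N) => //.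
have hu := unit_valK p_pr; rewrite expnS expn1 natrM pred_natr.
have : 1 <= p.-1%:R :> rat by rewrite ler1n p1_gt0.
move: (p.-1%:R) hu => q hu q1; nra.
Qed.

Lemma inE_nat (k : nat) : inE_ k%:R.
Proof. by elim: k => [|k IH]; [exact: inE0 | rewrite -addn1 natrD; apply: inED => //; exact: inE1]. Qed.

(** The iteration x - Lam x, started at pi: by [Lam_sub] the logarithm is the identity to first
    order, and every step gains one unit of valuation. *)
Lemma gamma_exists I (M : nat) : (1 < I)%N ->
  exists ga, [/\ inE_ ga, vge (2 * u) (ga - pi) & vge M%:R (Lam I ga)].
Proof.
move=> I1; have u20 : 0 <= 2 * u by rewrite mulr_ge0 // ltW.
suff [ga [h1 h2 h3]] : exists ga, [/\ inE_ ga, vge (2 * u) (ga - pi) & vge (2 * u + M%:R) (Lam I ga)].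
  by exists ga; split=> //; apply: vgeW h3; rewrite lerDr.
elim: M => [|M [x [xE xpi xL]]].
  exists pi; split; first exact: inE_pi; first by rewrite subrr vge0.
  by rewrite addr0; exact: Lam_pi.
have LE : inE_ (Lam I x).
  apply: inE_bigsum => i _; apply: inEM; first exact: inEX.
  by apply/inEV/inE_nat.
have rM : 2 * u <= 2 * u + M%:R by rewrite lerDl.
have ux : vge u x.
  rewrite -[x](subrK pi); apply: vgeD vge_pi; apply: vgeW xpi; rewrite ler_peMl ?(ltW u0) //.
exists (x - Lam I x); split; first exact: inED xE (inEN LE).
  by rewrite addrAC; apply: vgeB => //; exact: vgeW xL.
have ux' : vge u (x - Lam I x).
  by apply: vgeB => //; apply: vgeW xL; apply: le_trans rM; rewrite ler_peMl ?(ltW u0).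
have xx : x - (x - Lam I x) = Lam I x by ring.
have := @Lam_sub I x (x - Lam I x) _ (ltnW I1) ux ux' rM; rewrite xx => /(_ xL).
rewrite [X in vge _ X](_ : _ = - Lam I (x - Lam I x)); last by ring.
by rewrite vgeN -addrA -[M.+1]addn1 natrD.
Qed.

Section WithGamma.
Variables (ga : Qpbar K) (ga_pi : vge (2 * u) (ga - pi)).

Lemma ordp_ga : ordp ga = u%:E%E.
Proof.
apply: ordp_cong (ordp_pi p_pr pi_root) (_ : u < 2 * u) _; first by rewrite ltr_pMl // ltr1n.
by rewrite vgeBC.
Qed.

Lemma ga_neq0 : ga != 0.
Proof. by apply/eqP => h; have := ordp_ga; rewrite h ordp0. Qed.

Lemma vge_ga : vge u ga.
Proof. by rewrite (vgeE _ ordp_ga). Qed.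

(** As log theta(x) = sum_i (ga x)^(p^i) / p^i, the coefficient of x^(p^j) in the logarithmic
    derivative of prod_k theta(x^(p^k)) is p^j Lam_(j+1)(ga); the division by ga^(p^j) passes to X =
    ga x. *)
Definition eta_ j := (p ^ j)%:R * Lam j.+1 ga / ga ^+ (p ^ j).

Lemma eta_0 : eta_ 0 = 1.
Proof. by rewrite /eta_ /Lam big_ord1 expn0 expr1 divr1 mul1r divff // ga_neq0. Qed.

Lemma eta_rel j w : (p ^ j <= w)%N ->
  p%:R * eta_ j * ga ^+ (p.-1 * (w - p ^ j)) = (eta_ j.+1 - 1) * ga ^+ (p.-1 * w).
Proof.
move=> pw; have gn k : ga ^+ k != 0 by rewrite expf_neq0 // ga_neq0.
have pn : (p ^ j.+1)%:R != 0 :> Qpbar K by rewrite natr_Qpbar_eq0 // -lt0n expn_gt0 p0.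
have -> : eta_ j.+1 - 1 = (p ^ j.+1)%:R * Lam j.+1 ga / ga ^+ (p ^ j.+1).
  rewrite /eta_ /Lam [in LHS]big_ord_recr /= mulrDr mulrDl [X in _ + X - 1](_ : _ = 1) ?addrK //.
  by rewrite mulrCA mulfV // mulr1 mulfV.
rewrite /eta_ expnS natrM -!mulrA; congr (_ * (_ * (_ * _))).
apply: (mulfI (gn (p ^ j)%N)); rewrite mulVKf //.
apply: (mulfI (gn (p ^ j.+1)%N)); rewrite [RHS]mulrCA expnS mulVKf // -!exprD; congr (ga ^+ _).
rewrite mulnBr; have : (p.-1 * p ^ j <= p.-1 * w)%N by rewrite leq_mul2l pw orbT.
have -> : (p * p ^ j = p.-1 * p ^ j + p ^ j)%N by rewrite addnC -mulSn prednK.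
by lia.
Qed.

(** By the choice of ga the sum Lam_I(ga) is negligible, so Lam_(j+1)(ga) is minus the tail of that
    sum, which starts at the index j+1. *)
Lemma eta_small I (M : nat) j : vge M%:R (Lam I ga) -> (p ^ I <= M)%N -> (0 < j)%N -> (j < I)%N ->
  vge u (eta_ j).
Proof.
move=> hL IM j0 jI; have pj0 : ordp (ga ^+ (p ^ j)) = ((p ^ j)%:R * u)%:E%E by exact: ordpX ordp_ga.
have pjw : (p ^ j)%:R * p%:R * u = (p ^ j)%:R * (1 + u) by rewrite -mulrA pu.
have w1 : 1 <= (p ^ j)%:R :> rat by rewrite ler1n expn_gt0 p0.
have hu1 := unit_val_le1 p_pr.
have hLj : vge ((p ^ j.+1)%:R * u - j.+1%:R) (Lam j.+1 ga).
  have -> : Lam j.+1 ga = Lam I ga - \sum_(j.+1 <= i < I) ga ^+ (p ^ i) / (p ^ i)%:R.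
    rewrite /Lam -!(big_mkord xpredT (fun i => ga ^+ (p ^ i) / (p ^ i)%:R)).
    by rewrite (big_cat_nat (leq0n _) jI) /= addrK.
  apply: vgeB.
    apply: vgeW hL; apply: le_trans (_ : (p ^ I)%:R * 1 - 0 <= _); last by rewrite mulr1 subr0 ler_nat.
    apply: lerB => //; apply: ler_pM => //; first exact: ltW.
    by rewrite ler_nat leq_exp2l.
  rewrite big_nat; apply: vge_sum => i /andP[ji iI].
  exact: vgeW (pow_incr ji) (vge_Lam_term _ vge_ga).
have h1 := vgeM (_ : vge j%:R ((p ^ j)%:R : Qpbar K)) hLj.
rewrite /eta_; apply: vgeW (vgeM (h1 (vge_pexp K j)) (_ : vge (- ((p ^ j)%:R * u)) _)); last first.
  by rewrite (vgeE _ (ordpV pj0)).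
have j1 : j.+1%:R = j%:R + 1 :> rat by rewrite -addn1 natrD.
rewrite expnSr natrM pjw j1.
have : 2 <= (p ^ j)%:R :> rat.
  rewrite ler_nat; apply: leq_trans p1 _; rewrite -{1}[p]expn1 leq_exp2l //.
lra.
Qed.

End WithGamma.

(** The value at T = 1 of a truncated series; it is multiplicative up to terms of index at least D
    ([evs_conv]). *)
Definition evs D (g : nat -> Qpbar K) := \sum_(d < D) g d.
Definition sconv (L : seq (nat -> Qpbar K)) := foldr (@conv _) (one_series _) L.

Lemma evs_conv D (g h : nat -> Qpbar K) r : 0 <= r -> (forall d, vge (r * d%:R) (g d)) ->
  (forall d, vge (r * d%:R) (h d)) -> vge (r * D%:R) (evs D (conv g h) - evs D g * evs D h).
Proof.
move=> r0 hg hh; pose P := \poly_(i < D) g i; pose Q := \poly_(i < D) h i.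
have eP f : (\poly_(i < D) (f i : Qpbar K)).[1] = evs D f.
  rewrite horner_poly; by apply: eq_bigr => i _; rewrite expr1n mulr1.
have PQ : evs D g * evs D h = \sum_(N < D + D) (P * Q)`_N.
  rewrite -!eP -hornerM (@horner_coef_wide _ (D + D)).
    by apply: eq_bigr => i _; rewrite expr1n mulr1.
  apply: leq_trans (size_polyMleq _ _) _; apply: leq_trans (leq_pred _) _.
  by apply: leq_add; exact: size_poly.
have eN N : (N < D)%N -> (P * Q)`_N = conv g h N.
  move=> ND; rewrite coefM; apply: eq_bigr => i _; have iN : (i <= N)%N by rewrite -ltnS.
  by rewrite !coef_poly (leq_ltn_trans iN ND) (leq_ltn_trans (leq_subr _ _) ND).
rewrite PQ big_split_ord /= /evs (eq_bigr (fun N : 'I_D => (P * Q)`_N)) => [|N _]; last by rewrite eN.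
rewrite opprD addrA subrr add0r vgeN; apply: vge_sum => i _.
apply: (@vgeW _ _ (r * (D + i)%:R)); first by rewrite ler_wpM2l // ler_nat leq_addr.
rewrite coefM; apply: vge_sum => j _; rewrite !coef_poly.
have jD : (j <= D + i)%N by rewrite -ltnS.
case: ifP => _; last by rewrite mul0r vge0.
case: ifP => _; last by rewrite mulr0 vge0.
by apply: vgeW (vgeM (hg j) (hh (D + i - j)%N)); rewrite -mulrDr -natrD subnKC.
Qed.

Lemma evs_vge D (g : nat -> Qpbar K) : (forall d, vge 0 (g d)) -> vge 0 (evs D g).
Proof. by move=> h; apply: vge_sum. Qed.

Lemma one_series_vge r d : vge (r * d%:R) (one_series (Qpbar K) d).
Proof. by case: d => [|d]; rewrite /one_series ?mulr0 ?vge1 ?vge0. Qed.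

Lemma sconv_vge r (L : seq (nat -> Qpbar K)) :
  (forall g, List.In g L -> forall d, vge (r * d%:R) (g d)) -> forall d, vge (r * d%:R) (sconv L d).
Proof.
elim: L => [|g L IH] h d; first exact: one_series_vge.
have hg := h g (or_introl erefl); have hL := IH (fun g' i => h g' (or_intror i)).
apply: vge_sum => i _; have id : (i <= d)%N by rewrite -ltnS.
by apply: vgeW (vgeM (hg i) (hL (d - i)%N)); rewrite -mulrDr -natrD subnKC.
Qed.

Lemma evs_sconv D r (L : seq (nat -> Qpbar K)) : 0 <= r -> (0 < D)%N ->
  (forall g, List.In g L -> forall d, vge (r * d%:R) (g d)) ->
  vge (r * D%:R) (evs D (sconv L) - \prod_(g <- L) evs D g).
Proof.
move=> r0 D0; elim: L => [|g L IH] h.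
  rewrite big_nil /evs; case: (D) D0 => // D' _; rewrite big_ord_recl big1 ?addr0 ?subrr ?vge0 //.
have hg := h g (or_introl erefl); have hL := (fun g' i => h g' (or_intror i) : forall d, vge (r * d%:R) (g' d)).
rewrite big_cons; apply: vge_trans (evs_conv D r0 hg (sconv_vge hL)) _.
rewrite -mulrBr; apply: vgeMl (IH hL); apply: evs_vge => d.
by apply: vgeW (hg d); rewrite mulr_ge0.
Qed.

Lemma is_exp_sconv (I : Type) (t : seq I) (l g : I -> nat -> Qpbar K) :
  (forall i, is_exp (l i) (g i)) ->
  is_exp (fun m => \sum_(i <- t) l i m) (sconv [seq g i | i <- t]).
Proof.
move=> h; elim: t => [|i t IH].
  by apply: (eq_is_exp _ (@is_exp0 _)) => m _; rewrite big_nil.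
by apply: (eq_is_exp _ (is_exp_conv (h i) IH)) => m _; rewrite big_cons.
Qed.

Lemma is_exp_uniq_upto (l l' g g' : nat -> Qpbar K) D : is_exp l g -> is_exp l' g' ->
  (forall m, (0 < m)%N -> (m < D)%N -> l m = l' m) -> forall d, (d < D)%N -> g d = g' d.
Proof.
move=> [g0 hg] [g0' hg'] e; elim/ltn_ind => -[|d] IH dD; first by rewrite g0 g0'.
have n0 : d.+1%:R != 0 :> Qpbar K by rewrite natr_Qpbar_eq0.
apply: (mulfI n0); rewrite hg hg'; apply: eq_bigr => i _.
rewrite e ?(leq_ltn_trans _ dD) // IH // ?subSS ?ltnS ?leq_subr //.
by apply: leq_ltn_trans dD; rewrite leqW // leq_subr.
Qed.

Lemma stretch_vge r (g : nat -> Qpbar K) : (forall d, vge (r * d%:R) (g d)) ->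
  forall d, vge (r / p%:R * d%:R) (stretch g d).
Proof.
move=> h d; rewrite /stretch; case: ifP => [/dvdnP[q ->]|_]; last exact: vge0.
have pn : p%:R != 0 :> rat by rewrite pnatr_eq0 -lt0n.
by rewrite mulnK // natrM [X in vge X _](_ : _ = r * q%:R) //; field.
Qed.

(** Replacing T by T^p does not change the value at T = 1, except for the truncation. *)
Lemma evs_stretch r (g : nat -> Qpbar K) D : 0 <= r -> (forall d, vge (r * d%:R) (g d)) ->
  vge (r / p%:R * D%:R) (evs D (stretch g) - evs D g).
Proof.
move=> r0 h; have pn : 0 < p%:R :> rat by rewrite ltr0n.
rewrite /evs (_ : \sum_(d < D) stretch g d = \sum_(q < D | (q * p < D)%N) g q); last first.
  rewrite /stretch -big_mkcond /= -(big_mkord (fun d => p %| d)%N (fun d => g (d %/ p)%N)).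
  rewrite -(big_mkord (fun q => q * p < D)%N g) -big_filter -[RHS]big_filter -(big_map (fun d => d %/ p)%N xpredT g).
  apply: perm_big; apply: uniq_perm; last 2 first.
  - by apply: filter_uniq; exact: iota_uniq.
  - move=> q; rewrite mem_filter mem_index_iota; apply/mapP/idP => [[d]|/andP[qD _]].
      rewrite mem_filter mem_index_iota => /andP[/dvdnP[k ->] /andP[_ kD]] ->.
      by rewrite mulnK // kD /= (leq_ltn_trans _ kD) // leq_pmulr.
    by exists (q * p)%N; rewrite ?mulnK // mem_filter mem_index_iota dvdn_mull.
  rewrite map_inj_in_uniq ?filter_uniq ?iota_uniq // => a b.
  rewrite !mem_filter => /andP[da _] /andP[db _] e; by rewrite -(divnK da) e divnK.
rewrite [X in _ - X](bigID (fun q : 'I_D => q * p < D)%N) /= opprD addrA subrr add0r vgeN.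
apply: vge_sum => q; rewrite -leqNgt => Dq; apply: vgeW (h q).
rewrite mulrAC ler_pdivrMr // -mulrA ler_wpM2l // -natrM ler_nat //.
Qed.

Lemma stretch_iter_vge j r (g : nat -> Qpbar K) : (forall d, vge (r * d%:R) (g d)) ->
  forall d, vge (r / (p ^ j)%:R * d%:R) (iter j (@stretch p K) g d).
Proof.
have pn k : (p ^ k)%:R != 0 :> rat by rewrite pnatr_eq0 -lt0n expn_gt0 p0.
move=> h; elim: j => [|j IH] d /=; first by rewrite divr1.
have := stretch_vge IH d; rewrite expnSr natrM; congr vge; have := pn j; have := pn 1%N; rewrite expn1 => h1 h2.
by field; rewrite h1 h2.
Qed.

Lemma evs_stretch_iter j r (g : nat -> Qpbar K) D : 0 <= r -> (forall d, vge (r * d%:R) (g d)) ->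
  vge (r / (p ^ j)%:R * D%:R) (evs D (iter j (@stretch p K) g) - evs D g).
Proof.
move=> r0 h; have pn k : 0 < (p ^ k)%:R :> rat by rewrite ltr0n expn_gt0 p0.
elim: j => [|j IH] /=; first by rewrite subrr vge0.
have rj : 0 <= r / (p ^ j)%:R by rewrite divr_ge0 // ltW.
have eqr : r / (p ^ j)%:R / p%:R = r / (p ^ j.+1)%:R by rewrite expnSr natrM invfM mulrA.
have := evs_stretch D rj (stretch_iter_vge j h); rewrite eqr => h1.
apply: vge_trans h1 _; apply: vgeW IH; rewrite ler_wpM2r // ler_wpM2l //.
by rewrite lef_pV2 ?posrE ?pn // ler_nat leq_exp2l.
Qed.

Lemma is_exp_stretch_iter j c :
  is_exp (fun m => if m == (p ^ j)%N then (p ^ j)%:R * c else 0) (iter j (@stretch p K) (exp_mono c)).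
Proof.
elim: j => [|j IH] /=; first by apply: (eq_is_exp _ (is_exp_mono p_pr c)) => m _; rewrite expn0 mul1r.
apply: (eq_is_exp _ (is_exp_stretch p_pr IH)) => m _.
case: ifP => [/dvdnP[q ->]|nd].
  rewrite mulnK // [(p ^ j.+1)%N]expnSr eqn_pmul2r //; case: eqP => _; last by rewrite mulr0.
  by rewrite natrM; ring.
by case: eqP => // e; rewrite e expnS dvdn_mulr in nd.
Qed.

Lemma exp_mono_vge (c : Qpbar K) (a : rat) : 0 <= a -> vge (u + a) c -> forall d, vge (a * d%:R) (exp_mono c d).
Proof.
move=> a0 hc [|d]; first by rewrite mulr0 /exp_mono expr0 fact0 divr1 vge1.
apply: vgeW (vge_exp_mono p_pr (ltn0Sn d) hc).
have -> : u + a - u = a by ring.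
by rewrite /= -[in leLHS]addn1 natrD; have := ltW u0; lra.
Qed.

Lemma pos_p : 0 < p%:R :> rat.
Proof. by rewrite ltr0n. Qed.

Lemma exp_mono_sum (J : nat) (c : nat -> Qpbar K) D : (0 < D)%N ->
  (forall j, (j < J)%N -> vge (u + 1 / p%:R) (c j)) ->
  vge (1 / p%:R * D%:R) (\prod_(j < J) evs D (exp_mono (c j)) - evs D (exp_mono (\sum_(j < J) c j))).
Proof.
move=> D0 hc; have r0 : 0 <= 1 / p%:R :> rat by rewrite divr_ge0 // ltW.
have hu : 0 <= u + 1 / p%:R by rewrite addr_ge0 // ltW.
elim: J hc => [|J IH] hc.
  rewrite !big_ord0 /evs; case: (D) D0 => // D' _; rewrite big_ord_recl big1 => [|i _].
    by rewrite /exp_mono expr0 fact0 divr1 addr0 subrr vge0.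
  by rewrite /exp_mono expr0n mul0r.
rewrite !big_ord_recr /=; have h1 := IH (fun j lt => hc j (ltnW lt)).
set S := \sum_(j < J) c j in h1 *.
have hS : vge (u + 1 / p%:R) S by apply: vge_sum => j _; apply: hc; rewrite ltnW // ltnS.
have hcJ := hc J (ltnSn J).
have e1 : exp_mono (S + c J) =1 conv (exp_mono S) (exp_mono (c J)).
  apply: (is_exp_uniq (natr_Qpbar_eq0 p_pr K) (is_exp_mono p_pr (S + c J))).
  apply: (eq_is_exp _ (is_exp_conv (is_exp_mono p_pr S) (is_exp_mono p_pr (c J)))) => m _.
  by case: eqP => _; rewrite ?addr0.
rewrite [X in _ - X](_ : _ = evs D (conv (exp_mono S) (exp_mono (c J)))); last by apply: eq_bigr.
apply: vge_trans (_ : vge _ (evs D (exp_mono S) * evs D (exp_mono (c J)) - _)).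
  rewrite -mulrBl; apply: vgeMr h1 _; apply: evs_vge => d.
  by apply: vgeW (exp_mono_vge r0 hcJ d); rewrite mulr_ge0.
rewrite vgeBC; apply: evs_conv => //; exact: exp_mono_vge.
Qed.

Lemma evs_exp_mono_small c (M : rat) D : (0 < D)%N -> u <= M -> vge M c -> vge M (evs D (exp_mono c) - 1).
Proof.
move=> D0 uM hc; rewrite /evs; case: (D) D0 => // D' _; rewrite big_ord_recl {1}/exp_mono expr0 fact0 divr1.
rewrite addrAC subrr add0r; apply: vge_sum => i _; rewrite lift0.
apply: vgeW (vge_exp_mono p_pr (ltn0Sn i) hc); rewrite lerDl mulr_ge0 // subr_ge0 //.
Qed.

Variable e : nat -> Qpbar K.
Hypothesis e_exp : is_exp (fun m => (p_power p m)%:R) e.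

Definition ser x (d : nat) := e d * x ^+ d.

Lemma is_exp_ser x : is_exp (fun m => (p_power p m)%:R * x ^+ m) (ser x).
Proof.
case: e_exp => e0 he; split=> [|N]; first by rewrite /ser e0 expr0 mulr1.
rewrite /ser mulrA he mulr_suml; apply: eq_bigr => i _.
by rewrite -[in x ^+ N](subnKC (ltn_ord i)) exprD; ring.
Qed.

Lemma ser_vge x d : vge u x -> vge (u * d%:R) (ser x d).
Proof.
move=> ux; apply: vgeMl; first exact: in_Zp_vge (ah_in_Zp p_pr e_exp d).
by rewrite mulrC; exact: vgeX.
Qed.

Lemma invp_le_u : 1 / p%:R <= u.
Proof. by rewrite ler_pdivrMr ?pos_p // mulrC pu lerDl ltW. Qed.

(** The separate exponentials of x^(p^j)/p^j need not converge at T = 1. After a p-th power the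
    exponents c j are divisible enough for each exp(c_j T^(p^j)) to converge there; the product of
    the values is the exponential of the sum of the c j, which is 1 up to M. *)
Lemma ah_prod_pow (xs : seq (Qpbar K)) (J D : nat) (c : nat -> Qpbar K) (M : rat) :
  (0 < D)%N -> (D <= p ^ J)%N -> u <= M -> M <= 1 / p%:R * D%:R ->
  (forall x, x \in xs -> vge u x) ->
  (forall j, (j < J)%N -> (p ^ j)%:R * c j = p%:R * \sum_(x <- xs) x ^+ (p ^ j)) ->
  (forall j, (j < J)%N -> vge (u + (p ^ j)%:R / p%:R) (c j)) ->
  vge M (\sum_(j < J) c j) ->
  vge M ((\prod_(x <- xs) evs D (ser x)) ^+ p - 1).
Proof.
move=> D0 DJ uM MD hx hc cv hM; have r0 : 0 <= 1 / p%:R :> rat by rewrite divr_ge0 // ltW ?pos_p.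
pose xp := flatten (nseq p xs).
have inxp x : x \in xp -> x \in xs.
  by move=> /flattenP[t]; rewrite mem_nseq => /andP[_ /eqP ->].
have prodE : \prod_(g <- [seq ser x | x <- xp]) evs D g = (\prod_(x <- xs) evs D (ser x)) ^+ p.
  suff gen q : \prod_(x <- flatten (nseq q xs)) evs D (ser x) = (\prod_(x <- xs) evs D (ser x)) ^+ q.
    by rewrite big_map gen.
  elim: q => [|k IH]; first by rewrite big_nil expr0.
  by rewrite /= big_cat /= IH exprS.
have sumE (f : Qpbar K -> Qpbar K) : \sum_(x <- xp) f x = p%:R * \sum_(x <- xs) f x.
  suff gen q : \sum_(x <- flatten (nseq q xs)) f x = (\sum_(x <- xs) f x) *+ q by rewrite gen mulr_natl.
  elim: q => [|k IH]; first by rewrite big_nil mulr0n.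
  by rewrite /= big_cat /= IH mulrS.
have hser g : List.In g [seq ser x | x <- xp] -> forall d, vge (1 / p%:R * d%:R) (g d).
  have : forall x, x \in xp -> vge u x by move=> x /inxp; exact: hx.
  elim: (xp) => [//|x t IH] ht /= [<- d|hg]; last by apply: IH hg => y yt; apply: ht; rewrite inE yt orbT.
  apply: vgeW (ser_vge d (ht x (mem_head _ _))); rewrite ler_wpM2r //; exact: invp_le_u.
pose R j := iter j (@stretch p K) (exp_mono (c j)).
have pjp j : 0 <= (p ^ j)%:R / p%:R :> rat by rewrite divr_ge0 // ltW ?pos_p.
have pn j : (p ^ j)%:R != 0 :> rat by rewrite pnatr_eq0 -lt0n expn_gt0 p0.
have ppj j : (p ^ j)%:R / p%:R / (p ^ j)%:R = 1 / p%:R :> rat.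
  by rewrite mulrAC divff.
have hR g : List.In g [seq R j | j <- iota 0 J] -> forall d, vge (1 / p%:R * d%:R) (g d).
  have : forall j, j \in iota 0 J -> (j < J)%N by move=> j; rewrite mem_iota.
  elim: (iota 0 J) => [//|j t IH] ht /= [<- d|hg]; last by apply: IH hg => y yt; apply: ht; rewrite inE yt orbT.
  by rewrite -(ppj j); apply: stretch_iter_vge => k; apply: exp_mono_vge => //; apply: cv; apply: ht; exact: mem_head.
have same d : (d < D)%N -> sconv [seq ser x | x <- xp] d = sconv [seq R j | j <- iota 0 J] d.
  apply: (is_exp_uniq_upto (is_exp_sconv xp is_exp_ser) (is_exp_sconv (iota 0 J) (fun j => is_exp_stretch_iter j (c j)))).
  move=> m m0 mD; rewrite -mulr_sumr sumE.
  case: (boolP (p_power p m)) => [/eqP E|np]; last first.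
    rewrite mul0r big1 // => j _; case: eqP => // E; by rewrite E p_powerX in np.
  set k := logn p m in E; have kJ : (k < J)%N by rewrite -(ltn_exp2l _ _ p1) -E (leq_trans mD).
  rewrite mul1r (bigD1_seq k) ?iota_uniq ?mem_iota //= E eqxx hc // [X in _ = _ + X]big1 ?addr0 // => j jk.
  by case: eqP => // /eqP; rewrite eqn_exp2l // eq_sym (negPf jk).
have evE : evs D (sconv [seq ser x | x <- xp]) = evs D (sconv [seq R j | j <- iota 0 J]).
  by apply: eq_bigr => d _; exact: same.
have h1 := evs_sconv r0 D0 hser; have h2 := evs_sconv r0 D0 hR.
rewrite prodE in h1; rewrite -prodE prodE.
apply: vge_trans (_ : vge M (evs D (sconv [seq R j | j <- iota 0 J]) - 1)).
  by rewrite vgeBC -evE; exact: vgeW h1.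
apply: vge_trans (vgeW MD h2) _.
have prodR : \prod_(g <- [seq R j | j <- iota 0 J]) evs D g = \prod_(j < J) evs D (R j).
  by rewrite big_map -(big_mkord xpredT (fun j => evs D (R j))) /index_iota subn0.
have cv1 j : (j < J)%N -> vge (u + 1 / p%:R) (c j).
  move=> jJ; apply: vgeW (cv j jJ); rewrite lerD2l ler_wpM2r ?invr_ge0 // ler1n expn_gt0 p0 //.
rewrite prodR; apply: vge_trans (_ : vge M (\prod_(j < J) evs D (exp_mono (c j)) - 1)).
  have hk k : (k <= J)%N -> vge (1 / p%:R * D%:R) (\prod_(j < k) evs D (R j) - \prod_(j < k) evs D (exp_mono (c j))).
    elim: k => [|k IH] kJ; first by rewrite !big_ord0 subrr vge0.
    rewrite !big_ord_recr /=; apply: vge_subM.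
    - rewrite -(big_mkord xpredT (fun j => evs D (R j))) big_nat; apply: vge_prod0 => j /andP[_ jk].
      apply: evs_vge => d; apply: vgeW (stretch_iter_vge j (exp_mono_vge (pjp j) (cv j (ltn_trans jk kJ))) d).
      by rewrite ppj mulr_ge0.
    - by apply: evs_vge => d; apply: vgeW (exp_mono_vge r0 (cv1 k kJ) d); rewrite mulr_ge0.
    - by apply: IH; exact: ltnW.
    by rewrite -(ppj k); apply: evs_stretch_iter => //; apply: exp_mono_vge => //; exact: cv.
  by exact: vgeW MD (hk J (leqnn J)).
apply: vge_trans (vgeW MD (exp_mono_sum D0 cv1)) _.
exact: evs_exp_mono_small.
Qed.

Lemma prim_zeta : p.-primitive_root (1 + pi).
Proof.
have [k hk kp] := prim_order_exists p0 (zeta_p p_pr pi_root).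
suff E : k = p by move: hk; rewrite E.
apply/(prime_nt_dvdP p_pr) => //; apply/eqP => k1; have := prim_expr_order hk.
by rewrite k1 expr1 => /eqP; rewrite -subr_eq0 addrAC subrr add0r (negPf (pi_neq0 p_pr pi_root)).
Qed.

Lemma ordp_prod_const (I : finType) (P : pred I) (F : I -> Qpbar K) r :
  (forall i, P i -> ordp (F i) = r%:E%E) -> ordp (\prod_(i | P i) F i) = (#|P|%:R * r)%:E%E.
Proof.
move=> h; rewrite -sum1_card; apply: (big_ind2 (fun x (k : nat) => ordp x = (k%:R * r)%:E%E)).
- by rewrite mul0r ordp1.
- by move=> x k x' k' hx hx'; rewrite ordpM hx hx' natrD mulrDl.
by move=> i /h ->; rewrite mul1r.
Qed.

Lemma pow_linear x (k : nat) : vge u x -> vge (2 * u) ((1 + x) ^+ k - (1 + k%:R * x)).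
Proof.
move=> ux; elim: k => [|k IH]; first by rewrite expr0 mul0r addr0 subrr vge0.
have x0 : vge 0 x by apply: vgeW ux; exact: ltW.
rewrite exprS [X in vge _ X](_ : _ = (1 + x) * ((1 + x) ^+ k - (1 + k%:R * x)) + k%:R * (x * x)); last first.
  by rewrite -[k.+1]addn1 natrD; ring.
apply: vgeD; first by apply: vgeMl => //; apply: vgeD => //; exact: vge1.
apply: vgeMl; first exact: vge_nat.
by have -> : 2 * u = u + u; [ring | exact: vgeM].
Qed.

(** As V^p is 1 up to M, V is near a p-th root of unity, and the estimate V = 1 + ga s tells which
    one. In V^p - 1 = prod_b (V - zeta^b) each of the p-1 wrong factors has valuation exactly u,
    whence the loss (p-1) u = 1. *)
Lemma splitting_value (ga s : Qpbar K) (ts : seq (Qpbar K)) (J D a : nat) (M : rat) :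
  vge (2 * u) (ga - pi) -> (1 < D)%N -> (D <= p ^ J)%N -> u <= M -> M <= 1 / p%:R * D%:R ->
  vge M (Lam J ga) -> (forall t, t \in ts -> vge 0 t) ->
  (forall j, (j < J)%N -> \sum_(t <- ts) t ^+ (p ^ j) = s) -> (0 < J)%N ->
  (a < p)%N -> vgt 0 (s - a%:R) ->
  vge (M - 1) (\prod_(t <- ts) evs D (ser (ga * t)) - (1 + pi) ^+ a).
Proof.
move=> gp D1 DJ uM MD hL ht hs J0 ap sa.
have hga := vge_ga gp; have oga := ordp_ga gp.
have s0 : vge 0 s by rewrite -[s](subrK a%:R); apply: vgeD; [exact: vgtW | exact: vge_nat].
have hgt t : t \in ts -> vge u (ga * t) by move=> /ht t0; exact: vgeMr.
set V := \prod_(t <- ts) _.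
have hVp : vge M (V ^+ p - 1).
  rewrite /V -(big_map (fun t => ga * t) xpredT (fun x => evs D (ser x))).
  pose c j := p%:R * (ga ^+ (p ^ j) / (p ^ j)%:R) * s.
  apply: (@ah_prod_pow _ J D c M) => //; first exact: ltnW.
  - by move=> x /mapP[t tt ->]; exact: hgt.
  - move=> j jJ; have pn : (p ^ j)%:R != 0 :> Qpbar K by rewrite natr_Qpbar_eq0 // -lt0n expn_gt0 p0.
    rewrite big_map /c (eq_bigr (fun t => ga ^+ (p ^ j) * t ^+ (p ^ j))) => [|t _]; last by rewrite exprMn.
    by rewrite -mulr_sumr hs //; field.
  - move=> j jJ; apply: vgeMr s0; apply: vgeW (vgeM (vge_p K) (vge_Lam_term j hga)).
    case: j {jJ} => [|j].
      rewrite expn0; have := unit_val_le1 p_pr; have := invp_le_u; lra.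
    have -> : (p ^ j.+1)%:R / p%:R = (p ^ j)%:R :> rat.
      by rewrite expnSr natrM mulfK // pnatr_eq0 -lt0n.
    have : (p ^ j)%:R + j%:R <= ((p ^ j.+1)%:R - 1) * u.
      elim: j => [|j IH].
        by rewrite expn0 expn1 addr0 {1}pred_natr addrK unit_valK.
      have w1 : 1 <= (p ^ j.+1)%:R :> rat by rewrite ler1n expn_gt0 p0.
      have w2 : (p ^ j)%:R <= (p ^ j.+1)%:R :> rat by rewrite ler_nat leq_exp2l.
      rewrite [(p ^ j.+2)%N]expnS natrM -[in j.+1%:R]addn1 natrD.
      have -> : (p%:R * (p ^ j.+1)%:R - 1) * u = (p ^ j.+1)%:R + ((p ^ j.+1)%:R - 1) * u.
        by have := pu; move: ((p ^ j.+1)%:R) => w h; rewrite mulrBl mulrAC h; ring.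
      have w3 : 1 <= (p ^ j)%:R :> rat by rewrite ler1n expn_gt0 p0.
      lra.
    rewrite -[in j.+1%:R]addn1 natrD mulrBl mul1r.
    have := unit_val_le1 p_pr; lra.
  rewrite /c -mulr_suml -mulr_sumr; apply: vgeMr s0; apply: vgeMl hL; exact: vge_nat.
have hV1 : vge (2 * u) (V - (1 + ga * s)).
  have -> : ga * s = \sum_(t <- ts) ga * t.
    by rewrite -mulr_sumr -(hs 0%N J0); congr (_ * _); apply: eq_bigr => t _; rewrite expn0 expr1.
  have ev2 x : vge u x -> vge (2 * u) (evs D (ser x) - (1 + x)).
    move=> ux; rewrite /evs; case: (D) D1 => [|[|D']] // _; rewrite !big_ord_recl /ser expr0 mulr1 /bump /= expr1.
    have e0 : e 0%N = 1 by case: e_exp.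
    have e1 : e 1%N = 1.
      case: e_exp => _ /(_ 1%N); rewrite big_ord1 mul1r e0 mulr1 => ->; by rewrite -[1%N](expn0 p) p_powerX.
    rewrite e0 e1 mul1r [X in vge _ X](_ : _ = \sum_(i < D') ser x i.+2); last by rewrite /ser /=; ring.
    apply: vge_sum => i _; apply: vgeW (ser_vge i.+2 ux); rewrite mulrC ler_wpM2l ?(ltW u0) //.
    by rewrite ler_nat.
  rewrite /V; elim: (ts) hgt => [|t t' IH] hgt; first by rewrite !big_nil addr0 subrr vge0.
  have h1 := hgt t (mem_head _ _).
  have ht' x : x \in t' -> vge u (ga * x) by move=> xt; apply: hgt; rewrite inE xt orbT.
  have hS : vge u (\sum_(t0 <- t') ga * t0).
    by rewrite big_seq; apply: vge_sum => x; exact: ht'.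
  have hP0 : vge 0 (\prod_(t0 <- t') evs D (ser (ga * t0))).
    rewrite big_seq; apply: vge_prod0 => x /ht' hx; apply: evs_vge => d.
    by apply: vgeW (ser_vge d hx); rewrite mulr_ge0 // ltW.
  rewrite !big_cons; set S := \sum_(t0 <- t') _ in IH hS *; set P := \prod_(t0 <- t') _ in IH hP0 *.
  have xS : vge (2 * u) (ga * t * S) by have -> : 2 * u = u + u; [ring | exact: vgeM].
  rewrite [X in vge _ X](_ : _ = (evs D (ser (ga * t)) - (1 + ga * t)) * P + (1 + ga * t) * (P - (1 + S)) + ga * t * S); last by ring.
  apply: vgeD xS; apply: vgeD; first by apply: vgeMr; [exact: ev2 | exact: hP0].
  apply: vgeMl; last exact: IH.
  by apply: vgeD; [exact: vge1 | apply: vgeW h1; exact: ltW].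
have u2 : u < 2 * u by rewrite ltr_pMl // ltr1n.
have hVa : vgt u (V - (1 + ga * a%:R)).
  have -> : V - (1 + ga * a%:R) = (V - (1 + ga * s)) + ga * (s - a%:R) by ring.
  apply: vgtD; first exact: vge_gt hV1.
  by rewrite -[u]addr0; exact: vge_gtM.
have hz (b : 'I_p) : (b : nat) != a -> ordp (V - (1 + pi) ^+ b) = u%:E%E.
  move=> ba; have oab : ordp (ga * (a%:R - b%:R)) = u%:E%E.
    rewrite ordpM oga; suff -> : ordp (a%:R - b%:R : Qpbar K) = 0%:E%E by rewrite -EFinD addr0.
    have cop k : (0 < k)%N -> (k < p)%N -> ordp (k%:R : Qpbar K) = 0%:E%E.
      by move=> k0 kp; apply: ordp_coprime => //; rewrite prime_coprime // gtnNdvd.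
    have [ab|ab|ab] := ltngtP a b; last by rewrite ab eqxx in ba.
      rewrite -ordpN opprB -natrB ?(ltnW ab) //; apply: cop; first by rewrite subn_gt0.
      by apply: leq_ltn_trans (leq_subr _ _) (ltn_ord b).
    rewrite -natrB ?(ltnW ab) //; apply: cop; first by rewrite subn_gt0.
    by apply: leq_ltn_trans (leq_subr _ _) ap.
  have -> : V - (1 + pi) ^+ b = ga * (a%:R - b%:R) + ((V - (1 + ga * a%:R)) +
     (b%:R * (ga - pi) - ((1 + pi) ^+ b - (1 + b%:R * pi)))) by ring.
  apply: (ordpD_gt oab); apply: vgtD => //; apply: vge_gt u2 _; apply: vgeB.
    by apply: vgeMl => //; exact: vge_nat.
  exact: pow_linear vge_pi.
have prodV : \prod_(b < p) (V - (1 + pi) ^+ b) = V ^+ p - 1.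
  have := congr1 (horner^~ V) (factor_Xn_sub_1 prim_zeta).
  rewrite big_mkord horner_prod hornerD hornerN hornerXn hornerC => <-.
  by apply: eq_bigr => b _; rewrite hornerXsubC.
have := hVp; rewrite -prodV (bigD1 (Ordinal ap)) //= mulrC => h.
apply: vge_cancel h; rewrite (ordp_prod_const (r := u)).
  by rewrite cardC1 card_ord unit_valK.
by move=> b ba; apply: hz; rewrite -val_eqE in ba.
Qed.

End Splitting.

(** * Traces of finite fields and Teichmuller representatives *)

Section PrimeTrace.
Variables (p : nat) (E : finFieldType) (charE : p \in [pchar E]).
Local Notation L := (pPrimeCharType charE).
Let p_pr : prime p := pcharf_prime charE.
Let d := \dim {: L}.
Let b := vbasis {: L}.

Lemma card_pchar : exists2 m, (0 < m)%N & #|E| = (p ^ m)%N.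
Proof.
have [k E1] : exists k, #|E| = (p ^ k)%N by exists (logn p #|E|); exact: (card_pprimeChar charE).
by exists k => //; have := card_finNzRing_gt1 E; rewrite E1; case: (k).
Qed.

Lemma frobD (x y : E) i : (x + y) ^+ (p ^ i) = x ^+ (p ^ i) + y ^+ (p ^ i).
Proof. by rewrite exprDn_pchar // pnatX (pnatE _ p_pr) /= charE. Qed.

Lemma frob_sum (I : Type) (t : seq I) (P : pred I) (F : I -> E) i :
  (\sum_(k <- t | P k) F k) ^+ (p ^ i) = \sum_(k <- t | P k) F k ^+ (p ^ i).
Proof.
elim: t => [|k t IH]; first by rewrite !big_nil expr0n -leqn0 leqNgt expn_gt0 prime_gt0.
by rewrite !big_cons; case: (P k); rewrite ?frobD IH.
Qed.

Lemma scale_natr (a : 'F_p) (x : L) : a *: x = (a : nat)%:R * x :> E.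
Proof. by []. Qed.

Lemma frob_nat (k i : nat) : (k%:R : E) ^+ (p ^ i) = k%:R.
Proof.
elim: k => [|k IH]; first by rewrite expr0n -leqn0 leqNgt expn_gt0 prime_gt0.
by rewrite -[k.+1]addn1 natrD frobD IH expr1n.
Qed.

Definition moore : 'M[E]_d := \matrix_(j, i) (b`_j : E) ^+ (p ^ i).

(** A vector in the kernel gives an additive polynomial of degree less than p^d that vanishes on a
    basis, hence on all p^d elements. *)
Lemma moore_unit : #|E| = (p ^ d)%N -> moore \in unitmx.
Proof.
move=> cE; have d0 : (0 < d)%N.
  by rewrite lt0n; apply/eqP => h; have := card_finNzRing_gt1 E; rewrite cE h expn0.
rewrite -unitmx_tr -row_free_unit; apply: inj_row_free => v hv.
pose P : {poly E} := \sum_(i < d) v 0 i *: 'X^(p ^ i).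
have Pev x : P.[x] = \sum_(i < d) v 0 i * x ^+ (p ^ i).
  by rewrite horner_sum; apply: eq_bigr => i _; rewrite hornerZ hornerXn.
have Pb (j : 'I_d) : P.[b`_j] = 0.
  have := congr1 (fun M : 'rV_d => M 0 j) hv; rewrite !mxE Pev => hj.
  by apply: etrans hj; apply: eq_bigr => i _; rewrite !mxE.
have P0 x : P.[x] = 0.
  rewrite (coord_vbasis (memvf (x : L))) Pev.
  rewrite (eq_bigr (fun i : 'I_d => \sum_(j < d) (coord b j (x : L) : nat)%:R * (v 0 i * (b`_j : E) ^+ (p ^ i)))); last first.
    move=> i _; rewrite frob_sum mulr_sumr; apply: eq_bigr => j _.
    by rewrite scale_natr exprMn frob_nat mulrCA.
  by rewrite exchange_big big1 // => j _; rewrite -mulr_sumr -Pev Pb mulr0.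
have PE : P = 0.
  apply/eqP; apply/negPn/negP => Pn0.
  have := max_poly_roots Pn0 (_ : all (root P) (enum E)) (enum_uniq _).
  rewrite -cardE cE ltnNge => /(_ _)/negP; apply; first by apply/allP => x _; apply/rootP.
  apply: leq_trans (size_sum _ _ _) _; apply/bigmax_leqP => i _.
  apply: leq_trans (size_scale_leq _ _) _; rewrite size_polyXn.
  by rewrite ltn_exp2l ?prime_gt1.
apply/rowP => i; rewrite mxE; have := congr1 (fun q : {poly E} => q`_(p ^ i)) PE.
rewrite coef0 coef_sum (bigD1 i) //= coefZ coefXn eqxx mulr1 big1 ?addr0 // => k ki.
by rewrite coefZ coefXn eqn_exp2l ?prime_gt1 // eq_sym val_eqE (negPf ki) mulr0.
Qed.

(* The Moore matrix diagonalizes the multiplication by x. *)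
Lemma prime_trace_frob m (x : E) : #|E| = (p ^ m)%N ->
  ((prime_trace charE x : nat)%:R : E) = \sum_(i < m) x ^+ (p ^ i).
Proof.
move=> cE; have dm : d = m.
  have := pprimeChar_dimf charE; rewrite -/d => ->.
  by rewrite -(pfactorK m p_pr) -cE.
have cd : #|E| = (p ^ d)%N by rewrite dm.
pose M : 'M['F_p]_d := passmx.mxof b b (amull (x : L)).
have Mb (j : 'I_d) : x * b`_j = \sum_k (M j k : nat)%:R * b`_k.
  have hb : basis_of {:L} b := vbasisP _.
  rewrite [LHS](coord_vbasis (memvf (x * b`_j : L))); apply: eq_bigr => k _.
  rewrite scale_natr; congr ((nat_of_ord _)%:R * _).
  rewrite /M /passmx.mxof mxE /= /passmx.rVof mxE -/b lfunE /=; congr (coord _ _ (_ * _)).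
  rewrite /passmx.vecof (bigD1 j) //= mxE !eqxx scale1r big1 ?addr0 //.
  by move=> k' kj; rewrite mxE eqxx (negPf kj) scale0r.
pose D : 'M[E]_d := diag_mx (\row_i x ^+ (p ^ i)).
pose M' : 'M[E]_d := map_mx (fun a : 'F_p => (a : nat)%:R) M.
have MV : M' *m moore = moore *m D.
  apply/matrixP => j i; rewrite mul_mx_diag !mxE -exprMn mulrC Mb frob_sum.
  by apply: eq_bigr => k _; rewrite !mxE exprMn frob_nat.
have -> : ((prime_trace charE x : nat)%:R : E) = \tr M'.
  have fE (a : 'F_p) : in_alg L a = (a : nat)%:R :> E by rewrite /= scale_natr mulr1.
  have fs (h : 'I_d -> 'F_p) : (nat_of_ord (\sum_i h i)%R)%:R = \sum_i ((h i : nat)%:R : E).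
    apply: etrans (esym (fE _)) _; rewrite (raddf_sum (in_alg L)).
    by apply: eq_bigr => i _; exact: fE.
  have -> : prime_trace charE x = \sum_i M i i by [].
  by rewrite fs; apply: eq_bigr => i _; rewrite [RHS]mxE.
rewrite -[M'](mulmxK (moore_unit cd)) MV mxtrace_mulC mulmxA mulVmx ?moore_unit // mul1mx.
rewrite mxtrace_diag -dm; apply: eq_bigr => i _; by rewrite mxE.
Qed.

End PrimeTrace.

(** * Lifting from characteristic p *)

Section Lift.
Variables (p : nat) (p_pr : prime p) (K : padic_closure p).
Implicit Types (x y z : Qpbar K) (f g h : {poly 'F_p}).

(** Coefficients are lifted to 0, ..., p-1, so f -> f(z) respects sums and products only modulo
    p. *)
Definition evC z f : Qpbar K := \sum_(i < size f) (nat_of_ord f`_i)%:R * z ^+ i.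

Lemma evC_widen z f W : (size f <= W)%N -> evC z f = \sum_(i < W) (nat_of_ord f`_i)%:R * z ^+ i.
Proof.
move=> fW; rewrite /evC (big_ord_widen _ (fun i => (nat_of_ord f`_i)%:R * z ^+ i) fW) [RHS](bigID (fun i : 'I_W => i < size f)%N) /=.
rewrite [X in _ + X]big1 ?addr0 // => i; rewrite -leqNgt => /(nth_default 0) ->.
by rewrite mul0r.
Qed.

Lemma vge_Fp_natr (k k' : nat) : (k%:R : 'F_p) = k'%:R -> vge 1 (k%:R - k'%:R : Qpbar K).
Proof.
wlog kk : k k' / (k' <= k)%N => [H e|e].
  case/orP: (leq_total k' k) => kk; first exact: H.
  by rewrite vgeBC; apply: H.
have : ((k - k')%:R : 'F_p) = 0 by rewrite natrB // e subrr.
move=> /eqP; rewrite -(dvdn_pcharf (pchar_Fp p_pr)) => /dvdnP[c hc].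
by rewrite -natrB // hc natrM; apply: vgeMl (vge_nat _ _) (vge_p K).
Qed.

Lemma evC0 z : evC z 0 = 0.
Proof. by rewrite /evC size_poly0 big_ord0. Qed.

Lemma evC_Xn z i : evC z 'X^i = z ^+ i.
Proof.
rewrite /evC size_polyXn (bigD1 ord_max) //= coefXn eqxx mul1r big1 ?addr0 // => j.
by rewrite -val_eqE /= coefXn => /negPf ->; rewrite mul0r.
Qed.

Lemma evC_vge0 z f : vge 0 z -> vge 0 (evC z f).
Proof. by move=> z0; apply: vge_sum => i _; apply: vgeMl (vge_nat _ _) (vgeX0 _ z0). Qed.

Lemma evC_add z f g : vge 0 z -> vge 1 (evC z (f + g) - (evC z f + evC z g)).
Proof.
move=> z0; have [h1 h2] := (leq_maxl (size f) (size g), leq_maxr (size f) (size g)).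
rewrite (evC_widen z h1) (evC_widen z h2) (evC_widen z (size_polyD f g)) -big_split -sumrB.
apply: vge_sum => i _ /=; rewrite -mulrDl -mulrBl; apply: vgeMr (vgeX0 _ z0).
by rewrite -natrD; apply: vge_Fp_natr; rewrite natrD !natr_Zp coefD.
Qed.

Lemma evC_scale z (a : 'F_p) f : vge 0 z -> vge 1 (evC z (a *: f) - (nat_of_ord a)%:R * evC z f).
Proof.
move=> z0; rewrite (evC_widen z (size_scale_leq a f)) /evC mulr_sumr -sumrB.
apply: vge_sum => i _; rewrite mulrA -mulrBl; apply: vgeMr (vgeX0 _ z0).
by rewrite -natrM; apply: vge_Fp_natr; rewrite natrM !natr_Zp coefZ.
Qed.

Lemma evC_mulX z f : evC z (f * 'X) = evC z f * z.
Proof.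
have hs : (size (f * 'X)%R <= (size f).+1)%N by have := size_polyMleq f 'X; rewrite size_polyX addn2.
rewrite (evC_widen z hs) big_ord_recl coefMX mul0r add0r /evC mulr_suml; apply: eq_bigr => i _.
by rewrite coefMX /= /bump /= add1n exprSr mulrA.
Qed.

Lemma evC_mul z f g : vge 0 z -> vge 1 (evC z (f * g) - evC z f * evC z g).
Proof.
move=> z0; elim/poly_ind: f => [|f a IH]; first by rewrite !mul0r evC0 mul0r subrr vge0.
rewrite mulrDl mulrAC mul_polyC.
apply: vge_trans (evC_add _ _ z0) _; rewrite evC_mulX.
have hC : vge 1 (evC z (f * 'X + a%:P) - (evC z f * z + (nat_of_ord a)%:R)).
  apply: vge_trans (evC_add _ _ z0) _; rewrite evC_mulX opprD addrACA subrr add0r.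
  have := evC_scale a 1 z0; rewrite -mul_polyC mulr1.
  by rewrite -(expr0 'X) evC_Xn expr0 mulr1.
have hM : vge 1 ((evC z f * z + (nat_of_ord a)%:R) * evC z g - evC z (f * 'X + a%:P) * evC z g).
  by rewrite -mulrBl; apply: vgeMr; [rewrite vgeBC | exact: evC_vge0].
apply: vge_trans _ hM; rewrite mulrDl mulrAC opprD addrACA.
by apply: vgeD; [rewrite -mulrBl; apply: vgeMr | exact: evC_scale].
Qed.

Lemma evC_dvd z f g : vge 0 z -> vgt 0 (evC z f) -> f %| g -> vgt 0 (evC z g).
Proof.
move=> z0 fz /dvdpP[q ->]; rewrite -[evC _ _](subrK (evC z q * evC z f)).
apply: vgtD; first by apply: vge_gt (evC_mul _ _ z0).
by rewrite -[0]addr0; apply: vge_gtM fz; exact: evC_vge0.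
Qed.

Lemma monic_root_vge0 (P : {poly Qpbar K}) z : P \is monic -> (forall i, vge 0 P`_i) -> root P z -> vge 0 z.
Proof.
move=> mP iP rz; have [->|z0] := eqVneq z 0; first exact: vge0.
have [r hr] := ordp_fin z0; rewrite (vgeE _ hr) leNgt; apply/negP => r0.
have P0 : (0 < size P)%N by rewrite size_poly_gt0 monic_neq0.
have sz2 : size P = (size P).-1.+1 by rewrite prednK.
move: rz => /eqP; rewrite horner_coef sz2 big_ord_recr /= -lead_coefE (monicP mP) mul1r => /eqP.
rewrite addrC addr_eq0 => /eqP ez.
have hd := ordpX (size P).-1 hr.
have : vge ((size P).-1%:R * r - r) (z ^+ (size P).-1).
  rewrite ez vgeN; apply: vge_sum => i _; apply: vgeMl => //.
  rewrite (vgeE _ (ordpX i hr)) -[X in _ - X]mul1r -mulrBl ler_wnM2r ?(ltW r0) //.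
  by rewrite lerBrDr natr1 ler_nat.
by rewrite (vgeE _ hd); lra.
Qed.

(** x^N - 1 is x - 1 times a sum congruent to the unit N. *)
Lemma root1_sub_ord (N : nat) x : coprime p N -> (0 < N)%N -> x ^+ N = 1 -> vgt 0 (x - 1) -> x = 1.
Proof.
move=> pN N0 xN x1; apply/eqP; rewrite -subr_eq0; apply/negPn/negP => xn1.
have x0 : vge 0 x by rewrite -[x](subrK 1); apply: vgeD; [exact: vgtW | exact: vge1].
have /eqP : (x - 1) * \sum_(i < N) x ^+ i = 0 by rewrite -subrX1 xN subrr.
rewrite mulf_eq0 (negPf xn1) /= => /eqP s0.
have : vgt 0 (\sum_(i < N) (x ^+ i - 1)).
  apply: vgt_sum => i _; rewrite subrX1 -[0]addr0; apply: vgt_geM => //.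
  by apply: vge_sum => j _; exact: vgeX0.
by rewrite sumrB s0 sub0r vgtN sumr_const card_ord (vgtE _ (ordp_coprime p_pr K pN)) ltxx.
Qed.

Lemma ord_root1 (N : nat) x : (0 < N)%N -> x ^+ N = 1 -> ordp x = 0%:E%E.
Proof.
move=> N0 xN; have x0 : x != 0 by apply: contraTneq (oner_neq0 (Qpbar K)) => x0; rewrite -xN x0 expr0n gtn_eqF // eqxx.
have [r hr] := ordp_fin x0; have := ordpX N hr; rewrite xN ordp1 => -[/esym/eqP].
by rewrite mulf_eq0 pnatr_eq0 gtn_eqF //= => /eqP r0; rewrite hr r0.
Qed.

Lemma root1_cong (N : nat) x y : coprime p N -> (0 < N)%N -> x ^+ N = 1 -> y ^+ N = 1 ->
  vgt 0 (x - y) -> x = y.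
Proof.
move=> pN N0 xN yN xy; have oy := ord_root1 N0 yN.
have y0 : y != 0 by apply: contraTneq (oner_neq0 (Qpbar K)) => y0; rewrite -yN y0 expr0n gtn_eqF // eqxx.
apply: (mulIf (invr_neq0 y0)); rewrite mulfV //; apply: (root1_sub_ord pN N0).
  by rewrite exprMn exprVn xN yN invr1 mulr1.
have -> : x / y - 1 = (x - y) / y by rewrite mulrBl divff.
by rewrite -[0]addr0; apply: vgt_geM => //; apply: vgeV oy _; rewrite oppr0.
Qed.

Lemma vgt_prod (I : finType) (F : I -> Qpbar K) : (forall i, vge 0 (F i)) ->
  vgt 0 (\prod_i F i) -> exists i, vgt 0 (F i).
Proof.
move=> F0 h; apply: contrapT => hn.
have hi i : ordp (F i) = 0%:E%E.
  have hv : ~~ vgt 0 (F i) by apply/negP => hv; apply: hn; exists i.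
  have Fi0 : F i != 0 by apply: contraNneq hv => ->; exact: vgt0.
  have [r hr] := ordp_fin Fi0; move: hv (F0 i); rewrite (vgtE _ hr) (vgeE _ hr) -leNgt => a b.
  by rewrite hr; congr (_%:E%E); apply/le_anti/andP.
have := @ordp_prod_const p K I xpredT F 0 (fun i _ => hi i).
by rewrite mulr0 => o; rewrite (vgtE _ o) ltxx in h.
Qed.

End Lift.

Section EvaluationFp.
Variables (p : nat) (p_pr : prime p) (E : finFieldType) (charE : p \in [pchar E]).
Implicit Types (y : E) (f g h : {poly 'F_p}).

Definition evFp y f : E := \sum_(i < size f) (nat_of_ord f`_i)%:R * y ^+ i.

Definition embFp : {rmorphism 'F_p -> E} :=
  (in_alg (pPrimeCharType charE) : {rmorphism 'F_p -> pPrimeCharType charE}).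

Lemma embFpE (a : 'F_p) : embFp a = (a : nat)%:R.
Proof. by rewrite /embFp /= scale_natr mulr1. Qed.

Lemma evFpE y f : evFp y f = (map_poly embFp f).[y].
Proof.
rewrite horner_coef size_map_poly; apply: eq_bigr => i _.
by rewrite coef_map; congr (_ * _); apply: esym; exact: embFpE.
Qed.

Lemma evFpB y f g : evFp y (f - g) = evFp y f - evFp y g.
Proof. by rewrite !evFpE rmorphB hornerD hornerN. Qed.

Lemma evFpD y f g : evFp y (f + g) = evFp y f + evFp y g.
Proof. by rewrite !evFpE rmorphD hornerD. Qed.

Lemma evFpM y f g : evFp y (f * g) = evFp y f * evFp y g.
Proof. by rewrite !evFpE rmorphM hornerM. Qed.

Lemma evFpXn y i : evFp y 'X^i = y ^+ i.
Proof. by rewrite evFpE map_polyXn hornerXn. Qed.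

Lemma evFpX y : evFp y 'X = y.
Proof. by rewrite -['X]expr1 evFpXn expr1. Qed.

Lemma evFp1 y : evFp y 1 = 1.
Proof. by rewrite -(expr0 'X) evFpXn. Qed.

Lemma evFp0 y : evFp y 0 = 0.
Proof. by rewrite /evFp size_poly0 big_ord0. Qed.

Lemma exists_min_poly y : exists h, [/\ h \is monic, (1 < size h)%N, evFp y h = 0 &
  forall f, evFp y f = 0 -> h %| f].
Proof.
pose Q : pred nat := fun s => `[< exists2 f : {poly 'F_p}, f != 0 & evFp y f = 0 /\ size f = s >].
have exQ : exists s, Q s.
  have E1 := card_finNzRing_gt1 E.
  have sN : (size (- 'X : {poly 'F_p}) < size ('X^#|E| : {poly 'F_p}))%N by rewrite size_polyN size_polyX size_polyXn.
  exists #|E|.+1; apply/asboolP; exists ('X^#|E| - 'X).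
    by rewrite -size_poly_gt0 size_polyDl // size_polyXn.
  by rewrite size_polyDl // size_polyXn evFpB evFpXn evFpX expf_card subrr.
have [s /asboolP[h0 h0n [h0g h0s]] smin] := ex_minnP exQ.
pose h := (lead_coef h0)^-1 *: h0.
have l0 : lead_coef h0 != 0 by rewrite lead_coef_eq0.
have hs : size h = s by rewrite size_scale ?invr_eq0.
have hm : h \is monic by rewrite monicE lead_coefZ mulVf.
have hg : evFp y h = 0 by rewrite evFpE map_polyZ hornerZ -evFpE h0g mulr0.
exists h; split=> //.
  rewrite ltn_neqAle eq_sym size_poly_gt0 monic_neq0 // andbT; apply/eqP => h1.
  have := hg; have /size1_polyC hC : (size h <= 1)%N by rewrite h1.
  have : h = 1 by move: hm; rewrite hC monicE lead_coefC => /eqP->.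
  by move=> ->; rewrite evFp1 => /eqP; rewrite oner_eq0.
move=> f ef; rewrite /dvdp; apply/negPn/negP => rn.
have : Q (size (f %% h)).
  apply/asboolP; exists (f %% h) => //; split=> //.
  by have := congr1 (evFp y) (divp_eq f h); rewrite evFpD evFpM ef hg mulr0 add0r.
by move=> /smin; rewrite -hs leqNgt ltn_modp monic_neq0.
Qed.

End EvaluationFp.

Lemma expf_card1 (E : finFieldType) (x : E) : x != 0 -> x ^+ #|E|.-1 = 1.
Proof.
move=> x0; apply: (mulfI x0); rewrite -exprS prednK ?expf_card ?mulr1 //.
by rewrite (ltn_trans _ (card_finNzRing_gt1 E)).
Qed.

Lemma card_pred_gt0 (E : finFieldType) : (0 < #|E|.-1)%N.
Proof. by rewrite -subn1 subn_gt0 card_finNzRing_gt1. Qed.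

Lemma exists_prim_root (E : finFieldType) : exists g : E, #|E|.-1.-primitive_root g.
Proof.
have N0 := card_pred_gt0 E; set N := #|E|.-1 in N0 *.
suff [g _ pg] : exists2 g : E, g \in [seq x <- enum E | x != 0] & N.-primitive_root g by exists g.
apply/hasP; apply: has_prim_root N0 _ _ _.
- by apply/allP => x; rewrite mem_filter => /andP[x0 _]; rewrite unity_rootE expf_card1.
- by rewrite filter_uniq // enum_uniq.
by rewrite -(leq_add2l 1) add1n prednK ?(ltn_trans _ (card_finNzRing_gt1 E)) // cardE
  -(count_predC (pred1 0)) size_filter leq_add2r (count_uniq_mem _ (enum_uniq _)) leq_b1.
Qed.

Section Teichmuller.
Variables (p : nat) (p_pr : prime p) (K : padic_closure p).

(** A multiplicative section over some embedding of E into the residue field. The embedding is not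
    fixed, and [teich_conj] absorbs the choice. *)
Definition is_teichmuller (E : finFieldType) (T : E -> Qpbar K) :=
  [/\ T 0 = 0, T 1 = 1, {morph T : x y / x * y} &
      forall x y, vgt 0 (T (x + y) - (T x + T y))].

Section Properties.
Variables (E : finFieldType) (T : E -> Qpbar K) (TT : is_teichmuller T).
Hypothesis charE : p \in [pchar E].

Lemma teichX x i : T (x ^+ i) = T x ^+ i.
Proof. by case: TT => _ T1 TM _; elim: i => [|i IH]; rewrite ?expr0 // !exprS TM IH. Qed.

Lemma coprime_card_pred : coprime p #|E|.-1.
Proof.
have [k k0 cE] := card_pchar charE; rewrite prime_coprime //; apply/negP => h.
have : (p %| #|E|.-1.+1)%N by rewrite prednK ?cE ?dvdn_exp // expn_gt0 prime_gt0.
rewrite -addn1 dvdn_addr // dvdn1 => /eqP p1; by move: (prime_gt1 p_pr); rewrite p1.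
Qed.

Lemma teich_root x : x != 0 -> T x ^+ #|E|.-1 = 1.
Proof. by case: TT => _ T1 _ _ x0; rewrite -teichX expf_card1. Qed.

Lemma teich_card x : T x ^+ #|E| = T x.
Proof. by rewrite -teichX expf_card. Qed.

Lemma teich_ord x : x != 0 -> ordp (T x) = 0%:E%E.
Proof. by move=> x0; exact: (ord_root1 (card_pred_gt0 E) (teich_root x0)). Qed.

Lemma teich_vge0 x : vge 0 (T x).
Proof.
have [->|x0] := eqVneq x 0; first by case: TT => -> _ _ _; exact: vge0.
by rewrite (vgeE _ (teich_ord x0)).
Qed.

Lemma teich_neq0 x : x != 0 -> T x != 0.
Proof.
by move=> x0; apply/eqP => h; have := teich_ord x0; rewrite h ordp0.
Qed.

Lemma teich_sub x y : vgt 0 (T (x - y) - (T x - T y)).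
Proof.
case: TT => _ _ _ /(_ (x - y) y); rewrite subrK -vgtN; congr (vgt _ _); ring.
Qed.

Lemma teich_inj_cong x y : vgt 0 (T x - T y) -> x = y.
Proof.
move=> h; apply/eqP; rewrite -subr_eq0; apply/negPn/negP => xy.
have : vgt 0 (T (x - y)) by rewrite -[T _](subrK (T x - T y)); apply: vgtD (teich_sub _ _) h.
by rewrite (vgtE _ (teich_ord xy)) ltxx.
Qed.

Lemma teich_inj : injective T.
Proof. by move=> x y e; apply: teich_inj_cong; rewrite e subrr vgt0. Qed.

Lemma teich_sum (I : Type) (t : seq I) (F : I -> E) :
  vgt 0 (T (\sum_(i <- t) F i) - \sum_(i <- t) T (F i)).
Proof.
case: (TT) => T0 _ _ Tadd; elim: t => [|i t IH]; first by rewrite !big_nil T0 subrr vgt0.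
rewrite !big_cons; set A := \sum_(j <- t) F j in IH *; set B := \sum_(j <- t) T (F j) in IH *.
have -> : T (F i + A) - (T (F i) + B) = (T (F i + A) - (T (F i) + T A)) + (T A - B) by ring.
exact: vgtD.
Qed.

Lemma teich_nat (k : nat) : vgt 0 (T k%:R - k%:R).
Proof.
case: (TT) => _ T1 _ _; have := teich_sum (enum 'I_k) (fun=> 1).
by rewrite T1 !big_enum !sumr_const card_ord.
Qed.

Lemma teich_evC y (f : {poly 'F_p}) :
  vgt 0 (evC (T y) f - T (evFp y f)).
Proof.
case: (TT) => _ _ TM _; pose F i := (nat_of_ord f`_i)%:R * y ^+ i.
have h := teich_sum (index_enum 'I_(size f)) (fun i => F i).
set S := \sum_(i < size f) T (F i) in h; set B := T _ in h *; set A := evC _ _.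
have -> : A - B = (A - S) + - (B - S) by ring.
apply: vgtD; last by rewrite vgtN.
rewrite /A /S /evC -sumrB; apply: vgt_sum => i _; rewrite TM teichX -mulrBl -[0]addr0.
by apply: vgt_geM; [rewrite -vgtN opprB; exact: teich_nat | apply: vgeX0; exact: teich_vge0].
Qed.

End Properties.

(** Lift the minimal polynomial h of a generator g. A root th of the lift satisfies th^N = 1 modulo
    p, so it is close to an N-th root of unity om, and g^i is sent to om^i. As h(om) lies in the
    maximal ideal, additive relations between powers of g hold for those of om modulo this ideal. *)
Lemma teichmuller_exists (E : finFieldType) : p \in [pchar E] ->
  exists T : E -> Qpbar K, is_teichmuller T.
Proof.
move=> charE; pose N := #|E|.-1; have N0 := card_pred_gt0 E : (0 < N)%N.
have [g prim_g] := exists_prim_root E.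
have [h [hm hs1 hg hdiv]] := exists_min_poly charE g.
have evXN : @evFp p E g ('X^N - 1) = 0.
  by rewrite (evFpB charE) (evFpXn charE) (evFp1 charE) (prim_expr_order prim_g) subrr.
pose H : {poly Qpbar K} := map_poly (fun a : 'F_p => (nat_of_ord a)%:R) h.
have n0 : (nat_of_ord (0 : 'F_p))%:R = 0 :> Qpbar K by [].
have n1 : (nat_of_ord (1 : 'F_p))%:R = 1 :> Qpbar K by [].
have Hsz : size H = size h by rewrite size_map_poly_id0 // (monicP hm) n1 oner_eq0.
have Hm : H \is monic.
  by rewrite monicE lead_coefE Hsz coef_map_id0 // -lead_coefE (monicP hm).
have Hev z : H.[z] = evC z h.
  by rewrite horner_coef Hsz; apply: eq_bigr => i _; rewrite coef_map_id0.
have /closed_rootP[th rth] : size H != 1%N by rewrite Hsz gtn_eqF.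
have th0 : vge 0 th.
  by apply: (monic_root_vge0 Hm _ rth) => i; rewrite coef_map_id0 //; exact: vge_nat.
have thN : vge 1 (th ^+ N - 1).
  have hN : h %| 'X^N - 1.
    exact: hdiv.
  have e1 : vge 1 (evC th ('X^N - 1)).
    have /dvdpP[k ->] := hN; have := evC_mul p_pr k h th0.
    by rewrite -Hev (rootP rth) mulr0 subr0.
  have e2 := evC_add p_pr ('X^N - 1) 1 th0.
  rewrite subrK evC_Xn -(expr0 'X) evC_Xn expr0 in e2.
  have -> : th ^+ N - 1 = (th ^+ N - (evC th ('X^N - 'X^0) + 1)) + evC th ('X^N - 1) by rewrite expr0; ring.
  exact: vgeD.
have [w prim_w] : exists w : Qpbar K, N.-primitive_root w.
  pose P : {poly Qpbar K} := 'X^N - 1; have [r Dp] := closed_field_poly_normal P.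
  rewrite (monicP _) ?monicXnsubC // scale1r in Dp.
  have rn1 : all N.-unity_root r by apply/allP=> z; rewrite -root_prod_XsubC -Dp.
  have sz_r : (N < (size r).+1)%N by rewrite -(size_prod_XsubC r id) -Dp size_XnsubC.
  have [|z _ pz] := hasP (has_prim_root N0 rn1 _ sz_r); last by exists z.
  by rewrite -separable_prod_XsubC -Dp separable_Xn_sub_1 // natr_Qpbar_eq0 // -lt0n.
have [om oN omth] : exists2 om : Qpbar K, om ^+ N = 1 & vgt 0 (th - om).
  have := congr1 (fun q => q.[th]) (factor_Xn_sub_1 prim_w).
  rewrite big_mkord horner_prod hornerD hornerN hornerXn hornerC => eN.
  have [] := @vgt_prod p K 'I_N (fun i => ('X - (w ^+ i)%:P).[th]).
  - by move=> i; rewrite hornerXsubC; apply: vgeB => //; apply: vgeX0; rewrite (vgeE _ (ord_root1 N0 (prim_expr_order prim_w))).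
  - by rewrite eN; exact: vge_gt thN.
  move=> i; rewrite hornerXsubC => hi; exists (w ^+ i) => //.
  by rewrite -exprM mulnC exprM (prim_expr_order prim_w) expr1n.
have om0 : vge 0 om by rewrite (vgeE _ (ord_root1 N0 oN)).
have hom : vgt 0 (evC om h).
  rewrite -Hev; have : vgt 0 (H.[om] - H.[th]).
    rewrite !horner_coef -sumrB; apply: vgt_sum => i _; rewrite -mulrBr -[0]addr0.
    apply: vge_gtM; first by rewrite coef_map_id0 //; exact: vge_nat.
    rewrite subrXX -[0]addr0; apply: vgt_geM; first by rewrite -vgtN opprB.
    by apply: vge_sum => j _; rewrite -[0]addr0; apply: vgeM; exact: vgeX0.
  by rewrite (rootP rth) subr0.
have [lg lgP] : {lg : E -> nat & forall x, x != 0 -> x = g ^+ lg x}.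
  apply: (@choice _ _ (fun x i => x != 0 -> x = g ^+ i)) => x.
  have [->|x0] := eqVneq x 0; first by exists 0%N.
  by have [i ->] := prim_rootP prim_g (expf_card1 x0); exists i.
pose rep x : {poly 'F_p} := if x == 0 then 0 else 'X^(lg x).
pose T x : Qpbar K := if x == 0 then 0 else om ^+ lg x.
have evrep x : evFp g (rep x) = x.
  rewrite /rep; have [->|x0] := eqVneq x 0; first exact: evFp0.
  by rewrite (evFpXn charE) -lgP.
have Trep x : evC om (rep x) = T x.
  by rewrite /rep /T; case: ifP => _; rewrite ?evC0 ?evC_Xn.
have omE i j : g ^+ i = g ^+ j -> om ^+ i = om ^+ j.
  move=> /eqP; rewrite (eq_prim_root_expr prim_g) => /eqP e.
  by rewrite -(expr_mod i oN) e expr_mod.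
exists T; split.
- by rewrite /T eqxx.
- rewrite /T oner_eq0 -(expr0 om); apply: omE; by rewrite expr0 -lgP // oner_neq0.
- move=> x y; rewrite /T mulf_eq0; have [//|x0] := eqVneq x 0; first by rewrite mul0r.
  have [//|y0] := eqVneq y 0; first by rewrite mulr0.
  by rewrite /= -exprD; apply: omE; rewrite exprD -!lgP // mulf_neq0.
move=> x y; rewrite -!Trep.
have /dvdpP[k ek] : h %| rep (x + y) - (rep x + rep y).
  by apply: hdiv; rewrite (evFpB charE) (evFpD charE) !evrep subrr.
have e3 : vgt 0 (evC om (rep (x + y) - (rep x + rep y))).
  by rewrite ek; apply: evC_dvd hom _ => //; exact: dvdp_mull.
have e4 := evC_add p_pr (rep (x + y) - (rep x + rep y)) (rep x + rep y) om0.
rewrite subrK in e4; have e5 := evC_add p_pr (rep x) (rep y) om0.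
move: e3 (vge_gt (ltr01) e4) (vge_gt (ltr01) e5).
set A := evC om (_ - _); set B := evC om (rep x + rep y); set D := evC om (rep (x + y)); set X := evC om (rep x); set Y := evC om (rep y).
move=> e3' e4' e5'; have -> : D - (X + Y) = A + ((D - (A + B)) + (B - (X + Y))) by ring.
by apply: vgtD => //; apply: vgtD.
Qed.

End Teichmuller.

(** * Closed points and their geometric points *)

Section ResidueField.
Variables (p : nat) (p_pr : prime p) (h : closed_point p).
Local Notation F := (residue_field h).
Local Notation q := (in_qpoly (val h)).

Lemma residue_ev f : evFp (residue_coord h) f = q f :> F.
Proof.
rewrite -[in RHS](coefK f) poly_def /evFp raddf_sum; apply: eq_bigr => i _.
have : q (f`_i *: 'X^i) = f`_i *: (q 'X ^+ i) by rewrite in_qpolyZ rmorphXn.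
move=> e; apply: esym; apply: etrans e _.
by rewrite -[X in X *: _](natr_Zp f`_i) scaler_nat mulr_natl.
Qed.

Lemma residue_eq0 f : (q f == 0) = (val h %| f).
Proof.
have mi := closed_point_mi h; have mE : mk_monic (val h) = val h by exact: mk_monicE mi.
apply/eqP/idP => [/val_eqP /= | hD].
  by rewrite mE -Pdiv.IdomainMonic.modpE //; case: mi.
by apply/val_eqP; rewrite /= mE -Pdiv.IdomainMonic.modpE //; case: mi.
Qed.

Lemma residue_val (x : F) : q (val x) = x.
Proof.
apply/val_inj; apply: in_qpoly_small.
exact: (leq_ltn_trans (size_npoly x)) || by rewrite (leq_ltn_trans (size_npoly x)) // prednK // size_mk_monic_gt0.
Qed.

Lemma residue_card : #|F| = (p ^ closed_point_deg h)%N.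
Proof. by rewrite card_qfpoly card_Fp. Qed.

End ResidueField.

Lemma evFp_frob (p : nat) (E : finFieldType) (charE : p \in [pchar E]) (y : E) (f : {poly 'F_p}) i :
  evFp (y ^+ (p ^ i)) f = evFp y f ^+ (p ^ i).
Proof.
rewrite (frob_sum charE); apply: eq_bigr => j _.
by rewrite exprMn (frob_nat charE) -!exprM mulnC.
Qed.

Section ClosedPointRoots.
Variables (p : nat) (p_pr : prime p) (E : finFieldType) (charE : p \in [pchar E]).
Implicit Types (h : closed_point p) (y : E) (f : {poly 'F_p}).

Lemma closed_point_dvd h y f : evFp y (val h) = 0 -> evFp y f = 0 -> val h %| f.
Proof.
move=> h0 f0; have [[hs hirr] _] := closed_point_mi h.
apply/negPn/negP => nhf; have : coprimep (val h) f by rewrite irreducible_poly_coprime.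
rewrite -(coprimep_map (embFp charE)) => cp.
have := coprimep_root cp (_ : root _ y); rewrite -(evFpE charE) f0 eqxx => /(_ _)/negP; apply => //.
by rewrite /root -evFpE h0.
Qed.

Lemma closed_point_root_neq0 h y : evFp y (val h) = 0 -> y != 0.
Proof.
move=> h0; apply/eqP => y0; have hX : val h %| 'X.
  by apply: (closed_point_dvd h0); rewrite (evFpX charE).
have [hirr hm] := closed_point_mi h.
have /eqP hn : val h != 'X by case: h {h0 hX hirr hm} => /= h /andP[].
apply: hn; apply/eqP; rewrite -eqp_monic ?monicX //.
have irrX : irreducible_poly ('X : {poly 'F_p}) by rewrite -['X]subr0 -polyC0; exact: irredp_XsubC.
by apply: irrX => //; rewrite gtn_eqF //; case: hirr.
Qed.

Lemma closed_point_uniq h h' y : evFp y (val h) = 0 -> evFp y (val h') = 0 -> h = h'.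
Proof.
move=> r r'; apply/val_inj/eqP; rewrite -eqp_monic ?(closed_point_mi _).2 //.
by rewrite /eqp (closed_point_dvd r r') (closed_point_dvd r' r).
Qed.

Lemma exists_closed_point y : y != 0 -> exists h, evFp y (val h) = 0.
Proof.
move=> y0; have [h [hm hs h0 hd]] := exists_min_poly charE y.
have hirr : irreducible_poly h.
  split=> // q q1 /dvdpP[r hr].
  have qn0 : q != 0 by apply: contraTneq hm => q0; rewrite hr q0 mulr0 monicE lead_coef0 eq_sym oner_eq0.
  have rn0 : r != 0 by apply: contraTneq hm => r0; rewrite hr r0 mul0r monicE lead_coef0 eq_sym oner_eq0.
  have : evFp y r * evFp y q = 0 by rewrite -(evFpM charE) -hr.
  move=> /eqP; rewrite mulf_eq0 => /orP[/eqP/hd|/eqP/hd hq]; last first.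
    by rewrite /eqp hq hr dvdp_mull.
  move=> /dvdp_leq -/(_ rn0); rewrite hr size_mul // => hle.
  move: q1 hle; rewrite -(size_poly_gt0) in qn0; rewrite -size_poly_gt0 in rn0.
  case: (size q) qn0 => [|[|s]] // _ _; rewrite !addnS /= => hle.
  by move: hle; rewrite ltnNge leq_addr.
have hX : h != 'X.
  by apply: contra_neq y0 => hX; move: h0; rewrite hX (evFpX charE).
have hP : `[< irreducible_poly h >] && (h \is monic) && (h != 'X).
  by rewrite hm hX !andbT; apply/asboolP.
by exists (exist _ h hP).
Qed.

Variables (m : nat) (cE : #|E| = (p ^ m)%N).

Lemma Xcard_root y : @evFp p E y ('X^(p ^ m) - 'X) = 0.
Proof. by rewrite (evFpB charE) (evFpXn charE) (evFpX charE) -cE expf_card subrr. Qed.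

Lemma residue_frob h k (x : residue_field h) : x ^+ ((p ^ closed_point_deg h) ^ k) = x.
Proof.
elim: k => [|k IH]; first by rewrite expr1.
by rewrite expnS exprM -residue_card // expf_card residue_card.
Qed.

(** As h divides X^(p^m) - X, the p^m-th power is the identity on the residue field, and so is the
    p^r-th power for r = m mod d. If r > 0, the polynomial X^(p^r) - X would have p^d roots. *)
Lemma root_deg h y : (0 < m)%N -> evFp y (val h) = 0 -> (closed_point_deg h %| m)%N.
Proof.
move=> m0 h0; set d := closed_point_deg h; have d0 : (0 < d)%N := closed_point_deg_gt0 h.
have cF := pchar_residue_field p_pr h.
have hx (x : residue_field h) : x ^+ (p ^ m) = x.
  rewrite -(residue_val x) -residue_ev -(evFp_frob cF).
  have : @evFp p (residue_field h) (residue_coord h) ('X^(p ^ m) - 'X) = 0.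
    by apply/eqP; rewrite residue_ev residue_eq0; exact: closed_point_dvd h0 (Xcard_root y).
  by rewrite (evFpB cF) (evFpXn cF) (evFpX cF) => /eqP; rewrite subr_eq0 => /eqP ->.
have hr (x : residue_field h) : x ^+ (p ^ (m %% d)) = x.
  rewrite -[in RHS](hx x) [in RHS](divn_eq m d) expnD [(_ %/ _ * _)%N]mulnC expnM exprM.
  by rewrite (residue_frob (m %/ d) x).
rewrite /dvdn; apply/negPn/negP => r0; rewrite -lt0n in r0.
pose P : {poly residue_field h} := 'X^(p ^ (m %% d)) - 'X.
have pr1 : (1 < p ^ (m %% d))%N by rewrite -(exp1n (m %% d)) ltn_exp2r ?prime_gt1.
have sP : size P = (p ^ (m %% d)).+1.
  by rewrite size_polyDl size_polyXn // size_polyN size_polyX ltnS.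
have Pn0 : P != 0 by rewrite -size_poly_gt0 sP.
have : (#|residue_field h| < size P)%N.
  rewrite cardE; apply: (max_poly_roots Pn0 _ (enum_uniq _)).
  by apply/allP => x _; rewrite /root !hornerE hr subrr.
by rewrite residue_card // sP ltnS leqNgt ltn_exp2l ?prime_gt1 // ltn_mod d0.
Qed.

Lemma card_roots h : (closed_point_deg h %| m)%N ->
  #|[pred y : E | evFp y (val h) == 0]| = closed_point_deg h.
Proof.
move=> /dvdnP[k mk]; have cF := pchar_residue_field p_pr h.
have hX : val h %| 'X^(p ^ m) - 'X.
  rewrite -residue_eq0 -residue_ev (evFpB cF) (evFpXn cF) (evFpX cF).
  by rewrite mk mulnC expnM residue_frob subrr.
have eX : map_poly (embFp charE) ('X^(p ^ m) - 'X) = 'X^(p ^ m) - 'X.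
  by rewrite rmorphB; congr (_ - _); [exact: map_polyXn | exact: map_polyX].
rewrite -(dvdp_map (embFp charE)) eX -cE finField_genPoly in hX.
have [t ht] := dvdp_prod_XsubC hX.
have um : uniq (mask t (index_enum E)) by rewrite mask_uniq // index_enum_uniq.
have -> : closed_point_deg h = size (mask t (index_enum E)).
  by rewrite /closed_point_deg -(size_map_poly (embFp charE)) (eqp_size ht) size_prod_XsubC.
rewrite -(card_uniqP um); apply: eq_card => y; rewrite inE -root_prod_XsubC -(eqp_root ht).
by rewrite /root -evFpE.
Qed.

(** A closed point whose degree d divides m has exactly d roots in E, and a nonzero element of E is
    a root of exactly one closed point. *)
Lemma sum_closed_points (V : pzSemiRingType) (G : closed_point p -> V) (H : E -> V) : (0 < m)%N ->
  (forall h y, evFp y (val h) = 0 -> H y = G h) ->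
  \sum_(h <- points p m) (if (closed_point_deg h %| m)%N then (closed_point_deg h)%:R * G h else 0) =
  \sum_(y : E | y != 0) H y.
Proof.
move=> m0 HG; transitivity (\sum_(h <- points p m) \sum_(y : E | (y != 0) && (evFp y (val h) == 0)) H y).
  apply: eq_bigr => h _; rewrite (eq_bigr (fun=> G h)); last first.
    by move=> y /andP[_ /eqP]; exact: HG.
  rewrite (eq_bigl [pred y : E | evFp y (val h) == 0]); last first.
    move=> y; apply: andb_idl => /eqP; exact: closed_point_root_neq0.
  rewrite sumr_const; case: ifP => [dm|dm]; first by rewrite card_roots // mulr_natl.
  rewrite eq_card0 ?mulr0n // => y; apply/negP => /eqP /(root_deg m0).
  by rewrite dm.
rewrite (exchange_big_dep (fun y : E => y != 0)) /=; last by move=> h y _ /andP[].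
apply: eq_bigr => y y0; have [h hy] := exists_closed_point y0.
have hin : h \in points p m.
  by rewrite mem_points dvdn_leq //; exact: root_deg hy.
rewrite big_mkcond (bigD1_seq h) ?uniq_points //= y0 hy eqxx.
rewrite big1 ?addr0 // => h' hh'; case: ifP => // /eqP hy'.
by rewrite (closed_point_uniq hy' hy) eqxx in hh'.
Qed.

End ClosedPointRoots.

Lemma fixed_Fp (p : nat) (p_pr : prime p) (E : finFieldType) (charE : p \in [pchar E]) (a : E) :
  a ^+ p = a -> exists k : 'F_p, a = embFp charE k.
Proof.
move=> ap; apply: contrapT => hn.
pose P : {poly E} := 'X^p - 'X; have p1 := prime_gt1 p_pr.
have sP : size P = p.+1 by rewrite size_polyDl size_polyXn // size_polyN size_polyX ltnS.
have Pn0 : P != 0 by rewrite -size_poly_gt0 sP.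
pose t := a :: [seq embFp charE k | k <- enum 'F_p].
have ut : uniq t.
  have inj : injective (embFp charE) by exact: fmorph_inj.
  rewrite /= (map_inj_uniq inj) enum_uniq andbT.
  by apply/negP => /mapP[k _ ak]; apply: hn; exists k.
have : (size t < size P)%N.
  apply: (max_poly_roots Pn0) ut; apply/allP => x; rewrite inE /root !hornerE => /orP[/eqP->|/mapP[k _ ->]].
    by rewrite ap subrr.
  by rewrite embFpE -[X in _ ^+ X]expn1 (frob_nat charE) subrr.
by rewrite /= size_map -cardE card_Fp // sP ltnn.
Qed.

Section TeichmullerConj.
Variables (p : nat) (p_pr : prime p) (K : padic_closure p).
Variables (E E' : finFieldType) (T : E -> Qpbar K) (T' : E' -> Qpbar K).
Hypotheses (TT : is_teichmuller T) (TT' : is_teichmuller T').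
Variables (charE : p \in [pchar E]) (charE' : p \in [pchar E']).

Let evT z (Q : {poly E}) := \sum_(i < size Q) T Q`_i * z ^+ i.

Lemma evT_widen z (Q : {poly E}) W : (size Q <= W)%N -> evT z Q = \sum_(i < W) T Q`_i * z ^+ i.
Proof.
move=> QW; rewrite /evT (big_ord_widen _ (fun i => T Q`_i * z ^+ i) QW) [RHS](bigID (fun i : 'I_W => i < size Q)%N) /=.
rewrite [X in _ + X]big1 ?addr0 // => i; rewrite -leqNgt => /(nth_default 0) ->.
by case: TT => -> _ _ _; rewrite mul0r.
Qed.

Lemma evT_mulXsub z a (Q : {poly E}) : vge 0 z ->
  vgt 0 (evT z (('X - a%:P) * Q) - (z - T a) * evT z Q).
Proof.
move=> z0; have [T0 T1 TM Tadd] := TT; set W := size Q.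
have sW : (size (('X - a%:P) * Q)%R <= W.+1)%N.
  by apply: leq_trans (size_polyMleq _ _) _; rewrite size_XsubC.
rewrite (evT_widen z sW).
have -> : (z - T a) * evT z Q = \sum_(i < W.+1) (T (Q * 'X)`_i - T a * T Q`_i) * z ^+ i.
  under eq_bigr => i _ do rewrite mulrBl -mulrA.
  rewrite sumrB -mulr_sumr -(evT_widen z (leqnSn W)) mulrBl; congr (_ - _).
  rewrite big_ord_recl coefMX T0 mul0r add0r /evT mulr_sumr; apply: eq_bigr => i _.
  by rewrite coefMX /= /bump /= add1n exprS mulrCA.
rewrite -sumrB; apply: vgt_sum => i _; rewrite -mulrBl -[0]addr0; apply: vgt_geM (vgeX0 _ z0).
by rewrite mulrBl coefB coefCM mulrC -TM; exact: teich_sub.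
Qed.

(* Modulo the maximal ideal, [T' y'] is a root of the lift of h, whose roots are *)
(* the conjugates of [T y].                                                      *)
Lemma teich_conj (h : closed_point p) y y' :
  evFp y (val h) = 0 -> evFp y' (val h) = 0 -> exists i, T' y' = T y ^+ (p ^ i).
Proof.
move=> hy hy'; have [[//|m'] m0 cE] := card_pchar charE; set m := m'.+1 in cE.
have y0 := closed_point_root_neq0 charE hy; have y0' := closed_point_root_neq0 charE' hy'.
pose P : {poly E} := \prod_(i < m) ('X - (y ^+ (p ^ i))%:P).
have Pfix : map_poly (pFrobenius_aut charE) P = P.
  rewrite rmorph_prod /=; under eq_bigr => i _ do rewrite rmorphB /= map_polyX map_polyC /= pFrobenius_autE -exprM -expnSr.
  rewrite /P /m big_ord_recr big_ord_recl /= mulrC -[m'.+1]/m -cE expf_card expn0 expr1.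
  by congr (_ * _); apply: eq_bigr => i _.
have [c hc] : {c : nat -> 'F_p & forall i, P`_i = embFp charE (c i)}.
  apply: (@choice _ _ (fun i k => P`_i = embFp charE k)) => i; apply: (fixed_Fp p_pr).
  by rewrite -[in RHS]Pfix coef_map /= pFrobenius_autE.
pose P0 : {poly 'F_p} := \poly_(i < size P) c i.
have P0E : map_poly (embFp charE) P0 = P.
  apply/polyP => i; rewrite coef_map coef_poly; case: ltnP => iP; first by rewrite hc.
  by rewrite (nth_default _ iP); exact: rmorph0.
have P0y : evFp y P0 = 0.
  by rewrite (evFpE charE) P0E /P /m big_ord_recl hornerM hornerXsubC expn0 expr1 subrr mul0r.
have hP0 : evFp y' P0 = 0.
  by have /dvdpP[q ->] := closed_point_dvd charE hy P0y; rewrite (evFpM charE') hy' mulr0.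
pose z := T' y'; have z0 : vge 0 z by exact: teich_vge0.
have e1 : vgt 0 (evC z P0).
  have := teich_evC TT' y' P0; rewrite hP0; case: (TT') => -> _ _ _.
  by rewrite subr0.
have e2 : vgt 0 (evT z P - evC z P0).
  have sP0 : (size P0 <= size P)%N by exact: size_poly.
  rewrite (evC_widen z sP0) -sumrB; apply: vgt_sum => i _; rewrite -mulrBl -[0]addr0.
  apply: vgt_geM (vgeX0 _ z0); rewrite hc embFpE coef_poly ltn_ord.
  exact: teich_nat TT _.
have e3 : vgt 0 (evT z P - \prod_(i < m) (z - T y ^+ (p ^ i))).
  rewrite /P; elim: (m) => [|k IH].
    by rewrite !big_ord0 /evT size_poly1 big_ord1 coefC eqxx expr0 mulr1; case: (TT) => _ -> _ _; rewrite subrr vgt0.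
  rewrite !big_ord_recr /= mulrC [X in _ - X]mulrC; set Q := \prod_(i < k) _ in IH *; set R := \prod_(i < k) _ in IH *.
  rewrite -(teichX TT) in IH *.
  have h1 := evT_mulXsub (y ^+ (p ^ k)) Q z0; set b := z - T _ in h1 *.
  have -> : evT z (('X - (y ^+ (p ^ k))%:P) * Q) - b * R =
    (evT z (('X - (y ^+ (p ^ k))%:P) * Q) - b * evT z Q) + b * (evT z Q - R) by ring.
  apply: vgtD => //; rewrite -[0]addr0; apply: vge_gtM IH; apply: vgeB => //; exact: teich_vge0.
have : vgt 0 (\prod_(i < m) (z - T y ^+ (p ^ i))).
  have -> : \prod_(i < m) (z - T y ^+ (p ^ i)) = evC z P0 + (evT z P - evC z P0) + - (evT z P - \prod_(i < m) (z - T y ^+ (p ^ i))) by ring.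
  by apply: vgtD; [exact: vgtD | rewrite vgtN].
move=> /vgt_prod [i|i hi]; first by apply: vgeB => //; apply: vgeX0; exact: teich_vge0.
exists i; have N0 : (0 < #|E|.-1 * #|E'|.-1)%N by rewrite muln_gt0 !card_pred_gt0.
apply: (root1_cong p_pr) (N0) _ _ hi.
- by rewrite coprimeMr !coprime_card_pred.
- by rewrite mulnC exprM (teich_root TT') ?expr1n.
by rewrite exprAC exprM (teich_root TT) ?expr1n.
Qed.

End TeichmullerConj.

(** * Kloosterman sums as traces *)

Section Spread.
Variable R : comNzRingType.
Implicit Types (f g h : {poly R}) (q b d : nat).

(** For b = 0 this is the operator usually called psi_q or U_q. *)
Definition sect q b h : {poly R} := \poly_(u < size h) h`_(q * u + b).

Lemma coef_sect q b h u : (0 < q)%N -> (sect q b h)`_u = h`_(q * u + b).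
Proof.
move=> q0; rewrite coef_poly; case: ltnP => // hu; rewrite nth_default //.
by apply: leq_trans hu _; rewrite (leq_trans (leq_pmull u q0)) // leq_addr.
Qed.

Lemma sect_spread q b f g : (b < q)%N -> sect q b ((f \Po 'X^q) * g) = f * sect q b g.
Proof.
move=> bq; have q0 : (0 < q)%N by exact: leq_ltn_trans bq.
apply/polyP => u; rewrite coef_sect //; elim/poly_ind: f u => [|f c IH] u.
  by rewrite comp_poly0 !mul0r !coef0.
rewrite comp_polyD comp_polyM comp_polyX comp_polyC !mulrDl !coefD !coefCM coef_sect //; congr (_ + _).
have -> : f * 'X * sect q b g = f * sect q b g * 'X by ring.
have -> : (f \Po 'X^q) * 'X^q * g = (f \Po 'X^q) * g * 'X^q by ring.
rewrite coefMXn coefMX; case: u => [|u]; first by rewrite muln0 add0n bq.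
by rewrite mulnS -addnA ltnNge leq_addr /= addKn IH.
Qed.

Lemma sect_comp q b q' d g : (0 < q)%N -> (0 < q')%N ->
  sect q' d (sect q b g) = sect (q' * q) (q * d + b) g.
Proof.
move=> q0 q0'; apply/polyP => u; rewrite !coef_sect ?muln_gt0 ?q0' //.
by congr (g`_ _); rewrite mulnDr mulnA [(q * q')%N]mulnC addnA.
Qed.

End Spread.

Lemma sum_ord_mul (V : nmodType) m q (F : nat -> V) :
  \sum_(j < m * q) F j = \sum_(v < m) \sum_(I < q) F (q * v + I)%N.
Proof.
elim: m => [|m IH]; first by rewrite !big_ord0.
rewrite big_ord_recr -IH mulSnr big_split_ord /=; congr (_ + _).
by apply: eq_bigr => I _; rewrite mulnC.
Qed.

Section Gauge.
Variables (p m D : nat) (p_gt1 : (1 < p)%N) (mD : (D <= p.-1 * m)%N).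
Variables (F : fieldType) (ga : F) (ga0 : ga != 0) (e : nat -> F).
Hypothesis e_cut : forall a, (D <= a)%N -> e a = 0.
Implicit Types (h : {poly F}) (d : nat) (es : seq nat).
Let p0 : (0 < p)%N := ltnW p_gt1.

Definition theta : {poly F} := \poly_(a < D) (e a * ga ^+ a).

Fixpoint thetaN k : {poly F} := if k is k'.+1 then (theta \Po 'X^(p ^ k')) * thetaN k' else 1.

Lemma coef_theta a : theta`_a = e a * ga ^+ a.
Proof. by rewrite coef_poly; case: ltnP => // h; rewrite e_cut ?mul0r. Qed.

Fixpoint Thetas es h : {poly F} := if es is d :: es' then sect p d (theta * Thetas es' h) else h.

Lemma dval_lt es : all (fun d => d < p)%N es -> (dval p es < p ^ size es)%N.
Proof.
elim: es => [//|d es IH] /= /andP[dp /IH h]; rewrite expnS.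
apply: leq_trans (_ : d.+1 * p ^ size es <= _)%N; last by rewrite leq_mul2r dp orbT.
by rewrite mulSn addnC ltn_add2r.
Qed.

Lemma sect1 h : sect 1 0 h = h.
Proof. by apply/polyP => u; rewrite coef_sect // mul1n addn0. Qed.

Lemma ThetasE es h : all (fun d => d < p)%N es ->
  Thetas es h = sect (p ^ size es) (dval p es) (thetaN (size es) * h).
Proof.
elim: es => [|d es IH] /=; first by rewrite mul1r sect1.
move=> /andP[dp hes]; rewrite IH // -sect_spread ?dval_lt // sect_comp ?expn_gt0 ?p0 //.
by rewrite expnS mulrA [(d * _)%N]mulnC.
Qed.

(** Passes from X = ga x back to x, where Frobenius is a plain section of theta times h. *)
Definition gauge h := h \Po (ga *: 'X).

Lemma coef_gauge h u : (gauge h)`_u = ga ^+ u * h`_u.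
Proof.
rewrite /gauge comp_polyE coef_sum (eq_bigr (fun i : 'I_(size h) => h`_i * ga ^+ i * ((i : nat) == u)%:R)); last first.
  by move=> i _; rewrite coefZ exprZn coefZ coefXn mulrA eq_sym.
case: (ltnP u (size h)) => hu.
  rewrite (bigD1 (Ordinal hu)) //= eqxx mulr1 big1 ?addr0; first exact: mulrC.
  by move=> i; rewrite -val_eqE /= => /negPf ->; rewrite mulr0.
rewrite nth_default // mulr0 big1 // => i _.
by rewrite ltn_eqF ?mulr0 // (leq_trans (ltn_ord i)).
Qed.

Lemma gauge_Aop d h : (size h <= m)%N -> ga ^+ d *: gauge (Aop p m ga e d h) = sect p d (theta * gauge h).
Proof.
move=> hm; apply/polyP => u; rewrite coefZ coef_gauge coef_poly coef_sect // coefM.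
have -> : \sum_(j < (p * u + d).+1) theta`_j * (gauge h)`_(p * u + d - j) =
  ga ^+ (p * u + d) * \sum_(v < (p * u + d).+1) h`_v * e (p * u + d - v)%N.
  rewrite (reindex_inj rev_ord_inj) mulr_sumr; apply: eq_bigr => v _ /=.
  have hv : (v <= p * u + d)%N by rewrite -ltnS.
  rewrite subSS subKn // coef_theta coef_gauge -[in ga ^+ (p * u + d)](subnK hv) exprD; ring.
case: ltnP => um.
  rewrite !mulrA -!exprD; congr (ga ^+ _ * _).
  by case: (p) p0 => //= p' _; rewrite mulSn; lia.
rewrite mulr0 mulr0 big1 ?mulr0 // => v _.
have [hv|hv] := ltnP v (size h); last by rewrite nth_default ?mul0r.
rewrite e_cut ?mulr0 //; apply: leq_trans mD _.
have : (p.-1 * m + m <= p * u)%N by rewrite -mulSnr prednK // leq_mul2l um orbT.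
by move: (leq_trans hv hm); lia.
Qed.

Lemma size_Aops es h : (size h <= m)%N -> (size (Aops p m ga e es h) <= m)%N.
Proof. by case: es => [|d es] hm //=; exact: size_poly. Qed.

Lemma gauge_Aops es h : (size h <= m)%N ->
  ga ^+ sumn es *: gauge (Aops p m ga e es h) = Thetas es (gauge h).
Proof.
move=> hm; elim: es => [|d es IH] /=; first by rewrite scale1r.
rewrite -IH exprD mulrC -scalerA gauge_Aop ?size_Aops // -scalerAr.
by apply/polyP => u; rewrite !(coefZ, coef_sect).
Qed.

Lemma ptr_Aops es : all (fun d => d < p)%N es ->
  ga ^+ sumn es * ptr m (Aops p m ga e es) =
  \sum_(v < m) (thetaN (size es))`_((p ^ size es).-1 * v + dval p es).
Proof.
move=> hes; rewrite /ptr mulr_sumr; apply: eq_bigr => v _.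
have sv : (size ('X^v : {poly F}) <= m)%N by rewrite size_polyXn.
have /(congr1 (fun h : {poly F} => h`_v)) := gauge_Aops es sv.
have gX : gauge 'X^v = ga ^+ v *: 'X^v by rewrite /gauge comp_Xn_poly exprZn.
rewrite coefZ coef_gauge gX ThetasE // coef_sect ?expn_gt0 ?p0 // -scalerAr coefZ mulrCA.
move=> /(mulfI (expf_neq0 v ga0)) ->.
have hq : (p ^ size es * v + dval p es = ((p ^ size es).-1 * v + dval p es) + v)%N.
  by rewrite addnAC -mulSnr prednK // expn_gt0 p0.
by rewrite hq coefMXn ltnNge leq_addl /= addnK.
Qed.

Lemma size_thetaN k : (0 < D)%N -> (p.-1 * (size (thetaN k)).-1 <= D.-1 * (p ^ k).-1)%N.
Proof.
move=> D0; elim: k => [|k IH] /=; first by rewrite size_poly1 /= muln0.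
have q0 : (0 < p ^ k)%N by rewrite expn_gt0 p0.
have s1 : ((size (theta \Po 'X^(p ^ k))).-1 <= D.-1 * p ^ k)%N.
  rewrite size_comp_poly size_polyXn leq_mul2r -!subn1; apply/orP; right.
  by rewrite leq_sub2r // size_poly.
have s2 : ((size ((theta \Po 'X^(p ^ k)) * thetaN k)%R).-1 <= (size (theta \Po 'X^(p ^ k))).-1 + (size (thetaN k)).-1)%N.
  have := size_polyMleq (theta \Po 'X^(p ^ k)) (thetaN k).
  set A := (_ * thetaN k)%R; set B := _ \Po _.
  by move: (size A) (size B) (size (thetaN k)) => a b c; lia.
apply: leq_trans (leq_mul (leqnn p.-1) s2) _; rewrite mulnDr.
apply: leq_trans (leq_add (leq_mul (leqnn _) s1) IH) _.
rewrite expnS; move: q0 p0; case: (p ^ k)%N => [//|q] _; case: (p) => [//|p'] _.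
by have -> : (p'.+1 * q.+1).-1 = (p' * q.+1 + q)%N; nia.
Qed.

(** The I-th Fourier coefficient of [thetaN] on the roots of unity of order p^k - 1, that is, an
    approximate Gauss sum divided by p^k - 1. *)
Definition csum k I := \sum_(v < m) (thetaN k)`_((p ^ k).-1 * v + I).

Lemma horner_thetaN k t : (0 < D)%N -> (0 < k)%N -> t ^+ (p ^ k).-1 = 1 ->
  (thetaN k).[t] = \sum_(I < (p ^ k).-1) csum k I * t ^+ I.
Proof.
move=> D0 k0 tq; set q := (p ^ k).-1 in tq *.
have q0 : (0 < q)%N by rewrite /q -subn1 subn_gt0 -(exp1n k) ltn_exp2r.
have p10 : (0 < p.-1)%N by rewrite -subn1 subn_gt0.
have sz : (size (thetaN k) <= m * q)%N.
  have h : (p.-1 * (size (thetaN k)).-1 < p.-1 * (m * q))%N.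
    apply: leq_ltn_trans (size_thetaN k D0) _; rewrite -/q mulnA ltn_mul2r q0 /=.
    by apply: leq_trans mD; rewrite prednK.
  by move: h; rewrite ltn_mul2l p10 /=; lia.
rewrite (horner_coef_wide _ sz) (sum_ord_mul m q (fun j => (thetaN k)`_j * t ^+ j)) exchange_big; apply: eq_bigr => I _.
rewrite /csum mulr_suml; apply: eq_bigr => v _.
by rewrite exprD exprM tq expr1n mul1r.
Qed.

End Gauge.

Section CharacterSums.
Variables (p : nat) (p_pr : prime p) (K : padic_closure p).
Variables (E : finFieldType) (T : E -> Qpbar K) (TT : is_teichmuller T).
Local Notation Q := #|E|.

Lemma sum_teich (I J : 'I_Q.-1) :
  \sum_(x : E | x != 0) T x ^+ J * (T x ^+ I)^-1 = (if I == J then Q.-1%:R else 0 : Qpbar K).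
Proof.
case: eqP => [->|/eqP IJ].
  rewrite (eq_bigr (fun=> 1)) => [|x x0]; last by rewrite mulfV // expf_neq0 // (teich_neq0 TT).
  rewrite sumr_const; congr (_%:R); rewrite -(cardC1 0); exact: eq_card.
have [g pg] := exists_prim_root E.
have g0 : g != 0 by apply: contraTneq (oner_neq0 E) => g0; rewrite -(prim_expr_order pg) g0 expr0n gtn_eqF ?card_pred_gt0 ?eqxx.
set S := \sum_(x | _) _; have eS : S = T g ^+ J * (T g ^+ I)^-1 * S.
  rewrite mulr_sumr /S (reindex_inj (mulfI g0)) /=; apply: eq_big => [x|x _].
    by rewrite mulf_eq0 (negPf g0).
  case: (TT) => _ _ -> _; rewrite !exprMn invfM; ring.
have : (1 - T g ^+ J * (T g ^+ I)^-1) * S = 0 by rewrite mulrBl mul1r -eS subrr.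
move=> /eqP; rewrite mulf_eq0 => /orP[|/eqP //]; rewrite subr_eq0 => /eqP e1.
have : T (g ^+ J) = T (g ^+ I).
  rewrite !(teichX TT); apply: (mulIf (_ : (T g ^+ I)^-1 != 0)).
    by rewrite invr_eq0 expf_neq0 // (teich_neq0 TT).
  by rewrite -e1 mulfV // expf_neq0 // (teich_neq0 TT).
move=> /(teich_inj TT) /eqP; rewrite (eq_prim_root_expr pg) !modn_small //.
by rewrite val_eqE eq_sym (negPf IJ).
Qed.

(** Fourier expansion on the multiplicative group: the convolution of n+1 equal functions raises the
    coefficients to the power n+1, and every free variable contributes a factor Q - 1. *)
Lemma kloosterman_poly (n : nat) (c : nat -> Qpbar K) (Phi : Qpbar K -> Qpbar K) (y : E) :
  y != 0 -> (forall t, t ^+ Q.-1 = 1 -> Phi t = \sum_(I < Q.-1) c I * t ^+ I) ->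
  \sum_(x : {ffun 'I_n -> E} | [forall i, x i != 0])
     (\prod_i Phi (T (x i))) * Phi (T (y / \prod_i x i)) =
  Q.-1%:R ^+ n * \sum_(I < Q.-1) c I ^+ n.+1 * T y ^+ I.
Proof.
move=> y0 hPhi.
transitivity (\sum_(I < Q.-1) c I * T y ^+ I * \prod_(i < n) \sum_(x : E | x != 0) Phi (T x) * (T x ^+ I)^-1).
  rewrite (eq_bigr (fun x : {ffun 'I_n -> E} => \sum_(I < Q.-1) c I * T y ^+ I * \prod_i (Phi (T (x i)) * (T (x i) ^+ I)^-1))); last first.
    move=> x /forallP hx; have xn0 : \prod_i x i != 0 by apply/prodf_neq0.
    have yx0 : y / \prod_i x i != 0 by rewrite mulf_neq0 ?invr_eq0.
    rewrite [in X in _ * X]hPhi ?(teich_root TT) // mulr_sumr; apply: eq_bigr => I _.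
    rewrite big_split /= prodfV.
    have -> : \prod_i T (x i) ^+ I = T (\prod_i x i) ^+ I.
      by rewrite (big_morph T (id1 := 1) (op1 := *%R)) ?prodrXl //; case: (TT).
    have eT : T y = T (y / \prod_i x i) * T (\prod_i x i).
      by case: (TT) => _ _ <- _; rewrite divfK.
    have n0 : T (\prod_i x i) ^+ I != 0 by rewrite expf_neq0 // (teich_neq0 TT).
    by rewrite [in RHS]eT exprMn; field.
  rewrite exchange_big; apply: eq_bigr => I _; rewrite -mulr_sumr; congr (_ * _).
  rewrite bigA_distr_big; apply: eq_bigl => x.
  by apply/forallP/ffun_onP.
rewrite mulr_sumr; apply: eq_bigr => I _.
have -> : \sum_(x | x != 0) Phi (T x) * (T x ^+ I)^-1 = Q.-1%:R * c I.
  rewrite (eq_bigr (fun x => \sum_(J < Q.-1) c J * (T x ^+ J * (T x ^+ I)^-1))); last first.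
    by move=> x x0; rewrite hPhi ?(teich_root TT) // mulr_suml; apply: eq_bigr => J _; rewrite mulrA.
  rewrite exchange_big (bigD1 I) //= -mulr_sumr sum_teich eqxx big1 ?addr0; first exact: mulrC.
  by move=> J JI; rewrite -mulr_sumr sum_teich eq_sym (negPf JI) mulr0.
by rewrite prodr_const card_ord exprMn exprS; ring.
Qed.

End CharacterSums.

Definition cut_series (F : fieldType) D (e : nat -> F) a : F := if (a < D)%N then e a else 0.

(** The sum over an arbitrary finite field: the trace formula ranges over all points of one field,
    not over the extensions of one residue field. *)
Definition kloosterman_gen (p : nat) (Psi : 'F_p -> algC) (n : nat) (E : finFieldType)
    (charE : p \in [pchar E]) (y : E) : algC :=
  \sum_(x : {ffun 'I_n -> E} | [forall i, x i != 0])
    Psi (prime_trace charE (\sum_i x i + y / \prod_i x i)).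

Lemma dwtE (p n : nat) (S : comNzRingType) (ga y : S) es :
  dwt p n ga y es = ga ^+ (n.+1 * sumn es) * y ^+ dval p es.
Proof.
elim: es => [|d es IH] /=; first by rewrite muln0 !expr0 mulr1.
by rewrite IH /cfib exprMn -!exprM mulnDr !exprD [(d * _)%N]mulnC; ring.
Qed.

Section DigitSums.
Variables (p : nat) (p_gt1 : (1 < p)%N).

Lemma dval_max es : all (fun d => d < p)%N es ->
  (dval p es == (p ^ size es).-1) = (es == nseq (size es) p.-1).
Proof.
have p0 := ltnW p_gt1; elim: es => [//|d es IH] /= /andP[dp hes].
have hv := dval_lt hes; rewrite eqseq_cons -(IH hes) expnS.
have q0 : (0 < p ^ size es)%N by rewrite expn_gt0 p0.
move: hv q0 dp p0; move: (p ^ size es)%N (dval p es) => q v hv q0 dp p0.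
apply/eqP/andP => [h|[/eqP -> /eqP ->]].
  have hd : d = p.-1.
    apply/eqP; rewrite eqn_leq; apply/andP; split; first by lia.
    by rewrite leqNgt; apply/negP => hd; nia.
  by rewrite hd; split=> //; apply/eqP; move: h; rewrite hd; nia.
nia.
Qed.

Lemma sum_digs (V : nmodType) N (F : nat -> V) :
  \sum_(es <- digs p N | es != nseq N p.-1) F (dval p es) = \sum_(I < (p ^ N).-1) F I.
Proof.
have q0 : (0 < p ^ N)%N by rewrite expn_gt0 (ltnW p_gt1).
pose G I := if I != (p ^ N).-1 then F I else 0.
transitivity (\sum_(es <- digs p N) G (dval p es)).
  rewrite big_mkcond big_seq [RHS]big_seq; apply: eq_bigr => es.
  by rewrite mem_digs => /andP[/eqP sz hes]; rewrite /G -sz dval_max.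
rewrite -(big_map (dval p) xpredT G) map_dval_digs -[iota 0 _]/(iota 0 _) -{1}[(p ^ N)%N]subn0 big_mkord.
rewrite (big_ord_prev G q0) {2}/G eqxx addr0; apply: eq_bigr => I _; rewrite /G.
by rewrite ltn_eqF.
Qed.

End DigitSums.

Section PsiApproximation.
Variables (p : nat) (p_pr : prime p) (K : padic_closure p).
Variables (iota : {rmorphism algC -> Qpbar K}) (Psi : 'F_p -> algC).
Hypothesis Psi_char : nontrivial_additive_character Psi.
Local Notation u := (unit_val p).
Let p1 : (1 < p)%N := prime_gt1 p_pr.
Let p0 : (0 < p)%N := prime_gt0 p_pr.

(** The uniformizer is dictated by Psi and the embedding, so that Psi takes its values in the local
    field. *)
Definition psi_pi : Qpbar K := iota (Psi 1) - 1.

Lemma Psi_pow (a : 'F_p) : Psi a = Psi 1 ^+ a.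
Proof.
have [Psi0 PsiD _] := Psi_char; rewrite -[in LHS](natr_Zp a); elim: (nat_of_ord a) => [|k IH] //.
by rewrite -addn1 natrD PsiD IH addn1 exprSr.
Qed.

Lemma psi_pi_root : \sum_(i < p) (1 + psi_pi) ^+ i = 0.
Proof.
have -> : 1 + psi_pi = iota (Psi 1) by rewrite /psi_pi; ring.
have Psi1p : Psi 1 ^+ p = 1.
  have [Psi0 PsiD _] := Psi_char; have h k : Psi (k%:R) = Psi 1 ^+ k.
    by elim: k => [|k IH] //; rewrite -addn1 natrD PsiD IH addn1 exprSr.
  by rewrite -h pchar_Fp_0.
have Psi1 : Psi 1 != 1.
  by have [_ _ [a]] := Psi_char; rewrite Psi_pow; apply: contra_neq => ->; rewrite expr1n.
have /eqP : (Psi 1 - 1) * \sum_(i < p) Psi 1 ^+ i = 0 by rewrite -subrX1 Psi1p subrr.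
rewrite mulf_eq0 subr_eq0 (negPf Psi1) /= => /eqP h.
under eq_bigr => i _ do rewrite -rmorphXn.
by rewrite -rmorph_sum h rmorph0.
Qed.

Local Notation pi := psi_pi.

Variables (e : nat -> Qpbar K) (e_exp : is_exp (fun m => (p_power p m)%:R) e).
Variables (ga : Qpbar K) (J D m : nat) (M : rat).
Hypotheses (ga_pi : vge (2 * u) (ga - pi)) (D1 : (1 < D)%N) (DJ : (D <= p ^ J)%N).
Hypotheses (uM : u <= M) (MD : M <= 1 / p%:R * D%:R) (LamM : vge M (Lam J ga)) (J0 : (0 < J)%N).
Hypothesis mD : (D <= p.-1 * m)%N.
Variables (E : finFieldType) (charE : p \in [pchar E]) (N : nat) (cE : #|E| = (p ^ N)%N).
Variables (T : E -> Qpbar K) (TT : is_teichmuller T).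
Local Notation ec := (cut_series D e).
Local Notation thN := (thetaN p D ga ec N).

Lemma ga_neq0' : ga != 0.
Proof. exact: (ga_neq0 p_pr psi_pi_root ga_pi). Qed.

Lemma ec_cut a : (D <= a)%N -> ec a = 0.
Proof. by rewrite /cut_series ltnNge => ->. Qed.

Lemma horner_theta t : (theta D ga ec).[t] = evs D (ser e (ga * t)).
Proof.
rewrite /theta horner_poly; apply: eq_bigr => i _.
by rewrite /ser /cut_series ltn_ord exprMn mulrA.
Qed.

Lemma horner_thetaN_prod k t : (thetaN p D ga ec k).[t] = \prod_(i < k) evs D (ser e (ga * t ^+ (p ^ i))).
Proof.
elim: k => [|k IH] /=; first by rewrite big_ord0 hornerC.
by rewrite hornerM horner_comp hornerXn IH big_ord_recr /= mulrC horner_theta.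
Qed.

(** The conjugates of T x have as sum a lift of the trace of x ([prime_trace_frob]), and raising
    them to the power p permutes them: these are the hypotheses of [splitting_value]. *)
Lemma psi_approx x : vge (M - 1) (thN.[T x] - iota (Psi (prime_trace charE x))).
Proof.
pose ts := [seq T x ^+ (p ^ i) | i <- index_iota 0 N].
pose s := \sum_(i < N) T x ^+ (p ^ i).
have -> : thN.[T x] = \prod_(t <- ts) evs D (ser e (ga * t)).
  by rewrite horner_thetaN_prod big_map big_mkord.
have -> : iota (Psi (prime_trace charE x)) = (1 + pi) ^+ (prime_trace charE x).
  by rewrite Psi_pow rmorphXn /psi_pi addrC subrK.
apply: (splitting_value p_pr psi_pi_root e_exp ga_pi D1 DJ uM MD LamM (s := s)) => //.
- by move=> t /mapP[i _ ->]; apply: vgeX0; exact: teich_vge0.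
- move=> j _; rewrite big_map big_mkord.
  elim: j => [|j IH]; first by apply: eq_bigr => i _; rewrite expn0 expr1.
  rewrite -IH expnS; under eq_bigr => i _ do rewrite exprM -[(_ ^+ (p ^ i)) ^+ p]exprM -expnSr.
  have [N0 |[N' N'E]] : N = 0%N \/ exists N', N = N'.+1 by case: (N) => [|k]; [left | right; exists k].
    by rewrite N0 !big_ord0.
  rewrite N'E big_ord_recr big_ord_recl /= addrC -N'E -cE expn0 expr1 teich_card //; congr (_ + _).
- by apply: leq_trans (ltn_ord (prime_trace charE x)) _; rewrite Fp_cast.
have h := teich_sum TT (index_enum 'I_N) (fun i => x ^+ (p ^ i)).
rewrite -(prime_trace_frob charE x cE) in h.
have h2 := teich_nat TT (nat_of_ord (prime_trace charE x)).
have -> : s = \sum_(i < N) T (x ^+ (p ^ i)) by apply: eq_bigr => i _; rewrite (teichX TT).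
move: h h2; set A := T _; set B := \sum_(i < N) _; set C := _%:R => h h2.
have -> : B - C = - (A - B) + (A - C) by ring.
by apply: vgtD => //; rewrite vgtN.
Qed.

Lemma Psi_sum (I : Type) (t : seq I) (P : pred I) (F : I -> 'F_p) :
  Psi (\sum_(i <- t | P i) F i) = \prod_(i <- t | P i) Psi (F i).
Proof. by have [Psi0 PsiD _] := Psi_char; apply: big_morph. Qed.

Lemma prime_traceD x y : prime_trace charE (x + y) = prime_trace charE x + prime_trace charE y.
Proof.
have inj : injective (embFp charE) by exact: fmorph_inj.
apply: inj; rewrite rmorphD !embFpE !(prime_trace_frob charE _ cE) -big_split.
by apply: eq_bigr => i _; rewrite (frobD charE).
Qed.

Lemma prime_trace0 : prime_trace charE 0 = 0.
Proof. by apply: (addrI (prime_trace charE 0)); rewrite -prime_traceD !addr0. Qed.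

Lemma prime_trace_sum (I : Type) (t : seq I) (P : pred I) (F : I -> E) :
  prime_trace charE (\sum_(i <- t | P i) F i) = \sum_(i <- t | P i) prime_trace charE (F i).
Proof. by apply: big_morph; [exact: prime_traceD | exact: prime_trace0]. Qed.

Lemma thetaN_vge0 t : vge 0 t -> vge 0 thN.[t].
Proof.
move=> t0; rewrite horner_thetaN_prod; apply: vge_prod0 => i _; apply: evs_vge => d.
apply: vgeW (ser_vge p_pr e_exp d _); first by rewrite mulr_ge0 // ltW // unit_val_gt0.
by apply: vgeMr (vgeX0 _ t0); exact: (vge_ga p_pr psi_pi_root ga_pi).
Qed.

Lemma Psi_vge0 a : vge 0 (iota (Psi a)).
Proof.
rewrite Psi_pow rmorphXn; apply: vgeX0; rewrite (_ : iota (Psi 1) = 1 + pi); last by rewrite /psi_pi; ring.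
apply: vgeD; first exact: vge1.
by apply: vgeW (vge_pi p_pr psi_pi_root); rewrite ltW // unit_val_gt0.
Qed.

Lemma vge_prod_cong r (I : Type) (t : seq I) (F G : I -> Qpbar K) :
  (forall i, vge 0 (F i)) -> (forall i, vge 0 (G i)) -> (forall i, vge r (F i - G i)) ->
  vge r (\prod_(i <- t) F i - \prod_(i <- t) G i).
Proof.
move=> F0 G0 FG; elim: t => [|i t IH]; first by rewrite !big_nil subrr vge0.
by rewrite !big_cons; apply: vge_subM => //; apply: vge_prod0.
Qed.

Lemma kloosterman_approx n y : (0 < N)%N -> y != 0 ->
  vge (M - 1) (iota (kloosterman_gen Psi n charE y) -
    (p ^ N).-1%:R ^+ n * \sum_(es <- digs p N | es != nseq N p.-1)
       dwt p n ga (T y) es * ptr m (Aops p m ga ec es) ^+ n.+1).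
Proof.
move=> N0 y0.
have -> : (p ^ N).-1%:R ^+ n * \sum_(es <- digs p N | es != nseq N p.-1)
       dwt p n ga (T y) es * ptr m (Aops p m ga ec es) ^+ n.+1 =
  (p ^ N).-1%:R ^+ n * \sum_(I < (p ^ N).-1) csum p m D ga ec N I ^+ n.+1 * T y ^+ I.
  congr (_ * _); rewrite -(sum_digs p1 N (fun I => csum p m D ga ec N I ^+ n.+1 * T y ^+ I)).
  rewrite big_seq_cond [RHS]big_seq_cond; apply: eq_bigr => es /andP[+ _].
  rewrite mem_digs => /andP[/eqP sz hes]; rewrite dwtE mulrAC; congr (_ * _).
  by rewrite mulnC exprM -exprMn (ptr_Aops p1 mD ga_neq0' ec_cut hes) sz.
have hP t : t ^+ (#|E|).-1 = 1 -> thN.[t] = \sum_(I < #|E|.-1) csum p m D ga ec N I * t ^+ I.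
  rewrite cE => h1; exact: (horner_thetaN p1 mD ga_neq0' ec (ltnW D1) N0 h1).
rewrite -cE -(kloosterman_poly TT n y0 hP) /kloosterman_gen rmorph_sum -sumrB.
apply: vge_sum => x _; rewrite prime_traceD prime_trace_sum.
have [Psi0 PsiD _] := Psi_char; rewrite PsiD Psi_sum rmorphM rmorph_prod vgeBC.
apply: vge_subM; first by apply: vge_prod0 => i _; apply: thetaN_vge0; exact: teich_vge0.
- exact: Psi_vge0.
- apply: vge_prod_cong => i; [apply: thetaN_vge0; exact: teich_vge0 | exact: Psi_vge0 | exact: psi_approx].
exact: psi_approx.
Qed.

End PsiApproximation.

(** * The ring of integers modulo a power of p *)

Section Reduction.
Variables (p : nat) (p_pr : prime p) (K : padic_closure p).

Definition int_pred (x : Qpbar K) : bool := vge 0 x.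

Lemma int_pred_subring : subring_closed int_pred.
Proof. by split=> [|x y|x y]; rewrite !unfold_in; [apply: vge1 | apply: vgeB | apply: vgeMl]. Qed.

HB.instance Definition _ := GRing.isSubringClosed.Build (Qpbar K) int_pred int_pred_subring.

Definition int_ring := {x : Qpbar K | int_pred x}.
HB.instance Definition _ := SubChoice.copy int_ring {x : Qpbar K | int_pred x}.
HB.instance Definition _ := [SubChoice_isSubComNzRing of int_ring by <:].

Section Quotient.
Variable M : nat.

(** The exponent M+1 is positive, so the quotient ring is nonzero. *)
Definition pow_ideal (x : int_ring) : bool := vge M.+1%:R (val x).

Lemma pow_ideal_closed : idealr_closed pow_ideal.
Proof.
split=> [||a x y]; rewrite !unfold_in /pow_ideal.
- exact: vge0.
- by rewrite (vgeE _ (ordp1 K)) -ltNge.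
- by move=> hx hy; apply: vgeD => //; apply: vgeMl => //; apply: (valP a).
Qed.

HB.instance Definition _ := isIdealr.Build int_ring pow_ideal pow_ideal_closed.

Definition pow_idealr : idealr int_ring := pow_ideal.

Definition red_ring : comNzRingType := {ideal_quot pow_idealr}.

Definition int_proj (x : Qpbar K) : int_ring := insubd 0 x.
(** Defined on the whole field, with value 0 on nonintegral elements; it respects the operations on
    integral elements only. *)
Definition red (x : Qpbar K) : red_ring := (\pi_({ideal_quot pow_idealr}) (int_proj x))%qT.

Lemma int_projK x : vge 0 x -> val (int_proj x) = x.
Proof. by move=> h; rewrite insubdK. Qed.

Lemma red1 : red 1 = 1.
Proof.
by rewrite /red -[RHS](rmorph1 (\pi_({ideal_quot pow_idealr}))%qT); congr (\pi _)%qT;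
  apply: val_inj; rewrite int_projK ?vge1.
Qed.

Lemma redD x y : vge 0 x -> vge 0 y -> red (x + y) = red x + red y.
Proof.
move=> hx hy; rewrite /red -(rmorphD (\pi_({ideal_quot pow_idealr}))%qT); congr (\pi _)%qT.
by apply: val_inj; rewrite /= !int_projK // vgeD.
Qed.

Lemma redM x y : vge 0 x -> vge 0 y -> red (x * y) = red x * red y.
Proof.
move=> hx hy; rewrite /red -(rmorphM (\pi_({ideal_quot pow_idealr}))%qT); congr (\pi _)%qT.
by apply: val_inj; rewrite /= !int_projK // vgeMl.
Qed.

Lemma red_eq x y : vge 0 x -> vge 0 y -> (red x = red y) <-> vge M.+1%:R (x - y).
Proof.
move=> hx hy; rewrite /red; split=> [/eqP|h].
  by rewrite -Quotient.idealrBE [_ \in _]/(vge _ _) /= !int_projK.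
by apply/eqP; rewrite -Quotient.idealrBE [_ \in _]/(vge _ _) /= !int_projK.
Qed.

Lemma red0 : red 0 = 0.
Proof. by apply: (addrI (red 1)); rewrite -redD ?vge0 ?vge1 // !addr0. Qed.

Lemma red_eq0 x : vge M.+1%:R x -> red x = 0.
Proof.
move=> h; rewrite -red0; apply/red_eq; rewrite ?vge0 ?subr0 //.
by apply: vgeW h; rewrite ler0n.
Qed.

Lemma redN x : vge 0 x -> red (- x) = - red x.
Proof. by move=> h; apply: (addrI (red x)); rewrite -redD ?vgeN // !subrr red0. Qed.

Lemma red_nat k : red k%:R = k%:R.
Proof.
elim: k => [|k IH]; first exact: red0.
by rewrite -!natr1 redD ?vge_nat ?vge1 // red1 IH.
Qed.

Lemma redX x k : vge 0 x -> red (x ^+ k) = red x ^+ k.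
Proof.
move=> h; elim: k => [|k IH]; first by rewrite !expr0 red1.
by rewrite !exprS redM ?vgeX0 // IH.
Qed.

Lemma red_sum (I : Type) (t : seq I) (P : pred I) (F : I -> Qpbar K) :
  (forall i, P i -> vge 0 (F i)) -> red (\sum_(i <- t | P i) F i) = \sum_(i <- t | P i) red (F i).
Proof.
move=> h; elim: t => [|i t IH]; first by rewrite !big_nil red0.
by rewrite !big_cons; case: ifP => [Pi|//]; rewrite redD ?h ?vge_sum // IH.
Qed.

End Quotient.
End Reduction.

Section ReductionField.
Variables (p : nat) (K : padic_closure p) (pi : Qpbar K) (M : nat).
Local Notation inE_ := (inE_ pi).

(** The classes with an integral representative in the local field. The algebra takes place in this
    subring, so that its results lift to the local field, where compactness is available. *)
Definition red_sub_pred (s : red_ring K M) : bool :=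
  `[< exists x, [/\ inE_ x, vge 0 x & red M x = s] >].

Lemma red_sub_closed : subring_closed red_sub_pred.
Proof.
split=> [|s t|s t]; rewrite !unfold_in.
- by apply/asboolP; exists 1; rewrite vge1 red1; split=> //; apply: inE1.
- case/asboolP=> x [xE x0 <-] /asboolP[y [yE y0 <-]]; apply/asboolP; exists (x - y).
  by rewrite redD ?redN ?vgeN // vgeB //; split=> //; apply: inED => //; apply: inEN.
- case/asboolP=> x [xE x0 <-] /asboolP[y [yE y0 <-]]; apply/asboolP; exists (x * y).
  by rewrite redM // vgeMl //; split=> //; apply: inEM.
Qed.

HB.instance Definition _ := GRing.isSubringClosed.Build (red_ring K M) red_sub_pred red_sub_closed.

Definition red_sub := {s : red_ring K M | red_sub_pred s}.
HB.instance Definition _ := SubChoice.copy red_sub {s : red_ring K M | red_sub_pred s}.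
HB.instance Definition _ := [SubChoice_isSubComNzRing of red_sub by <:].

Lemma red_lift : exists rL : red_sub -> Qpbar K, forall s, [/\ inE_ (rL s), vge 0 (rL s) & red M (rL s) = val s].
Proof.
have /choice[rL h] : forall s : red_sub, exists x, [/\ inE_ x, vge 0 x & red M x = val s].
  by move=> s; apply/asboolP/(valP s).
by exists rL.
Qed.

End ReductionField.

Section MellinMap.
Variables (p m J : nat) (n : nat).
Variables (S S' : comNzRingType) (f : {rmorphism S -> S'}) (ga : S) (e eta : nat -> S).
Hypothesis fd : frob_data p m J ga e eta.

Lemma mel_map H : map_poly f (mel p J eta H) = mel p J (f \o eta) (map_poly (map_poly f) H).
Proof.
have h := @rho_map p m J _ _ (map_poly f : {rmorphism {poly S} -> {poly S'}}) _ _ _ 'X H (fdT fd).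
rewrite /mel; rewrite [LHS]h /= map_polyX; congr (rho _ _ _ _ _).
by apply: funext => j /=; rewrite map_polyC.
Qed.

Lemma amel_map d : map_poly f (amel p m J ga e eta d) = amel p m J (f ga) (f \o e) (f \o eta) d.
Proof.
rewrite /amel mel_map; congr mel.
have h := @Aop_map p m _ _ (map_poly f : {rmorphism {poly S} -> {poly S'}}) ga%:P (polyC \o e) d 1.
rewrite [LHS]h rmorph1 /= map_polyC; congr (Aop _ _ _ _ _ _).
by apply: funext => j /=; rewrite map_polyC.
Qed.

Lemma alpha_map c h : map_poly f (alpha p m J ga e eta n c h) =
  alpha p m J (f ga) (f \o e) (f \o eta) n (f c) (map_poly f h).
Proof.
rewrite /alpha rmorph_sum /=; apply: eq_bigr => d _.
rewrite map_polyZ rmorphXn rmorphM rmorphXn /= amel_map map_comp_poly.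
by rewrite rmorphD rmorphM /= map_polyX !rmorph_nat.
Qed.

Lemma Xi_map c h : map_poly f (Xi p J eta n c h) = Xi p J (f \o eta) n (f c) (map_poly f h).
Proof.
rewrite /Xi rmorphB /= map_polyZ rmorphM rmorphXn /= /rmel mel_map map_polyX map_comp_poly.
by rewrite rmorphB /= map_polyX rmorph1.
Qed.

End MellinMap.

Section SubProj.
Variables (p : nat) (p_pr : prime p) (K : padic_closure p) (pi : Qpbar K) (M : nat).
Local Notation inE_ := (inE_ pi).

Definition sub_proj (x : Qpbar K) : red_sub pi M := insubd 0 (red M x).

Lemma sub_projE x : inE_ x -> vge 0 x -> val (sub_proj x) = red M x.
Proof. by move=> xE x0; rewrite insubdK //; apply/asboolP; exists x. Qed.

Hypothesis pi_root : \sum_(i < p) (1 + pi) ^+ i = 0.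
Local Notation u := (unit_val p).
Variables (e : nat -> Qpbar K) (e_exp : is_exp (fun m => (p_power p m)%:R) e).
Variables (ga : Qpbar K) (J : nat).
Hypotheses (ga_pi : vge (2 * u) (ga - pi)) (gaE : inE_ ga).
Hypotheses (LamM : vge (p ^ J)%:R (Lam J ga)) (J2 : (M < p ^ J.-1)%N) (J0 : (0 < J)%N).

(** The cut makes the logarithmic derivative a polynomial. From j = J - 1 on, the relation [fd_eta]
    holds because both of its sides vanish modulo p^(M+1). *)
Definition cut_eta j : Qpbar K := if (j < J)%N then eta_ ga j else 0.

Let u0 := unit_val_gt0 p_pr.
Let ga_ord : ordp ga = u%:E%E := ordp_ga p_pr pi_root ga_pi.
Let ga0 : ga != 0 := ga_neq0 p_pr pi_root ga_pi.
Let ga_u : vge u ga := vge_ga p_pr pi_root ga_pi.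
Let ga_v0 : vge 0 ga := vgeW (ltW u0) ga_u.

Lemma inE_e a : inE_ (e a).
Proof.
elim/ltn_ind: a => -[|a] IH; first by rewrite e_exp.1; apply: inE1.
have -> : e a.+1 = a.+1%:R^-1 * (a.+1%:R * e a.+1) by rewrite mulKf // natr_Qpbar_eq0.
rewrite ah_rec //; apply: inEM; first by apply: inEV => //; apply: inE_nat.
apply: inE_bigsum => j _; apply: IH; by rewrite ltn_subrL expn_gt0 prime_gt0.
Qed.

Lemma e_vge0 a : vge 0 (e a).
Proof. by apply: in_Zp_vge; apply: ah_in_Zp. Qed.

Lemma inE_Lam I : inE_ (Lam I ga).
Proof.
apply: inE_bigsum => i _; apply: inEM; first exact: inEX.
by apply: inEV => //; apply: inE_nat.
Qed.

Lemma inE_cut_eta j : inE_ (cut_eta j).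
Proof.
rewrite /cut_eta; case: ifP => _; last exact: inE0.
apply: inEM; first by apply: inEM; [apply: inE_nat | apply: inE_Lam].
by apply: inEV => //; apply: inEX.
Qed.

Lemma cut_eta_small j : (0 < j)%N -> vge u (cut_eta j).
Proof.
by move=> j0; rewrite /cut_eta; case: ifP => jJ; [apply: (eta_small p_pr pi_root ga_pi LamM) | apply: vge0].
Qed.

Lemma cut_eta_vge0 j : vge 0 (cut_eta j).
Proof.
case: j => [|j]; first by rewrite /cut_eta J0 (eta_0 p_pr pi_root ga_pi) vge1.
by apply: vgeW (cut_eta_small _) => //; apply: ltW.
Qed.

Local Notation Sp := sub_proj.
Hypothesis D0 : (p.-1 * M.+1 <= p ^ J)%N.

Lemma red_ga_pow k : (p.-1 * M.+1 <= k)%N -> vge M.+1%:R (ga ^+ k).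
Proof.
move=> h; rewrite (vgeE _ (ordpX k ga_ord)).
rewrite -[leLHS]mulr1 -[X in _ * X <= _](unit_valK p_pr) mulrA -natrM mulnC ler_wpM2r ?ler_nat //; exact: ltW.
Qed.

Lemma p_div_ga : vge 0 (p%:R / ga) /\ inE_ (p%:R / ga).
Proof.
split; last by apply: inEM; [apply: inE_nat | apply: inEV].
have h := vgeM (vge_p K) (_ : vge (- u) ga^-1); apply: vgeW (h _).
  by have := unit_val_le1 p_pr; lra.
by rewrite (vgeE _ (ordpV ga_ord)).
Qed.

Lemma frob_data_sub m : (p.-1 * M.+1 <= m)%N ->
  frob_data p m J (Sp ga) (Sp \o e) (Sp \o cut_eta).
Proof.
move=> hm; have [h1 h2] := p_div_ga.
split=> /=.
- exists (Sp (p%:R / ga)); apply: val_inj; rewrite rmorphM rmorph_nat /= !sub_projE //.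
  by rewrite -redM // mulrC divfK // red_nat.
- by apply: val_inj; rewrite rmorphXn rmorph0 /= sub_projE // -redX // red_eq0 // red_ga_pow.
- by apply: val_inj; rewrite sub_projE ?e_exp.1 ?rmorph1 ?red1 //; [apply: inE1 | apply: vge1].
- move=> a; apply: val_inj; rewrite rmorphM rmorph_sum rmorph_nat /= sub_projE ?e_vge0 //; last exact: inE_e.
  rewrite -red_nat -redM ?vge_nat ?e_vge0 // ah_rec // red_sum => [|j _]; last exact: e_vge0.
  by apply: eq_bigr => j _; rewrite sub_projE ?e_vge0 //; apply: inE_e.
- apply: val_inj; rewrite /cut_eta J0 (eta_0 p_pr pi_root ga_pi) sub_projE ?rmorph1 ?red1 //.
  + exact: inE1.
  + exact: vge1.
- by apply: val_inj; rewrite /cut_eta ltnn sub_projE ?rmorph0 ?red0 ?vge0 //; apply: inE0.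
- move=> j; exists (Sp (cut_eta j.+1 / ga)); apply: val_inj.
  have h3 : vge 0 (cut_eta j.+1 / ga).
    apply: vgeW (vgeM (cut_eta_small (ltn0Sn j)) (_ : vge (- u) _)); first by rewrite subrr.
    by rewrite (vgeE _ (ordpV ga_ord)).
  have h4 : inE_ (cut_eta j.+1 / ga) by apply: inEM; [apply: inE_cut_eta | apply: inEV].
  rewrite rmorphM /= !sub_projE ?cut_eta_vge0 //; last exact: inE_cut_eta.
  by rewrite -redM // mulrC divfK.
move=> j w jw; apply: val_inj; have hE := inE_cut_eta; have hv := cut_eta_vge0.
rewrite !(rmorphM, rmorphB, rmorphXn, rmorph1, rmorph_nat) /= !sub_projE //.
rewrite -red_nat -!redX // -redM ?vge_nat // -redM ?vgeX0 ?vgeMl ?vge_nat //.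
have [jJ|jJ] := ltnP j J; last first.
  rewrite {1}/cut_eta ltnNge jJ /= mulr0 mul0r red0 (@red_eq0 _ _ _ (ga ^+ _)) ?mulr0 // red_ga_pow //.
  apply: leq_trans D0 _; apply: leq_trans (leq_pexp2l (prime_gt0 p_pr) jJ) _; apply: leq_trans jw _.
  by rewrite leq_pmull // p1_gt0.
have [e1|jJ1] := eqVneq j.+1 J.
  have eJ : cut_eta j.+1 = 0 by rewrite /cut_eta e1 ltnn.
  rewrite eJ red0 sub0r [in RHS]red_eq0; last first.
    rewrite red_ga_pow // leq_mul2l (leq_trans _ jw) ?orbT //.
    by move: J2; rewrite -e1.
  rewrite mulr0 red_eq0 //.
  rewrite /cut_eta jJ /eta_.
  have -> : p%:R * ((p ^ j)%:R * Lam j.+1 ga / ga ^+ (p ^ j)) * ga ^+ (p.-1 * (w - p ^ j)) =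
    (p%:R * (p ^ j)%:R * ga ^+ (p.-1 * (w - p ^ j))) * (Lam j.+1 ga / ga ^+ (p ^ j)) by ring.
  apply: vgeMl; first by rewrite !vgeMl ?vge_nat ?vgeX0.
  have pj := ordpV (ordpX (p ^ j) ga_ord).
  rewrite e1; apply: vgeW (vgeM LamM (_ : vge (- ((p ^ j)%:R * u)) _)); last by rewrite (vgeE _ pj).
  have a1 : (p ^ J)%:R = p%:R * (p ^ j)%:R :> rat by rewrite -e1 expnS natrM.
  have a2 : (M.+1)%:R <= (p ^ j)%:R :> rat by rewrite ler_nat; move: J2; rewrite -e1.
  have a3 : 2 <= p%:R :> rat by rewrite ler_nat prime_gt1.
  have a4 : 0 <= (p ^ j)%:R :> rat by rewrite ler0n.
  have a5 : u <= 1 := unit_val_le1 p_pr.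
  rewrite a1; nra.
have jJ' : (j.+1 < J)%N by rewrite ltn_neqAle jJ1.
have := eta_rel p_pr pi_root ga_pi jw; rewrite {1 2}/cut_eta jJ jJ' => ->.
rewrite redM ?vgeX0 ?vgeB ?vge1 //.
  rewrite redD ?vgeN ?vge1 ?redN ?vge1 ?red1 //.
all: by have := hv j.+1; rewrite /cut_eta jJ'.
Qed.

End SubProj.

Section Bieval.
Variables (A : comNzRingType).

(** Written as a double sum because L will be a mere choice of lifts; [bihornerE] treats the case of
    a morphism. *)
Definition bieval (R : pzRingType) (L : A -> R) (r : {poly {poly A}}) (x x' : R) : R :=
  \sum_(b < size r) \sum_(a < size r`_b) L r`_b`_a * x ^+ a * x' ^+ b.

Variables (R : comNzRingType) (f : {rmorphism A -> R}).

Definition bihorner (x x' : R) : {rmorphism {poly {poly A}} -> R} :=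
  (horner_eval x \o horner_eval x'%:P) \o map_poly (map_poly f).

Lemma bihornerE x x' r : bihorner x x' r = bieval f r x x'.
Proof.
have s (B B' : nzSemiRingType) (g : {rmorphism B -> B'}) (q : {poly B}) : (size (map_poly g q) <= size q)%N.
  exact: size_poly.
rewrite /= /horner_eval (horner_coef_wide _ (s _ _ (map_poly f : {rmorphism _ -> _}) r)) horner_sum.
apply: eq_bigr => b _; rewrite coef_map /= -polyC_exp hornerM hornerC.
rewrite (horner_coef_wide _ (s _ _ f r`_b)) mulr_suml.
by apply: eq_bigr => a _; rewrite coef_map.
Qed.

Lemma bihornerC x x' s : bihorner x x' s%:P%:P = f s.
Proof. by rewrite /= /horner_eval !map_polyC /= !hornerC map_polyC hornerC. Qed.

Lemma bihornerX x x' : bihorner x x' 'X%:P = x.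
Proof. by rewrite /= /horner_eval !map_polyC /= !hornerC map_polyX hornerX. Qed.

Lemma bihornerY x x' : bihorner x x' 'X = x'.
Proof. by rewrite /= /horner_eval !map_polyX /= !hornerX hornerC. Qed.

End Bieval.

Definition frob_eval (R : comNzRingType) n (H : 'M[{poly R}]_n) (t : R) : 'M[R]_n :=
  map_mx (fun q => q.[t]) H.

Fixpoint frob_prod (p : nat) (R : comNzRingType) n (H : 'M[{poly R}]_n) N (t : R) : 'M[R]_n :=
  if N is N'.+1 then frob_eval H (t ^+ (p ^ N')) *m frob_prod p H N' t else 1%:M.

Section ReducedOperators.
Variables (p : nat) (p_pr : prime p) (K : padic_closure p) (M : nat).
Local Notation red := (@red p K M).

Lemma red_mulmx m n k (A : 'M[Qpbar K]_(m, n)) (B : 'M_(n, k)) :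
  (forall i j, vge 0 (A i j)) -> (forall i j, vge 0 (B i j)) ->
  map_mx red (A *m B) = map_mx red A *m map_mx red B.
Proof.
move=> hA hB; apply/matrixP => i j; rewrite !mxE red_sum => [|l _]; last exact: vgeMl.
by apply: eq_bigr => l _; rewrite !mxE redM.
Qed.

Lemma vge0_mulmx m n k (A : 'M[Qpbar K]_(m, n)) (B : 'M_(n, k)) :
  (forall i j, vge 0 (A i j)) -> (forall i j, vge 0 (B i j)) -> forall i j, vge 0 ((A *m B) i j).
Proof. by move=> hA hB i j; rewrite mxE; apply: vge_sum => l _; apply: vgeMl. Qed.

Lemma vge0_mx1 n i j : vge 0 ((1%:M : 'M[Qpbar K]_n) i j).
Proof. by rewrite mxE; case: (_ == _); rewrite ?vge1 ?vge0. Qed.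

Lemma vge0_horner (q : {poly Qpbar K}) t : (forall l, vge 0 q`_l) -> vge 0 t -> vge 0 q.[t].
Proof. by move=> hq ht; rewrite horner_coef; apply: vge_sum => i _; rewrite vgeMl ?vgeX0. Qed.

Variables (m D : nat) (ga : Qpbar K) (e : nat -> Qpbar K).
Hypotheses (ga0 : vge 0 ga) (e0 : forall a, vge 0 (e a)) (DE : D = (p * M.+2)%N).
Hypothesis ga_pow : forall k, (p.-1 * M.+1 <= k)%N -> vge M.+1%:R (ga ^+ k).
Local Notation ec := (cut_series D e).

Let ec0 a : vge 0 (ec a).
Proof. by rewrite /cut_series; case: ifP; rewrite ?vge0. Qed.

Lemma vge0_Aop d (h : {poly Qpbar K}) : (forall i, vge 0 h`_i) -> forall i, vge 0 (Aop p m ga ec d h)`_i.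
Proof.
move=> hh i; rewrite coef_poly; case: ifP => _; last exact: vge0.
by rewrite vgeMl ?vgeX0 //; apply: vge_sum => v _; rewrite vgeMl.
Qed.

Lemma vge0_ptr_Aops es : vge 0 (ptr m (Aops p m ga ec es)).
Proof.
have h (q : {poly Qpbar K}) i : (forall j, vge 0 q`_j) -> vge 0 (Aops p m ga ec es q)`_i.
  by move=> hq; elim: es i => [|d es IH] i //=; apply: vge0_Aop.
by apply: vge_sum => v _; apply: h => j; rewrite coefXn; case: eqP; rewrite ?vge1 ?vge0.
Qed.

(** The cut removes e a only for a >= p (M+2). Such an a enters the coefficient of index u only if u
    > M, and then the power of ga is 0 modulo p^(M+1). *)
Lemma red_Aop d (h : {poly Qpbar K}) (h' : {poly red_ring K M}) : (d < p)%N -> (forall i, vge 0 h`_i) -> (forall i, h'`_i = red h`_i) ->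
  forall i, (Aop p m (red ga) (red \o e) d h')`_i = red (Aop p m ga ec d h)`_i.
Proof.
move=> dp hh hE i; rewrite !coef_poly; case: ifP => _; last by rewrite red0.
rewrite redM ?vgeX0 //; last by apply: vge_sum => v _; rewrite vgeMl.
rewrite redX // red_sum => [|v _]; last by rewrite vgeMl.
rewrite !mulr_sumr; apply: eq_bigr => v _ /=; rewrite hE redM //.
rewrite /cut_series; case: ltnP => // ha.
rewrite -redX // (@red_eq0 _ _ _ (ga ^+ _)) ?mul0r // ga_pow // leq_mul2l; apply/orP; right.
have h1 : (p * M.+1 < p * i.+1)%N.
  by move: ha dp; rewrite DE (mulnS p i) (mulnS p M.+1); lia.
by rewrite -ltnS; move: h1; rewrite ltn_mul2l => /andP[].
Qed.

Lemma red_ptr_Aops es : all (fun d => d < p)%N es ->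
  ptr m (Aops p m (red ga) (red \o e) es) = red (ptr m (Aops p m ga ec es)).
Proof.
move=> hes; have key (h : {poly Qpbar K}) (h' : {poly red_ring K M}) : (forall i, vge 0 h`_i) -> (forall i, h'`_i = red h`_i) ->
    (forall i, vge 0 (Aops p m ga ec es h)`_i) /\
    (forall i, (Aops p m (red ga) (red \o e) es h')`_i = red (Aops p m ga ec es h)`_i).
  move=> hh hE; elim: es hes => [|d es IH] //= /andP[dp /IH[h1 h2]].
  by split; [apply: vge0_Aop | apply: red_Aop].
have hX v : (forall i, vge 0 ('X^v : {poly Qpbar K})`_i) /\ (forall i, ('X^v : {poly red_ring K M})`_i = red 'X^v`_i).
  by split=> i; rewrite !coefXn; case: eqP; rewrite ?vge1 ?vge0 ?red1 ?red0.
rewrite /ptr red_sum => [|v _]; last by apply: (key _ _ (hX v).1 (hX v).2).1.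
by apply: eq_bigr => v _; apply: (key _ _ (hX v).1 (hX v).2).2.
Qed.

End ReducedOperators.

(** * Overconvergence and the Frobenius matrix *)

Section Growth.
Variables (p : nat) (p_pr : prime p) (K : padic_closure p) (pi : Qpbar K).
Local Notation inE_ := (inE_ pi).
Implicit Types (f g : {poly Qpbar K}) (r s : rat).

(* Overconvergence of a family of polynomials, uniform when s and r are. *)
Definition grows r s f := forall l, inE_ f`_l /\ vge (s + r * l%:R) f`_l.

Lemma grows0 r s : grows r s 0.
Proof. by move=> l; rewrite coef0 vge0; split=> //; apply: inE0. Qed.

Lemma growsD r s f g : grows r s f -> grows r s g -> grows r s (f + g).
Proof.
by move=> hf hg l; rewrite coefD; split; [apply: inED (hf l).1 (hg l).1 | apply: vgeD (hf l).2 (hg l).2].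
Qed.

Lemma grows_sum r s (I : Type) (t : seq I) (P : pred I) (F : I -> {poly Qpbar K}) :
  (forall i, P i -> grows r s (F i)) -> grows r s (\sum_(i <- t | P i) F i).
Proof. by move=> h; apply: (big_ind (grows r s)) => //; [apply: grows0 | apply: growsD]. Qed.

Lemma growsM r s s' f g : grows r s f -> grows r s' g -> grows r (s + s') (f * g).
Proof.
move=> hf hg l; rewrite coefM; split.
  by apply: inE_bigsum => i _; apply: inEM (hf i).1 (hg _).1.
apply: vge_sum => i _; apply: vgeW (vgeM (hf i).2 (hg _).2).
rewrite -subr_ge0 natrB; last by rewrite -ltnS.
by have -> : s + r * i%:R + (s' + r * (l%:R - i%:R)) - (s + s' + r * l%:R) = 0 by ring.
Qed.

Lemma growsC r s c : inE_ c -> vge s c -> grows r s c%:P.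
Proof.
move=> cE cs l; rewrite coefC; case: eqP => [->|_]; last by rewrite vge0; split=> //; apply: inE0.
by rewrite mulr0 addr0.
Qed.

Lemma grows1 r : grows r 0 1.
Proof. by rewrite -[1]polyC1; apply: growsC; [apply: inE1 | apply: vge1]. Qed.

Lemma growsX r f k : grows r 0 f -> grows r 0 (f ^+ k).
Proof.
move=> h; elim: k => [|k IH]; first exact: grows1.
by rewrite exprS -[0]addr0; apply: growsM.
Qed.

Lemma grows_prod r (I : Type) (t : seq I) (s : I -> rat) (F : I -> {poly Qpbar K}) :
  (forall i, grows r (s i) (F i)) -> grows r (\sum_(i <- t) s i) (\prod_(i <- t) F i).
Proof.
move=> h; elim: t => [|i t IH]; first by rewrite !big_nil; apply: grows1.
by rewrite !big_cons; apply: growsM.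
Qed.

Lemma growsZXn r c k : inE_ c -> vge (r * k%:R) c -> grows r 0 (c *: 'X^k).
Proof.
move=> cE ck l; rewrite coefZ coefXn add0r; case: eqP => [->|_].
  by rewrite mulr1.
by rewrite mulr0 vge0; split=> //; apply: inE0.
Qed.

Lemma growsW r s s' f : s' <= s -> grows r s f -> grows r s' f.
Proof. by move=> h hf l; split; [apply: (hf l).1 | apply: vgeW (hf l).2; rewrite lerD2r]. Qed.

Lemma grows_vge0 r s f l : 0 <= r -> 0 <= s -> grows r s f -> vge 0 f`_l.
Proof. by move=> r0 s0 /(_ l)[_]; apply: vgeW; rewrite addr_ge0 // mulr_ge0. Qed.

End Growth.

Lemma inE_bieval (p : nat) (K : padic_closure p) (pi : Qpbar K) (A : comNzRingType) (L : A -> Qpbar K)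
    r s (x x' : {poly Qpbar K}) :
  (forall a, inE_ pi (L a) /\ vge 0 (L a)) -> grows pi s 0 x -> grows pi s 0 x' ->
  grows pi s 0 (bieval (polyC \o L) r x x').
Proof.
move=> hL hx hx'; apply: grows_sum => b _; apply: grows_sum => a _ /=.
rewrite -[0]addr0; apply: growsM; last exact: growsX.
by rewrite -[0]addr0; apply: growsM; [apply: growsC (hL _).1 (hL _).2 | apply: growsX].
Qed.

Lemma horner_bieval (R A : comNzRingType) (L : A -> R) r (x x' : {poly R}) t :
  (bieval (polyC \o L) r x x').[t] = bieval L r x.[t] x'.[t].
Proof.
rewrite horner_sum; apply: eq_bigr => b _; rewrite horner_sum; apply: eq_bigr => a _.
by rewrite !hornerM hornerC !horner_exp.
Qed.

Section FrobeniusStructure.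
Variables (p : nat) (p_pr : prime p) (K : padic_closure p).
Variables (iota : {rmorphism algC -> Qpbar K}) (Psi : 'F_p -> algC).
Hypothesis Psi_char : nontrivial_additive_character Psi.
Variables (n M : nat).
Local Notation u := (unit_val p).
Local Notation pi := (psi_pi iota Psi).
Local Notation red := (@red p K M).

(** The matrix is computed once with c and c' independent variables, and its coefficients are
    lifted. Only then are c = ga^(n+1) t and c' = ga^(n+1) t^p substituted: at most p powers of t
    come with each ga^(n+1), which gives the rate u/p whatever the lifts and M are. *)
Lemma frobenius_structure : exists H : 'M[{poly Qpbar K}]_n.+1,
  (forall i j, grows pi (u / p%:R) (u * (i != ord0)%:R) (H i j)) /\
  forall (E : finFieldType) (charE : p \in [pchar E]) N (T : E -> Qpbar K) (y : E),
    #|E| = (p ^ N)%N -> (0 < N)%N -> is_teichmuller T -> y != 0 ->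
    vge M%:R ((-1) ^+ n * iota (kloosterman_gen Psi n charE y) - \tr (frob_prod p H N (T y))).
Proof.
have p1 := prime_gt1 p_pr; have p0 := prime_gt0 p_pr; have u0 := unit_val_gt0 p_pr.
have pi_root := psi_pi_root p_pr iota Psi_char.
have [e e_exp] := is_exp_exists (@natr_Qpbar_eq0 p p_pr K) (fun m => (p_power p m)%:R).
(* Evaluation at 1 has precision D/p = M+2; one unit is lost in [splitting_value], and the reduction
   is modulo p^(M+1). The value of J is a crude choice with D <= p^J. *)
pose D := (p * M.+2)%N; pose J := D.
have DM : (M.+2 + M.+2 <= D)%N by rewrite addnn -mul2n leq_mul2r p1 orbT.
have DJ : (D <= p ^ J)%N by apply: ltnW; apply: ltn_expl.
have J2 : (M < p ^ J.-1)%N.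
  apply: ltn_trans (ltn_expl J.-1 p1); rewrite /J; lia.
have pD : (p.-1 * M.+1 <= D)%N by apply: leq_mul; rewrite ?leq_pred.
have J0 : (0 < J)%N by rewrite /J; lia.
have J1 : (1 < J)%N by rewrite /J; lia.
have D1 : (1 < D)%N by lia.
have [ga [gaE ga_pi LamM]] := gamma_exists p_pr pi_root (p ^ J) J1.
have fdE := frob_data_sub p_pr pi_root e_exp ga_pi gaE LamM J2 J0 (leq_trans pD DJ) pD.
have ga_u := vge_ga p_pr pi_root ga_pi; have ga_v0 := vgeW (ltW u0) ga_u.
have e0 := e_vge0 p_pr e_exp; have eE := inE_e p_pr pi e_exp.
have g0 := cut_eta_vge0 p_pr pi_root ga_pi LamM J0.
have gE := inE_cut_eta p_pr J gaE.
have ga_pow := red_ga_pow (M := M) p_pr pi_root ga_pi.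
pose SE : comNzRingType := red_sub pi M; pose S : comNzRingType := red_ring K M.
have [vl vlE] : exists vl : {rmorphism SE -> S}, forall s, vl s = val s by exists val.
have [P2 P2E] : exists P2 : {rmorphism SE -> {poly {poly SE}}}, forall s, P2 s = s%:P%:P.
  by exists (polyC \o polyC).
have fd2 := frob_data_map P2 fdE.
have [r rP] := frob_matrix p1 DJ n fd2 ('X%:P) 'X.
have fdS : frob_data p D J (red ga) (red \o e) (red \o cut_eta ga J).
  have := frob_data_map vl fdE; rewrite vlE sub_projE //.
  have -> : vl \o (sub_proj pi M \o e) = red \o e by apply: funext => a /=; rewrite vlE sub_projE.
  have -> // : vl \o (sub_proj pi M \o cut_eta ga J) = red \o cut_eta ga J.
  by apply: funext => a /=; rewrite vlE sub_projE.
have [rL rLP] := red_lift pi M.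
pose kap i (c : {poly Qpbar K}) : {poly Qpbar K} :=
  \sum_(d < p) c ^+ d * (e d ^+ n.+1 * d%:R ^+ i)%:P.
pose xc : {poly Qpbar K} := ga ^+ n.+1 *: 'X^1; pose xc' := ga ^+ n.+1 *: 'X^p.
pose H : 'M[{poly Qpbar K}]_n.+1 := \matrix_(j, i)
  ((j == ord0)%:R * kap i xc + ga%:P * bieval (polyC \o rL) (r j i) xc xc').
have up0 : 0 <= u / p%:R by rewrite divr_ge0 ?ler0n // ltW.
have ga_n k : (k <= p)%N -> vge (u / p%:R * k%:R) (ga ^+ n.+1).
  move=> kp; rewrite exprS; apply: vgeMr; last exact: vgeX0.
  apply: vgeW ga_u; rewrite mulrAC ler_pdivrMr ?ltr0n // ler_wpM2l ?ler_nat //; exact: ltW.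
have hxc : grows pi (u / p%:R) 0 xc by apply: growsZXn; [apply: inEX | apply: ga_n].
have hxc' : grows pi (u / p%:R) 0 xc' by apply: growsZXn; [apply: inEX | apply: ga_n].
have hH i j : grows pi (u / p%:R) (u * (i != ord0)%:R) (H i j).
  rewrite mxE; apply: growsD.
    case: eqP => [_|_]; last by rewrite mul0r; apply: grows0.
    rewrite mul1r mulr0; apply: grows_sum => d _; rewrite -[0]addr0; apply: growsM; first exact: growsX.
    apply: growsC; first by apply: inEM; apply: inEX => //; apply: inE_nat.
    by rewrite vgeMl ?vgeX0 ?vge_nat.
  apply: (@growsW _ _ _ _ u); first by case: (_ == _); rewrite ?mulr1 ?mulr0 // ltW.
  rewrite -[u in grows _ _ u]addr0; apply: growsM; first exact: growsC.
  by apply: inE_bieval => // a; have [] := rLP a.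
exists H; split=> // E charE N T y cE N0 TT y0.
pose t := T y; have t0 : vge 0 t := teich_vge0 TT y.
have tN : t ^+ (p ^ N).-1 = 1 by rewrite -cE; apply: (teich_root TT).
pose c k := cfib p n (red ga) (red t) k.
have cE2 k : c k = red (ga ^+ n.+1 * t ^+ (p ^ k)) by rewrite redM ?vgeX0 // !redX.
have [ev [evP evX evY evE]] : exists ev : nat -> {rmorphism {poly {poly SE}} -> S},
    [/\ forall k s, ev k (P2 s) = vl s, forall k, ev k 'X%:P = c k, forall k, ev k 'X = c k.+1 &
        forall k q, ev k q = bieval vl q (c k) (c k.+1)].
  exists (fun k => bihorner vl (c k) (c k.+1)).
  by split=> *; rewrite ?P2E ?bihornerC ?bihornerX ?bihornerY ?bihornerE.
pose Hf k : 'M[S]_n.+1 := \matrix_(j, i)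
  ((j == ord0)%:R * (\sum_(d < p) c k ^+ d * ((red \o e) d ^+ n.+1 * d%:R ^+ i)) + red ga * ev k (r j i)).
have HfP k (i : 'I_n.+1) : exists q, alpha p D J (red ga) (red \o e) (red \o cut_eta ga J) n (c k) 'X^i =
    \sum_j Hf k j i *: 'X^j + Xi p J (red \o cut_eta ga J) n (c k.+1) q.
  have [q hq] := rP i; exists (map_poly (ev k) q).
  have := congr1 (map_poly (ev k)) hq; rewrite (alpha_map _ _ fd2) [X in _ = X -> _]rmorphD [X in _ = _ + X -> _](Xi_map _ (ev k) fd2).
  have e1 : (ev k) \o (P2 \o (sub_proj pi M \o e)) = red \o e.
    by apply: funext => a; rewrite /comp evP vlE sub_projE.
  have e2 : (ev k) \o (P2 \o (sub_proj pi M \o cut_eta ga J)) = red \o cut_eta ga J.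
    by apply: funext => a; rewrite /comp evP vlE sub_projE.
  have e3 : (ev k) (P2 (sub_proj pi M ga)) = red ga by rewrite evP vlE sub_projE.
  rewrite e1 e2 e3 evX evY map_polyXn => ->.
  congr (_ + _); rewrite rmorph_sum /=; apply: eq_bigr => j _.
  rewrite map_polyZ map_polyXn mxE; congr (_ *: _).
  rewrite rmorphD !rmorphM rmorph_nat rmorph_sum e3.
  congr (_ * _ + _ * _); apply: eq_bigr => d _.
  rewrite !rmorphM !rmorphXn rmorph_nat evX; congr (_ ^+ _ * (_ ^+ _ * _)).
  by have := congr1 (fun g => g (d : nat)) e1.
have bie k q : red (bieval rL q (ga ^+ n.+1 * t ^+ (p ^ k)) (ga ^+ n.+1 * t ^+ (p ^ k.+1))) = ev k q.
  have rL0 a : vge 0 (rL a) by have [] := rLP a.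
  rewrite evE red_sum => [|b _]; last by apply: vge_sum => a _; rewrite !(vgeMl, vgeX0).
  apply: eq_bigr => b _; rewrite red_sum => [|a _]; last by rewrite !(vgeMl, vgeX0).
  apply: eq_bigr => a _; rewrite !cE2 vlE; have [_ _ <-] := rLP (q`_b`_a).
  by rewrite -!redX ?(vgeMl, vgeX0) // -!redM ?(vgeMl, vgeX0).
have xcE k : xc.[t ^+ (p ^ k)] = ga ^+ n.+1 * t ^+ (p ^ k) by rewrite hornerZ hornerXn expr1.
have xcE' k : xc'.[t ^+ (p ^ k)] = ga ^+ n.+1 * t ^+ (p ^ k.+1).
  by rewrite hornerZ hornerXn -exprM -expnSr.
have hev k j i : red (frob_eval H (t ^+ (p ^ k)) j i) = Hf k j i.
  have hb : vge 0 (bieval rL (r j i) (ga ^+ n.+1 * t ^+ (p ^ k)) (ga ^+ n.+1 * t ^+ (p ^ k.+1))).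
    apply: vge_sum => b _; apply: vge_sum => a _; have [_ ? _] := rLP ((r j i)`_b`_a).
    by rewrite !(vgeMl, vgeX0).
  have hk d : vge 0 ((ga ^+ n.+1 * t ^+ (p ^ k)) ^+ d * (e d ^+ n.+1 * d%:R ^+ i)).
    by rewrite !(vgeMl, vgeX0, vge_nat).
  rewrite !mxE !hornerE horner_bieval xcE xcE'.
  have -> : ((j == ord0)%:R : {poly Qpbar K}).[t ^+ (p ^ k)] = (j == ord0)%:R.
    by case: eqP => _; rewrite ?hornerC ?horner0 // -polyC1 hornerC.
  have -> : (kap i xc).[t ^+ (p ^ k)] =
      \sum_(d < p) (ga ^+ n.+1 * t ^+ (p ^ k)) ^+ d * (e d ^+ n.+1 * d%:R ^+ i).
    by rewrite horner_sum; apply: eq_bigr => d _; rewrite hornerM hornerC horner_exp xcE.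
  rewrite redD ?(redM _ ga_v0) ?bie ?vgeMl ?vge_nat //; last by apply: vge_sum => d _.
  congr (_ + _); rewrite redM ?vge_nat ?red_nat //; last by apply: vge_sum => d _.
  congr (_ * _); rewrite red_sum //; apply: eq_bigr => d _.
  by rewrite cE2 /= -red_nat -!redX ?(vgeMl, vgeX0, vge_nat) // -!redM ?(vgeMl, vgeX0, vge_nat).
have hev0 k j i : vge 0 (frob_eval H (t ^+ (p ^ k)) j i).
  rewrite mxE; apply: vge0_horner; last exact: vgeX0.
  by move=> l; apply: (grows_vge0 l up0 _ (hH j i)); rewrite mulr_ge0 ?ler0n // ltW.
have hprod k : (forall j i, vge 0 (frob_prod p H k t j i)) /\ map_mx red (frob_prod p H k t) = Hprod Hf k.
  elim: k => [|k [IH1 IH2]] /=.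
    split; first exact: vge0_mx1.
    by apply/matrixP => j i; rewrite !mxE red_nat.
  split; first exact: vge0_mulmx.
  rewrite red_mulmx // IH2; congr (_ *m _); apply/matrixP => j i.
  by rewrite mxE hev.
have trH := frob_trace p1 DJ fdS HfP N0 (_ : red t ^+ (p ^ N).-1 = 1).
have uM : u <= M.+2%:R.
  by apply: le_trans (unit_val_le1 p_pr) _; rewrite ler1n.
have MD : M.+2%:R <= 1 / p%:R * D%:R :> rat.
  by rewrite /D natrM mulrA divfK ?mul1r // pnatr_eq0 -lt0n.
have LamM' : vge M.+2%:R (Lam J ga).
  by apply: vgeW LamM; rewrite ler_nat (leq_trans _ DJ) // (leq_trans _ DM) // leq_addr.
have mD : (D <= p.-1 * D)%N by rewrite leq_pmull // p1_gt0.
have := kloosterman_approx p_pr Psi_char e_exp ga_pi D1 DJ uM MD LamM' J0 mD charE cE TT n N0 y0.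
set B := \sum_(es <- _ | _) _ => hK.
have DE : D = (p * M.+2)%N by [].
have ptr0 es : vge 0 (ptr D (Aops p D ga (cut_series D e) es)) by apply: vge0_ptr_Aops.
have trm es : vge 0 (dwt p n ga t es * ptr D (Aops p D ga (cut_series D e) es) ^+ n.+1).
  by rewrite dwtE !(vgeMl, vgeX0).
have B0 : vge 0 B by apply: vge_sum => es _.
have sg : vge 0 ((-1) ^+ n * (p ^ N).-1%:R ^+ n : Qpbar K) by rewrite vgeMl ?vgeX0 ?vge_nat // vgeN vge1.
have redB : red B = \sum_(es <- digs p N | es != nseq N p.-1)
    dwt p n (red ga) (red t) es * ptr D (Aops p D (red ga) (red \o e) es) ^+ n.+1.
  rewrite /B red_sum => [|es _] //; rewrite big_seq_cond [RHS]big_seq_cond; apply: eq_bigr => es /andP[].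
  rewrite mem_digs => /andP[_ hes] _.
  by rewrite !dwtE (red_ptr_Aops p_pr D ga_v0 e0 DE ga_pow hes) -!redX // -!redM ?(vgeMl, vgeX0).
have h1 : vge M.+1%:R ((-1) ^+ n * iota (kloosterman_gen Psi n charE y) - (-1) ^+ n * (p ^ N).-1%:R ^+ n * B).
  rewrite -mulrA -mulrBr; apply: vgeMl; first by rewrite vgeX0 // vgeN vge1.
  by apply: vgeW hK; rewrite -[M.+2]addn1 natrD addrK.
have h2 : vge M.+1%:R ((-1) ^+ n * (p ^ N).-1%:R ^+ n * B - \tr (frob_prod p H N t)).
  have trE : \tr (map_mx red (frob_prod p H N t)) = red (\tr (frob_prod p H N t)).
    by rewrite /mxtrace red_sum => [|i _]; [apply: eq_bigr => i _; rewrite mxE | apply: (hprod N).1].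
  apply/red_eq; first exact: vgeMl.
    by apply: vge_sum => i _; apply: (hprod N).1.
  rewrite -trE (hprod N).2 trH; last by rewrite -redX // tN red1.
  rewrite redM // redB; congr (_ * _).
  (* The sign (-1)^n turns (p^N - 1)^n into the factor (1 - p^N)^n of [frob_trace]. *)
  rewrite -exprMn mulN1r redX ?vgeN ?vge_nat // redN ?vge_nat // red_nat; congr (_ ^+ _).
  by rewrite -subn1 natrB ?expn_gt0 ?p0 // opprB.
apply: vgeW (vge_trans h1 h2); by rewrite ler_nat.
Qed.
End FrobeniusStructure.

Lemma rat_le_nat (r : rat) : exists M : nat, r <= M%:R.
Proof. by exists (Num.bound `|r|); apply: le_trans (ler_norm r) _; apply: ltW; apply: archi_boundP. Qed.

Lemma is_exp_sums_uniq (F : fieldType) (l l' g : nat -> F) : is_exp l g -> is_exp l' g ->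
  forall m, (0 < m)%N -> l m = l' m.
Proof.
move=> [g0 h] [_ h']; elim/ltn_ind => -[//|m] IH _.
have := h m.+1; rewrite h' !big_ord_recr /= subnn g0 !mulr1.
rewrite (eq_bigr (fun i : 'I_m => l i.+1 * g (m.+1 - i.+1)%N)) => [/addrI //|i _].
by rewrite IH // ltnS.
Qed.

(** * The unit root *)

Section UnitRootSplit.
Variables (p : nat) (p_pr : prime p) (K : padic_closure p) (n : nat) (u : rat) (u0 : 0 < u).
Variable l : nat -> Qpbar K.
Hypotheses (l0 : forall m, vge 0 (l m)) (l1 : vge u (l 1 - 1)).
Hypothesis approx : forall M : nat, exists2 A : 'M[Qpbar K]_n.+1,
  forall i j, vge (u * (i != ord0)%:R) (A i j) & forall m, (0 < m)%N -> vge M%:R (l m - \tr (A ^+ m)).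
Variable G : nat -> Qpbar K.
Hypothesis G_exp : is_exp (fun m => - l m) G.

(** The number of rows of weight less than W, when the first row has weight 0 and the n others
    weight 1. *)
Definition slope_count W : nat := if W is W'.+2 then n.+1 else W.

(** The matrices for different precisions are unrelated, but their determinants obey one bound; it
    passes to G by taking M large enough for each coefficient. *)
Lemma unit_series_bnd : bnd u slope_count G.
Proof.
move=> W N; set r := u * _; have [M hM] := rat_le_nat (r + (logn p N`!)%:R).
have [A hA trA] := approx M.
have b : bnd u slope_count (fun N => (fred A)`_N).
  apply: (@bnd_fred p p_pr K _ A u (fun i => (i != ord0) : nat) (fun=> 0)); first exact: ltW.
    by move=> i j; rewrite addr0 subr0.
  case=> [|[|W']] /=; first by rewrite (eq_card0 (_ : _ =i pred0)) // => i; rewrite inE ltn0.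
    apply: leq_trans (_ : #|[set (ord0 : 'I_n.+1)]| <= _)%N; last by rewrite cards1.
    by apply: subset_leq_card; apply/fintype.subsetP => i; rewrite !inE; case: eqP.
  by apply: leq_trans (max_card _) _; rewrite card_ord.
have := is_exp_cong p_pr (M := M%:R) (is_exp_fred A) G_exp (fun N => bnd_vge0 N b).
move=> /(_ _ _ N) hc; have {hc} : vge (M%:R - (logn p N`!)%:R) ((fred A)`_N - G N).
  by apply: hc => m; [rewrite vgeN | move=> m0; rewrite opprK addrC trA].
move=> h; rewrite -(@vge_cong p K _ _ _ _ (_ : r <= M%:R - (logn p N`!)%:R) h) ?b // lerBrDr //.
Qed.

(** For W >= 2 the count stays n+1, so beyond the degree n+1 the bound is arbitrarily large. *)
Lemma unit_series_degree N : (n.+1 < N)%N -> G N = 0.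
Proof.
move=> hN; apply: (@vge_eq0 p K) => k.
have [W hW] := rat_le_nat (k%:R / u).
apply: vgeW (unit_series_bnd W.+2 N) => /=.
have : 1 <= N%:R - (n.+1)%:R :> rat by rewrite lerBrDr -(natrD _ 1) ler_nat.
move: hW; rewrite ler_pdivrMr // => h1 h2; apply: le_trans h1 _; rewrite mulrC ler_pM2l // -addn2 natrD.
have : 0 <= W%:R :> rat by rewrite ler0n.
by move: h2; set X := _ - _; nra.
Qed.

Lemma np_unit_series s : 0 <= s -> s < u -> exists a, np G s a 1 /\ (s = 0 -> a = 0%N).
Proof.
move=> s0 su; have G0 : G 0%N = 1 := G_exp.1.
have G1 : ordp (G 1%N) = 0%:E%E.
  have := G_exp.2 1%N; rewrite mul1r big_ord1 subnn G0 mulr1 => ->; rewrite ordpN.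
  by apply: (ordp_cong (ordp1 K) u0); rewrite vgeBC.
have Gge N : (1 < N)%N -> vgt (- s + s * N%:R) (G N).
  move=> hN; apply: vge_gt (unit_series_bnd 1 N) => /=.
  have : 2 <= N%:R :> rat by rewrite ler_nat.
  rewrite mul1r; nra.
have G1s N : N = 1%N -> vge (- s + s * N%:R) (G N).
  by move=> ->; rewrite mulr1 addNr (vgeE _ G1).
have [e|ne] := eqVneq s 0.
  exists 0%N; split=> //; exists 0; rewrite !mulr0 !addr0 G0 ordp1; split=> //.
  - by rewrite e mul0r add0r G1.
  - move=> [|[|N]]; rewrite e mul0r ?addr0 ?G0 ?vge1 //; first by rewrite (vgeE _ G1).
    by have := vgtW (Gge N.+2 isT); rewrite e oppr0 mul0r addr0.
  - by move=> [|[|N]] // _; have := Gge N.+2 isT; rewrite e oppr0 mul0r addr0.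
have sp : 0 < s by rewrite lt_neqAle eq_sym ne.
exists 1%N; split=> [|e]; last by rewrite e eqxx in ne.
exists (- s); rewrite mulr1 addNr; split=> //.
- move=> [|[|N]]; [|by apply: G1s|by apply: vgtW; apply: Gge].
  by rewrite G0 mulr0 addr0 (vgeE _ (ordp1 K)) oppr_le0 ltW.
- move=> [|[|N]] // _; last exact: Gge.
  by rewrite G0 mulr0 addr0 (vgtE _ (ordp1 K)) oppr_lt0.
Qed.

Lemma unit_root_split (Q : {poly Qpbar K}) : (forall N, Q`_N = G N) -> exists z s,
  [/\ Q = \prod_(x <- z :: s) (1 - x *: 'X), ordp z = 0%:E%E, forall x, x \in s -> vge u x &
      forall m, (0 < m)%N -> l m = z ^+ m + \sum_(x <- s) x ^+ m].
Proof.
move=> hQ; have [|t tE _] := poly_split1 (G := Q); first by rewrite hQ G_exp.1.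
have cnt s : 0 <= s -> s < u -> exists a, [/\ (\sum_(z <- t) (ordp z < s%:E)%E)%N = a,
    (\sum_(z <- t) (ordp z <= s%:E)%E)%N = 1%N & s = 0 -> a = 0%N].
  move=> s0 su; have [a [hn ha]] := np_unit_series s0 su; exists a.
  have e : G =1 [eta nth 0 (\prod_(z <- t) (1 - z *: 'X))] by move=> N; rewrite -hQ tE.
  by have [<- <-] := np_uniq (eq_np e hn) (np_prod p_pr t s).
have [a0 [c1 c2 /(_ erefl) a00]] := cnt 0 (lexx _) u0; rewrite a00 {a0 a00} in c1.
have [z zt zle] : exists2 z, z \in t & (ordp z <= 0%:E)%E.
  by apply/hasP; rewrite has_count -sum1_count big_mkcond c2.
have z0 : ordp z = 0%:E%E.
  apply/eqP; rewrite eq_le zle leNgt; apply/negP => zlt.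
  move: c1; rewrite (big_rem z) //= zlt; lia.
have tp := perm_to_rem zt; exists z, (rem z t); split=> //.
- by rewrite tE (perm_big _ tp).
- move=> x xt; rewrite /vge leNgt; apply/negP => xu.
  have x0 : x != 0 by apply: contraTN xu => /eqP ->; rewrite ordp0.
  have [r er] := ordp_fin x0; rewrite er lte_fin in xu.
  have [] := cnt (Num.max 0 r); rewrite ?le_max ?lexx // ?gt_max ?u0 // => a [_ c3 _].
  move: c3; rewrite (big_rem z) //= (big_rem x) //= z0 er !lee_fin !le_max !lexx orbT; lia.
- move=> m m0; apply: oppr_inj; rewrite -(big_cons _ _ z _ xpredT (fun x => x ^+ m)) -(perm_big _ tp) /=.
  have G_exp' : is_exp (fun m => - \sum_(x <- t) x ^+ m) G.
    have := is_exp_prod t; rewrite -tE => -[h0 h1].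
    by split=> [|N]; rewrite -?hQ // h1; apply: eq_bigr => i _; rewrite hQ.
  exact: is_exp_sums_uniq G_exp G_exp' _ m0.
Qed.

End UnitRootSplit.

(** The roots of the polynomial are distinct and form the fixed field of a power of Frobenius; this
    is everything, because they generate the splitting field. *)
Lemma card_finite_extension (F : finFieldType) m (m0 : (0 < m)%N) :
  #|finvect_type (finite_extension F m0)| = (#|F| ^ m)%N.
Proof.
rewrite /finite_extension; case: (FinSplittingFieldFor _) => L /=.
have q1 := card_finNzRing_gt1 F; have N1 : (1 < #|F| ^ m)%N by rewrite -(exp1n m) ltn_exp2r.
rewrite [map_poly _ _]rmorphB rmorphXn /= map_polyX => -[zs DqL defL].
set N := (#|F| ^ m)%N in N1 DqL *.
pose Lf := finvect_type L.
have /finField_galois_generator[/= a _ Da] : (1 <= {:L})%VS by apply: sub1v.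
pose Em := fixedSpace (a ^+ m)%g; rewrite dimv1 expn1 in Da.
have [p p_pr pF] := finPcharP F; have pL : p \in [pchar L] by rewrite pchar_lalg.
have sep : uniq zs.
  rewrite -separable_prod_XsubC -(eqp_separable DqL) unlock derivB derivXn derivX.
  have -> : 'X^(N.-1) *+ N = 0 :> {poly L}.
    have N0 : N%:R = 0 :> L.
      move: N1; rewrite /N (card_pprimeChar pF) -expnM; case: (_ * m)%N => // k _.
      by rewrite natrX (pcharf0 pL) expr0n.
    by rewrite -mulr_natr -polyC_natr N0 mulr0.
  by rewrite sub0r coprimep_sym -scaleN1r coprimepZl ?oppr_eq0 ?oner_eq0 // coprime1p.
suffices /eq_card -> : Lf =i zs.
  apply: succn_inj; rewrite (card_uniqP _) //= -(size_prod_XsubC _ id).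
  by rewrite -(eqp_size DqL) size_polyDl size_polyXn // size_polyN size_polyX.
have in_zs : zs =i Em.
  move=> z; rewrite -root_prod_XsubC -(eqp_root DqL) (sameP fixedSpaceP eqP).
  rewrite /root !hornerE subr_eq0 /= /N; congr (_ == z).
  elim: (m) => [|i IHi]; first by rewrite gal_id.
  by rewrite expgSr expnSr exprM IHi galM ?Da ?memvf.
suffices defEm : Em = {:L}%VS by move=> z; rewrite in_zs defEm memvf.
apply/eqP; rewrite eqEsubv subvf -defL -[Em]subfield_closed agenvS //.
by rewrite subv_add sub1v; apply/span_subvP => z; rewrite in_zs.
Qed.

Section FrobProd.
Variables (p : nat) (R : comNzRingType) (n : nat) (H : 'M[{poly R}]_n.+1).
Local Notation fp := (frob_prod p H).

Lemma frob_prodD a b t : fp (a + b) t = fp a (t ^+ (p ^ b)) *m fp b t.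
Proof.
elim: a => [|a IH] /=; first by rewrite mul1mx.
by rewrite IH mulmxA -exprM -expnD addnC.
Qed.

Lemma frob_pow_iter d k (t : R) : t ^+ (p ^ d) = t -> t ^+ (p ^ (d * k)) = t.
Proof. by move=> h; elim: k => [|k IH]; rewrite ?muln0 ?expr1 // mulnS expnD exprM h. Qed.

Lemma frob_prodX d k t : t ^+ (p ^ d) = t -> fp (d * k) t = fp d t ^+ k.
Proof.
move=> h; elim: k => [|k IH]; first by rewrite muln0.
by rewrite mulnS frob_prodD frob_pow_iter // IH exprS.
Qed.

(** Replacing t by t^p moves one factor of a cyclic product from one end to the other. *)
Lemma frob_prod_tr_conj N t i : t ^+ (p ^ N) = t -> \tr (fp N (t ^+ (p ^ i))) = \tr (fp N t).
Proof.
move=> h; elim: i => [|i <-]; first by rewrite expr1.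
set s := t ^+ (p ^ i); have hs : s ^+ (p ^ N) = s by rewrite /s exprAC h.
have e k : fp k.+1 s = fp k (s ^+ p) *m frob_eval H s.
  by have := frob_prodD k 1 s; rewrite addn1 /= expn1 expn0 expr1 mulmx1.
rewrite expnSr exprM -/s; case: N h hs => [//|N] h hs.
by rewrite e mxtrace_mulC /= -exprM -expnS hs.
Qed.

End FrobProd.

Definition frob_approx (p : nat) (K : padic_closure p) (iota : {rmorphism algC -> Qpbar K})
    (Psi : 'F_p -> algC) n (H : 'M[{poly Qpbar K}]_n.+1) (M : nat) : Prop :=
  (forall i j, grows (psi_pi iota Psi) (unit_val p / p%:R) (unit_val p * (i != ord0)%:R) (H i j)) /\
  forall (E : finFieldType) (charE : p \in [pchar E]) N (T : E -> Qpbar K) (y : E),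
    #|E| = (p ^ N)%N -> (0 < N)%N -> is_teichmuller T -> y != 0 ->
    vge M%:R ((-1) ^+ n * iota (kloosterman_gen Psi n charE y) - \tr (frob_prod p H N (T y))).

Lemma kloosterman_sumE (p : nat) (Psi : 'F_p -> algC) n (F : finFieldType) (charF : p \in [pchar F]) (y : F) m (m0 : (0 < m)%N) :
  kloosterman_sum Psi n charF y m0 =
  kloosterman_gen Psi n (pchar_finite_extension m0 charF) (y%:A : finvect_type (finite_extension F m0)).
Proof.
rewrite /kloosterman_sum /kloosterman_gen.
move: (pchar_finite_extension m0 charF) => c; move: c.
move: (finite_extension F m0) => L c.
apply: eq_big => [x|x _].
  by [].
by congr (Psi _).
Qed.

Section UnitRoot.
Variables (p : nat) (p_pr : prime p) (K : padic_closure p).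
Variables (iota : {rmorphism algC -> Qpbar K}) (Psi : 'F_p -> algC).
Hypothesis Psi_char : nontrivial_additive_character Psi.
Variable n : nat.
Local Notation u := (unit_val p).
Local Notation pi := (psi_pi iota Psi).
Let u0 : 0 < u := unit_val_gt0 p_pr.

Lemma frob_eval_vge (H : 'M[{poly Qpbar K}]_n.+1) (M : nat) t i j : frob_approx iota Psi H M -> vge 0 t ->
  vge (u * (i != ord0)%:R) (frob_eval H t i j).
Proof.
move=> [hH _] ht; rewrite mxE horner_coef; apply: vge_sum => l _.
apply: vgeMr; last exact: vgeX0.
apply: vgeW (hH i j l).2; rewrite lerDl mulr_ge0 // divr_ge0 ?ler0n //; exact: ltW.
Qed.

Lemma frob_prod_vge (H : 'M[{poly Qpbar K}]_n.+1) (M : nat) N t : frob_approx iota Psi H M -> vge 0 t ->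
  forall i j, vge (if (0 < N)%N then u * (i != ord0)%:R else 0) (frob_prod p H N t i j).
Proof.
move=> hH ht; elim: N => [|N IH] i j; first exact: vge0_mx1.
rewrite /= mxE; apply: vge_sum => l _; apply: vgeMr; first by apply: (frob_eval_vge _ _ hH); apply: vgeX0.
by apply: vgeW (IH l j); case: ifP => // _; rewrite mulr_ge0 ?ler0n // ltW.
Qed.

Lemma Psi_cong1 a : vge u (iota (Psi a) - 1).
Proof.
have pi_root := psi_pi_root p_pr iota Psi_char.
rewrite (Psi_pow Psi_char) rmorphXn; set z := iota _.
have hz : vge u (z - 1) by apply: (vge_pi p_pr pi_root).
have z0 : vge 0 z by rewrite -(subrK 1 z) vgeD ?vge1 // (vgeW (ltW u0)).
by have := vge_subX a z0 (vge1 K) hz; rewrite expr1n.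
Qed.

(** Psi is 1 modulo the uniformizer, so the sum is congruent to its number of terms (q-1)^n, hence
    to (-1)^n. *)
Lemma kloosterman_cong1 (E : finFieldType) (charE : p \in [pchar E]) (y : E) :
  vge u ((-1) ^+ n * iota (kloosterman_gen Psi n charE y) - 1).
Proof.
have [m m0 cE] := card_pchar charE.
have cnt : #|[pred x : {ffun 'I_n -> E} | [forall i, x i != 0]]| = (#|E|.-1 ^ n)%N.
  have := card_ffun_on 'I_n (predC1 (0 : E)); rewrite card_ord cardC1 => <-.
  by apply: eq_card => x; rewrite !inE; apply: eq_forallb => i.
have h1 : vge u (iota (kloosterman_gen Psi n charE y) - (#|E|.-1 ^ n)%:R).
  rewrite rmorph_sum /= -cnt -sum1_card natr_sum -sumrB; apply: vge_sum => x _.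
  exact: Psi_cong1.
have h2 : vge u ((-1) ^+ n * (#|E|.-1 ^ n)%:R - 1 : Qpbar K).
  rewrite natrX -exprMn mulN1r -[X in _ - X](expr1n _ n).
  apply: vge_subX; rewrite ?vge1 ?vgeN ?vge_nat //.
  rewrite -opprD vgeN natr1 (ltn_predK (card_finNzRing_gt1 E)) cE.
  by apply: vgeW (vge_pexp K m); apply: le_trans (unit_val_le1 p_pr) _; rewrite ler1n.
rewrite -(subrK ((-1) ^+ n * (#|E|.-1 ^ n)%:R) ((-1) ^+ n * _)) -addrA -mulrBr.
by apply: vgeD => //; apply: vgeMl => //; rewrite vgeX0 // vgeN vge1.
Qed.

Variable h : closed_point p.
Local Notation F := (residue_field h).
Local Notation charF := (pchar_residue_field p_pr h).
Local Notation d := (closed_point_deg h).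
Local Notation y := (residue_coord h).
Local Notation ksum m0 := (@kloosterman_sum p Psi n F charF y _ m0).

Lemma closed_point_root_card (E : finFieldType) (charE : p \in [pchar E]) (z : E) :
  evFp z (val h) = 0 -> z ^+ (p ^ d) = z.
Proof.
move=> hz.
have hy : evFp y (val h) = 0 by rewrite residue_ev; apply/eqP; rewrite residue_eq0 dvdpp.
have := closed_point_dvd charF hy (Xcard_root charF (residue_card p_pr h) y) => /dvdpP[q e].
have : evFp z (q * val h) = 0 by rewrite (evFpM charE) hz mulr0.
by rewrite -e (evFpB charE) (evFpXn charE) (evFpX charE) => /eqP; rewrite subr_eq0 => /eqP.
Qed.

(** The power sums of the reciprocal roots of L^((-1)^(n-1)); the value at m = 0 is a default. *)
Definition ksum_pow m : Qpbar K := if m is m'.+1 then (-1) ^+ n * iota (ksum (ltn0Sn m')) else 1.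

Lemma ksum_powE m (m0 : (0 < m)%N) : exists (E : finFieldType) (charE : p \in [pchar E]) (z : E),
  [/\ #|E| = (p ^ (d * m))%N, z != 0, evFp z (val h) = 0 &
      ksum_pow m = (-1) ^+ n * iota (kloosterman_gen Psi n charE z)].
Proof.
case: m m0 => // m' _; have m0 := ltn0Sn m'; rewrite /ksum_pow (bool_irrelevance (ltn0Sn m') m0); pose E := finvect_type (finite_extension F m0).
pose z : E := y%:A.
have charE := pchar_finite_extension m0 charF.
have hz : evFp z (val h) = 0.
  rewrite /evFp; have := congr1 (in_alg (finite_extension F m0)) (residue_ev h (val h)).
  have -> : in_qpoly (val h) (val h) = 0 by apply/eqP; rewrite residue_eq0 dvdpp.
  rewrite rmorph0 /evFp rmorph_sum => e0; apply: etrans e0; apply: eq_bigr => i _.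
  by rewrite rmorphM rmorphXn rmorph_nat.
exists E, (pchar_finite_extension m0 charF), z; split.
- by rewrite card_finite_extension (residue_card p_pr) expnM.
- exact: (closed_point_root_neq0 charE hz).
- exact: hz.
- by rewrite kloosterman_sumE.
Qed.

(** The field defining the sum and the field E have unrelated Teichmuller maps. By [teich_conj] the
    two lifts of the closed point are Frobenius conjugate, which does not affect the trace. *)
Lemma ksum_pow_trace (H : 'M[{poly Qpbar K}]_n.+1) (M m : nat) (E : finFieldType) (T : E -> Qpbar K) (z : E) :
  p \in [pchar E] -> is_teichmuller T -> evFp z (val h) = 0 ->
  frob_approx iota Psi H M -> (0 < m)%N ->
  vge M%:R (ksum_pow m - \tr (frob_prod p H (d * m) (T z))).
Proof.
move=> charE TT hz hH m0; have [E' [charE' [z' [cE' z0 hz' ->]]]] := ksum_powE m0.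
have [T' TT'] := teichmuller_exists p_pr K charE'.
have [i hi] := teich_conj p_pr TT TT' charE charE' hz hz'.
have := hH.2 E' charE' (d * m)%N T' z' cE' _ TT' z0; rewrite hi frob_prod_tr_conj.
  by apply; rewrite muln_gt0 closed_point_deg_gt0.
by apply: frob_pow_iter; rewrite -(teichX TT) (closed_point_root_card charE hz).
Qed.

Lemma ksum_pow_vge0 m : vge 0 (ksum_pow m).
Proof.
case: m => [|m]; first exact: vge1.
have [E [charE [z [_ _ _ ->]]]] := ksum_powE (ltn0Sn m).
have := kloosterman_cong1 charE z; set x := _ * _ => hx.
by rewrite -(subrK 1 x) vgeD ?vge1 // (vgeW (ltW u0)).
Qed.

Lemma kloosterman_poly_series (Q : {poly algC}) g :
  is_exp (fun m => - (if m is m'.+1 then (-1) ^+ n * ksum (ltn0Sn m') else 1)) g ->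
  is_kloosterman_poly Psi n charF y Q <-> (forall N, Q`_N = g N).
Proof.
move=> hg; set L := kloosterman_L Psi n charF y.
have C0 k : ((k%:R : algC) == 0) = (k == 0%N) by rewrite pnatr_eq0.
have hL : is_exp (fun m => if m is m'.+1 then ksum (ltn0Sn m') else 0) L.
  apply: eq_is_exp (is_exp_exp_series C0 _) => // -[|m] // _.
  by rewrite mulrC divfK // pnatr_eq0.
rewrite /is_kloosterman_poly -/L; case: ifP => on.
  have e : L =1 g.
    apply: (is_exp_uniq C0 hL); apply: eq_is_exp hg => -[|m] // _.
    by rewrite -signr_odd on expr1 mulN1r opprK.
  by split=> hN N; rewrite hN e.
have e : conv L g =1 one_series algC.
  apply: (is_exp_uniq C0) (is_exp0 _); apply: eq_is_exp (is_exp_conv hL hg) => -[|m] // _.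
  by rewrite -signr_odd on expr0 mul1r subrr.
split=> hN N.
  apply: (@conv_inj _ L (fun i => Q`_i)); first by rewrite hL.1 oner_neq0.
  by move=> k; rewrite e convC /conv hN.
by rewrite (eq_bigr (fun i : 'I_N.+1 => g i * L (N - i)%N)) => [|i _]; rewrite ?hN // -[LHS]/(conv g L N) convC e.
Qed.

(* The Newton polygon of the reciprocal polynomial has exactly one segment of slope 0. *)
Lemma unit_root_spec : let a := alpha0 p_pr Psi n iota h in
  vge u (a - 1) /\ forall m, (0 < m)%N -> vge (m%:R * u) (ksum_pow m - a ^+ m).
Proof.
move=> a; have C0 k : ((k%:R : algC) == 0) = (k == 0%N) by rewrite pnatr_eq0.
have [g hg] := is_exp_exists C0 (fun m => - (if m is m'.+1 then (-1) ^+ n * ksum (ltn0Sn m') else 1)).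
pose G N := iota (g N).
have G_exp : is_exp (fun m => - ksum_pow m) G.
  split=> [|N]; first by rewrite /G hg.1 rmorph1.
  rewrite -(rmorph_nat iota) -rmorphM hg.2 rmorph_sum; apply: eq_bigr => i _ /=.
  by rewrite rmorphM rmorphN rmorphM rmorphXn rmorphN rmorph1.
have l1 : vge u (ksum_pow 1 - 1).
  have [E [charE [z [_ _ _ ->]]]] := ksum_powE (ltn0Sn 0); exact: kloosterman_cong1.
have charF' := charF; have [T TT] := teichmuller_exists p_pr K charF'.
have hy : evFp y (val h) = 0 by rewrite residue_ev; apply/eqP; rewrite residue_eq0 dvdpp.
have approx M : exists2 A : 'M[Qpbar K]_n.+1, forall i j, vge (u * (i != ord0)%:R) (A i j) &
    forall m, (0 < m)%N -> vge M%:R (ksum_pow m - \tr (A ^+ m)).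
  have [H hH] := frobenius_structure p_pr iota Psi_char n M.
  exists (frob_prod p H d (T y)).
    move=> i j; have := frob_prod_vge d hH (teich_vge0 TT y) i j.
    by rewrite closed_point_deg_gt0.
  move=> m m0; rewrite -frob_prodX; first exact: ksum_pow_trace.
  by rewrite -(teichX TT) (closed_point_root_card charF' hy).
(* The series g, over the algebraic numbers, is a polynomial because its image under iota is one. *)
pose Q := \poly_(i < n.+2) g i.
have QE N : Q`_N = g N.
  rewrite coef_poly; case: ltnP => // hN; apply: (fmorph_inj iota); rewrite rmorph0.
  by rewrite -/(G N) (unit_series_degree p_pr u0 ksum_pow_vge0 approx G_exp).
have QG N : (map_poly iota Q)`_N = G N by rewrite coef_map QE.
have [z [s [Qs z0 hs hl]]] := unit_root_split p_pr u0 ksum_pow_vge0 l1 approx G_exp QG.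
have nz : z != 0 by apply: contra_eq_neq z0 => ->; rewrite ordp0.
have rootQ b : b != 0 -> root (map_poly iota Q) b^-1 = (b \in z :: s).
  move=> b0; rewrite Qs /root horner_prod prodf_seq_eq0; apply/hasP/idP => [[x xs]|bs].
    rewrite !hornerE subr_eq0 eq_sym => /eqP e.
    by have <- : x = b by rewrite -(mulfK b0 x) mulrAC e mul1r.
  by exists b => //; rewrite !hornerE divff // subrr.
have az : a = z.
  rewrite /a /alpha0 /unit_root; set A := (X in xget 0 X).
  have : A (xget 0 A).
    apply: xgetPex; exists z, Q; first exact/(kloosterman_poly_series Q hg).
    by rewrite rootQ ?mem_head.
  case=> Q' /(kloosterman_poly_series Q' hg) hQ' [h0 h1].
  have eQ : Q' = Q by apply/polyP => N; rewrite hQ' QE.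
  move: h1; rewrite eQ rootQ; last by apply: contra_eq_neq h0 => ->; rewrite ordp0.
  rewrite inE => /orP[/eqP //|/hs]; rewrite (vgeE _ h0) => hu.
  by have := lt_le_trans u0 hu; rewrite ltxx.
have rest m : (0 < m)%N -> vge (m%:R * u) (ksum_pow m - a ^+ m).
  move=> m0; rewrite hl // az addrC addKr big_seq; apply: vge_sum => x xs; exact: vgeX (hs x xs).
split=> //; have := rest 1%N isT; rewrite mul1r expr1 vgeBC => h2.
by rewrite -(subrK (ksum_pow 1) a) -addrA vgeD.
Qed.

End UnitRoot.

(** * Powers of unit roots as Frobenius traces *)

Section TraceFormula.
Variables (p : nat) (p_pr : prime p) (K : padic_closure p).
Variables (iota : {rmorphism algC -> Qpbar K}) (Psi : 'F_p -> algC).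
Hypothesis Psi_char : nontrivial_additive_character Psi.
Variables (n : nat) (H : 'M[{poly Qpbar K}]_n.+1) (M : nat).
Hypothesis hH : frob_approx iota Psi H M.
Local Notation alpha h := (alpha0 p_pr Psi n iota h).
Local Notation deg h := (closed_point_deg h).

(** The condition j u >= M makes the j-th powers of the other eigenvalues vanish modulo p^M. The
    trace of the j-th power of m steps of Frobenius is that of m j steps, to which [ksum_pow_trace]
    applies. *)
Lemma trace_formula (j m : nat) (E : finFieldType) (T : E -> Qpbar K) :
  M%:R <= j%:R * unit_val p -> (0 < j)%N -> (0 < m)%N -> #|E| = (p ^ m)%N -> is_teichmuller T ->
  vge M%:R (\sum_(h <- points p m) (if (deg h %| m)%N then (deg h)%:R * (alpha h ^ j%:Z) ^+ (m %/ deg h) else 0)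
    - \sum_(y : E | y != 0) \tr (frob_prod p H m (T y) ^+ j)).
Proof.
move=> hj j0 m0 cE TT; have charE : p \in [pchar E] := card_finPcharP cE p_pr.
have /choice[hp hpP] : forall y : E, exists h : closed_point p, y != 0 -> evFp y (val h) = 0.
  move=> y; have [->|y0] := eqVneq y 0; last by have [h hh] := exists_closed_point charE y0; exists h.
  by have [h _] := exists_closed_point charE (oner_neq0 E); exists h.
pose G h := (alpha h ^ j%:Z) ^+ (m %/ deg h).
rewrite (@sum_closed_points p p_pr E charE m cE _ G (fun y => G (hp y)) m0); last first.
  move=> h y hy; have y0 := closed_point_root_neq0 charE hy.
  by rewrite (closed_point_uniq charE hy (hpP y y0)).
rewrite -sumrB; apply: vge_sum => y y0; have hy := hpP y y0; set h := hp y in hy *.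
have dm : (deg h %| m)%N := root_deg p_pr charE cE m0 hy.
have k0 : (0 < m %/ deg h)%N by rewrite divn_gt0 ?closed_point_deg_gt0 // dvdn_leq.
have [_ /(_ (j * (m %/ deg h))%N)] := unit_root_spec p_pr iota Psi_char n h.
rewrite muln_gt0 j0 k0 => /(_ isT) h1.
have := ksum_pow_trace p_pr charE TT hy hH (_ : 0 < j * (m %/ deg h))%N.
rewrite muln_gt0 j0 k0 => /(_ isT) h2.
rewrite -frob_prodX; last by rewrite -(teichX TT) -cE expf_card.
rewrite /G -exprnP -exprM.
have e : (deg h * (j * (m %/ deg h)) = m * j)%N by rewrite mulnCA [(deg h * _)%N]mulnC divnK // mulnC.
apply: vge_trans (_ : vge M%:R (_ - ksum_pow p_pr iota Psi n h (j * (m %/ deg h)))) _; last by rewrite -e.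
rewrite vgeBC; apply: vgeW h1; rewrite natrM; apply: le_trans hj _.
rewrite mulrAC ler_peMr ?ler1n // mulr_ge0 ?ler0n // ltW // unit_val_gt0 //.
Qed.

End TraceFormula.

(** * Symmetric powers *)

Section FinMatrices.
Variables (R : comNzRingType) (I : finType).
Implicit Types X Y : I -> I -> R.

(** Matrices indexed by any finite type, since exponent vectors and pairs have no preferred
    numbering. *)
Definition fmul X Y i j := \sum_k X i k * Y k j.
Definition fone (i j : I) : R := (i == j)%:R.
Definition ftr X := \sum_i X i i.

Lemma ftr_mulC X Y : ftr (fmul X Y) = ftr (fmul Y X).
Proof.
rewrite /ftr /fmul exchange_big; apply: eq_bigr => j _; apply: eq_bigr => i _.
exact: mulrC.
Qed.

End FinMatrices.

Section Words.
Variables n k : nat.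
Local Notation I := 'I_n.+1.
Local Notation word := {ffun 'I_k -> I}.

Definition word_count (f : word) (i : I) : nat := count_mem i [tuple f a | a < k].

Definition content := {c : {ffun I -> 'I_k.+1} | (\sum_i (c i : nat) == k)%N}.
HB.instance Definition _ := SubFinite.copy content {c : {ffun I -> 'I_k.+1} | (\sum_i (c i : nat) == k)%N}.

Lemma word_countE f i : word_count f i = #|[set a | f a == i]|.
Proof.
rewrite /word_count /= count_map -sum1_count big_enum_cond -sum1_card.
by apply: eq_bigl => a; rewrite !inE.
Qed.

Lemma sum_word_count f : (\sum_i word_count f i)%N = k.
Proof.
rewrite -[RHS]card_ord -sum1_card (partition_big f xpredT) //=; apply: eq_bigr => i _.
by rewrite word_countE -sum1_card; apply: eq_bigl => a; rewrite inE.
Qed.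

Lemma word_count_lt f i : (word_count f i < k.+1)%N.
Proof. by rewrite ltnS -[X in (_ <= X)%N](sum_word_count f) (bigD1 i) //= leq_addr. Qed.

Lemma cnt_subproof f : (\sum_i ([ffun i => Ordinal (word_count_lt f i)] i : nat) == k)%N.
Proof. by apply/eqP; rewrite -[RHS](sum_word_count f); apply: eq_bigr => i _; rewrite ffunE. Qed.

Definition cnt f : content := Sub [ffun i => Ordinal (word_count_lt f i)] (cnt_subproof f).

(** The sorted word of content c. *)
Definition rep (c : content) : word :=
  [ffun a : 'I_k => nth ord0 (flatten [seq nseq (val c i) i | i <- enum I]) a].

Lemma cntE f i : (val (cnt f) i : nat) = word_count f i.
Proof. by rewrite ffunE. Qed.

Lemma repK : cancel rep cnt.
Proof.
move=> c; apply: val_inj; apply/ffunP => i; apply: val_inj; rewrite /= cntE /word_count.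
pose s := flatten [seq nseq (val c i) i | i <- enum I]; have ss : size s = k.
  rewrite size_flatten /shape -map_comp sumnE big_map big_enum /= -[RHS](eqP (valP c)).
  by apply: eq_bigr => j _; rewrite /= size_nseq.
have -> : tval [tuple rep c a | a < k] = s.
  apply: (@eq_from_nth _ ord0); rewrite size_tuple // => a ak.
  by rewrite (nth_map (Ordinal ak)) ?size_enum_ord // ffunE nth_enum_ord.
rewrite count_flatten -map_comp sumnE big_map big_enum (bigD1 i) //= big1 ?addn0 => [|j ji].
  by rewrite count_nseq /= eqxx mul1n.
by rewrite count_nseq /= (negPf ji).
Qed.

Lemma cnt_perm f g : cnt f = cnt g -> exists s : 'S_k, forall a, f (s a) = g a.
Proof.
move=> e; have : perm_eq [tuple g a | a < k] [tuple f a | a < k].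
  apply/allP => i _ /=; have := congr1 (fun c : content => val c i : nat) e.
  by rewrite /= !cntE /word_count => ->.
move/tuple_permP => [s hs]; exists s => a.
have := congr1 (fun t => nth ord0 t a) hs; rewrite /= -[LHS]/(nth ord0 [tuple g a | a < k] a).
by rewrite -[RHS]/(nth ord0 [tuple tnth [tuple f a | a < k] (s a) | a < k] a) -!tnth_nth !tnth_mktuple.
Qed.

Lemma cnt_comp (f : word) (s : 'S_k) : cnt [ffun a => f (s a)] = cnt f.
Proof.
apply: val_inj; apply/ffunP => i; apply: val_inj; rewrite /= !cntE !word_countE.
rewrite -(card_imset [set a | f a == i] (@perm_inj _ s^-1)%g); congr #|pred_of_set _|.
apply/setP => a; rewrite inE ffunE; apply/idP/imsetP => [h|[b]].
  by exists (s a); rewrite ?inE ?permK.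
by rewrite inE => hb ->; rewrite permKV.
Qed.

Lemma sum_content (V : nmodType) (F : word -> V) : \sum_f F f = \sum_c \sum_(f | cnt f == c) F f.
Proof. exact: (partition_big cnt xpredT). Qed.

Lemma sum_word_cnt (F : I -> nat) (f : word) : (\sum_a F (f a))%N = (\sum_i val (cnt f) i * F i)%N.
Proof.
rewrite (partition_big f xpredT) //=; apply: eq_bigr => i _.
rewrite cntE word_countE -sum_nat_const; apply: eq_big => [a|a /eqP ->//].
by rewrite inE.
Qed.

Lemma prod_word_cnt (R : comNzRingType) (F : I -> R) (f : word) : \prod_a F (f a) = \prod_i F i ^+ val (cnt f) i.
Proof.
rewrite (partition_big f xpredT) //=; apply: eq_bigr => i _.
rewrite cntE word_countE -prodr_const; apply: eq_big => [a|a /eqP ->//].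
by rewrite inE.
Qed.

End Words.

Section SymmetricPower.
Variables n k : nat.
Local Notation I := 'I_n.+1.
Local Notation word := {ffun 'I_k -> I}.
Implicit Types (c d : content n k) (f g : word).

(* The action on monomials of degree k in n+1 variables: column d is the image of *)
(* the monomial with exponents d.                                                 *)
Definition symf (R : comNzRingType) (X : I -> I -> R) c d : R :=
  \sum_(f : word | cnt f == c) \prod_a X (f a) (rep d a).

Variable R : comNzRingType.
Implicit Types X Y : I -> I -> R.

(** A column depends only on the content of the word: this descends the tensor power to the
    symmetric power. *)
Lemma symf_cnt X c g : \sum_(f : word | cnt f == c) \prod_a X (f a) (g a) = symf X c (cnt g).
Proof.
have [s hs] := cnt_perm (repK (cnt g)).
rewrite /symf (reindex_inj (h := fun f : word => [ffun a => f (s a)])) => [|f f' e]; last first.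
  by apply/ffunP => a; have := congr1 (fun h : word => h (s^-1 a)%g) e; rewrite /= !ffunE permKV.
apply: eq_big => [f|f _]; first by rewrite cnt_comp.
rewrite [RHS](reindex_inj (@perm_inj _ s)); apply: eq_bigr => a _; by rewrite ffunE hs.
Qed.

Lemma eq_symf X Y : (forall i j, X i j = Y i j) -> forall c d, symf X c d = symf Y c d.
Proof. by move=> h c d; apply: eq_bigr => f _; apply: eq_bigr => a _. Qed.

Lemma symf_mul X Y c d : symf (fmul X Y) c d = fmul (symf X) (symf Y) c d.
Proof.
rewrite /symf; under eq_bigr do rewrite /fmul bigA_distr_bigA /=.
rewrite exchange_big /= (sum_content (k := k)); apply: eq_bigr => b _.
rewrite mulr_sumr; apply: eq_bigr => g /eqP cg.
by under eq_bigr do rewrite big_split /=; rewrite -mulr_suml symf_cnt cg.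
Qed.

Lemma symf_one c d : symf (fone R (I := I)) c d = fone R c d.
Proof.
rewrite /symf (eq_bigr (fun f => (f == rep d)%:R)) => [|f _]; last first.
  have [->|ne] := eqVneq f (rep d); first by rewrite big1 // => a _; rewrite /fone eqxx.
  have [a ha] : exists a, f a != rep d a.
    apply/existsP; apply: contraNT ne; rewrite negb_exists => /forallP h.
    by apply/eqP/ffunP => a; apply/eqP; have := h a; rewrite negbK.
  by rewrite (bigD1 a) //= /fone (negPf ha) mul0r.
rewrite /fone; have [->|ne] := eqVneq c d.
  by rewrite (bigD1 (rep d)) ?repK //= eqxx big1 ?addr0 // => f /andP[_ /negPf ->].
by rewrite big1 // => f /eqP cf; case: eqP => // e; move: ne; rewrite -cf e repK eqxx.
Qed.

Definition complete_sym (z : I -> R) : R := \sum_(c : content n k) \prod_i z i ^+ val c i.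

Lemma ftr_symf_trig X : (forall i j : I, (i < j)%N -> X i j = 0) ->
  ftr (symf X) = complete_sym (fun i => X i i).
Proof.
move=> hX; apply: eq_bigr => c _; rewrite /symf (bigD1 (rep c)) ?repK //= [X in _ + X]big1 ?addr0.
  by have := prod_word_cnt (fun i => X i i) (rep c); rewrite repK.
(* Two words of the same content have the same sum of letters, so a word other than the
   representative has a smaller letter somewhere, where the triangular matrix has a zero entry. *)
move=> f /andP[/eqP cf nf]; have [a ha] : exists a, (f a < rep c a)%N.
  apply/existsP; apply: contraNT nf; rewrite negb_exists => /forallP h.
  have le a : (rep c a <= f a)%N by rewrite leqNgt h.
  have e : (\sum_a rep c a = \sum_a f a)%N.
    by rewrite (sum_word_cnt (fun i => i : nat)) (sum_word_cnt (fun i => i : nat) f) cf repK.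
  have := leqif_sum (fun a (_ : xpredT a) => leqif_geq (le a)).
  rewrite /leqif e eqxx => -[_ /esym/forall_inP h'].
  by apply/eqP/ffunP => a; apply: val_inj; apply/eqP; rewrite eqn_leq le (h' a).
by rewrite (bigD1 a) //= hX // mul0r.
Qed.

End SymmetricPower.

Section CompleteSymmetric.
Variables (F : closedFieldType) (n : nat).
Local Notation I := 'I_n.+1.

Lemma complete_sym_coef (z : I -> F) k :
  complete_sym k z = (\prod_i \sum_(j < k.+1) (z i ^+ j *: 'X^j))`_k.
Proof.
rewrite bigA_distr_bigA /= coef_sum.
rewrite (eq_bigr (fun g : {ffun I -> 'I_k.+1} => if (\sum_i (g i : nat) == k)%N then \prod_i z i ^+ g i else 0)).
  rewrite -big_mkcond /= [RHS](reindex_omap (val : content n k -> _) insub) => [|g hg]; last by rewrite insubT.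
  by apply: eq_bigl => c; rewrite valK eqxx andbT; apply/esym/(valP c).
move=> g _; rewrite scaler_prod coefZ prodrXr coefXn eq_sym.
by case: ifP => _; rewrite ?mulr1 ?mulr0.
Qed.

Lemma complete_sym_trunc (z : I -> F) k N : (k <= N)%N ->
  complete_sym k z = (\prod_i \poly_(j < N.+1) z i ^+ j)`_k.
Proof.
move=> kN; rewrite complete_sym_coef; apply: coef_prod_poly_eq (leqnn k) => i l lk.
rewrite -poly_def !coef_poly ltnS lk ltnS (leq_trans lk) //.
Qed.

Hypothesis F0 : forall k, ((k%:R : F) == 0) = (k == 0%N).

Definition sym_trace k (A : 'M[F]_n.+1) : F := ftr (@symf n k F (fun i j => A i j)).

Lemma sym_traceC k (A B : 'M[F]_n.+1) : sym_trace k (A *m B) = sym_trace k (B *m A).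
Proof.
have e (X Y : 'M[F]_n.+1) : sym_trace k (X *m Y) = ftr (fmul (@symf n k F (fun i j => X i j)) (symf (fun i j => Y i j))).
  by apply: eq_bigr => c _; rewrite -symf_mul; apply: eq_symf => i j; rewrite mxE.
by rewrite !e ftr_mulC.
Qed.

Lemma fred_sym_eig (A : 'M[F]_n.+1) : exists z : I -> F,
  (forall k, sym_trace k A = complete_sym k z) /\ forall N, (fred A)`_N = (\prod_i (1 - z i *: 'X))`_N.
Proof.
have [P [T [Pu eT tT]]] := ex_trigmx A; pose z i := T i i.
have hA k : sym_trace k A = complete_sym k z.
  have -> : A = invmx P *m (T *m P) by rewrite -eT mulKmx.
  rewrite sym_traceC -mulmxA mulmxV // mulmx1 /sym_trace ftr_symf_trig // => i j ij.
  exact: (is_trig_mxP tT).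
have fA N : (fred A)`_N = (\prod_i (1 - z i *: 'X))`_N.
  apply: (is_exp_uniq F0 (is_exp_fred A)); rewrite -(big_map z xpredT (fun x => 1 - x *: 'X)).
  apply: eq_is_exp (is_exp_prod _) => m _; congr (- _); rewrite big_map.
  rewrite (mxtrace_conj Pu (conj_expmx m eT)); apply: eq_bigr => i _.
  by rewrite (trig_expmx m tT).2.
by exists z.
Qed.

Lemma fred_sym_trace (A : 'M[F]_n.+1) : conv (fun N => (fred A)`_N) (sym_trace^~ A) =1 one_series F.
Proof.
have [z [hA fA]] := fred_sym_eig A; move=> N; rewrite /conv.
rewrite (eq_bigr (fun i : 'I_N.+1 => (\prod_i (1 - z i *: 'X))`_i * (\prod_i \poly_(j < N.+1) z i ^+ j)`_(N - i))).
  rewrite -coefM -big_split /= /one_series -coef1.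
  rewrite (@coef_prod_poly_eq F _ _ _ (fun=> 1) N _ N (leqnn N)) ?big1 // => i l lN.
  rewrite mulrBl mul1r -scalerAl coefB coefZ coefXM !coef_poly coef1 ltnS lN.
  case: l lN => [|l] lN /=; first by rewrite mulr0 subr0.
  by rewrite ltnS (ltnW lN) exprS subrr.
by move=> i _; rewrite fA hA -complete_sym_trunc // leq_subr.
Qed.

Lemma fred_degree (A : 'M[F]_n.+1) N : (n.+1 < N)%N -> (fred A)`_N = 0.
Proof.
have [z [_ ->]] := fred_sym_eig A => hN; apply: nth_default; apply: leq_trans hN.
apply: leq_trans (size_prod_leq _ _) _; rewrite card_ord leq_subLR addnS ltnS.
apply: leq_trans (_ : \sum_(i < n.+1) 2 <= _)%N; last by rewrite sum_nat_const card_ord muln2 -addnn.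
apply: leq_sum => i _; apply: leq_trans (size_polyD _ _) _.
rewrite geq_max size_polyC oner_neq0 size_polyN; apply: leq_trans (size_scale_leq _ _) _.
by rewrite size_polyX.
Qed.

(** Expresses the coefficients, which are traces of exterior powers up to sign, through symmetric
    powers only. *)
Lemma fred_rec (A : 'M[F]_n.+1) N :
  (fred A)`_N.+1 = - \sum_(i < N.+1) sym_trace i.+1 A * (fred A)`_(N - i).
Proof.
have := fred_sym_trace A N.+1; rewrite convC /conv big_ord_recl subn0 /one_series /=.
have := fred_sym_trace A 0%N; rewrite conv_coef0 /one_series /= (is_exp_fred A).1 mul1r => ->.
rewrite mul1r => /eqP; rewrite addr_eq0 => /eqP ->; congr (- _).
Qed.

(** The coefficient of T^j in -T f'/f for f = det(1 - T A), where 1/f generates the traces on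
    symmetric powers. As f has degree at most n+1, the number of terms does not depend on j, and n <
    j makes all degrees j - b nonnegative. *)
Lemma power_trace (A : 'M[F]_n.+1) j : (n < j)%N ->
  \tr (A ^+ j) = \sum_(b < n.+2) (- (fred A)`_b *+ b) * sym_trace (j - b) A.
Proof.
move=> nj; pose f N := (fred A)`_N; have [f0 hf] := is_exp_fred A.
have h1 : conv (fun N => f N *+ N) (sym_trace^~ A) j = - \tr (A ^+ j).
  rewrite (eq_conv (f' := conv (pos_part (fun m => - \tr (A ^+ m))) f) (g' := sym_trace^~ A)) => [|i _|//].
    by rewrite -convA (eq_conv (fun _ _ => erefl) (fun i _ => fred_sym_trace A i)) convC conv1; case: j nj.
  by rewrite conv_pos_part -hf mulr_natl.
rewrite -[LHS]opprK -h1 -sumrN; pose g i := - f i *+ i * sym_trace (j - i) A.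
rewrite (eq_bigr (fun i : 'I_j.+1 => g i)) => [|i _]; last by rewrite /g mulNrn mulNr.
rewrite -!(big_mkord xpredT g) (big_cat_nat (leq0n n.+2) (_ : n.+2 <= j.+1)%N) //=.
rewrite [X in _ + X]big_nat [X in _ + X]big1 ?addr0 // => i /andP[hi _].
by rewrite /g /f fred_degree // oppr0 mul0rn mul0r.
Qed.
End CompleteSymmetric.

(** * Overconvergent systems *)

Section FinProducts.
Variables (p : nat) (R : comNzRingType).

Fixpoint frob_fprod (I : finType) (A : I -> I -> {poly R}) m t : I -> I -> R :=
  if m is m'.+1 then fmul (fun i j => (A i j).[t ^+ (p ^ m')]) (frob_fprod A m' t) else @fone R I.

Lemma frob_prodE n (H : 'M[{poly R}]_n) m t i j : frob_prod p H m t i j = frob_fprod (fun i j => H i j) m t i j.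
Proof.
elim: m i j => [|m IH] i j /=; first by rewrite mxE.
by rewrite mxE; apply: eq_bigr => k _; rewrite mxE IH.
Qed.

Lemma frob_fprod_sym n k (A : 'I_n.+1 -> 'I_n.+1 -> {poly R}) m t c d :
  frob_fprod (@symf n k _ A) m t c d = symf (frob_fprod A m t) c d.
Proof.
elim: m c d => [|m IH] c d /=; first by rewrite symf_one.
rewrite symf_mul; apply: eq_bigr => b _; rewrite IH; congr (_ * _).
by rewrite /symf horner_sum; apply: eq_bigr => f _; rewrite horner_prod.
Qed.

Lemma frob_fprod_tensor (I J : finType) (A : I -> I -> {poly R}) (B : J -> J -> {poly R}) m t x y :
  frob_fprod (fun x y : I * J => A x.1 y.1 * B x.2 y.2) m t x y = frob_fprod A m t x.1 y.1 * frob_fprod B m t x.2 y.2.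
Proof.
elim: m x y => [|m IH] [i i'] [j j'] /=; first by rewrite /fone xpair_eqE -mulnb natrM.
rewrite /fmul big_distrlr pair_bigA; apply: eq_bigr => -[k k'] _ /=.
by rewrite IH hornerM /= mulrACA.
Qed.

End FinProducts.

Section Systems.
Variables (p : nat) (p_pr : prime p) (K : padic_closure p) (pi : Qpbar K).
Local Notation u := (unit_val p).
Local Notation r := (unit_val p / p%:R).

(** Weights are attached to rows, and the rate u/p is the one of [frobenius_structure]; both survive
    tensor and symmetric powers. *)
Record sys := Sys {
  sI : finType; sw : sI -> nat; sA : sI -> sI -> {poly Qpbar K};
  sP : forall i j, grows pi r (u * (sw i)%:R) (sA i j)
}.

Definition str (s : sys) m t := ftr (frob_fprod p (@sA s) m t).
Definition scount (s : sys) W := #|[set i | (@sw s i < W)%N]|.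

Lemma one_subproof (i j : unit) : grows pi r (u * 0%:R) (fone {poly Qpbar K} i j).
Proof. by rewrite mulr0 /fone; case: i; case: j; apply: grows1. Qed.
Definition one_sys := @Sys unit (fun=> 0%N) _ one_subproof.

Lemma tensor_subproof (s s' : sys) (x y : sI s * sI s') :
  grows pi r (u * (sw x.1 + sw x.2)%:R) (sA x.1 y.1 * sA x.2 y.2).
Proof. by rewrite natrD mulrDr; apply: growsM; apply: sP. Qed.
Definition tensor_sys s s' := @Sys _ (fun x => sw x.1 + sw x.2)%N _ (@tensor_subproof s s').

Lemma str_one m t : str one_sys m t = 1.
Proof.
rewrite /str /ftr (big_pred1 tt) => [|[] //].
by elim: m => [//|m IH]; rewrite /= /fmul (big_pred1 tt) => [|[] //]; rewrite IH mulr1 hornerC.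
Qed.

Lemma str_tensor s s' m t : str (tensor_sys s s') m t = str s m t * str s' m t.
Proof.
rewrite /str /ftr big_distrlr pair_bigA; apply: eq_bigr => -[i i'] _ /=.
exact: (frob_fprod_tensor p (@sA s) (@sA s') m t (i, i') (i, i')).
Qed.

Lemma scount_one W : (scount one_sys W <= 1)%N.
Proof. by apply: leq_trans (max_card _) _; rewrite card_unit. Qed.

Lemma scount_tensor s s' W : (scount (tensor_sys s s') W <= scount s W * scount s' W)%N.
Proof.
rewrite /scount -cardsX; apply: subset_leq_card; apply/fintype.subsetP => -[i i'].
rewrite !inE /= => h; apply/andP; split; apply: leq_ltn_trans h; rewrite ?leq_addr ?leq_addl //.
Qed.

Section SymSystem.
Variables (n k : nat) (H : 'M[{poly Qpbar K}]_n.+1).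
Hypothesis hH : forall i j, grows pi r (u * (i != ord0)%:R) (H i j).

Definition sym_weight (c : content n k) : nat := \sum_i val c i * (i != ord0).

Lemma sym_subproof (c d : content n k) : grows pi r (u * (sym_weight c)%:R) (symf (fun i j => H i j) c d).
Proof.
apply: grows_sum => f /eqP cf.
have := grows_prod (index_enum 'I_k) (fun a => hH (f a) (rep d a)).
by rewrite -mulr_sumr -natr_sum (sum_word_cnt (fun i => (i != ord0) : nat) f) cf.
Qed.
Definition sym_sys := @Sys _ sym_weight _ sym_subproof.

Lemma str_sym m t : str sym_sys m t = sym_trace k (frob_prod p H m t).
Proof.
apply: eq_bigr => c _; rewrite [LHS]frob_fprod_sym; apply: eq_symf => i j.
by rewrite frob_prodE.
Qed.

(* The bound does not depend on k: the exponent of the first variable is determined *)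
(* by the other ones.                                                              *)
Lemma scount_sym W : (scount sym_sys W <= W ^ n)%N.
Proof.
case: W => [|W]; first by rewrite /scount (eq_card0 (_ : _ =i pred0)) // => c; rewrite inE.
pose g (c : content n k) : {ffun 'I_n -> 'I_W.+1} := [ffun i => inord (val c (lift ord0 i))].
have hw (c : content n k) i : (val c (lift ord0 i) <= sym_weight c)%N.
  by rewrite /sym_weight (bigD1 (lift ord0 i)) //= muln1 leq_addr.
have gi : {in [set c | (sym_weight c < W.+1)%N] &, injective g}.
  move=> c d; rewrite !inE => hc hd e.
  have e1 i : val c (lift ord0 i) = val d (lift ord0 i) :> nat.
    have := congr1 (fun h : {ffun 'I_n -> 'I_W.+1} => h i : nat) e; rewrite /= !ffunE !inordK //.
      exact: leq_ltn_trans (hw d i) hd.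
    exact: leq_ltn_trans (hw c i) hc.
  apply: val_inj; apply/ffunP => i; apply: val_inj; case: (unliftP ord0 i) => [j ->|->]; first exact: e1.
  have := eqP (valP c); rewrite -[RHS](eqP (valP d)) !big_ord_recl /=.
  by rewrite (eq_bigr (fun i => val d (lift ord0 i) : nat)) => [/addIn|j _]; rewrite ?e1.
rewrite /scount -(card_in_imset gi); apply: leq_trans (max_card _) _.
by rewrite card_ffun !card_ord.
Qed.

End SymSystem.
End Systems.

Section VirtualSystems.
Variables (p : nat) (p_pr : prime p) (K : padic_closure p) (pi : Qpbar K) (n : nat).
Local Notation u := (unit_val p).
Local Notation r := (unit_val p / p%:R).
Local Notation C := (Qpbar K).
Implicit Types (L : seq (bool * sys pi)) (tau : 'M[C]_n.+1 -> C).

Definition vtr L m t : C := \sum_(x <- L) (-1) ^+ x.1 * str x.2 m t.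
Definition vcount L W : nat := \sum_(x <- L) scount x.2 W.

(* tau is a virtual representation of the Frobenius matrix, with a bound on the *)
(* number of basis vectors of small weight.                                     *)
Definition virtual (c : nat -> nat) tau := forall H : 'M[{poly C}]_n.+1,
  (forall i j, grows pi r (u * (i != ord0)%:R) (H i j)) ->
  exists2 L, forall W, (vcount L W <= c W)%N & forall m t, vtr L m t = tau (frob_prod p H m t).

Lemma eq_virtual c tau tau' : tau =1 tau' -> virtual c tau -> virtual c tau'.
Proof. by move=> e h H /h[L hL hT]; exists L => // m t; rewrite hT e. Qed.

Lemma virtual0 : virtual (fun=> 0%N) (fun=> 0).
Proof. by move=> H _; exists [::] => [W|m t]; rewrite /vcount /vtr big_nil. Qed.

Lemma virtual1 : virtual (fun=> 1%N) (fun=> 1).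
Proof.
move=> H _; exists [:: (false, one_sys pi)] => [W|m t]; rewrite /vcount /vtr big_seq1.
  exact: scount_one.
by rewrite mul1r str_one.
Qed.

Lemma virtual_sym k : virtual (expn^~ n) (sym_trace k).
Proof.
move=> H hH; exists [:: (false, sym_sys k hH)] => [W|m t]; rewrite /vcount /vtr big_seq1.
  exact: scount_sym.
by rewrite mul1r str_sym.
Qed.

Lemma virtualD c c' tau tau' : virtual c tau -> virtual c' tau' ->
  virtual (fun W => c W + c' W)%N (fun X => tau X + tau' X).
Proof.
move=> h h' H hH; have [L hL hT] := h H hH; have [L' hL' hT'] := h' H hH.
exists (L ++ L') => [W|m t]; first by rewrite /vcount big_cat leq_add ?hL ?hL'.
by rewrite /vtr big_cat /= -hT -hT'.
Qed.

Lemma virtualN c tau : virtual c tau -> virtual c (fun X => - tau X).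
Proof.
move=> h H hH; have [L hL hT] := h H hH.
exists [seq (~~ x.1, x.2) | x <- L] => [W|m t]; first by rewrite /vcount big_map hL.
by rewrite /vtr big_map -hT -sumrN; apply: eq_bigr => x _; rewrite signrN mulNr.
Qed.

Lemma virtualM c c' tau tau' : virtual c tau -> virtual c' tau' ->
  virtual (fun W => c W * c' W)%N (fun X => tau X * tau' X).
Proof.
move=> h h' H hH; have [L hL hT] := h H hH; have [L' hL' hT'] := h' H hH.
exists [seq (x.1 (+) y.1, tensor_sys x.2 y.2) | x <- L, y <- L'] => [W|m t].
  apply: leq_trans (leq_mul (hL W) (hL' W)); rewrite /vcount big_allpairs_dep big_distrlr.
  by apply: leq_sum => x _; apply: leq_sum => y _; apply: scount_tensor.
rewrite -hT -hT' /vtr big_allpairs_dep big_distrlr; apply: eq_bigr => x _; apply: eq_bigr => y _ /=.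
by rewrite signr_addb str_tensor mulrACA.
Qed.

(** The order of quantifiers is the point: one count c serves all j. *)
Lemma virtual_sum (J : Type) k (tau : nat -> J -> 'M[C]_n.+1 -> C) :
  (forall i, (i < k)%N -> exists c, forall j, virtual c (tau i j)) ->
  exists c, forall j, virtual c (fun X => \sum_(i < k) tau i j X).
Proof.
elim: k => [|k IH] h.
  exists (fun=> 0%N) => j; apply: eq_virtual virtual0 => X; by rewrite big_ord0.
have [c hc] := IH (fun i hi => h i (ltnW hi)); have [c' hc'] := h k (leqnn _).
exists (fun W => c W + c' W)%N => j; apply: eq_virtual (virtualD (hc j) (hc' j)) => X.
by rewrite big_ord_recr.
Qed.

Let C0 k : ((k%:R : C) == 0) = (k == 0%N) := natr_Qpbar_eq0 p_pr K k.

(** The recursion [fred_rec] spares the construction of exterior powers. *)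
Lemma virtual_fred b : exists c, virtual c (fun X => (fred X)`_b).
Proof.
elim/ltn_ind: b => -[|b] IH.
  by exists (fun=> 1%N); apply: eq_virtual virtual1 => X; rewrite (is_exp_fred X).1.
have [i hi|c hc] := @virtual_sum unit b.+1 (fun i _ X => sym_trace i.+1 X * (fred X)`_(b - i)).
  have [|c hc] := IH (b - i)%N; first by rewrite ltnS leq_subr.
  by exists (fun W => W ^ n * c W)%N => _; apply: virtualM => //; apply: virtual_sym.
by exists c; apply: eq_virtual (virtualN (hc tt)) => X; rewrite fred_rec.
Qed.

(** A symmetric power has count W^n whatever its degree, so c is independent of j; this is the
    source of the uniformity in k. *)
Lemma virtual_power : exists c, forall j, (n < j)%N -> virtual c (fun X => \tr (X ^+ j)).
Proof.
have [b _|c hc] := @virtual_sum nat n.+2 (fun b j X => (- (fred X)`_b *+ b) * sym_trace (j - b) X).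
  have [c hc] := virtual_fred b.
  have [_ _|c' hc'] := @virtual_sum unit b (fun _ _ X => - (fred X)`_b).
    by exists c => _; apply: virtualN.
  exists (fun W => c' W * W ^ n)%N => j; apply: virtualM (virtual_sym _).
  by apply: eq_virtual (hc' tt) => X; rewrite sumr_const card_ord.
by exists c => j nj; apply: eq_virtual (hc j) => X; rewrite power_trace.
Qed.

End VirtualSystems.

(** * The Dwork operator *)

Section DworkOperator.
Variables (p : nat) (p_pr : prime p) (K : padic_closure p) (pi : Qpbar K) (s : sys pi).
Local Notation C := (Qpbar K).
Local Notation u := (unit_val p).
Local Notation A := (@sA _ _ _ s).
Local Notation I := (sI s).
Let p1 : (1 < p)%N := prime_gt1 p_pr.
Let p0 : (0 < p)%N := prime_gt0 p_pr.

Fixpoint frob_poly m : I -> I -> {poly C} :=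
  if m is m'.+1 then fmul (fun i j => A i j \Po 'X^(p ^ m')) (frob_poly m') else @fone _ I.

Lemma horner_frob_poly m t i j : (frob_poly m i j).[t] = frob_fprod p A m t i j.
Proof.
elim: m i j => [|m IH] i j /=; first by rewrite /fone; case: eqP => _; rewrite ?hornerC ?horner0 // -polyC1 hornerC.
rewrite /fmul horner_sum; apply: eq_bigr => k _.
by rewrite hornerM horner_comp hornerXn IH.
Qed.

Variable d : nat.
Hypothesis hd : forall i j, (size (A i j) <= d.+1)%N.

Lemma size_frob_poly m i j : (size (frob_poly m i j) <= (d * (p ^ m).-1).+1)%N.
Proof.
elim: m i j => [|m IH] i j /=; first by rewrite /fone muln0; case: eqP => _; rewrite ?size_poly1 ?size_poly0.
apply: (leq_trans (size_sum _ _ _)); apply/bigmax_leqP => k _.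
apply: leq_trans (size_polyMleq _ _) _.
have h1 : ((size (A i k \Po 'X^(p ^ m))).-1 <= d * p ^ m)%N.
  rewrite size_comp_poly size_polyXn leq_mul2r; apply/orP; right.
  by case: (size _) (hd i k).
have h2 := IH k j; have q0 : (0 < p ^ m)%N by rewrite expn_gt0 p0.
have h3 : (d * p ^ m + d * (p ^ m).-1 <= d * (p ^ m.+1).-1)%N.
  rewrite -mulnDr leq_mul2l expnS; apply/orP; right; case: (p ^ m)%N q0 => // q _.
  have := leq_mul p1 (leqnn q.+1); lia.
move: h1 h2 h3; lia.
Qed.

(** The operator psi_p o A on vectors of polynomials of degree at most d, where d bounds the degrees
    of the entries of A. *)
Definition dwork (x y : I * 'I_d.+1) : C := (sect p 0 (A x.1 y.1 * 'X^(y.2)))`_(x.2).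

Fixpoint dwork_pow m : I * 'I_d.+1 -> I * 'I_d.+1 -> C :=
  if m is m'.+1 then fmul dwork (dwork_pow m') else @fone _ _.

Lemma dwork_powE m x y : dwork_pow m x y = (sect (p ^ m) 0 (frob_poly m x.1 y.1 * 'X^(y.2)))`_(x.2).
Proof.
elim: m x y => [|m IH] [i l'] [j l] /=.
  rewrite /fone coef_sect // addn0 mul1n coefMXn xpair_eqE.
  case: ltnP => ll.
    by have -> : (l' == l) = false; [apply/negbTE; rewrite -val_eqE neq_ltn ll | rewrite andbF].
  case: (i == j) => /=; rewrite ?coef0 // coef1 subn_eq0; congr (nat_of_bool _)%:R.
  by rewrite -val_eqE /= eqn_leq ll andbT.
have q0 : (0 < p ^ m)%N by rewrite expn_gt0 p0.
rewrite /fmul (eq_bigr (fun z => dwork (i, l') (z.1, z.2) * dwork_pow m (z.1, z.2) (j, l))) => [|[] //].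
rewrite -(pair_bigA _ (fun k l'' => dwork (i, l') (k, l'') * dwork_pow m (k, l'') (j, l))) /=.
rewrite expnS coef_sect ?muln_gt0 ?p0 // addn0 mulr_suml coef_sum; apply: eq_bigr => k _.
pose g := sect (p ^ m) 0 (frob_poly m k j * 'X^l).
(* This space is stable, the degree being at most (d (q-1) + d) / q = d for q = p^m. *)
have sg : (size g <= d.+1)%N.
  apply/leq_sizeP => v hv; rewrite coef_sect // addn0 coefMXn; case: ltnP => // _.
  apply: nth_default; apply: leq_trans (size_frob_poly m k j) _.
  rewrite ltn_subRL; have hl := ltn_ord l; have h1 : (p ^ m * d.+1 <= p ^ m * v)%N by rewrite leq_mul2l hv orbT.
  apply: leq_trans h1; case: (p ^ m)%N q0 => // q _; rewrite /= mulnS mulSn; lia.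
have gE : \sum_(v < d.+1) g`_v *: 'X^v = g.
  rewrite -(poly_def d.+1 (fun v => g`_v)); apply/polyP => v.
  by rewrite coef_poly; case: ltnP => // hv; rewrite nth_default // (leq_trans sg).
have -> : \sum_(v < d.+1) dwork (i, l') (k, v) * dwork_pow m (k, v) (j, l) = (sect p 0 (A i k * g))`_l'.
  rewrite (eq_bigr (fun v : 'I_d.+1 => (A i k * (g`_v *: 'X^v))`_(p * l' + 0)%N)) => [|v _].
    by rewrite coef_sect // -coef_sum -mulr_sumr gE.
  by rewrite IH /dwork coef_sect //= -scalerAr coefZ mulrC.
rewrite -(sect_spread (A i k) _ q0) sect_comp // muln0 addn0 coef_sect ?muln_gt0 ?p0 // addn0.
by rewrite mulrA.
Qed.

Lemma big_enum_valT (J : finType) (V : nmodType) (F : J -> V) : \sum_(a < #|J|) F (enum_val a) = \sum_x F x.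
Proof. by rewrite -(big_enum_val (A := J) F); apply: eq_bigl => x. Qed.

Definition dwork_mx : 'M[C]_#|{: I * 'I_d.+1}| := \matrix_(a, b) dwork (enum_val a) (enum_val b).

Lemma dwork_mxX m a b : (dwork_mx ^+ m) a b = dwork_pow m (enum_val a) (enum_val b).
Proof.
elim: m a b => [|m IH] a b; first by rewrite expr0 mxE /= /fone (inj_eq enum_val_inj).
rewrite exprS [LHS]mxE -[RHS](big_enum_valT (fun z => dwork (enum_val a) z * dwork_pow m z (enum_val b))).
apply: eq_bigr => k _.
by rewrite mxE IH.
Qed.

Lemma dwork_trace m : \tr (dwork_mx ^+ m) = \sum_i \sum_(l < d.+1) (frob_poly m i i)`_((p ^ m).-1 * l).
Proof.
rewrite /mxtrace (eq_bigr (fun a => dwork_pow m (enum_val a) (enum_val a))) => [|a _]; last exact: dwork_mxX.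
rewrite (big_enum_valT (fun x => dwork_pow m x x)) pair_bigA; apply: eq_bigr => -[i l] _ /=.
have q0 : (0 < p ^ m)%N by rewrite expn_gt0 p0.
rewrite dwork_powE coef_sect // addn0 coefMXn /= ltnNge leq_pmull //=.
by rewrite -{1}(prednK q0) mulSn addKn.
Qed.

(** Orthogonality keeps the exponents divisible by the order of the multiplicative group, exactly
    those that appear in [dwork_trace]. *)
Lemma sum_teich_poly (E : finFieldType) (T : E -> C) (b : {poly C}) : is_teichmuller T ->
  (size b <= (d * #|E|.-1).+1)%N ->
  \sum_(y | y != 0) b.[T y] = #|E|.-1%:R * \sum_(l < d.+1) b`_(#|E|.-1 * l).
Proof.
move=> TT sb; have Q0 := card_pred_gt0 E; set Q := #|E|.-1 in sb Q0 *.
have sb' : (size b <= d.+1 * Q)%N by apply: leq_trans sb _; rewrite mulSn -addn1 addnC leq_add2r.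
rewrite (eq_bigr (fun y => \sum_(e < d.+1 * Q) b`_e * T y ^+ e)) => [|y _]; last exact: horner_coef_wide.
rewrite exchange_big /= (sum_ord_mul _ _ (fun e => \sum_(y | y != 0) b`_e * T y ^+ e)) mulr_sumr.
apply: eq_bigr => v _; rewrite (bigD1 (Ordinal Q0)) //= [X in _ + X]big1 => [|I0 I0n]; rewrite -mulr_sumr.
  rewrite addn0 addr0 mulrC; congr (_ * _); rewrite (eq_bigr (fun=> 1)) => [|y y0].
    by rewrite sumr_const cardC1.
  by rewrite exprM (teich_root TT) // expr1n.
have := sum_teich TT (Ordinal Q0) I0; rewrite eq_sym (negPf I0n) => e.
rewrite (eq_bigr (fun y => T y ^+ I0 / T y ^+ Ordinal Q0)) ?e ?mulr0 // => y y0.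
by rewrite exprD exprM (teich_root TT) // expr1n mul1r /= expr0 invr1 mulr1.
Qed.

Lemma dwork_trace_formula m (E : finFieldType) (T : E -> C) : is_teichmuller T -> #|E| = (p ^ m)%N ->
  \sum_(y | y != 0) str s m (T y) = (p ^ m).-1%:R * \tr (dwork_mx ^+ m).
Proof.
move=> TT cE; rewrite exchange_big /= dwork_trace mulr_sumr; apply: eq_bigr => i _.
rewrite (eq_bigr (fun y => (frob_poly m i i).[T y])) => [|y _]; last by rewrite horner_frob_poly.
by rewrite sum_teich_poly ?cE // size_frob_poly.
Qed.

(** With both rates 0, [grows] records integrality and membership in the local field. *)
Lemma dwork_grows a b : grows pi 0 0 (dwork_mx a b)%:P.
Proof.
have [e1 e2] := sP (enum_val a).1 (enum_val b).1 (p * (enum_val a).2 - (enum_val b).2)%N.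
have c : inE_ pi (dwork_mx a b) /\ vge 0 (dwork_mx a b); last exact: growsC c.1 c.2.
rewrite mxE /dwork coef_sect // addn0 coefMXn; case: ltnP => _; first by split; [apply: inE0 | apply: vge0].
split=> //; apply: vgeW e2; have u0 := ltW (unit_val_gt0 p_pr).
by rewrite addr_ge0 // mulr_ge0 ?ler0n // divr_ge0 ?ler0n.
Qed.

Lemma grows_fred x : inE_ pi x -> vge 0 x -> grows pi 0 0 (fred (x *: dwork_mx)).
Proof.
move=> xE x0; have gM f g : grows pi 0 0 f -> grows pi 0 0 g -> grows pi 0 0 (f * g).
  by move=> hf hg; rewrite -[X in grows _ _ X]addr0; apply: growsM.
apply: grows_sum => sg _; apply: (gM).
  apply: growsX; rewrite -polyC1 -polyCN; apply: growsC; first by apply: inEN; apply: inE1.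
  by rewrite vgeN vge1.
apply: big_ind => [|f g|a _]; [exact: grows1 | exact: (gM) |].
rewrite !mxE; apply: growsD.
  by case: (_ == _); [apply: grows1 | apply: grows0].
have -> : - ('X * (x * dwork (enum_val a) (enum_val (sg a)))%:P) =
    ((- x)%:P * (dwork_mx a (sg a))%:P) * (1 *: 'X^1) :> {poly C}.
  by rewrite mxE scale1r expr1 -polyCM mulNr polyCN mulNr mulrC.
apply: (gM); first (apply: (gM); last exact: dwork_grows).
  by apply: growsC; rewrite ?vgeN //; apply: inEN.
by apply: growsZXn; [apply: inE1 | rewrite mul0r vge1].
Qed.

(** The coefficient of X^(p l' - l) has valuation at least u w_i + u l' - (u/p) l. The potential
    (u/p) l absorbs the difference between l' and l, and p u = 1 + u leaves l'/p: hence the weight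
    w_i + l' and the constant 1/p. *)
Lemma bnd_dwork x : vge 0 x ->
  bnd p%:R^-1 (fun W => scount s W * W)%N (fun N => (fred (x *: dwork_mx))`_N).
Proof.
move=> x0; have u0 := unit_val_gt0 p_pr; have pp : 0 < p%:R :> rat by rewrite ltr0n.
apply: (@bnd_fred p p_pr K _ (x *: dwork_mx) _ (fun a => sw (enum_val a).1 + (enum_val a).2)%N
  (fun a => u / p%:R * ((enum_val a).2 : nat)%:R)); first by rewrite invr_ge0 ltW.
  move=> a b; rewrite !mxE /dwork; case: (enum_val a) => i l'; case: (enum_val b) => j l /=.
  apply: vgeMl => //; rewrite coef_sect // addn0 coefMXn; case: ltnP => ll; first exact: vge0.
  apply: vgeW (sP i j _).2; rewrite natrB // natrM natrD.
  have e : u / p%:R * (p%:R * l'%:R - l%:R) = u * l'%:R - u / p%:R * l%:R.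
    by rewrite mulrBr mulrA divfK ?gt_eqF.
  have e2 : u = p%:R^-1 + u / p%:R.
    by rewrite -[X in X + _]mul1r -mulrDl -(pu p_pr) mulrAC divff ?mul1r // gt_eqF.
  have w0 : 0 <= (sw i)%:R :> rat by rewrite ler0n.
  have up : 0 <= u / p%:R by rewrite divr_ge0 // ltW.
  rewrite e [X in _ <= X * _ + _]e2 [X in _ <= _ + (X * _ - _)]e2; nra.
case=> [|W]; first by rewrite muln0 (eq_card0 (_ : _ =i pred0)) // => a; rewrite inE.
pose g (a : 'I_#|{: I * 'I_d.+1}|) : I * 'I_W.+1 := ((enum_val a).1, inord (enum_val a).2).
rewrite -(card_in_imset (f := g)) => [|a b]; last first.
  rewrite !inE /g => ha hb [e1 /(congr1 val)] /=; rewrite !inordK => [/val_inj e2||].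
  - by apply: enum_val_inj; rewrite [LHS]surjective_pairing [RHS]surjective_pairing e1 e2.
  - exact: leq_ltn_trans (leq_addl _ _) hb.
  - exact: leq_ltn_trans (leq_addl _ _) ha.
rewrite /scount -[X in (_ <= _ * X)%N]card_ord -[#|'I__|]cardsT -cardsX; apply: subset_leq_card.
apply/fintype.subsetP => _ /imsetP[a ha ->]; rewrite !inE andbT /g /=.
by move: ha; rewrite inE; apply: leq_ltn_trans (leq_addr _ _).
Qed.

End DworkOperator.

Lemma is_exp_vge0 (p : nat) (K : padic_closure p) (l g : nat -> Qpbar K) : is_exp l g ->
  (forall N, vge 0 (g N)) -> forall m, (0 < m)%N -> vge 0 (l m).
Proof.
move=> [g0 hl] hg; elim/ltn_ind => -[//|m] IH _.
have := hl m.+1; rewrite big_ord_recr /= subnn g0 mulr1 => /eqP.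
rewrite [X in _ == X]addrC -subr_eq => /eqP <-; apply: vgeB; first by apply: vgeMl => //; apply: vge_nat.
by apply: vge_sum => i _; apply: vgeMl => //; apply: IH => //; rewrite ltnS.
Qed.

Lemma scale_mxX (F : fieldType) n (x : F) (A : 'M[F]_n) m : (x *: A) ^+ m = x ^+ m *: A ^+ m.
Proof.
elim: m => [|m IH]; first by rewrite !expr0 scale1r.
by rewrite !exprS IH -[LHS]/(_ *m _) -scalemxAl -scalemxAr scalerA.
Qed.

(** * Meromorphy of the unit root L-function *)

Section VirtualSeries.
Variables (p : nat) (p_pr : prime p) (K : padic_closure p) (pi : Qpbar K).
Local Notation C := (Qpbar K).
Let p0 : (0 < p)%N := prime_gt0 p_pr.

(* The sum over the points is [(p^m - 1) tr D^m], whence the quotient of *)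
(* [det (1 - T D)] and [det (1 - p T D)].                                *)
Lemma virtual_series (L : seq (bool * sys pi)) : exists P Q lP lQ : nat -> C,
  [/\ is_exp lP P, is_exp lQ Q, bnd p%:R^-1 (fun W => vcount L W * W)%N P,
      bnd p%:R^-1 (fun W => vcount L W * W)%N Q &
  [/\ forall N, inE_ pi (P N), forall N, inE_ pi (Q N) &
      forall m (E : finFieldType) (T : E -> C), (0 < m)%N -> is_teichmuller T -> #|E| = (p ^ m)%N ->
        \sum_(y | y != 0) vtr L m (T y) = lP m - lQ m]].
Proof.
have v0 : 0 <= p%:R^-1 :> rat by rewrite invr_ge0 ler0n.
elim: L => [|[b s] L [P [Q [lP [lQ [hP hQ bP bQ [eP eQ hL]]]]]]].
  exists (one_series C), (one_series C), (fun=> 0), (fun=> 0).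
  split; [exact: is_exp0 | exact: is_exp0 | exact: bnd_one | exact: bnd_one |].
  have e N : inE_ pi (one_series C N) by apply: inE_nat.
  by split=> // m E T _ _ _; rewrite subrr big1 // => y _; rewrite /vtr big_nil.
have [d hd] : exists d, forall i j : sI s, (size (sA i j) <= d.+1)%N.
  exists (\max_(x : sI s * sI s) size (sA x.1 x.2)) => i j; apply: leqW.
  by have := leq_bigmax (F := fun x : sI s * sI s => size (sA x.1 x.2)) (i, j).
pose D x N : C := (fred (x *: dwork_mx s d))`_N.
pose l x m : C := - \tr ((x *: dwork_mx s d) ^+ m).
have hD x : is_exp (l x) (D x) by exact: is_exp_fred.
have bD x : vge 0 x -> bnd p%:R^-1 (fun W => scount s W * W)%N (D x) by exact: bnd_dwork.
have eD x N : inE_ pi x -> vge 0 x -> inE_ pi (D x N).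
  by move=> xE x0; apply: (grows_fred p_pr s d xE x0 N).1.
have cE g h : (forall N, inE_ pi (g N)) -> (forall N, inE_ pi (h N)) -> forall N, inE_ pi (conv g h N).
  by move=> hg hh N; apply: inE_bigsum => i _; apply: inEM.
(* A negative sign exchanges the roles of the two determinants. *)
pose x1 : C := if b then p%:R else 1; pose x2 : C := if b then 1 else p%:R.
have [x1E x1v] : inE_ pi x1 /\ vge 0 x1.
  by rewrite /x1; case: (b); split; [apply: inE_nat | apply: vge_nat | apply: inE1 | apply: vge1].
have [x2E x2v] : inE_ pi x2 /\ vge 0 x2.
  by rewrite /x2; case: (b); split; [apply: inE1 | apply: vge1 | apply: inE_nat | apply: vge_nat].
have bc g h : bnd p%:R^-1 (fun W => scount s W * W)%N g -> bnd p%:R^-1 (fun W => vcount L W * W)%N h ->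
    bnd p%:R^-1 (fun W => vcount ((b, s) :: L) W * W)%N (conv g h).
  move=> hg hh; apply: bndW (bnd_conv v0 hg hh) => // W.
  by rewrite /vcount big_cons mulnDl.
exists (conv (D x1) P), (conv (D x2) Q), (fun m => l x1 m + lP m), (fun m => l x2 m + lQ m).
split; [exact: is_exp_conv | exact: is_exp_conv | apply: bc => //; exact: bD | apply: bc => //; exact: bD |].
split; [by apply: cE => // N; apply: eD | by apply: cE => // N; apply: eD |].
move=> m E T m0 TT cardE; rewrite opprD addrACA -(hL m E T) //.
rewrite (eq_bigr (fun y => (-1) ^+ b * str s m (T y) + vtr L m (T y))) => [|y _]; last by rewrite /vtr big_cons.
rewrite big_split /=; congr (_ + _); rewrite -mulr_sumr (dwork_trace_formula p_pr hd TT cardE).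
rewrite /l !scale_mxX !mxtraceZ -subn1 natrB ?expn_gt0 ?p0 // natrX /x1 /x2.
by case: (b) => /=; rewrite expr1n ?expr1 ?expr0; ring.
Qed.

End VirtualSeries.

Section Meromorphy.
Variables (p : nat) (p_pr : prime p) (K : padic_closure p).
Variables (iota : {rmorphism algC -> Qpbar K}) (Psi : 'F_p -> algC).
Hypothesis Psi_char : nontrivial_additive_character Psi.
Variable n : nat.
Local Notation u := (unit_val p).
Local Notation pi := (psi_pi iota Psi).
Local Notation f k := (unit_root_L p_pr Psi n iota k).

Lemma alpha0_cong1 y : vge u (alpha0 p_pr Psi n iota y - 1).
Proof. exact: (unit_root_spec p_pr iota Psi_char n y).1. Qed.

Lemma unit_root_L_vge0 k N : vge 0 (f k N).
Proof.
have u0 := unit_val_gt0 p_pr.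
rewrite (unit_root_L_points p_pr Psi n iota k (leqnn N)); apply: vge_prod_coef => y i.
rewrite coef_trunc; case: ifP => _; last exact: vge0.
rewrite /euler_factor; case: ifP => _; last exact: vge0.
apply: vgeX0; have := exprz_cong k u0 (alpha0_cong1 y); set a := _ ^ k => ha.
by rewrite -(subrK 1 a) vgeD ?vge1 // (vgeW (ltW u0)).
Qed.

Lemma large_residue (k : int) (q B : nat) : (0 < q)%N ->
  exists2 j : nat, (B <= j)%N & (k = j%:Z %[mod q])%Z.
Proof.
move=> q0; have h := modz_ge0 k (_ : q%:Z != 0); exists (`|(k %% q)%Z|%N + q * B)%N.
  by apply: leq_trans (leq_addl _ _); rewrite leq_pmull.
rewrite PoszD PoszM gez0_abs ?h ?eqz_nat -?lt0n //.
by rewrite -[RHS]modzDmr mulrC modzMl addr0 modz_mod.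
Qed.

(* Modulo p^M, alpha0 ^ k is alpha0 ^ j for a large j, which is a power sum of the *)
(* Frobenius eigenvalues.                                                          *)
Lemma unit_root_L_quotient : exists c, forall k, exists P Q,
  [/\ P 0%N = 1, Q 0%N = 1, bnd p%:R^-1 c P, bnd p%:R^-1 c Q &
  [/\ forall N, inE_ pi (P N), forall N, inE_ pi (Q N) & conv (f k) Q =1 P]].
Proof.
have v0 : 0 <= p%:R^-1 :> rat by rewrite invr_ge0 ler0n.
have u0 := unit_val_gt0 p_pr; have pi_root := psi_pi_root p_pr iota Psi_char.
have [c hc] := virtual_power p_pr pi n; exists (fun W => c W * W)%N => k.
apply: (approx_quotient (e := fun N => logn p N`!) p_pr pi_root v0) => [|M].
  exact: unit_root_L_vge0.
have q0 : (0 < p.-1 * p ^ M)%N by rewrite muln_gt0 p1_gt0 // expn_gt0 prime_gt0.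
(* j > n for [virtual_power], and j >= M (p-1) to have j u >= M. *)
have [j hj kj] := large_residue k (n.+1 + M * p.-1) q0.
have nj : (n < j)%N by apply: leq_trans hj; rewrite leq_addr.
have Mj : M%:R <= j%:R * u.
  rewrite -[leLHS]mulr1 -[X in _ * X <= _](unit_valK p_pr) mulrA -natrM ler_wpM2r ?ler_nat //; first exact: ltW.
  by apply: leq_trans hj; rewrite leq_addl.
have [H hH] := frobenius_structure p_pr iota Psi_char n M.
have [L hL trL] := hc j nj H hH.1.
have [P [Q [lP [lQ [hP hQ bP bQ [eP eQ hS]]]]]] := virtual_series p_pr L.
have bw g : bnd p%:R^-1 (fun W => vcount L W * W)%N g -> bnd p%:R^-1 (fun W => c W * W)%N g.
  by apply: bndW => // W; rewrite leq_mul2r hL orbT.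
have P0 N := bnd_vge0 N bP; have Q0 N := bnd_vge0 N bQ.
exists P, Q; split; [exact: hP.1 | exact: hQ.1 | exact: bw | exact: bw |]; split=> // N.
have fj := is_exp_conv (is_exp_unit_root_L p_pr Psi n iota j) hQ.
have hP' : is_exp (pos_part lP) P by apply: eq_is_exp hP => -[].
have conv0 g i : (forall N, vge 0 (g N)) -> vge 0 (conv g Q i).
  by move=> hg; apply: vge_sum => a _; apply: vgeMl.
have h1 : vge (M%:R - (logn p N`!)%:R) (conv (f j) Q N - P N).
  apply: (is_exp_cong p_pr fj hP') => [i|[|m]|[//|m] m0].
  - by apply: conv0 => i'; apply: unit_root_L_vge0.
  - exact: vge0.
  - exact: is_exp_vge0 hP P0 _ _.
  have [E charE cE] := pPrimePowerField p_pr m0.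
  have [T TT] := teichmuller_exists p_pr K charE.
  have := trace_formula p_pr Psi_char hH Mj (leq_ltn_trans (leq0n n) nj) m0 cE TT.
  rewrite (eq_bigr (fun y => vtr L m.+1 (T y))) => [|y _]; last by rewrite trL.
  by rewrite (hS m.+1 E T) // opprB addrA addrAC.
have h2 : vge M%:R (conv (f k) Q N - conv (f j) Q N).
  rewrite /conv -sumrB; apply: vge_sum => i _; rewrite -mulrBl; apply: vgeMr => //.
  exact: unit_root_L_cong alpha0_cong1 _ _ _ kj _.
apply: vge_trans h1; apply: vgeW h2; by rewrite gerBl ler0n.
Qed.

End Meromorphy.

Theorem theorem1p2 (p : nat) (p_pr : prime p)
    (K : padic_closure p) (iota : {rmorphism algC -> Qpbar K})
    (Psi : 'F_p -> algC) (Psi_char : nontrivial_additive_character Psi)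
    (n : nat) (n_gt0 : (0 < n)%N) (s : rat) :
  exists m : nat, mU p_pr Psi n iota s = m%:E%E.
Proof.
have [c hc] := unit_root_L_quotient p_pr iota Psi_char n.
apply: (mU_finite (psi_pi_root p_pr iota Psi_char) s _ (alpha0_cong1 p_pr iota Psi_char n) hc).
by rewrite invr_gt0 ltr0n prime_gt0.
Qed.
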